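(* Assume that $C_1, C'_1, C_2, C'_2$ satisfy $Q(C_1),Q(C'_1),Q(C_2),Q(C'_2)>0$, $\Delta_{11'22'}>0$, $D_{11'},D_{22'}\geq0$, and that the matrix \begin{equation} {\operatorname M}= \begin{pmatrix} \Delta_{1'22'} & 0 & D_{12} & D_{12'} \\ 0 & \Delta_{122'} & D_{1'2} & D_{1'2'} \\ D_{12} & D_{1'2} & \Delta_{11'2'} & 0 \\ D_{12'}& D_{1'2'} & 0 & \Delta_{11'2} \end{pmatrix} \end{equation} is negative definite; and in addition that \begin{eqnarray} \Delta_{12},\ \Delta_{1'2},\ \Delta_{12'},\ \Delta_{1'2'} &>& 0 , \\ B(C_{2\perp 1},C_{2'\perp 1})= B(C_2,C_2')-\tfrac{B(C_1,C_2) B(C_1,C_2')}{Q(C_1) } &\geq& 0, \\ B(C_{1\perp 2},C_{1'\perp2})= B(C_1,C_1')-\tfrac{B(C_2,C_1) B(C_2,C_1')}{Q(C_2)} &\geq& 0, \\ B(C_{2\perp 1'},C_{2'\perp 1'})= B(C_2,C'_2)-\tfrac{ B(C'_1,C'_2) B(C'_1,C_2)}{Q(C'_1)}&\geq& 0, \\ B(C_{1\perp 2'},C_{1'\perp2'})= B(C_1,C_1')-\tfrac{B(C'_2,C_1) B(C'_2,C_1')}{Q(C'_2)}&\geq& 0. \end{eqnarray} Then the theta series $\vartheta_{\mu}[\widehat\Phi_2,0]$ with kernel \begin{equation} \widehat\Phi_2(x) = \frac14\, \Bigl[ E_2(C_1,C_2;x) - E_2(C_1,C_2';x) - E_2(C'_1,C_2;x)+E_2(C'_1,C'_2;x)\Bigr]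 \end{equation} is a non-holomorphic vector-valued Jacobi form of weight $(\tfrac{n}{2},0)$. Its shadow (image under $\tau_2^2\partial_{\bar\tau}$) is the non-holomorphic Lorentzian theta series $\vartheta_{\mu}[\Psi_2,-2]$ with kernel \begin{equation} \begin{split} \Psi_2(x) =& \,\frac{\mathrm{i}}{8}\, \Biggl\{ \tfrac{B(C_1,x)}{\sqrt{Q(C_1)}}\, e^{- \tfrac{\pi B(C_1,x)^2}{Q(C_1)}} \Bigl[ E_1(C_{2\perp 1};x)-E_1(C_{2'\perp 1};x)\Bigr] \\&\, +\tfrac{B (C_2,x)}{\sqrt{Q(C_2)}}\, e^{- \tfrac{\pi B(C_2,x)^2}{Q(C_2)}} \Bigl[E_1(C_{1\perp2};x)- E_1(C_{1'\perp2};x)\Bigr] \\&\, + \tfrac{B(C'_1,x)}{\sqrt{Q(C'_1)}}\, e^{-\tfrac{\pi B(C'_1,x)^2}{Q(C'_1)}} \Bigl[E_1(C_{2'\perp1'};x)- E_1(C_{2\perp1'};x)\Bigr] \\ &\, + \tfrac{B(C'_2,x)}{\sqrt{Q(C'_2)}}\, e^{-\tfrac{\pi B(C'_2,x)^2}{Q(C'_2)}} \Bigl[E_1(C_{1'\perp2'};x)- E_1(C_{1\perp2'};x)\Bigr] \Biggr\}. \end{split} \end{equation}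
   Context: Let $\Lambda$ be an $n$-dimensional lattice with symmetric bilinear form $B$ whose quadratic form $Q(x)=B(x,x)$ is integer valued on $\Lambda$ and has signature $(2,n-2)$. Let $p\in\Lambda$ be a characteristic vector, $\mu\in\Lambda^*/\Lambda$, $q=e^{2\pi\mathrm{i}\tau}$, $\tau_2=\operatorname{Im}\tau>0$, $b,c\in\Lambda\otimes\mathbb{R}$, $\mathbf{e}(x)=e^{2\pi\mathrm{i} x}$, and \begin{equation} \vartheta_{\mu}[\Phi,\lambda](\tau, b, c)=\tau_2^{-\lambda/2} \sum_{k\in \Lambda+\mu+\frac{1}{2}p} (-1)^{B(k,p)}\,\Phi(\sqrt{2\tau_2}(k+b))\, q^{-\frac12 Q(k+b)}\,\mathbf{e}\bigl(B(c,k+\tfrac{1}{2}b)\bigr). \end{equation} Write $C_{j'}=C'_j$; $\Delta_{\mathcal{I}}$ is the determinant of the Gram matrix $B(C_i,C_j)_{i,j\in\mathcal{I}}$ for $\mathcal{I}\subset\{1,1',2,2'\}$, and $D_{ij}$ are the off-diagonal cofactors of the $4\times4$ Gram matrix $B(C_i,C_j)_{i,j\in\{1,1',2,2'\}}$. For vectors $C,C'$ set $C_{\perp C'}$ notation $C_{i\perp j}=C_i-\tfrac{B(C_i,C_j)}{Q(C_j)}C_j$. $E_1(C;x)=\operatorname{Erf}\!\left(\sqrt{\pi}\,\tfrac{B(C,x)}{\sqrt{Q(C)}}\right)$. The double error function is $E_2(\alpha;u_1,u_2)=\int_{\mathbb{R}^2}\mathrm{d}u'_1\mathrm{d}u'_2\,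 e^{-\pi(u_1-u'_1)^2-\pi(u_2-u'_2)^2}\operatorname{sign}(u'_2)\operatorname{sign}(u'_1+\alpha u'_2)$, and for $C_1,C_2$ with $Q(C_i)>0$, $\Delta(C_1,C_2)=Q(C_1)Q(C_2)-B(C_1,C_2)^2>0$, $E_2(C_1,C_2;x) = E_2\!\left( \tfrac{B(C_1,C_2)}{\sqrt{\Delta(C_1,C_2)}};\tfrac{B(C_{1\perp 2},x)}{\sqrt{Q(C_{1\perp 2})}},\tfrac{B(C_2,x)}{\sqrt{Q(C_2)}} \right)$. *)

(* Defs.v *)
From HB Require Import structures.
From mathcomp Require Import all_boot all_order all_algebra.
From mathcomp Require Import archimedean finmap.
From mathcomp Require Import complex.
From mathcomp Require Import all_classical all_reals all_analysis.

Set Implicit Arguments.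
Unset Strict Implicit.
Unset Printing Implicit Defensive.

Import Order.TTheory GRing.Theory Num.Theory.
Import numFieldNormedType.Exports.

Local Open Scope classical_set_scope.
Local Open Scope ring_scope.
Local Open Scope complex_scope.

Section Complex.
Variable R : realType.
Implicit Types (z : R[i]) (w : R).

Definition cexp z : R[i] :=
  (expR (complex.Re z))%:C * (cos (complex.Im z) +i* sin (complex.Im z)).

Definition ee z : R[i] := cexp ((2 * pi)%:C * 'i%C * z).

Definition cabs z : R := Num.sqrt (complex.Re z ^+ 2 + complex.Im z ^+ 2).

(* The principal branch of z^w on the upper half-plane: there the argument
   acos (Re z / |z|) is in ]0, pi[. *)
Definition hpow z w : R[i] :=
  (cabs z `^ w)%:C * cexp ('i%C * (w * acos (complex.Re z / cabs z))%:C).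

(* Sums of families indexed by a countable type, without any choice of an
   order of summation; meaningful for absolutely summable families. *)
Definition rsum (T : choiceType) (f : T -> R) : R :=
  fine (esum setT (EFin \o f)^\+%E) - fine (esum setT (EFin \o f)^\-%E).

Definition csum (T : choiceType) (f : T -> R[i]) : R[i] :=
  rsum (fun t => complex.Re (f t)) +i* rsum (fun t => complex.Im (f t)).

Definition abs_summable (T : choiceType) (f : T -> R[i]) : Prop :=
  summable setT (fun t => (cabs (f t))%:E).

(* The Wirtinger derivative (d/dx + i d/dy) / 2 with respect to the conjugate
   of the variable. *)
Definition dbar (f : R[i] -> R[i]) (tau : R[i]) : R[i] :=
  let x0 := complex.Re tau in let y0 := complex.Im tau in
  let fx := derive1 (fun x => complex.Re (f (x +i* y0))) x0
            +i* derive1 (fun x => complex.Im (f (x +i* y0))) x0 in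
  let fy := derive1 (fun y => complex.Re (f (x0 +i* y))) y0
            +i* derive1 (fun y => complex.Im (f (x0 +i* y))) y0 in
  (2^-1)%:C * (fx + 'i%C * fy).

(* C^oo on the open set U: all iterated directional derivatives exist and are
   continuous at the points of U. *)
Definition smooth_on (W : normedModType R) (U : set W) (f : W -> R) : Prop :=
  forall vs : seq W,
    let g := foldr (fun v h => 'D_v h) f vs in
    forall x, U x ->
      {for x, continuous g} /\ (forall v, derivable g x v).

End Complex.

(* In coordinates with respect to a basis of the lattice: Lambda = Z^n in R^n,
   and A is the Gram matrix of the bilinear form. *)

Section Lattice.
Variables (R : realType) (n : nat).
Local Notation V := 'rV[R]_n.
Variable A : 'M[R]_n.
Implicit Types (x y p mu : V).

Definition B x y : R := (x *m A *m y^T) 0 0.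
Definition Q x : R := B x x.

Definition Lambda : set V := [set x | forall j, x 0 j \is a Num.int].

Definition Lambda_dual : set V :=
  [set x | forall y, Lambda y -> B x y \is a Num.int].

(* The representatives of Lambda^* / Lambda with coordinates in [0, 1[. *)
Definition dual_reps : set V :=
  [set x | Lambda_dual x /\ forall j, 0 <= x 0 j < 1].

Definition integral_form : Prop := forall k, Lambda k -> Q k \is a Num.int.

Definition characteristic p : Prop :=
  Lambda p /\ forall k, Lambda k -> (Q k + B k p) / 2 \is a Num.int.

Definition has_signature (r s : nat) : Prop :=
  (r + s = n)%N /\
  exists2 P : 'M[R]_n, P \in unitmx &
    P *m A *m P^T = diag_mx (\row_(i < n) (if (i < r)%N then 1 else -1)).

(* Off the lattice, (-1)^x is read as exp (i pi x): here B k p may be a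
   half-integer. *)
Definition theta_term (Phi : V -> R[i]) mu p (tau : R[i]) (b c : V)
    (l : 'rV[int]_n) : R[i] :=
  let k := map_mx intr l + mu + 2^-1 *: p in
  ee (B k p / 2)%:C
  * Phi (Num.sqrt (2 * complex.Im tau) *: (k + b))
  * ee (- (Q (k + b) / 2)%:C * tau)
  * ee (B c (k + 2^-1 *: b))%:C.

Definition theta (Phi : V -> R[i]) (lambda : int) p mu (tau : R[i])
    (b c : V) : R[i] :=
  (complex.Im tau `^ (- lambda%:~R / 2))%:C * csum (theta_term Phi mu p tau b c).

Definition theta_summable (Phi : V -> R[i]) p : Prop :=
  forall mu (tau : R[i]) (b c : V), Lambda_dual mu -> 0 < complex.Im tau ->
    abs_summable (theta_term Phi mu p tau b c).

(* Vector-valued Jacobi forms of weight (w, w') for the lattice Lambda of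
   signature (r, s): smooth functions of (tau, b, c), not required to be
   holomorphic, with the multiplier system of the theta series with
   characteristic vector p (for kernel homogeneity lambda, so w = lambda + n/2
   and w' = 0, the factor e((r - s)/8) tau^w in the last clause is
   i^(lambda + r) (- i tau)^w with principal branches). *)
Record nonhol_jacobi_form (r s : nat) p (w w' : R)
    (phi : V -> R[i] -> V -> V -> R[i]) : Prop := {
  jacobi_smooth : forall mu, Lambda_dual mu ->
    let U := [set t : R * R * V * V | 0 < t.1.1.2] in
    let f := fun t : R * R * V * V =>
               phi mu (t.1.1.1 +i* t.1.1.2) t.1.2 t.2 in
    smooth_on U (fun t => complex.Re (f t)) /\
    smooth_on U (fun t => complex.Im (f t));
  jacobi_coset : forall (mu l : V) (tau : R[i]) (b c : V),
    Lambda_dual mu -> Lambda l ->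
    0 < complex.Im tau ->
    phi (mu + l) tau b c = phi mu tau b c;
  jacobi_shift_b : forall (mu l : V) (tau : R[i]) (b c : V),
    Lambda_dual mu -> Lambda l ->
    0 < complex.Im tau ->
    phi mu tau (b + l) c =
      ee (B l p / 2)%:C * ee (- (B c l / 2))%:C * phi mu tau b c;
  jacobi_shift_c : forall (mu l : V) (tau : R[i]) (b c : V),
    Lambda_dual mu -> Lambda l ->
    0 < complex.Im tau ->
    phi mu tau b (c + l) =
      ee (B l p / 2)%:C * ee (B b l / 2)%:C * phi mu tau b c;
  jacobi_T : forall (mu : V) (tau : R[i]) (b c : V),
    Lambda_dual mu -> 0 < complex.Im tau ->
    phi mu (tau + 1) b (c + b) =
      ee (- (Q (mu + 2^-1 *: p) / 2))%:C * phi mu tau b c;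
  jacobi_S : forall (mu : V) (tau : R[i]) (b c : V),
    Lambda_dual mu -> 0 < complex.Im tau ->
    phi mu (- tau^-1) c (- b) =
      ee ((r%:R - s%:R) / 8)%:C * ee (Q p / 4)%:C
      * hpow tau w * conjc (hpow tau w')
      * ((Num.sqrt (#|` fset_set dual_reps|)%:R)^-1)%:C
      * \sum_(nu \in dual_reps) (ee (B mu nu)%:C * phi nu tau b c)
}.

Definition gram (s : seq V) : 'M[R]_(size s) :=
  \matrix_(i, j) B s`_i s`_j.

Definition Delta (s : seq V) : R := \det (gram s).

Definition perp (C C' : V) : V := C - (B C C' / Q C') *: C'.

Definition matrix4 (s : seq (seq R)) : 'M[R]_4 :=
  \matrix_(i, j) (nth [::] s i)`_j.

Definition matrixM (C1 C1' C2 C2' : V) : 'M[R]_4 :=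
  let D (i j : 'I_4) := cofactor (gram [:: C1; C1'; C2; C2']) i j in
  let i1 : 'I_4 := inord 0 in let i1' : 'I_4 := inord 1 in
  let i2 : 'I_4 := inord 2 in let i2' : 'I_4 := inord 3 in
  matrix4 [:: [:: Delta [:: C1'; C2; C2']; 0; D i1 i2; D i1 i2'];
              [:: 0; Delta [:: C1; C2; C2']; D i1' i2; D i1' i2'];
              [:: D i1 i2; D i1' i2; Delta [:: C1; C1'; C2']; 0];
              [:: D i1 i2'; D i1' i2'; 0; Delta [:: C1; C1'; C2]]].

Definition Erf (u : R) : R :=
  Num.sg u * (2 / Num.sqrt pi)
  * \int[lebesgue_measure]_(t in `[0, `|u|]) gauss_fun t.

Definition E1 (C x : V) : R :=
  Erf (Num.sqrt pi * (B C x / Num.sqrt (Q C))).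

Definition double_erf (alpha u1 u2 : R) : R :=
  \int[(lebesgue_measure \x lebesgue_measure)%E]_t
    (expR (- pi * (u1 - t.1) ^+ 2 - pi * (u2 - t.2) ^+ 2)
     * Num.sg t.2 * Num.sg (t.1 + alpha * t.2)).

Definition E2 (C1 C2 x : V) : R :=
  double_erf (B C1 C2 / Num.sqrt (Q C1 * Q C2 - B C1 C2 ^+ 2))
             (B (perp C1 C2) x / Num.sqrt (Q (perp C1 C2)))
             (B C2 x / Num.sqrt (Q C2)).

Definition Phi2_hat (C1 C1' C2 C2' : V) (x : V) : R[i] :=
  (4^-1 * (E2 C1 C2 x - E2 C1 C2' x - E2 C1' C2 x + E2 C1' C2' x))%:C.

Definition gauss1 (C x : V) : R :=
  B C x / Num.sqrt (Q C) * expR (- (pi * B C x ^+ 2 / Q C)).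

Definition Psi2 (C1 C1' C2 C2' : V) (x : V) : R[i] :=
  (8^-1)%:C * 'i%C *
  (gauss1 C1 x * (E1 (perp C2 C1) x - E1 (perp C2' C1) x)
   + gauss1 C2 x * (E1 (perp C1 C2) x - E1 (perp C1' C2) x)
   + gauss1 C1' x * (E1 (perp C2' C1') x - E1 (perp C2 C1') x)
   + gauss1 C2' x * (E1 (perp C1' C2') x - E1 (perp C1 C2') x))%:C.

End Lattice.

Definition neg_definite (R : realType) (m : nat) (M : 'M[R]_m) : Prop :=
  forall x : 'rV[R]_m, x != 0 -> (x *m M *m x^T) 0 0 < 0.

(* Main.v *)
Require Import Defs.
From HB Require Import structures.
From mathcomp Require Import all_boot all_order all_algebra.
From mathcomp Require Import archimedean finmap.
From mathcomp Require Import complex.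
From mathcomp Require Import all_classical all_reals all_analysis.
From mathcomp Require Import ring lra zify.
From mathcomp Require Import measurable_realfun.

Set Implicit Arguments.
Unset Strict Implicit.
Unset Printing Implicit Defensive.

Import Order.TTheory GRing.Theory Num.Theory.
Import numFieldNormedType.Exports.

Local Open Scope classical_set_scope.
Local Open Scope ring_scope.
Local Open Scope complex_scope.

(** Join C1 to C1' and C2 to C2' by segments c1(s), c2(u). The sign conditions
    force every pair (c1(s), c2(u)) to span a positive definite plane, and
    differentiating the double error functions along the segments writes
    Phi2_hat as the integral over the unit square of a polynomial times the
    Gaussian exp (- pi Q+(x)), where Q+ is the square of the projection to that
    plane. The theta series is thus an average of Siegel theta series with a
    quadratic insertion, dominated uniformly because 2 Q+ - Q is positive
    definite, uniformly on the square; this gives convergence, smoothness and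
    termwise differentiation. Every Siegel theta series transforms by the
    inversion formula of a Riemann theta function, which is reduced one
    variable at a time to Jacobi's; the insertion is obtained by
    differentiating that formula in the elliptic variables along two vectors
    orthogonal to the plane. The shadow is computed one lattice vector at a
    time, where the antiholomorphic derivative only sees the radial derivative
    of the kernel. *)

(** Lattice and square form one measure space: a lattice sum is an integral for counting measure on
    [nat] along an enumeration. One theory of integrals of polynomial times Gaussian ([gpol],
    [gint]), a class closed under directional derivatives, then gives convergence, smoothness of all
    orders and termwise differentiation together.

    For a plane with form [P] the Siegel theta series has exponent matrix
    [- (conj tau P + tau (A - P))], hence weight ((n - 2)/2, 1). The quadratic insertion, with the
    factor [2 Im tau] coming from the scaled argument and with the constant [Bp v1 v2 / (2 pi)],
    contributes exactly [tau / conj tau]; this is the origin of the weight (n/2, 0).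

    The phase e(B(c, b)/2) involves both elliptic variables and would be hit by differentiation in
    either. The exponent therefore carries a parameter [kap]: 0 before inversion, 1 after it, and
    1/2 in the theta series itself.

    Poisson summation comes from uniqueness of Fourier coefficients. The branch of the square root
    is settled by computing the square of the constant and following its sign along a segment that
    starts at [i]. *)

Local Notation Re := complex.Re.
Local Notation Im := complex.Im.

(** * Modulus and exponential of complex numbers *)

Section ComplexExponential.
Variable R : realType.
Implicit Types z w : R[i].

Lemma cReD z w : Re (z + w) = Re z + Re w. Proof. by case: z; case: w. Qed.
Lemma cImD z w : Im (z + w) = Im z + Im w. Proof. by case: z; case: w. Qed.
Lemma cReN z : Re (- z) = - Re z. Proof. by case: z. Qed.
Lemma cImN z : Im (- z) = - Im z. Proof. by case: z. Qed.
Lemma cReM z w : Re (z * w) = Re z * Re w - Im z * Im w.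
Proof. by case: z; case: w. Qed.
Lemma cImM z w : Im (z * w) = Re z * Im w + Im z * Re w.
Proof. by case: z; case: w => a b c d /=; ring. Qed.
Lemma cReC (a : R) : Re a%:C = a. Proof. by []. Qed.
Lemma cImC (a : R) : Im a%:C = 0. Proof. by []. Qed.

Lemma complexRI z w : Re z = Re w -> Im z = Im w -> z = w.
Proof. by case: z; case: w => a b c d /= -> ->. Qed.

Lemma cabsE z : cabs z = ComplexField.Normc.normc z. Proof. by case: z. Qed.
Lemma cabsM z w : cabs (z * w) = cabs z * cabs w.
Proof. by rewrite !cabsE ComplexField.Normc.normcM. Qed.
Lemma cabsD z w : cabs (z + w) <= cabs z + cabs w.
Proof. by rewrite !cabsE le_normcD. Qed.
Lemma cabs_ge0 z : 0 <= cabs z. Proof. exact: sqrtr_ge0. Qed.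
Lemma cabs0 : cabs 0 = 0 :> R.
Proof. by rewrite cabsE ComplexField.Normc.normc0. Qed.
Lemma cabs_eq0 z : cabs z = 0 -> z = 0.
Proof. by rewrite cabsE => /ComplexField.Normc.eq0_normc. Qed.
Lemma cabs_gt0 z : z != 0 -> 0 < cabs z.
Proof.
by move=> z0; rewrite lt_neqAle cabs_ge0 andbT eq_sym; apply: contra z0 => /eqP/cabs_eq0/eqP.
Qed.
Lemma cabsN z : cabs (- z) = cabs z.
Proof. by rewrite !cabsE normcN. Qed.
Lemma cabs_real (a : R) : cabs a%:C = `|a|.
Proof. by rewrite /cabs /= expr0n /= addr0 sqrtr_sqr. Qed.
Lemma cabs_Re z : `|Re z| <= cabs z.
Proof.
by rewrite -sqrtr_sqr /cabs ler_sqrt ?lerDl ?addr_ge0 ?sqr_ge0.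
Qed.
Lemma cabs_Im z : `|Im z| <= cabs z.
Proof.
by rewrite -sqrtr_sqr /cabs ler_sqrt ?lerDr ?addr_ge0 ?sqr_ge0.
Qed.
Lemma cabs_le z : cabs z <= `|Re z| + `|Im z|.
Proof.
rewrite {1}(complexE z) (le_trans (cabsD _ _)) // cabsM !cabs_real.
by rewrite {1}/cabs /= expr0n /= add0r expr1n sqrtr1 mul1r.
Qed.

Lemma cexpD z w : cexp (z + w) = cexp z * cexp w.
Proof.
rewrite /cexp cReD cImD expRD cosD sinD; apply/eqP; rewrite eq_complex.
by rewrite !cReM !cImM /=; apply/andP; split; apply/eqP; ring.
Qed.
Lemma cexp0 : cexp 0 = 1 :> R[i].
Proof. by rewrite /cexp /= expR0 cos0 sin0 mul1r. Qed.
Lemma cabs_cexp z : cabs (cexp z) = expR (Re z).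
Proof.
rewrite /cexp cabsM cabs_real ger0_norm ?expR_ge0 //.
by rewrite {1}/cabs /= cos2Dsin2 sqrtr1 mulr1.
Qed.
Lemma cexp_neq0 z : cexp z != 0.
Proof.
apply/eqP => h; have := cabs_cexp z; rewrite h cabsE ComplexField.Normc.normc0 => /esym/eqP.
by rewrite gt_eqF ?expR_gt0.
Qed.
Lemma cexpN z : cexp (- z) = (cexp z)^-1.
Proof.
by apply: (mulfI (cexp_neq0 z)); rewrite -cexpD subrr cexp0 divff ?cexp_neq0.
Qed.
Lemma cexp_real (a : R) : cexp a%:C = (expR a)%:C.
Proof. by rewrite /cexp /= cos0 sin0; apply/eqP; rewrite eq_complex /= !mulr0 !mulr1 subr0 addr0 !eqxx. Qed.

Lemma ee_D z w : ee (z + w) = ee z * ee w.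
Proof. by rewrite /ee mulrDr cexpD. Qed.
Lemma ee0 : ee 0 = 1 :> R[i]. Proof. by rewrite /ee mulr0 cexp0. Qed.
Lemma ee_N z : ee (- z) = (ee z)^-1.
Proof. by rewrite /ee mulrN cexpN. Qed.
Lemma ee_neq0 z : ee z != 0. Proof. exact: cexp_neq0. Qed.
Lemma ee1 : ee 1 = 1 :> R[i].
Proof.
have -> : ee 1 = cexp (0 +i* (pi *+ 2)) :> R[i].
  by congr cexp; apply: complexRI; rewrite !(cReM, cImM) /=; ring.
rewrite /cexp /= expR0 cos2pi sin2pi mul1r.
by [].
Qed.
Lemma ee_int (a : R) : a \is a Num.int -> ee a%:C = 1.
Proof.
have en (n : nat) : ee (n%:R : R)%:C = 1.
  elim: n => [|n ih]; first by rewrite ee0.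
  by rewrite -natr1 rmorphD ee_D ih mul1r rmorph1 ee1.
move=> /intrP[[n|n] ->]; first by rewrite en.
by rewrite NegzE mulrNz rmorphN ee_N -pmulrn en invr1.
Qed.
Lemma cabs_ee z : cabs (ee z) = expR (- (2 * pi * Im z)).
Proof.
rewrite /ee cabs_cexp; congr expR.
by rewrite !(cReM, cImM) /=; ring.
Qed.

End ComplexExponential.

(** * Directional derivatives of complex-valued functions on a real normed space *)

Section Derivatives.
Variable R : realType.

(** The difference quotient along [v] at [t] is that of a function of one real variable at 0, so
    directional derivatives inherit the one-variable chain rule. *)
Lemma is_derive_dir (W : normedModType R) (f : W -> R) (t v : W) (l : R) :
  is_derive t v f l <-> is_derive (0 : R) 1 (fun h : R => f (h *: v + t)) l.
Proof.
have e : (fun h : R => h^-1 *: (f (h *: v + t) - f t)) =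
   (fun h : R => h^-1 *: ((fun h : R => f (h *: v + t)) (h *: (1:R) + 0) -
        (fun h : R => f (h *: v + t)) 0)).
  by apply/funext => h; rewrite /= scale0r add0r addr0 /GRing.scale /= mulr1.
split=> -[d1 d2]; apply: DeriveDef.
- by rewrite /derivable -e.
- by rewrite /derive -e.
- by rewrite /derivable e.
- by rewrite /derive e.
Qed.

Lemma is_derive_compW (W : normedModType R) (g : R -> R) (f : W -> R)
    (t v : W) (l m : R) :
  is_derive t v f l -> is_derive (f t) 1 g m ->
  is_derive t v (fun x => g (f x)) (l * m).
Proof.
move=> /is_derive_dir df dg; apply/is_derive_dir.
rewrite mulrC; apply: (@is_derive1_comp _ g _ 0 m l).
by rewrite scale0r add0r.
Qed.

Lemma is_derive_continuous (f : R -> R) (t l : R) :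
  is_derive t 1 f l -> {for t, continuous f}.
Proof. by move=> [d _]; apply/differentiable_continuous/derivable1_diffP. Qed.

Variable W : normedModType R.
Implicit Types (f g : W -> R[i]) (t v : W).

(** Real differentiability of both components, with the derivative carried as data: values are
    produced by rules such as [cderM], and two computations of one derivative are compared by
    [cder_uniq]. *)
Definition cder f t v (l : R[i]) :=
  is_derive t v (fun x => Re (f x)) (Re l) /\
  is_derive t v (fun x => Im (f x)) (Im l).

Lemma cder_ext f g t v l : f =1 g -> cder f t v l -> cder g t v l.
Proof. by move=> /funext ->. Qed.

Lemma cder_eq f t v l l' : cder f t v l -> l = l' -> cder f t v l'.
Proof. by move=> ? <-. Qed.

Lemma cder_cst (c : R[i]) t v : cder (fun => c) t v 0.
Proof. by split; exact: is_derive_cst. Qed.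

Lemma cderD f g t v l m : cder f t v l -> cder g t v m ->
  cder (fun x => f x + g x) t v (l + m).
Proof.
move=> [f1 f2] [g1 g2]; split.
  rewrite cReD [X in is_derive _ _ X](_ : _ =
    (fun x => Re (f x)) \+ (fun x => Re (g x))); first exact: is_deriveD.
  by apply/funext => x; rewrite /= cReD.
rewrite cImD [X in is_derive _ _ X](_ : _ =
  (fun x => Im (f x)) \+ (fun x => Im (g x))); first exact: is_deriveD.
by apply/funext => x; rewrite /= cImD.
Qed.

Lemma cderM f g t v l m : cder f t v l -> cder g t v m ->
  cder (fun x => f x * g x) t v (l * g t + f t * m).
Proof.
move=> [f1 f2] [g1 g2]; split.
  rewrite [X in is_derive _ _ X](_ : _ =
    (fun x => Re (f x)) * (fun x => Re (g x)) -
    (fun x => Im (f x)) * (fun x => Im (g x))).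
    apply: is_derive_eq; rewrite cReD !cReM /GRing.scale /=.
    move: (Re _) (Re _) (Re _) (Re _) (Im _) (Im _) (Im _) (Im _) => *; ring.
  by apply/funext => x; rewrite !fctE cReM.
rewrite [X in is_derive _ _ X](_ : _ =
    (fun x => Re (f x)) * (fun x => Im (g x)) +
    (fun x => Im (f x)) * (fun x => Re (g x))).
  apply: (is_derive_eq (is_deriveD (is_deriveM f1 g2) (is_deriveM f2 g1))); rewrite cImD !cImM /GRing.scale /=.
  move: (Re _) (Re _) (Re _) (Re _) (Im _) (Im _) (Im _) (Im _) => *; ring.
by apply/funext => x; rewrite !fctE cImM.
Qed.

Lemma cderZ (c : R[i]) f t v l : cder f t v l ->
  cder (fun x => c * f x) t v (c * l).
Proof.
move=> h; apply: cder_eq (cderM (cder_cst c t v) h) _.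
by rewrite mul0r add0r.
Qed.

Lemma cderN f t v l : cder f t v l -> cder (fun x => - f x) t v (- l).
Proof.
move=> h; have := cderZ (-1) h; rewrite mulN1r.
by apply: cder_ext => x; rewrite mulN1r.
Qed.

Lemma cder_real (f : W -> R) t v (l : R) : is_derive t v f l ->
  cder (fun x => (f x)%:C) t v l%:C.
Proof. by move=> h; split => //=; exact: is_derive_cst. Qed.

Lemma cder_cexp f t v l : cder f t v l ->
  cder (fun x => cexp (f x)) t v (l * cexp (f t)).
Proof.
move=> [f1 f2]; rewrite /cexp.
have h1 : cder (fun x => (expR (Re (f x)))%:C) t v (Re l * expR (Re (f t)))%:C.
  by apply: cder_real; apply: is_derive_compW f1 (is_derive_expR _).
have h2 : cder (fun x => cos (Im (f x)) +i* sin (Im (f x))) t v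
    ((Im l * - sin (Im (f t))) +i* (Im l * cos (Im (f t)))).
  split => /=; first exact: is_derive_compW f2 (is_derive_cos _).
  exact: is_derive_compW f2 (is_derive_sin _).
apply: cder_eq (cderM h1 h2) _.
apply: complexRI; rewrite ?cReD ?cImD !(cReM, cImM) /=; ring.
Qed.

Lemma cder_uniq f t v l m : cder f t v l -> cder f t v m -> l = m.
Proof.
move=> [f1 f2] [g1 g2]; apply: complexRI.
  by rewrite -(@derive_val _ _ _ _ _ _ _ f1) (@derive_val _ _ _ _ _ _ _ g1).
by rewrite -(@derive_val _ _ _ _ _ _ _ f2) (@derive_val _ _ _ _ _ _ _ g2).
Qed.

Lemma is_derive_linear (f : W -> R) t v :
  (forall x y, f (x + y) = f x + f y) -> (forall a x, f (a *: x) = a * f x) ->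
  is_derive t v f (f v).
Proof.
move=> fD fZ; apply/is_derive_dir.
have -> : (fun h : R => f (h *: v + t)) = (fun h : R => h * f v + f t).
  by apply/funext => h; rewrite fD fZ.
apply: is_derive_eq; rewrite /GRing.scale /=; ring.
Qed.

End Derivatives.

(** * Continuity and differentiation under a dominated integral *)

Section DominatedIntegrals.
Context d (X : measurableType d) (R : realType) (mu : {measure set X -> \bar R}).

Lemma integrable_dominated (f G : X -> R) : measurable_fun setT f ->
  mu.-integrable setT (EFin \o G) -> (forall x, `|f x| <= G x) ->
  mu.-integrable setT (EFin \o f).
Proof.
move=> mf iG fG; apply: le_integrable iG => //; first exact/measurable_EFinP.
by move=> x _ /=; rewrite lee_fin (le_trans (fG x)) // ler_norm.
Qed.

Lemma dominated_Rintegral (f : nat -> X -> R) (g G : X -> R) :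
  (forall n, measurable_fun setT (f n)) -> measurable_fun setT g ->
  mu.-integrable setT (EFin \o G) -> (forall n x, `|f n x| <= G x) ->
  (forall x, f n x @[n --> \oo] --> g x) ->
  (\int[mu]_x f n x) @[n --> \oo] --> \int[mu]_x g x.
Proof.
move=> mf mg iG fG fg.
have [ig _ h] : [/\ mu.-integrable setT (EFin \o g),
   [sequence \int[mu]_(x in setT) `|(f n x)%:E - (g x)%:E|]_n @ \oo --> 0%E &
   [sequence \int[mu]_(x in setT) (f n x)%:E]_n @ \oo --> (\int[mu]_(x in setT) (g x)%:E)%E]%E.
  apply: (@dominated_convergence _ _ _ mu setT measurableT
    (fun n => EFin \o f n) (EFin \o g) (EFin \o G)) => //.
  - by move=> n; exact/measurable_EFinP.
  - exact/measurable_EFinP.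
  - by apply: aeW => x _; apply: cvg_EFin; [exact: nearW|exact: fg].
  - by apply: aeW => x n _ /=; rewrite lee_fin.
rewrite /Rintegral; apply: fine_cvg; rewrite fineK //.
exact: integrable_fin_num.
Qed.

Variable W : normedModType R.

(** Dominated convergence speaks of sequences, so the proof is by contradiction: a failure of size
    [r] yields points [t_ n] within [1 / (n + 1)] of [t0] along which the integrals stay away from
    the value at [t0]. *)
Lemma Rintegral_continuous (f : W -> X -> R) (t0 : W) (e : R) (G : X -> R) :
  0 < e -> (forall t, `|t - t0| < e -> measurable_fun setT (f t)) ->
  mu.-integrable setT (EFin \o G) ->
  (forall t, `|t - t0| < e -> forall x, `|f t x| <= G x) ->
  (forall x, {for t0, continuous (fun t => f t x)}) ->
  {for t0, continuous (fun t => \int[mu]_x f t x)}.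
Proof.
move=> e0 mf iG fG cf; apply/cvgrPdist_lt => r r0; apply: contrapT => nh.
have ht (n : nat) : exists t, (`|t - t0| < e /\ `|t - t0| < n.+1%:R^-1) /\
    r <= `|\int[mu]_x f t0 x - \int[mu]_x f t x|.
  apply: contrapT => /forallNP hn; apply: nh; apply/nbhs_ballP.
  exists (Num.min e n.+1%:R^-1); first by rewrite /= lt_min e0 invr_gt0 ltr0n.
  move=> t; rewrite -ball_normE /= distrC lt_min => /andP[t1 t2].
  by apply: contrapT => /negP; rewrite -leNgt => rt; exact: (hn t).
have [t_ t_P] := choice ht.
have t_c : t_ n @[n --> \oo] --> t0.
  apply/cvgrPdist_lt => s s0; near=> n; rewrite distrC.
  apply: (lt_trans (t_P n).1.2); rewrite invf_plt ?posrE ?ltr0n //.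
  have : s^-1 < n%:R by near: n; exact: nbhs_infty_gtr.
  by move=> /lt_trans; apply; rewrite ltr_nat.
have : (\int[mu]_x f (t_ n) x) @[n --> \oo] --> \int[mu]_x f t0 x.
  apply: (@dominated_Rintegral _ _ G) => //.
  - by move=> n; apply: mf; exact: (t_P n).1.1.
  - by apply: mf; rewrite subrr normr0.
  - by move=> n x; apply: fG; exact: (t_P n).1.1.
  - by move=> x; exact: (cvg_comp _ _ t_c (cf x)).
move=> /cvgrPdist_lt /(_ r r0)[m _ /(_ m (leqnn m))] /=.
by rewrite ltNge (t_P m).2.
Unshelve. all: by end_near. Qed.

Lemma Rintegral_is_derive (f f' : W -> X -> R) (t0 v : W) (e : R) (G : X -> R) :
  0 < e -> (forall t, `|t - t0| < e -> measurable_fun setT (f t)) ->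
  mu.-integrable setT (EFin \o G) ->
  (forall t, `|t - t0| < e -> forall x, `|f t x| <= G x) ->
  (forall t, `|t - t0| < e -> forall x, `|f' t x| <= G x) ->
  (forall t, `|t - t0| < e -> forall x, is_derive t v (f^~ x) (f' t x)) ->
  is_derive t0 v (fun t => \int[mu]_x f t x) (\int[mu]_x f' t0 x).
Proof.
move=> e0 mf iG fG f'G df.
(* On []-h, h[] the line through [t0] in direction [v] stays in the ball of radius [e]; the [+ 1]
   covers [v = 0]. *)
pose h := e / (`|v| + 1).
have v1 : 0 < `|v| + 1 by rewrite ltr_wpDl.
have h0 : 0 < h by rewrite divr_gt0.
have hv (s : R) : s \in `]-h, h[ -> `|s *: v + t0 - t0| < e.
  rewrite in_itv /= -ltr_norml addrK normrZ /h ltr_pdivlMr // => hs.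
  by apply: le_lt_trans hs; rewrite ler_wpM2l // lerDl.
apply/is_derive_dir.
pose F (s : R) x := f (s *: v + t0) x.
have dF (s : R) x : s \in `]-h, h[ -> is_derive s 1 (F^~ x) (f' (s *: v + t0) x).
  move=> sh; have /is_derive_dir D := df _ (hv s sh) x.
  apply/is_derive_dir; rewrite /F.
  rewrite [X in is_derive _ _ X](_ : _ = (fun k : R => f (k *: v + (s *: v + t0)) x)) //.
  by apply/funext => k; rewrite /GRing.scale /= mulr1 -/(GRing.scale _ _) scalerDl addrA.
have dFE (s : R) x : s \in `]-h, h[ -> partial1of2 F s x = f' (s *: v + t0) x.
  by move=> sh; rewrite partial1of2E; exact: (@derive_val _ _ _ _ _ _ _ (dF s x sh)).
have I0 : (0 : R) \in `]-h, h[ by rewrite in_itv /= oppr_lt0 h0.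
have G0 x : 0 <= G x by apply: le_trans (fG t0 _ x); rewrite // subrr normr0.
have iF (s : R) : `]-h, h[%classic s -> mu.-integrable setT (EFin \o F s).
  move=> sh; apply: (@integrable_dominated _ G) => //; first exact/mf/hv.
  by move=> x; exact/fG/hv.
have dd (s : R) x : `]-h, h[%classic s -> [set: X] x -> derivable (F^~ x) s 1.
  by move=> sh _; have [] := dF s x sh.
have bb (s : R) x : `]-h, h[%classic s -> [set: X] x -> `|partial1of2 F s x| <= G x.
  by move=> sh _; rewrite dFE //; exact/f'G/hv.
have D1 := @derivable_under_integral _ _ _ mu F setT measurableT 0 (-h) h I0 iF dd G G0 iG bb.
have D2 := @differentiation_under_integral _ _ _ mu F setT measurableT 0 (-h) h I0 iF dd G G0 iG bb.
apply: DeriveDef; first exact: D1.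
rewrite -derive1E D2; apply: eq_Rintegral => x _; rewrite dFE //.
by rewrite scale0r add0r.
Qed.

End DominatedIntegrals.

(** * Componentwise integrals of complex-valued functions, and Fubini *)

Section ComplexIntegral.
Context d (X : measurableType d) (R : realType) (mu : {measure set X -> \bar R}).
Implicit Types f g : X -> R[i].

Definition cint f : R[i] := (\int[mu]_x Re (f x)) +i* (\int[mu]_x Im (f x)).

Definition cmeas f :=
  measurable_fun setT (fun x => Re (f x)) /\ measurable_fun setT (fun x => Im (f x)).

Definition cintegrable f := mu.-integrable setT (fun x => (Re (f x))%:E) /\
  mu.-integrable setT (fun x => (Im (f x))%:E).

Lemma cmeas_cst (c : R[i]) : cmeas (fun => c).
Proof. by split; exact: measurable_cst. Qed.

Lemma cmeas_real (f : X -> R) : measurable_fun setT f -> cmeas (fun x => (f x)%:C).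
Proof. by split => //=; exact: measurable_cst. Qed.

Lemma cmeasD f g : cmeas f -> cmeas g -> cmeas (fun x => f x + g x).
Proof.
move=> [f1 f2] [g1 g2]; split.
  by under eq_fun do rewrite cReD; exact: measurable_funD.
by under eq_fun do rewrite cImD; exact: measurable_funD.
Qed.

Lemma cmeasM f g : cmeas f -> cmeas g -> cmeas (fun x => f x * g x).
Proof.
move=> [f1 f2] [g1 g2]; split.
  under eq_fun do rewrite cReM.
  by apply: measurable_funB; exact: measurable_funM.
under eq_fun do rewrite cImM.
by apply: measurable_funD; exact: measurable_funM.
Qed.

Lemma cmeas_cexp f : cmeas f -> cmeas (fun x => cexp (f x)).
Proof.
move=> [f1 f2]; apply: cmeasM.
  by apply: cmeas_real; apply: (measurableT_comp (@measurable_expR _)).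
split => /=; first exact: (measurableT_comp (continuous_measurable_fun (@continuous_cos _))).
exact: (measurableT_comp (continuous_measurable_fun (@continuous_sin _))).
Qed.

Lemma cintegrable_dominated f (G : X -> R) : cmeas f ->
  mu.-integrable setT (EFin \o G) -> (forall x, cabs (f x) <= G x) ->
  cintegrable f.
Proof.
move=> [f1 f2] iG fG; split; apply: integrable_dominated iG _ => // x.
  exact: le_trans (cabs_Re _) (fG x).
exact: le_trans (cabs_Im _) (fG x).
Qed.

Lemma eq_cint f g : f =1 g -> cint f = cint g.
Proof. by move=> /funext ->. Qed.

Lemma cint0 : cint (fun=> 0) = 0.
Proof. by rewrite /cint /Rintegral /= !integral0. Qed.

Lemma cintD f g : cintegrable f -> cintegrable g ->
  cint (fun x => f x + g x) = cint f + cint g.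
Proof.
move=> [f1 f2] [g1 g2]; apply: complexRI => /=.
  by under eq_Rintegral do rewrite cReD; rewrite RintegralD.
by under eq_Rintegral do rewrite cImD; rewrite RintegralD.
Qed.

Lemma cintZ (c : R[i]) f : cintegrable f ->
  cint (fun x => c * f x) = c * cint f.
Proof.
move=> [f1 f2]; apply: complexRI; rewrite ?cReM ?cImM /=.
  under eq_Rintegral do rewrite cReM.
  rewrite RintegralB ?RintegralZl //.
  - by rewrite (_ : EFin \o _ = (fun x => (Re c)%:E * (Re (f x))%:E)%E) //; exact: integrableZl.
  - by rewrite (_ : EFin \o _ = (fun x => (Im c)%:E * (Im (f x))%:E)%E) //; exact: integrableZl.
under eq_Rintegral do rewrite cImM.
rewrite RintegralD ?RintegralZl //.
- by rewrite (_ : EFin \o _ = (fun x => (Re c)%:E * (Im (f x))%:E)%E) //; exact: integrableZl.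
- by rewrite (_ : EFin \o _ = (fun x => (Im c)%:E * (Re (f x))%:E)%E) //; exact: integrableZl.
Qed.

Lemma cintegrableZ (c : R[i]) f : cintegrable f -> cintegrable (fun x => c * f x).
Proof.
move=> [f1 f2]; split.
  under eq_fun do rewrite cReM EFinB !EFinM.
  by apply: integrableB => //; exact: integrableZl.
under eq_fun do rewrite cImM EFinD !EFinM.
by apply: integrableD => //; exact: integrableZl.
Qed.

Lemma cintegrableD f g : cintegrable f -> cintegrable g ->
  cintegrable (fun x => f x + g x).
Proof.
move=> [f1 f2] [g1 g2]; split.
  by under eq_fun do rewrite cReD EFinD; exact: integrableD.
by under eq_fun do rewrite cImD EFinD; exact: integrableD.
Qed.

End ComplexIntegral.

Section ComplexFubini.
Context d1 d2 (X : measurableType d1) (Y : measurableType d2) (R : realType).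
Variables (m1 : {sigma_finite_measure set X -> \bar R})
  (m2 : {sigma_finite_measure set Y -> \bar R}).

(** Every section is asked to be integrable, not just almost every one: the real integral is [fine]
    of the extended one, and so the two inner integrals agree at each point. *)
Lemma Rintegral_Fubini1 (f : X * Y -> R) :
  (m1 \x m2)%E.-integrable setT (EFin \o f) ->
  (forall x, m2.-integrable setT (fun y => (f (x, y))%:E)) ->
  \int[(m1 \x m2)%E]_z f z = \int[m1]_x (\int[m2]_y f (x, y)).
Proof.
move=> h hy; rewrite /Rintegral -integral12_prod_meas1 //; congr fine.
apply: eq_integral => x _; rewrite fineK //.
exact: integrable_fin_num.
Qed.

Lemma Rintegral_Fubini2 (f : X * Y -> R) :
  (m1 \x m2)%E.-integrable setT (EFin \o f) ->
  (forall y, m1.-integrable setT (fun x => (f (x, y))%:E)) ->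
  \int[(m1 \x m2)%E]_z f z = \int[m2]_y (\int[m1]_x f (x, y)).
Proof.
move=> h hy; rewrite /Rintegral -integral21_prod_meas1 //; congr fine.
apply: eq_integral => x _; rewrite fineK //.
exact: integrable_fin_num.
Qed.

Lemma cint_Fubini1 (f : X * Y -> R[i]) :
  cintegrable (m1 \x m2)%E f ->
  (forall x, cintegrable m2 (fun y => f (x, y))) ->
  cint (m1 \x m2)%E f = cint m1 (fun x => cint m2 (fun y => f (x, y))).
Proof.
move=> [f1 f2] h; apply: complexRI => /=.
  by apply: Rintegral_Fubini1 => // x; exact: (h x).1.
by apply: Rintegral_Fubini1 => // x; exact: (h x).2.
Qed.

Lemma cint_Fubini2 (f : X * Y -> R[i]) :
  cintegrable (m1 \x m2)%E f ->
  (forall y, cintegrable m1 (fun x => f (x, y))) ->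
  cint (m1 \x m2)%E f = cint m2 (fun y => cint m1 (fun x => f (x, y))).
Proof.
move=> [f1 f2] h; apply: complexRI => /=.
  by apply: Rintegral_Fubini2 => // x; exact: (h x).1.
by apply: Rintegral_Fubini2 => // x; exact: (h x).2.
Qed.

End ComplexFubini.

(** * Parameter integrals of a polynomial times a Gaussian *)

Section GaussianIntegrals.
Context (R : realType) d (X : measurableType d) (mu : {measure set X -> \bar R}).
Variable N : X -> R.
Variable W : normedModType R.
Implicit Types (p q : W -> X -> R[i]) (t v : W).

(* Polynomials in the parameter t whose coefficients have polynomial growth in
   the weight N of the integration variable. *)
Inductive gpol : (W -> X -> R[i]) -> Prop :=
| gpol_coef (g : X -> R[i]) (C : R) (e : nat) : cmeas g ->
    (forall x, cabs (g x) <= C * (1 + N x) ^+ e) -> gpol (fun _ x => g x)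
| gpol_lin (l : W -> R) (K : R) : (forall x y, l (x + y) = l x + l y) ->
    (forall a x, l (a *: x) = a * l x) -> (forall x, `|l x| <= K * `|x|) ->
    gpol (fun t _ => (l t)%:C)
| gpol_add p q : gpol p -> gpol q -> gpol (fun t x => p t x + q t x)
| gpol_mul p q : gpol p -> gpol q -> gpol (fun t x => p t x * q t x).

Hypothesis N0 : forall x, 0 <= N x.
Hypothesis mN : measurable_fun setT N.

Lemma one_weight x : 1 <= 1 + N x.
Proof. by rewrite lerDl. Qed.
Hint Resolve one_weight : core.

Lemma gpol_ext p q : (forall t x, p t x = q t x) -> gpol p -> gpol q.
Proof. by move=> h; have -> // : p = q by do 2 apply/funext => ?. Qed.

Lemma gpol_cst (c : R[i]) : gpol (fun _ _ => c).
Proof.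
apply: (@gpol_coef (fun=> c) (cabs c) 0%N); first exact: cmeas_cst.
by move=> x; rewrite expr0 mulr1.
Qed.

Lemma gpol_sum n (p : 'I_n -> W -> X -> R[i]) : (forall i, gpol (p i)) ->
  gpol (fun t x => \sum_(i < n) p i t x).
Proof.
elim: n p => [|n ih] p hp.
  by apply: gpol_ext (gpol_cst 0) => t x; rewrite big_ord0.
apply: gpol_ext (gpol_add (hp ord0) (ih _ (fun i => hp (lift ord0 i)))) => t x.
by rewrite big_ord_recl.
Qed.

Lemma gpol_weight (g : X -> R) (C : R) (e : nat) : measurable_fun setT g ->
  (forall x, `|g x| <= C * (1 + N x) ^+ e) -> gpol (fun _ x => (g x)%:C).
Proof.
move=> mg gC; apply: (@gpol_coef _ C e); first exact: cmeas_real.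
by move=> x; rewrite cabs_real.
Qed.

(** This closure is what makes all iterated derivatives of a Gaussian integral Gaussian integrals
    again: coefficients in [x] have derivative zero, linear forms have constant derivative, and sums
    and products follow Leibniz. *)
Lemma gpol_is_derive p v : gpol p -> exists p', gpol p' /\
  forall t x, cder (fun t => p t x) t v (p' t x).
Proof.
elim=> {p} [g C e mg gC|l K lD lZ lK|p q pp [p' [pp' dp]] qq [q' [qq' dq]]
            |p q pp [p' [pp' dp]] qq [q' [qq' dq]]].
- by exists (fun _ _ => 0); split; [exact: gpol_cst|move=> t x; exact: cder_cst].
- exists (fun _ _ => (l v)%:C); split; first exact: gpol_cst.
  by move=> t x; apply: cder_real; exact: is_derive_linear.
- exists (fun t x => p' t x + q' t x); split; first exact: gpol_add.
  by move=> t x; exact: cderD.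
- exists (fun t x => p' t x * q t x + p t x * q' t x); split.
    by apply: gpol_add; exact: gpol_mul.
  by move=> t x; exact: cderM.
Qed.

(** Linear forms in the parameter are bounded on bounded sets, so the growth in [N] gets a constant
    and a degree independent of [t]. Domination near a point requires this uniformity. *)
Lemma gpol_bounded p (M : R) : gpol p -> exists C e, 0 <= C /\
  forall t, `|t| <= M -> forall x, cabs (p t x) <= C * (1 + N x) ^+ e.
Proof.
elim=> {p} [g C e mg gC|l K lD lZ lK|p q _ [C [e [C0 pC]]] _ [D [f [D0 qD]]]
            |p q _ [C [e [C0 pC]]] _ [D [f [D0 qD]]]].
- exists `|C|, e; split => // t _ x; apply: le_trans (gC x) _.
  by rewrite ler_wpM2r ?exprn_ge0 ?ler_norm // (le_trans ler01).
- exists (`|K| * `|M|), 0%N; split => [|t tM x]; first by rewrite mulr_ge0.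
  rewrite cabs_real expr0 mulr1 (le_trans (lK t)) //.
  apply: (@le_trans _ _ (`|K| * `|t|)); first by rewrite ler_wpM2r ?ler_norm.
  by rewrite ler_wpM2l // (le_trans tM) // ler_norm.
- exists (C + D), (e + f)%N; split => [|t tM x]; first exact: addr_ge0.
  rewrite (le_trans (cabsD _ _)) // mulrDl lerD //.
    rewrite (le_trans (pC t tM x)) // ler_wpM2l // ler_weXn2l ?leq_addr //.
  by rewrite (le_trans (qD t tM x)) // ler_wpM2l // ler_weXn2l ?leq_addl //.
- exists (C * D), (e + f)%N; split => [|t tM x]; first exact: mulr_ge0.
  by rewrite cabsM exprD mulrACA ler_pM ?cabs_ge0 ?pC ?qD.
Qed.

Lemma gpol_cmeas p t : gpol p -> cmeas (p t).
Proof.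
elim=> {p} [g C e mg gC|l K lD lZ lK|p q _ mp _ mq|p q _ mp _ mq] //.
- exact: cmeasD.
- exact: cmeasM.
Qed.

Definition ccont (f : W -> R[i]) t :=
  {for t, continuous (fun t => Re (f t))} /\ {for t, continuous (fun t => Im (f t))}.

Lemma ccont_cst (c : R[i]) t : ccont (fun=> c) t.
Proof. by split; exact: cvg_cst. Qed.

Lemma ccont_real (f : W -> R) t : {for t, continuous f} -> ccont (fun t => (f t)%:C) t.
Proof. by split => //=; exact: cvg_cst. Qed.

Lemma ccontD (f g : W -> R[i]) t : ccont f t -> ccont g t ->
  ccont (fun t => f t + g t) t.
Proof.
move=> [f1 f2] [g1 g2]; split; rewrite /prop_for /continuous_at.
  by under eq_fun do rewrite cReD; rewrite cReD; exact: cvgD.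
by under eq_fun do rewrite cImD; rewrite cImD; exact: cvgD.
Qed.

Lemma ccontM (f g : W -> R[i]) t : ccont f t -> ccont g t ->
  ccont (fun t => f t * g t) t.
Proof.
move=> [f1 f2] [g1 g2]; split; rewrite /prop_for /continuous_at.
  under eq_fun do rewrite cReM; rewrite cReM; apply: cvgB; exact: cvgM.
by under eq_fun do rewrite cImM; rewrite cImM; apply: cvgD; exact: cvgM.
Qed.

Lemma ccont_cexp (f : W -> R[i]) t : ccont f t -> ccont (fun t => cexp (f t)) t.
Proof.
move=> [f1 f2]; apply: ccontM.
  by apply: ccont_real; apply: continuous_comp f1 _; exact: continuous_expR.
split; [exact: (continuous_comp f2 (@continuous_cos _ _))|].
exact: (continuous_comp f2 (@continuous_sin _ _)).
Qed.

Lemma linear_continuous_bound (l : W -> R) (K : R) t :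
  (forall x y, l (x + y) = l x + l y) -> (forall a x, l (a *: x) = a * l x) ->
  (forall x, `|l x| <= K * `|x|) -> {for t, continuous l}.
Proof.
move=> lD lZ lK; apply/cvgrPdist_lt => e e0; apply/nbhs_ballP.
exists (e / (`|K| + 1)) => [|s]; first by rewrite /= divr_gt0 // ltr_wpDl.
rewrite -ball_normE /= => hs.
have -> : l t - l s = l (t - s) by rewrite lD -(scaleN1r s) lZ mulN1r.
apply: le_lt_trans (lK _) _.
apply: (@le_lt_trans _ _ ((`|K| + 1) * `|t - s|)).
  by rewrite ler_wpM2r // (le_trans (ler_norm _)) // lerDl.
by rewrite mulrC -ltr_pdivlMr // ltr_wpDl.
Qed.

Lemma gpol_ccont p t x : gpol p -> ccont (fun t => p t x) t.
Proof.
elim=> {p} [g C e mg gC|l K lD lZ lK|p q _ mp _ mq|p q _ mp _ mq].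
- exact: ccont_cst.
- by apply: ccont_real; exact: linear_continuous_bound lK.
- exact: ccontD.
- exact: ccontM.
Qed.

Hypothesis HN : forall (e : nat) (a : R), 0 < a ->
  mu.-integrable setT (EFin \o (fun x => (1 + N x) ^+ e * expR (- a * N x ^+ 2))).

Variable U : set W.
Variable q : W -> X -> R[i].
Hypothesis gq : gpol q.
Hypothesis q_decay : forall t0, U t0 -> exists r a K : R, [/\ 0 < r, 0 < a &
  forall t, `|t - t0| < r -> U t /\ forall x, Re (q t x) <= K - a * N x ^+ 2].

(** Theta series (counting measure), Gaussian integrals unfolded over the integers, and theta series
    averaged over the square are all of this form. *)
Definition gint p t : R[i] := cint mu (fun x => p t x * cexp (q t x)).

(** The decay of [Re q] in [N ^+ 2] is uniform near [t0] and absorbs any power of [1 + N]; the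
    majorant is a constant times one of the functions in [HN]. *)
Lemma gint_bound p t0 : gpol p -> U t0 -> exists (r : R) (G : X -> R),
  [/\ 0 < r, mu.-integrable setT (EFin \o G) &
  forall t, `|t - t0| < r -> U t /\ forall x, cabs (p t x * cexp (q t x)) <= G x].
Proof.
move=> gp Ut0; have [r [a [K [r0 a0 qK]]]] := q_decay Ut0.
have [C [e [C0 pC]]] := gpol_bounded (`|t0| + r) gp.
exists r, (fun x => (C * expR K) * ((1 + N x) ^+ e * expR (- a * N x ^+ 2))).
split => //.
  rewrite (_ : _ \o _ = (fun x => (C * expR K)%:E *
     ((1 + N x) ^+ e * expR (- a * N x ^+ 2))%:E)%E); last exact/funext.
  by apply: integrableZl => //; exact: HN.
move=> t tr; have [Ut qt] := qK t tr; split=> // x.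
rewrite cabsM cabs_cexp mulrACA -expRD mulNr.
rewrite ler_pM ?cabs_ge0 ?expR_ge0 ?ler_expR // pC //.
rewrite -(subrK t0 t) addrC (le_trans (ler_normD _ _)) // lerD2l.
exact: ltW.
Qed.

Lemma gint_cmeas p t : gpol p -> cmeas (fun x => p t x * cexp (q t x)).
Proof. by move=> gp; apply: cmeasM; [|apply: cmeas_cexp]; exact: gpol_cmeas. Qed.

Lemma gint_integrable p t : gpol p -> U t ->
  cintegrable mu (fun x => p t x * cexp (q t x)).
Proof.
move=> gp Ut; have [r [G [r0 iG pG]]] := gint_bound gp Ut.
apply: (@cintegrable_dominated _ _ _ _ _ G) => //; first exact: gint_cmeas.
by apply: (pG t _).2; rewrite subrr normr0.
Qed.

Lemma gint_abs_integrable p t : gpol p -> U t ->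
  mu.-integrable setT (fun x => (cabs (p t x * cexp (q t x)))%:E).
Proof.
move=> gp Ut; have [r [G [r0 iG pG]]] := gint_bound gp Ut.
apply: (@integrable_dominated _ _ _ _ (fun x => cabs (p t x * cexp (q t x))) G) => //.
  have [m1 m2] := gint_cmeas t gp.
  apply: (measurableT_comp (continuous_measurable_fun (@sqrt_continuous _))).
  apply: measurable_funD; exact: measurable_funX.
by move=> x; rewrite ger0_norm ?cabs_ge0 //; apply: (pG t _).2; rewrite subrr normr0.
Qed.

(** The derivative of [p * cexp q] is [(p' + p * q') * cexp q], which has the same shape, so the
    same domination applies to it. *)
Lemma gint_is_derive p p' q' t v : gpol p -> gpol p' -> gpol q' ->
  (forall t x, cder (fun t => p t x) t v (p' t x)) ->
  (forall t x, cder (fun t => q t x) t v (q' t x)) -> U t ->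
  cder (gint p) t v (gint (fun t x => p' t x + p t x * q' t x) t).
Proof.
move=> gp gp' gq' dp dq Ut.
have gpq : gpol (fun t x => p' t x + p t x * q' t x).
  by apply: gpol_add => //; exact: gpol_mul.
have [r [G [r0 iG pG]]] := gint_bound gp Ut.
have [s [H [s0 iH pH]]] := gint_bound gpq Ut.
have d0 t1 x : cder (fun t => p t x * cexp (q t x)) t1 v
    ((p' t1 x + p t1 x * q' t1 x) * cexp (q t1 x)).
  apply: cder_eq (cderM (dp t1 x) (cder_cexp (dq t1 x))) _.
  by rewrite mulrDl mulrA.
(* A single majorant has to serve the integrand and its derivative. *)
pose GH x := G x + H x.
have GH1 t1 x : `|t1 - t| < Num.min r s -> G x <= GH x /\ H x <= GH x.
  rewrite lt_min => /andP[t1r t1s]; rewrite /GH lerDl lerDr.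
  by split; [apply: le_trans ((pH _ t1s).2 x)|apply: le_trans ((pG _ t1r).2 x)];
    exact: cabs_ge0.
have iGH : mu.-integrable setT (EFin \o GH).
  by rewrite (_ : EFin \o GH = (EFin \o G) \+ (EFin \o H)); [exact: integrableD|exact/funext].
have m0 : 0 < Num.min r s by rewrite lt_min r0.
split.
  apply: (@Rintegral_is_derive _ _ _ mu _ (fun t x => Re (p t x * cexp (q t x)))
    (fun t x => Re ((p' t x + p t x * q' t x) * cexp (q t x))) t v _ GH m0) => //.
  - by move=> t1 _; exact: (gint_cmeas t1 gp).1.
  - move=> t1 h x; have [g1 g2] := GH1 t1 x h; move: h; rewrite lt_min => /andP[h1 h2].
    by rewrite (le_trans (cabs_Re _)) // (le_trans ((pG t1 h1).2 x)).
  - move=> t1 h x; have [g1 g2] := GH1 t1 x h; move: h; rewrite lt_min => /andP[h1 h2].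
    by rewrite (le_trans (cabs_Re _)) // (le_trans ((pH t1 h2).2 x)).
  - by move=> t1 _ x; have [] := d0 t1 x.
apply: (@Rintegral_is_derive _ _ _ mu _ (fun t x => Im (p t x * cexp (q t x)))
    (fun t x => Im ((p' t x + p t x * q' t x) * cexp (q t x))) t v _ GH m0) => //.
- by move=> t1 _; exact: (gint_cmeas t1 gp).2.
- move=> t1 h x; have [g1 g2] := GH1 t1 x h; move: h; rewrite lt_min => /andP[h1 h2].
  by rewrite (le_trans (cabs_Im _)) // (le_trans ((pG t1 h1).2 x)).
- move=> t1 h x; have [g1 g2] := GH1 t1 x h; move: h; rewrite lt_min => /andP[h1 h2].
  by rewrite (le_trans (cabs_Im _)) // (le_trans ((pH t1 h2).2 x)).
- by move=> t1 _ x; have [] := d0 t1 x.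
Qed.

Lemma gint_ccont p t : gpol p -> U t -> ccont (gint p) t.
Proof.
move=> gp Ut; have [r [G [r0 iG pG]]] := gint_bound gp Ut.
have c0 x : ccont (fun t => p t x * cexp (q t x)) t.
  by apply: ccontM; [|apply: ccont_cexp]; exact: gpol_ccont.
split; apply: (@Rintegral_continuous _ _ _ _ _ _ _ r G) => //.
- by move=> t1 _; exact: (gint_cmeas t1 gp).1.
- by move=> t1 h x; rewrite (le_trans (cabs_Re _)) // (pG t1 h).2.
- by move=> x; have [] := c0 x.
- by move=> t1 _; exact: (gint_cmeas t1 gp).2.
- by move=> t1 h x; rewrite (le_trans (cabs_Im _)) // (pG t1 h).2.
- by move=> x; have [] := c0 x.
Qed.

Lemma decay_near t : U t -> \forall s \near t, U s.
Proof.
move=> Ut; have [r [a [K [r0 a0 qK]]]] := q_decay Ut.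
by apply/nbhs_ballP; exists r => // s; rewrite -ball_normE /= distrC => /qK[].
Qed.

Lemma gint_smooth p : gpol p ->
  smooth_on U (fun t => Re (gint p t)) /\ smooth_on U (fun t => Im (gint p t)).
Proof.
move=> gp.
(* An iterated derivative is identified with some [gint p'] on [U] only; the next derivative is
   still determined, because [U] contains a neighbourhood of each of its points ([decay_near]). *)
have key (vs : seq W) : exists p', gpol p' /\ forall t, U t ->
    foldr (fun v h => 'D_v h) (fun t => Re (gint p t)) vs t = Re (gint p' t) /\
    foldr (fun v h => 'D_v h) (fun t => Im (gint p t)) vs t = Im (gint p' t).
  elim: vs => [|v vs [p' [gp' hp']]]; first by exists p.
  have [p'' [gp'' dp'']] := gpol_is_derive v gp'.
  have [q' [gq' dq']] := gpol_is_derive v gq.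
  exists (fun t x => p'' t x + p' t x * q' t x); split.
    by apply: gpol_add => //; exact: gpol_mul.
  move=> t Ut; have [d1 d2] := gint_is_derive gp' gp'' gq' dp'' dq' Ut.
  split.
    transitivity ('D_v (fun x => Re (gint p' x)) t); last exact: derive_val.
    by apply: near_eq_derive; near=> s; apply hp'; near: s; exact: decay_near.
  transitivity ('D_v (fun x => Im (gint p' x)) t); last exact: derive_val.
  by apply: near_eq_derive; near=> s; apply hp'; near: s; exact: decay_near.
split=> vs g t Ut; have [p' [gp' hp']] := key vs.
  have e : \forall s \near t, Re (gint p' s) = g s.
    by near=> s; rewrite -(hp' s _).1 //; near: s; exact: decay_near.
  split.
    rewrite /prop_for /continuous_at -(nbhs_singleton e); apply: cvg_trans (gint_ccont gp' Ut).1.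
    exact: near_eq_cvg.
  move=> v; apply: near_eq_derivable e _.
  have [p'' [gp'' dp'']] := gpol_is_derive v gp'.
  have [q' [gq' dq']] := gpol_is_derive v gq.
  by have [[]] := gint_is_derive gp' gp'' gq' dp'' dq' Ut.
have e : \forall s \near t, Im (gint p' s) = g s.
  by near=> s; rewrite -(hp' s _).2 //; near: s; exact: decay_near.
split.
  rewrite /prop_for /continuous_at -(nbhs_singleton e); apply: cvg_trans (gint_ccont gp' Ut).2.
  exact: near_eq_cvg.
move=> v; apply: near_eq_derivable e _.
have [p'' [gp'' dp'']] := gpol_is_derive v gp'.
have [q' [gq' dq']] := gpol_is_derive v gq.
by have [_ []] := gint_is_derive gp' gp'' gq' dp'' dq' Ut.
Unshelve. all: by end_near. Qed.

End GaussianIntegrals.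

(** * Unordered sums over countable types: reindexing, linearity, Fubini *)

Section CountableSums.
Variable R : realType.

Lemma esum_inj (T T' : choiceType) (e : T -> T') (a : T' -> \bar R) :
  injective e -> (forall t, ~ range e t -> a t = 0%E) ->
  \esum_(t in [set: T']) a t = \esum_(t in [set: T]) a (e t).
Proof.
move=> ei a0; rewrite -(@reindex_esum R T T' setT (range e) e a).
  rewrite [RHS]esum_mkcond.
  apply: eq_esum => t _; case: ifPn => // /negP h.
  by apply: a0 => ht; apply: h; exact: mem_set.
split=> [t _|x y _ _|t []//]; last by move=> s _ <-; exists s.
  by exists t.
exact: ei.
Qed.

Lemma csum_inj (T T' : choiceType) (e : T -> T') (f : T' -> R[i]) :
  injective e -> (forall t, ~ range e t -> f t = 0) ->
  csum f = csum (fun t => f (e t)).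
Proof.
move=> ei f0; rewrite /csum /rsum.
have p (g : T' -> R) : (forall t, ~ range e t -> g t = 0) ->
    esum setT (EFin \o g)^\+%E = esum setT (EFin \o (fun t => g (e t)))^\+%E /\
    esum setT (EFin \o g)^\-%E = esum setT (EFin \o (fun t => g (e t)))^\-%E.
  move=> g0; split.
    rewrite (esum_inj ei); first by apply: eq_esum => t _; rewrite !funeposE.
    by move=> t /g0 h; rewrite funeposE /= h maxxx.
  rewrite (esum_inj ei); first by apply: eq_esum => t _; rewrite !funenegE.
  by move=> t /g0 h; rewrite funenegE /= h oppr0 maxxx.
have [-> ->] := p (fun t => Re (f t)) (fun t h => congr1 (@Re R) (f0 t h)).
by have [-> ->] := p (fun t => Im (f t)) (fun t h => congr1 (@Im R) (f0 t h)).
Qed.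

Lemma csum_bij (T T' : choiceType) (e : T -> T') (f : T' -> R[i]) :
  bijective e -> csum f = csum (fun t => f (e t)).
Proof.
move=> [g ge eg]; apply: csum_inj; first exact: can_inj ge.
by move=> t []; exists (g t).
Qed.

Lemma abs_summable_inj (T T' : choiceType) (e : T -> T') (f : T' -> R[i]) :
  injective e -> abs_summable f -> abs_summable (fun t => f (e t)).
Proof.
move=> ei; rewrite /abs_summable /summable; apply: le_lt_trans.
rewrite -(@reindex_esum R T T' setT (range e) e (fun t => `|(cabs (f t))%:E|%E)).
  by rewrite esum_mkcond; apply: le_esum => t _; case: ifP.
split=> [t _|x y _ _|t []//]; last by move=> s _ <-; exists s.
  by exists t.
exact: ei.
Qed.

Lemma abs_summable_bij (T T' : choiceType) (e : T -> T') (f : T' -> R[i]) :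
  bijective e -> abs_summable (fun t => f (e t)) -> abs_summable f.
Proof.
move=> [g ge eg] /(abs_summable_inj (can_inj eg)).
by rewrite [X in abs_summable X](_ : _ = f) //; apply/funext => t; rewrite eg.
Qed.

Lemma abs_summable_le (T : choiceType) (f : T -> R[i]) (E : T -> R) :
  summable setT (fun t => (E t)%:E) -> (forall t, cabs (f t) <= E t) ->
  abs_summable f.
Proof.
move=> sE fE; apply: le_lt_trans sE; apply: le_esum => t _.
by rewrite /= lee_fin ger0_norm ?cabs_ge0 // (le_trans (fE t)) // ler_norm.
Qed.

Lemma summableZ (T : choiceType) (E : T -> R) (c : R) :
  summable setT (fun t => (E t)%:E) -> summable setT (fun t => (c * E t)%:E).
Proof.
rewrite /summable => sE.
suff : (\esum_(t in [set: T]) `|(c * E t)%:E| <= `|c|%:E * \esum_(t in [set: T]) `|(E t)%:E|)%E.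
  move=> h; apply: le_lt_trans h _; apply: lte_mul_pinfty => //.
apply: ge_ereal_sup => x [A [finA _] <-].
rewrite [X in (X <= _)%E](_ : _ = `|c|%:E * \sum_(t \in A) `|(E t)%:E|)%E; last first.
  rewrite !fsbig_finite //= ge0_sume_distrr //.
  by apply: eq_bigr => t _; rewrite /= -EFinM normrM.
apply: lee_pmul => //; rewrite ?lee_fin //; first exact: fsume_ge0.
by apply: ereal_sup_ubound; exists A => //; split.
Qed.

(** [rsum] is defined through positive and negative parts; this frees it to be computed from any
    splitting into nonnegative summable families, whether or not they overlap. *)
Lemma rsumB (T : choiceType) (f g : T -> R) :
  summable setT (fun t => (f t)%:E) -> summable setT (fun t => (g t)%:E) ->
  (forall t, 0 <= f t) -> (forall t, 0 <= g t) ->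
  rsum (fun t => f t - g t) =
  fine (\esum_(t in [set: T]) (f t)%:E) - fine (\esum_(t in [set: T]) (g t)%:E).
Proof.
move=> sf sg f0 g0; rewrite /rsum.
have h := esumB sf sg (fun i _ => f0 i) (fun i _ => g0 i).
have fin (u : T -> R) : (forall t, 0 <= u t) -> summable setT (fun t => (u t)%:E) ->
    (\esum_(t in [set: T]) (u t)%:E)%E \is a fin_num.
  move=> u0; rewrite summableE.
  by under eq_esum do rewrite gee0_abs ?lee_fin ?u0 //.
have sfg := summableB sf sg.
rewrite -!fineB ?fin //; first by rewrite -h.
  rewrite ge0_fin_numE ?esum_ge0 //.
  have := summable_funepos sfg; rewrite /summable.
  by under eq_esum do rewrite gee0_abs //.
rewrite ge0_fin_numE ?esum_ge0 //.
have := summable_funeneg sfg; rewrite /summable.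
by under eq_esum do rewrite gee0_abs //.
Qed.

Lemma esum_counting (a : nat -> \bar R) : (forall n, (0 <= a n)%E) ->
  \esum_(n in [set: nat]) a n = (\int[@counting nat R]_n a n)%E.
Proof. by move=> a0; rewrite ge0_integral_count // nneseries_esumT. Qed.

Lemma counting_integrableE (f : nat -> R) :
  summable setT (fun n => (f n)%:E) <->
  (@counting nat R).-integrable setT (fun n => (f n)%:E).
Proof.
rewrite /summable esum_counting //; split=> [h|/integrableP[]//].
by apply/integrableP; split.
Qed.

Lemma rsum_counting (f : nat -> R) : summable setT (fun n => (f n)%:E) ->
  rsum f = \int[@counting nat R]_n f n.
Proof.
move=> sf; rewrite /rsum /Rintegral integralE fineB.
- by rewrite !esum_counting.
- by apply: integrable_pos_fin_num => //; apply/counting_integrableE.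
- by apply: integrable_neg_fin_num => //; apply/counting_integrableE.
Qed.

Lemma csum_counting (f : nat -> R[i]) : abs_summable f ->
  cintegrable (@counting nat R) f /\ csum f = cint (@counting nat R) f.
Proof.
move=> sf.
have s1 : summable setT (fun n => (Re (f n))%:E).
  apply: le_lt_trans sf; apply: le_esum => n _.
  by rewrite /= lee_fin [X in _ <= X]ger0_norm ?cabs_ge0 ?cabs_Re.
have s2 : summable setT (fun n => (Im (f n))%:E).
  apply: le_lt_trans sf; apply: le_esum => n _.
  by rewrite /= lee_fin [X in _ <= X]ger0_norm ?cabs_ge0 ?cabs_Im.
split; first by split; exact/counting_integrableE.
by rewrite /csum /cint !rsum_counting.
Qed.

Lemma abs_summable_counting (f : nat -> R[i]) : abs_summable f <->
  (@counting nat R).-integrable setT (fun n => (cabs (f n))%:E).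
Proof. exact: counting_integrableE. Qed.

(** Extension by zero along the encoding of [T] in [nat]. It turns a sum over any countable type,
    finite or not, into an integral for counting measure, where linearity is available. *)
Definition cext (T : countType) (f : T -> R[i]) (j : nat) : R[i] :=
  oapp f 0 (@pickle_inv T j).

Lemma csum_cext (T : countType) (f : T -> R[i]) : csum f = csum (cext f).
Proof.
rewrite [RHS](@csum_inj _ _ (@choice.pickle T)).
- by congr csum; apply/funext => t; rewrite /cext pickleK_inv.
- exact: (pcan_inj pickleK_inv).
- move=> j nj; rewrite /cext; case E : (pickle_inv j) => [t|] //=.
  by case: nj; exists t => //; have := @pickle_invK T j; rewrite E.
Qed.

Lemma abs_summable_cext (T : countType) (f : T -> R[i]) :
  abs_summable f -> abs_summable (cext f).
Proof.
rewrite /abs_summable /summable (@esum_inj _ _ (@choice.pickle T)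
  (fun j => `|(cabs (cext f j))%:E|)%E).
- by under [X in _ -> (X < _)%E]eq_esum do rewrite /cext pickleK_inv /=.
- exact: (pcan_inj pickleK_inv).
- move=> j nj; rewrite /cext; case E : (pickle_inv j) => [t|] /=.
    by case: nj; exists t => //; have := @pickle_invK T j; rewrite E.
  by rewrite (_ : cabs 0 = 0) ?normr0 // cabsE ComplexField.Normc.normc0.
Qed.

Lemma csumZ (T : countType) (c : R[i]) (f : T -> R[i]) : abs_summable f ->
  csum (fun t => c * f t) = c * csum f.
Proof.
move=> sf; have [i1 e1] := csum_counting (abs_summable_cext sf).
have sZ : abs_summable (fun t => c * f t).
  apply: (abs_summable_le (E := fun t => cabs c * cabs (f t))); first exact: summableZ.
  by move=> t; rewrite cabsM.
have [i2 e2] := csum_counting (abs_summable_cext sZ).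
rewrite csum_cext e2 (csum_cext f) e1 -cintZ //; apply: eq_cint => j.
by rewrite /cext; case: pickle_inv => //=; rewrite mulr0.
Qed.

Lemma abs_summableZ (T : countType) (c : R[i]) (f : T -> R[i]) : abs_summable f ->
  abs_summable (fun t => c * f t).
Proof.
move=> sf; apply: (abs_summable_le (E := fun t => cabs c * cabs (f t))); first exact: summableZ.
by move=> t; rewrite cabsM.
Qed.

Lemma abs_summableD (T : countType) (f g : T -> R[i]) : abs_summable f ->
  abs_summable g -> abs_summable (fun t => f t + g t).
Proof.
move=> sf sg.
apply: (abs_summable_le (E := fun t => cabs (f t) + cabs (g t))) => [|t].
  exact: summableD sf sg.
exact: cabsD.
Qed.

Lemma csumD (T : countType) (f g : T -> R[i]) : abs_summable f ->
  abs_summable g -> csum (fun t => f t + g t) = csum f + csum g.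
Proof.
move=> sf sg; have [i1 e1] := csum_counting (abs_summable_cext sf).
have [i2 e2] := csum_counting (abs_summable_cext sg).
have [i3 e3] := csum_counting (abs_summable_cext (abs_summableD sf sg)).
rewrite csum_cext e3 (csum_cext f) (csum_cext g) e1 e2 -cintD //.
by apply: eq_cint => j; rewrite /cext; case: pickle_inv => //=; rewrite addr0.
Qed.

Lemma csum_sum (T : countType) (I : eqType) (s : seq I) (f : I -> T -> R[i]) :
  (forall i, i \in s -> abs_summable (f i)) ->
  abs_summable (fun t => \sum_(i <- s) f i t) /\
  csum (fun t => \sum_(i <- s) f i t) = \sum_(i <- s) csum (f i).
Proof.
elim: s => [|i s ih] h.
  have s0 : abs_summable (fun _ : T => 0 : R[i]).
    rewrite /abs_summable /summable esum1 // => t _.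
    by rewrite (_ : cabs 0 = 0) ?abse0 // cabsE ComplexField.Normc.normc0.
  have e : (fun t => \sum_(i <- [::]) f i t) = (fun _ => 0).
    by apply/funext => t; rewrite big_nil.
  rewrite e big_nil; split=> //.
  by have := csumZ 0 s0; rewrite !mul0r.
have [ih1 ih2] := ih (fun j js => h j (mem_behead (s := i :: s) js)).
have si := h i (mem_head i s).
have e : (fun t => \sum_(i <- i :: s) f i t) = (fun t => f i t + \sum_(j <- s) f j t).
  by apply/funext => t; rewrite big_cons.
by rewrite e big_cons -ih2; split; [exact: abs_summableD|exact: csumD].
Qed.

(** Tonelli is applied to the positive and the negative part of [f]. The row sums [P] and [M] of
    these parts are in general not the parts of the row sum [P - M], so [rsumB] is used to recombine
    them. *)
Lemma rsum_pair (T1 T2 : choiceType) (f : T1 * T2 -> R) :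
  summable setT (fun t => (f t)%:E) ->
  (forall t1, summable setT (fun t2 => (f (t1, t2))%:E)) /\
  rsum f = rsum (fun t1 => rsum (fun t2 => f (t1, t2))).
Proof.
move=> sf.
have TT : [set: T1] `*`` (fun=> [set: T2]) = [set: T1 * T2] by apply/seteqP; split.
have pairE (a : T1 * T2 -> \bar R) : (forall t, (0 <= a t)%E) ->
   \esum_(t in [set: T1 * T2]) a t =
   \esum_(t1 in [set: T1]) \esum_(t2 in [set: T2]) a (t1, t2).
  move=> a0; rewrite esum_esum // TT; apply: eq_esum => -[t1 t2] _ //.
have sp := summable_funepos sf; have sn := summable_funeneg sf.
have fin1 (a : T1 * T2 -> \bar R) t1 : (forall t, (0 <= a t)%E) ->
   summable setT a -> (\esum_(t2 in [set: T2]) a (t1, t2))%E \is a fin_num.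
  move=> a0; rewrite /summable; under eq_esum do rewrite gee0_abs //.
  rewrite pairE // => h; rewrite ge0_fin_numE ?esum_ge0 //; apply: le_lt_trans h.
  apply: esum_ge; exists [set t1]; first by split => //; exact: finite_set1.
  by rewrite fsbig_set1.
have p0 t : (0 <= (EFin \o f)^\+ t)%E by [].
have n0 t : (0 <= (EFin \o f)^\- t)%E by [].
split=> [t1|].
  rewrite summableE.
  have h := fin1 (fun t => `|(f t)%:E|)%E t1 (fun t => abse_ge0 _).
  by apply: h; rewrite /summable; under eq_esum do rewrite abse_id.
pose P t1 := fine (\esum_(t2 in [set: T2]) (EFin \o f)^\+%E (t1, t2)).
pose M t1 := fine (\esum_(t2 in [set: T2]) (EFin \o f)^\-%E (t1, t2)).
have PE t1 : (P t1)%:E = \esum_(t2 in [set: T2]) (EFin \o f)^\+%E (t1, t2).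
  by rewrite fineK // fin1.
have ME t1 : (M t1)%:E = \esum_(t2 in [set: T2]) (EFin \o f)^\-%E (t1, t2).
  by rewrite fineK // fin1.
have P0 t1 : 0 <= P t1 by rewrite fine_ge0 ?esum_ge0.
have M0 t1 : 0 <= M t1 by rewrite fine_ge0 ?esum_ge0.
have sP : summable setT (fun t1 => (P t1)%:E).
  rewrite /summable; under eq_esum do rewrite gee0_abs ?lee_fin ?P0 // PE.
  rewrite -pairE //; move: sp; rewrite /summable.
  by under eq_esum do rewrite gee0_abs //.
have sM : summable setT (fun t1 => (M t1)%:E).
  rewrite /summable; under eq_esum do rewrite gee0_abs ?lee_fin ?M0 // ME.
  rewrite -pairE //; move: sn; rewrite /summable.
  by under eq_esum do rewrite gee0_abs //.
have -> : rsum (fun t1 => rsum (fun t2 => f (t1, t2))) = rsum (fun t1 => P t1 - M t1).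
  congr rsum; apply/funext => t1; rewrite /P /M /rsum.
  by congr (fine _ - fine _); apply: eq_esum => t2 _; rewrite ?funeposE ?funenegE.
rewrite rsumB // /rsum !pairE //.
by congr (fine _ - fine _); apply: eq_esum => t1 _; rewrite ?PE ?ME.
Qed.

Lemma csum_pair (T1 T2 : countType) (f : T1 * T2 -> R[i]) : abs_summable f ->
  (forall t1, abs_summable (fun t2 => f (t1, t2))) /\
  csum f = csum (fun t1 => csum (fun t2 => f (t1, t2))).
Proof.
move=> sf; split; first by have [] := rsum_pair sf.
have s1 : summable setT (fun t => (Re (f t))%:E).
  apply: le_lt_trans sf; apply: le_esum => n _.
  by rewrite /= lee_fin [X in _ <= X]ger0_norm ?cabs_ge0 ?cabs_Re.
have s2 : summable setT (fun t => (Im (f t))%:E).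
  apply: le_lt_trans sf; apply: le_esum => n _.
  by rewrite /= lee_fin [X in _ <= X]ger0_norm ?cabs_ge0 ?cabs_Im.
by rewrite /csum (rsum_pair s1).2 (rsum_pair s2).2.
Qed.

Lemma csum_swap (T1 T2 : countType) (f : T1 -> T2 -> R[i]) :
  abs_summable (fun t : T1 * T2 => f t.1 t.2) ->
  csum (fun t1 => csum (fun t2 => f t1 t2)) =
  csum (fun t2 => csum (fun t1 => f t1 t2)).
Proof.
move=> sf; have [_ <-] := csum_pair sf.
have sw : bijective (fun t : T2 * T1 => (t.2, t.1)).
  by exists (fun t => (t.2, t.1)) => -[].
rewrite (csum_bij _ sw).
by have [_ ->] := csum_pair (abs_summable_inj (bij_inj sw) sf).
Qed.

End CountableSums.

HB.instance Definition _ (R : realType) :=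
  @Measure_isSigmaFinite.Build _ nat R (@counting nat R) (sigma_finite_counting R).

(** * Summability over the lattice *)

Section LatticeWeights.
Variable R : realType.

(** The l1 norm is chosen because its exponential is a product over the coordinates, so that
    summability follows by induction on the dimension. *)
Definition zwt n (k : 'rV[int]_n) : R := \sum_(i < n) (absz (k ord0 i))%:R.

Lemma zwt_ge0 n (k : 'rV[int]_n) : 0 <= zwt k.
Proof. exact: sumr_ge0. Qed.

Definition zcons n (t : int * 'rV[int]_n) : 'rV[int]_(1 + n) :=
  row_mx (const_mx t.1) t.2.

Lemma zcons_bij n : bijective (@zcons n).
Proof.
exists (fun k : 'rV[int]_(1 + n) => (k ord0 (lshift n ord0), rsubmx k)) => [[k1 k']|k].
  by rewrite /zcons /= row_mxEl mxE row_mxKr.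
rewrite /zcons /=; rewrite -[RHS]hsubmxK; congr row_mx.
by apply/rowP => i; rewrite !mxE !ord1.
Qed.

Lemma zwt_cons n (t : int * 'rV[int]_n) :
  zwt (zcons t) = (absz t.1)%:R + zwt t.2.
Proof.
rewrite /zwt (@big_split_ord _ _ _ 1 n) /= big_ord1 /zcons row_mxEl mxE; congr (_ + _).
by apply: eq_bigr => i _; rewrite row_mxEr.
Qed.

Lemma summable_nat_exp : summable [set: nat] (fun n => (expR (- n%:R) : R)%:E).
Proof.
pose z : R := expR (- 1).
have z0 : 0 < z := expR_gt0 _.
have z1 : z < 1 by rewrite expR_lt1.
have e (n : nat) : expR (- n%:R) = geometric 1 z n :> R.
  by rewrite /= mul1r -expRM_natl mulrN1.
rewrite /summable; under eq_esum do rewrite gee0_abs ?lee_fin ?expR_ge0 //.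
rewrite -nneseries_esumT; last by move=> n; rewrite lee_fin expR_ge0.
apply: (@le_lt_trans _ _ (1 / (1 - z))%:E); last by rewrite ltry.
apply: lime_le.
  by apply: is_cvg_nneseries => n _ _; rewrite lee_fin expR_ge0.
near=> n; rewrite sumEFin lee_fin.
have zn : `|z| < 1 by rewrite ger0_norm // ltW.
have := @geometric_le_lim R n 1 z ler01 z0 zn.
by rewrite /series /=; under [X in _ -> X <= _]eq_bigr do rewrite e.
Unshelve. all: by end_near. Qed.

Lemma esum_inj_lty (T T' : choiceType) (e : T -> T') (a : T -> R) (A : set T') (b : T' -> R) :
  set_bij setT A e -> (forall t, b (e t) = a t) ->
  summable setT (fun t => (a t)%:E) -> (\esum_(t in A) `|(b t)%:E| < +oo)%E.
Proof.
move=> eb ba; apply: le_lt_trans.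
by rewrite (@reindex_esum R _ _ setT A e) //; apply: le_esum => t _; rewrite ba.
Qed.

Lemma summable_int_exp : summable [set: int] (fun k => (expR (- (absz k)%:R) : R)%:E).
Proof.
rewrite /summable (esumID (range Posz)); last by move=> *; exact: abse_ge0.
rewrite !setTI; apply: lte_add_pinfty.
  apply: (@esum_inj_lty _ _ Posz (fun n => expR (- n%:R))) => //; last exact: summable_nat_exp.
  by split=> [t _|x y _ _ []//|t []]; [exists t|move=> n _ <-; exists n].
have s1 : summable [set: nat] (fun n => (expR (- n.+1%:R) : R)%:E).
  apply: le_lt_trans summable_nat_exp; apply: le_esum => n _.
  rewrite !gee0_abs ?lee_fin ?expR_ge0 // ler_expR lerN2 ler_nat //.
apply: (@esum_inj_lty _ _ Negz (fun n => expR (- n.+1%:R))) s1 => //.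
split=> [t _ /= [//]|x y _ _ []//|[n|n] nn]; last by exists n.
by case: nn; exists n.
Qed.

Lemma summable_lattice_exp n :
  summable [set: 'rV[int]_n] (fun k => (expR (- zwt k))%:E).
Proof.
elim: n => [|n ih].
  rewrite /summable (_ : [set: 'rV[int]_0] = [set 0]).
    by rewrite esum_set1 ?abse_ge0 // ltry.
  by apply/seteqP; split=> // k _; apply/rowP => -[].
have eb : set_bij [set: int * 'rV[int]_n] [set: 'rV[int]_(1 + n)] (@zcons n).
  have [g h1 h2] := zcons_bij n.
  split=> [//|x y _ _|k _]; first exact: (can_inj h1).
  by exists (g k).
rewrite /summable (@reindex_esum R _ _ _ _ _ _ eb).
rewrite (_ : [set: int * 'rV[int]_n] = [set: int] `*`` (fun=> [set: 'rV[int]_n])); last first.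
  by apply/seteqP; split.
under eq_esum do rewrite zwt_cons.
pose a k1 k' := (`| (expR (- ((absz k1)%:R + @zwt n k')))%:E |)%E.
rewrite (_ : (fun i : int * 'rV[int]_n => _) = (fun i => a i.1 i.2)) //.
rewrite -esum_esum; last by move=> *; exact: abse_ge0.
pose S := (\esum_(k in [set: 'rV[int]_n]) `|(expR (- zwt k))%:E|)%E.
have Sfin : S \is a fin_num by rewrite /S -summableE.
have aE k1 : (\esum_(k' in [set: 'rV[int]_n]) a k1 k' <= (fine S * expR (- (absz k1)%:R))%:E)%E.
  apply: ge_ereal_sup => x [A [finA _] <-].
  rewrite [X in (X <= _)%E](_ : _ = (expR (- (absz k1)%:R))%:E *
     \sum_(t \in A) `|(expR (- zwt t))%:E|)%E; last first.
    rewrite !fsbig_finite //= ge0_sume_distrr //.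
    by apply: eq_bigr => t _; rewrite /a opprD expRD EFinM abseM gee0_abs ?lee_fin ?expR_ge0.
  rewrite muleC EFinM fineK // lee_pmul ?lee_fin ?expR_ge0 //; first exact: fsume_ge0.
  by apply: ereal_sup_ubound; exists A => //; split.
have := summableZ (fine S) summable_int_exp; rewrite /summable.
apply: le_lt_trans; apply: le_esum => k1 _; apply: le_trans (aE k1) _.
exact: lee_abs.
Qed.

(** With [m = e + 1], the inequality [1 + t <= exp t] at [t = N / m] gives [(1 + N)^e <= m^e exp N],
    and completing the square gives [2 N - a N^2 <= 1 / a]. The constant is [m^e exp (1 / a)]. *)
Lemma weight_dominated (e : nat) (a : R) : 0 < a -> exists C, 0 <= C /\
  forall N : R, 0 <= N -> (1 + N) ^+ e * expR (- a * N ^+ 2) <= C * expR (- N).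
Proof.
move=> a0; pose m : R := e.+1%:R; exists (m ^+ e * expR a^-1); split.
  by rewrite mulr_ge0 ?exprn_ge0 ?expR_ge0 // ler0n.
move=> N N0.
have m0 : 0 < m by rewrite ltr0n.
have h1 : (1 + N) ^+ e <= m ^+ e * expR N.
  apply: (@le_trans _ _ ((m * expR (N / m)) ^+ e)).
    have h0 : 1 + N <= m * expR (N / m).
      apply: (@le_trans _ _ (m * (1 + N / m))); last by rewrite ler_pM2l ?expR_ge1Dx.
      rewrite mulrDr mulr1 mulrCA divff ?gt_eqF // mulr1 lerD2r /m.
      by rewrite -[1]/(1%:R) ler_nat.
    by apply: lerXn2r => //; rewrite nnegrE ?addr_ge0 // mulr_ge0 ?expR_ge0 // ltW.
  rewrite exprMn ler_wpM2l ?exprn_ge0 ?(ltW m0) // -expRM_natl ler_expR.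
  rewrite mulrA ler_pdivrMr // mulrC ler_wpM2l // /m ler_nat //.
apply: (@le_trans _ _ (m ^+ e * expR N * expR (- a * N ^+ 2))).
  by rewrite ler_wpM2r ?expR_ge0.
rewrite -!mulrA ler_wpM2l ?exprn_ge0 ?(ltW m0) // -!expRD ler_expR.
have h : 0 <= a * (N - a^-1) ^+ 2 by rewrite mulr_ge0 ?sqr_ge0 ?ltW.
have e1 : a * (N - a^-1) ^+ 2 = a * N ^+ 2 - 2 * N + a^-1 by field; rewrite gt_eqF.
rewrite e1 in h; lra.
Qed.

(** An enumeration by all of [nat] requires an infinite lattice, hence the positive dimension
    [n.+1]. *)
Lemma lattice_enum n : exists g : nat -> 'rV[int]_n.+1, bijective g.
Proof.
have inf : ~ finite_set [set: 'rV[int]_n.+1].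
  pose c (j : nat) : 'rV[int]_n.+1 := const_mx (Posz j).
  move=> /(@finite_preimage _ _ _ c) h; apply: infinite_nat.
  rewrite -[X in finite_set X](_ : c @^-1` setT = setT) //; apply: h.
  move=> x y _ _ /(congr1 (fun u : 'rV[int]_n.+1 => u ord0 ord0)).
  by rewrite !mxE => -[].
have := eq_card_nat (countableP [set: 'rV[int]_n.+1]) inf.
move=> /card_set_bijP [f [_ fi fs]].
have fs' j : exists t, f t = j by have [t _ <-] := fs j I; exists t.
have [h hf] := choice fs'; exists h; exists f => // t.
by apply: fi; rewrite ?in_setT // hf.
Qed.

Variables (T : countType) (wt : T -> R) (g : nat -> T).
Hypothesis g_bij : bijective g.
Hypothesis wt0 : forall k, 0 <= wt k.
Hypothesis wt_summable : summable setT (fun k => (expR (- wt k))%:E).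

Lemma count_weight_integrable (e : nat) (a : R) : 0 < a ->
  (@counting nat R).-integrable setT
    (EFin \o (fun j => (1 + wt (g j)) ^+ e * expR (- a * wt (g j) ^+ 2))).
Proof.
move=> a0; have [C [C0 hC]] := weight_dominated e a0.
apply/counting_integrableE.
have s1 : abs_summable (fun k => (expR (- wt k))%:C).
  by apply: (abs_summable_le wt_summable) => k; rewrite cabs_real ger0_norm ?expR_ge0.
have s2 : summable setT (fun j => (C * expR (- wt (g j)))%:E).
  apply: summableZ; have := abs_summable_inj (bij_inj g_bij) s1.
  rewrite /abs_summable; apply: le_lt_trans; apply: le_esum => j _.
  by rewrite cabs_real /= normr_id.
apply: le_lt_trans s2; apply: le_esum => j _; rewrite lee_fin /=.
rewrite !ger0_norm ?mulr_ge0 ?expR_ge0 ?exprn_ge0 ?addr_ge0 //; exact: hC.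
Qed.

Lemma csum_enum (f : T -> R[i]) : abs_summable f ->
  cintegrable (@counting nat R) (fun j => f (g j)) /\
  csum f = cint (@counting nat R) (fun j => f (g j)).
Proof.
move=> sf; rewrite (csum_bij f g_bij); apply: csum_counting.
exact: abs_summable_inj (bij_inj g_bij) sf.
Qed.

Lemma abs_summable_enum (f : T -> R[i]) :
  (@counting nat R).-integrable setT (fun j => (cabs (f (g j)))%:E) ->
  abs_summable f.
Proof. by move=> /abs_summable_counting; exact: abs_summable_bij. Qed.

Context d (Y : measurableType d) (nu : {sigma_finite_measure set Y -> \bar R}).
Hypothesis nu_fin : (nu setT < +oo)%E.

Lemma measurable_count_fst (h : nat -> R) :
  measurable_fun setT (fun z : nat * Y => h z.1).
Proof.
by apply: (@measurableT_comp _ _ _ _ _ _ h _ (@fst nat Y)).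
Qed.

Lemma count_prod_weight_integrable (e : nat) (a : R) : 0 < a ->
  (@counting nat R \x nu)%E.-integrable setT
    (EFin \o (fun z : nat * Y => (1 + wt (g z.1)) ^+ e * expR (- a * wt (g z.1) ^+ 2))).
Proof.
move=> a0; pose F j := (1 + wt (g j)) ^+ e * expR (- a * wt (g j) ^+ 2).
have mF : measurable_fun setT (fun z : nat * Y => (F z.1)%:E).
  by apply/measurable_EFinP; exact: measurable_count_fst.
have h := @integrable12ltyP _ _ nat Y R (@counting nat R) nu _ mF.
apply: h.2; have /integrableP[_] := count_weight_integrable e a0.
rewrite -/F => hF.
under eq_integral do rewrite /= integral_cst //.
have nuE : nu setT = (fine (nu setT))%:E.
  by rewrite fineK // ge0_fin_numE.
pose c := fine (nu setT); rewrite -/c in nuE.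
have c0 : (0 <= c%:E)%E by rewrite lee_fin fine_ge0.
rewrite (_ : (fun x => _) = (fun x => c%:E * `|(F x)%:E|)%E); last first.
  by apply/funext => x; rewrite muleC -nuE.
by rewrite ge0_integralZl //; exact: lte_mul_pinfty.
Qed.

End LatticeWeights.

(** * Integration over the unit interval *)

Section UnitInterval.
Variable R : realType.

Definition unitP : probability (measurableTypeR R) R := uniform_prob (@ltr01 R).

(** The retraction of the line onto [0, 1]. Functions composed with it are defined, bounded and
    measurable on the whole line, so that integrals over the interval become integrals against the
    uniform probability [unitP] without restricting domains. *)
Definition clamp (x : R) : R := Num.max 0 (Num.min x 1).

Lemma clamp_ge0 x : 0 <= clamp x. Proof. by rewrite /clamp le_max lexx. Qed.

Lemma clamp_le1 x : clamp x <= 1.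
Proof. by rewrite /clamp ge_max ler01 ge_min lexx orbT. Qed.

Lemma clamp_id x : 0 <= x <= 1 -> clamp x = x.
Proof. by move=> /andP[x0 x1]; rewrite /clamp min_l // max_r. Qed.

Lemma continuous_clamp : continuous clamp.
Proof.
move=> x.
have h1 : {for x, continuous ((id : R -> R) \min (fun=> 1))}.
  by apply: continuous_min; [exact: cvg_id|exact: cvg_cst].
have h0 : {for x, continuous (fun _ : R => 0 : R)} by exact: cvg_cst.
exact: (continuous_max h0 h1).
Qed.

Lemma measurable_clamp : measurable_fun setT clamp.
Proof. exact: (continuous_measurable_fun continuous_clamp). Qed.

Lemma measurable_comp_clamp (f : R -> R) : continuous f ->
  measurable_fun [set: measurableTypeR R] (fun x => f (clamp x)).
Proof.
move=> cf; apply: (measurableT_comp (continuous_measurable_fun cf)).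
exact: measurable_clamp.
Qed.

Lemma Rintegral_unit (f : R -> R) : continuous f ->
  \int[unitP]_x f (clamp x) = \int[lebesgue_measure]_(x in `[0, 1]) f x.
Proof.
move=> cf; rewrite /Rintegral.
have mf : measurable_fun [set: measurableTypeR R] (EFin \o (fun x => f (clamp x))).
  by apply/measurable_EFinP; exact: measurable_comp_clamp.
have e : (\int[lebesgue_measure]_(x in `[0%R, 1%R]) (f x)%:E =
          \int[lebesgue_measure]_(x in `[0%R, 1%R]) (f (clamp x))%:E)%E.
  by apply: eq_integral => x; rewrite inE /= in_itv /= => x01; rewrite clamp_id.
rewrite e; congr fine; rewrite integralE [RHS]integralE; congr (_ - _)%E.
  rewrite integral_uniform //; last exact: measurable_funepos.
  by rewrite subr0 invr1 mul1e.
rewrite integral_uniform //; last exact: measurable_funeneg.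
by rewrite subr0 invr1 mul1e.
Qed.

Lemma unit_FTC (f F : R -> R) : continuous f ->
  (forall x : R, is_derive x 1 F (f x)) -> \int[unitP]_x f (clamp x) = F 1 - F 0.
Proof.
move=> cf dF; rewrite Rintegral_unit // /Rintegral.
have cF : continuous F by move=> x; exact: is_derive_continuous (dF x).
rewrite (@continuous_FTC2 _ _ F) ?ltr01 //.
- exact: continuous_subspaceT.
- split=> [x _||]; first by have [] := dF x.
    by apply: cvg_at_right_filter; exact: cF.
  by apply: cvg_at_left_filter; exact: cF.
- by move=> x _; rewrite derive1E; exact: derive_val.
Qed.

Definition uavg (f : R -> R[i]) : R[i] := cint unitP (fun x => f (clamp x)).

Definition ccontinuous (f : R -> R[i]) := forall x, ccont f x.

Lemma uavg_FTC (f F : R -> R[i]) : ccontinuous f ->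
  (forall x, cder F x 1 (f x)) -> uavg f = F 1 - F 0.
Proof.
move=> cf dF; apply: complexRI; rewrite ?cReD ?cImD ?cReN ?cImN /=.
  apply: (@unit_FTC (fun x => Re (f x)) (fun x => Re (F x))).
    by move=> x; exact: (cf x).1.
  by move=> x; exact: (dF x).1.
apply: (@unit_FTC (fun x => Im (f x)) (fun x => Im (F x))).
  by move=> x; exact: (cf x).2.
by move=> x; exact: (dF x).2.
Qed.

Lemma unit_integrable_bounded (f : R -> R) (M : R) :
  measurable_fun [set: measurableTypeR R] f -> (forall x, `|f x| <= M) ->
  unitP.-integrable setT (EFin \o f).
Proof.
move=> mf fM; have h := @integrable_dominated _ _ _ unitP f (fun=> M) mf.
by apply: h => //; exact: finite_measure_integrable_cst.
Qed.

Lemma unit_cintegrable_bounded (f : measurableTypeR R -> R[i]) (M : R) :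
  cmeas f -> (forall x, cabs (f x) <= M) -> cintegrable unitP f.
Proof.
move=> [m1 m2] fM; split; apply: (@unit_integrable_bounded _ M) => // x.
  exact: le_trans (cabs_Re _) (fM x).
exact: le_trans (cabs_Im _) (fM x).
Qed.

Lemma ccontinuous_cmeas (f : R -> R[i]) : ccontinuous f ->
  cmeas (fun x : measurableTypeR R => f (clamp x)).
Proof.
move=> cf; split.
  by apply: (@measurable_comp_clamp (fun x => Re (f x))) => x; exact: (cf x).1.
by apply: (@measurable_comp_clamp (fun x => Im (f x))) => x; exact: (cf x).2.
Qed.

Lemma ccontinuous_bounded (f : R -> R[i]) (a b : R) : a <= b -> ccontinuous f ->
  exists M, 0 <= M /\ forall x, a <= x <= b -> cabs (f x) <= M.
Proof.
move=> ab cf.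
have key (g : R -> R) : continuous g ->
    exists M, 0 <= M /\ forall x, a <= x <= b -> `|g x| <= M.
  move=> cg; have cn : {within `[a, b], continuous (fun x => `|g x|)}.
    apply: continuous_subspaceT => x; apply: continuous_comp; [exact: cg|exact: norm_continuous].
  have [c _ hc] := EVT_max ab cn; exists `|g c|; split => //.
have [M [M0 hM]] := key _ (fun x => (cf x).1).
have [N [N0 hN]] := key _ (fun x => (cf x).2).
exists (M + N); split; first exact: addr_ge0.
by move=> x xab; rewrite (le_trans (cabs_le _)) // lerD ?hM ?hN.
Qed.

Lemma uavg_integrable (f : R -> R[i]) : ccontinuous f ->
  cintegrable unitP (fun x => f (clamp x)).
Proof.
move=> cf; have [M [M0 hM]] := ccontinuous_bounded ler01 cf.
apply: (@unit_cintegrable_bounded _ M); first exact: ccontinuous_cmeas.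
by move=> x; apply: hM; rewrite clamp_ge0 clamp_le1.
Qed.

Lemma clipschitz (f f' : R -> R[i]) (a b : R) : a <= b ->
  (forall x, cder f x 1 (f' x)) -> ccontinuous f' ->
  exists M, 0 <= M /\ forall x y, a <= x <= b -> a <= y <= b ->
    cabs (f x - f y) <= M * `|x - y|.
Proof.
move=> ab df cf'; have [M [M0 hM]] := ccontinuous_bounded ab cf'.
have key (g g' : R -> R) : (forall x : R, is_derive x 1 g (g' x)) ->
    (forall x : R, a <= x <= b -> `|g' x| <= M) -> forall x y, a <= x <= b -> a <= y <= b ->
    `|g x - g y| <= M * `|x - y|.
  move=> dg g'M x y; wlog xy : x y / x <= y.
    move=> H hx hy; have [xy|/ltW yx] := leP x y; first exact: H.
    by rewrite distrC (distrC x); exact: H.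
  move=> /andP[ax xb] /andP[ay yb].
  have cg : {within `[x, y], continuous g}.
    by apply: continuous_subspaceT => z; exact: is_derive_continuous (dg z).
  have [c /[!in_itv]/= /andP[xc cy] e] := MVT_segment xy (fun z _ => dg z) cg.
  rewrite distrC e normrM (distrC x) ler_wpM2r // g'M //.
  by rewrite (le_trans ax xc) (le_trans cy yb).
exists (M + M); split; first exact: addr_ge0.
move=> x y hx hy; apply: le_trans (cabs_le _) _; rewrite cReD cImD cReN cImN mulrDl.
apply: lerD.
  apply: (key (fun z => Re (f z)) (fun z => Re (f' z))) => // z; first exact: (df z).1.
  by move=> hz; rewrite (le_trans (cabs_Re _)) // hM.
apply: (key (fun z => Im (f z)) (fun z => Im (f' z))) => // z; first exact: (df z).2.
by move=> hz; rewrite (le_trans (cabs_Im _)) // hM.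
Qed.

(** A chord of the unit circle is at least a fixed multiple of its arc. Up to 1 the sine grows with
    slope at least the minimum of the cosine there, which is positive; from 1 to pi the cosine stays
    away from 1. *)
Lemma circle_chord_bound : exists c : R, 0 < c /\ forall x : R, `|x| <= pi ->
  c * `|x| <= `|cos x - 1| + `|sin x|.
Proof.
have pi1 : 1 < (pi : R) by rewrite (lt_le_trans _ (pi_ge2 R)) // ltr1n.
have cc : {within `[0, 1], continuous (@cos R)}.
  by apply: continuous_subspaceT => z; exact: continuous_cos.
have [c1 c1in hc1] := EVT_min ler01 cc.
have cpi : {within `[1, pi], continuous (@cos R)}.
  by apply: continuous_subspaceT => z; exact: continuous_cos.
have [c2 c2in hc2] := EVT_max (ltW pi1) cpi.
have m0 : 0 < cos c1.
  move: c1in; rewrite in_itv /= => /andP[a]; rewrite le_eqVlt => /orP[/eqP ->|b].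
    exact: cos1_gt0.
  by apply: cos_gt0_pihalf; have := pi_ge2 R => p2; apply/andP; split; lra.
have M1 : cos c2 < 1.
  rewrite lt_neqAle cos_le1 andbT; apply/eqP => h.
  move: c2in; rewrite in_itv /= => /andP[a b].
  have : c2 = 0 by apply: cos_inj; rewrite ?in_itv /= ?lexx ?pi_ge0 ?b ?andbT ?cos0 // (le_trans ler01).
  by move=> z; rewrite z ler10 in a.
pose c := Num.min (cos c1) ((1 - cos c2) / pi).
exists c; split.
  by rewrite lt_min m0 divr_gt0 ?subr_gt0 ?pi_gt0.
have key (x : R) : 0 <= x -> x <= pi -> c * x <= `|cos x - 1| + `|sin x|.
  move=> x0 xpi; have [x1|/ltW x1] := leP x 1.
    have [y /[!in_itv]/= /andP[y0 yx] e] := @MVT_segment R sin cos 0 x x0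
      (fun z _ => is_derive_sin z) (continuous_subspaceT (@continuous_sin R)).
    have hy : cos c1 <= cos y by apply: hc1; rewrite in_itv /= y0 (le_trans yx).
    rewrite ler_wpDl // -[sin x]subr0 -{1}(@sin0 R) e subr0 normrM (ger0_norm x0).
    rewrite ler_wpM2r // (le_trans _ (ler_norm _)) // (le_trans _ hy) //.
    by rewrite ge_min lexx.
  rewrite ler_wpDr // distrC.
  have hx : cos x <= cos c2 by apply: hc2; rewrite in_itv /= x1.
  rewrite (le_trans _ (ler_norm _)) //.
  apply: (@le_trans _ _ (((1 - cos c2) / pi) * pi)).
    apply: ler_pM => //; last by rewrite ge_min lexx orbT.
    by rewrite ltW // lt_min m0 divr_gt0 ?subr_gt0 ?pi_gt0.
  by rewrite mulfVK ?gt_eqF ?pi_gt0 // lerD2l lerN2.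
move=> x xpi; have [x0|/ltW x0] := leP 0 x.
  by rewrite ger0_norm // key // -(ger0_norm x0).
have := key (- x); rewrite oppr_ge0 cosN sinN normrN => /(_ x0).
by rewrite ler0_norm // in xpi *; apply.
Qed.

End UnitInterval.

(** * Uniqueness of Fourier coefficients for periodic functions *)

Section FourierUniqueness.
Variable R : realType.

Definition ex (x : R) : R[i] := ee x%:C.

Lemma exE (x : R) : ex x = cos (2 * pi * x) +i* sin (2 * pi * x).
Proof.
rewrite /ex /ee /cexp; have -> : (2 * pi)%:C * 'i%C * x%:C = 0 +i* (2 * pi * x).
  by apply: complexRI; rewrite !(cReM, cImM) /=; ring.
by rewrite /= expR0 mul1r.
Qed.

Lemma exD (x y : R) : ex (x + y) = ex x * ex y.
Proof. by rewrite /ex rmorphD ee_D. Qed.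

Lemma ex_int (x : R) : x \is a Num.int -> ex x = 1.
Proof. exact: ee_int. Qed.

Lemma cabs_ex x : cabs (ex x) = 1.
Proof. by rewrite /ex cabs_ee /= mulr0 oppr0 expR0. Qed.

Lemma cder_ex (a b x : R) :
  cder (fun x => ex (a + b * x)) x 1 ((2 * pi * b)%:C * 'i%C * ex (a + b * x)).
Proof.
rewrite /ex /ee; apply: cder_eq.
  by apply: cder_cexp; apply: cderZ; apply: cder_real.
have -> : (0 + 1) * b%:A = b :> R by rewrite add0r mul1r /GRing.scale /= mulr1.
have -> : (2 * pi * b)%:C = (2 * pi)%:C * b%:C :> R[i] by rewrite rmorphM.
by congr (_ * _); ring.
Qed.

Lemma ccontinuous_ex (a b : R) : ccontinuous (fun x => ex (a + b * x)).
Proof.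
move=> x; have [d1 d2] := cder_ex a b x.
by split; [exact: is_derive_continuous d1|exact: is_derive_continuous d2].
Qed.

Lemma cder_ccontinuous (f f' : R -> R[i]) : (forall x, cder f x 1 (f' x)) ->
  ccontinuous f.
Proof.
move=> df x; have [d1 d2] := df x.
by split; [exact: is_derive_continuous d1|exact: is_derive_continuous d2].
Qed.

Lemma uavg_ex (x0 : R) (k : int) : k != 0 ->
  uavg (fun x => ex (k%:~R * x0 + - k%:~R * x)) = 0.
Proof.
move=> k0; pose c : R[i] := (2 * pi * - k%:~R)%:C * 'i%C.
have kR : (k%:~R : R) != 0 by rewrite intr_eq0.
have c0 : c != 0.
  rewrite /c mulf_neq0 //.
    by rewrite eq_complex /= eqxx andbT !mulf_neq0 ?oppr_eq0 // gt_eqF ?pi_gt0.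
  by rewrite eq_complex /= oner_eq0 andbF.
have := @uavg_FTC R (fun x => ex (k%:~R * x0 + - k%:~R * x))
   (fun x => c^-1 * ex (k%:~R * x0 + - k%:~R * x)) (ccontinuous_ex _ _).
move=> -> => [|x].
  rewrite -mulrBr !exD mulr1 mulr0 -mulrBr (ex_int (x := - _)) ?rpredN ?intr_int //.
  by rewrite (ex_int (x := 0)) ?rpred0 // subrr !mulr0.
apply: cder_eq (cderZ _ (cder_ex _ _ x)) _.
by rewrite -/c mulrA mulVf // mul1r.
Qed.

Lemma measurable_realinv : measurable_fun setT (@GRing.inv R).
Proof.
have -> : [set: R] = [set x | x != 0] `|` [set 0].
  by apply/seteqP; split=> // x _; have [->|x0] := eqVneq x 0; [right|left].
apply/measurable_funU.
- by apply: open_measurable; exact: open_neq.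
- exact: measurable_set1.
split; last exact: measurable_fun_set1.
apply: open_continuous_measurable_fun; first exact: open_neq.
by move=> x; rewrite inE /= => x0; apply: cvgV => //; exact: cvg_id.
Qed.

Lemma cmeas_inv d (X : measurableType d) (f : X -> R[i]) : cmeas f -> cmeas (fun x => (f x)^-1).
Proof.
move=> [f1 f2].
have e z : z^-1 = ((Re z ^+ 2 + Im z ^+ 2)^-1)%:C * (Re z -i* Im z) :> R[i].
  case: z => a b; apply: complexRI; rewrite ?cReM ?cImM /=; [ring|].
  by rewrite !mulrN mul0r addr0 mulrC.
have -> : (fun x => (f x)^-1) = (fun x => ((Re (f x) ^+ 2 + Im (f x) ^+ 2)^-1)%:C * (Re (f x) -i* Im (f x))).
  by apply/funext => x; rewrite e.
apply: cmeasM.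
  apply: cmeas_real; apply: (measurableT_comp measurable_realinv).
  apply: measurable_funD; exact: measurable_funX.
by split => //=; apply: measurableT_comp f2.
Qed.

Variables (G G' : R -> R[i]).
Hypothesis dG : forall x, cder G x 1 (G' x).
Hypothesis cG' : ccontinuous G'.
Hypothesis G_per : forall x, G (x + 1) = G x.
Hypothesis G_coef : forall k : int, uavg (fun x => G x * ex (- k%:~R * x)) = 0.

Lemma periodic_int x (k : int) : G (x + k%:~R) = G x.
Proof.
have hn (n : nat) y : G (y + n%:R) = G y.
  by elim: n => [|n ih]; rewrite ?addr0 // -natr1 addrA G_per ih.
case: k => n; first exact: hn.
by rewrite NegzE mulrNz; have := hn n.+1 (x - n.+1%:R); rewrite subrK => ->.
Qed.

(** [G] is Lipschitz on an interval around [x0]; by periodicity [x] can be moved by an integer to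
    within 1/2 of [x0], and there [circle_chord_bound] turns distance into chord length. *)
Lemma chord_bound x0 : exists M : R, 0 <= M /\ forall x,
  cabs (G x - G x0) <= M * cabs (ex (x0 - x) - 1).
Proof.
have [c [c0 hc]] := circle_chord_bound R.
have ab : x0 - 1 <= x0 + 1 by lra.
have [M [M0 hM]] := clipschitz ab dG cG'.
have pi0 : 0 < (pi : R) := pi_gt0 R.
exists (M / c); split; first by rewrite divr_ge0 // ltW.
move=> x; pose k := Num.floor (x - x0 + 2^-1).
have /andP[k1 k2] : (k%:~R <= x - x0 + 2^-1 :> R) && (x - x0 + 2^-1 < (k + 1)%:~R :> R).
  by have /andP[-> ->] := Num.Theory.floor_itv (x - x0 + 2^-1).
rewrite intrD in k2.
pose y := x - k%:~R.
have -> : G x = G y by rewrite -(periodic_int y k) /y subrK.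
have -> : ex (x0 - x) = ex (x0 - y).
  rewrite /y (_ : x0 - (x - k%:~R) = x0 - x + k%:~R); last by ring.
  by rewrite (exD (x0 - x)) (ex_int (x := k%:~R)) ?intr_int // mulr1.
have yx : `|x0 - y| <= 2^-1 by rewrite ler_norml /y; apply/andP; split; lra.
apply: (@le_trans _ _ (M * `|y - x0|)).
  by apply: hM; move: yx; rewrite ler_norml => /andP[? ?]; apply/andP; split; lra.
rewrite -mulrA; apply: ler_wpM2l => //.
rewrite mulrC ler_pdivlMr // mulrC distrC.
have h2 : `|2 * pi * (x0 - y)| <= pi.
  rewrite normrM (ger0_norm (x := 2 * pi)); last by rewrite mulr_ge0 // ltW.
  apply: (@le_trans _ _ (2 * pi * 2^-1)); first by rewrite ler_wpM2l // mulr_ge0 // ltW.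
  by rewrite mulrAC divff // mul1r.
have := hc _ h2; rewrite normrM (ger0_norm (x := 2 * pi)); last by rewrite mulr_ge0 // ltW.
move=> h3; have h4 : `|cos (2 * pi * (x0 - y)) - 1| + `|sin (2 * pi * (x0 - y))| <=
    2 * cabs (ex (x0 - y) - 1).
  have two (z : R) : 2 * z = z + z by ring.
  rewrite exE (two (cabs _)); apply: lerD.
    by have := cabs_Re (cos (2 * pi * (x0 - y)) +i* sin (2 * pi * (x0 - y)) - 1); rewrite cReD cReN.
  by have := cabs_Im (cos (2 * pi * (x0 - y)) +i* sin (2 * pi * (x0 - y)) - 1); rewrite cImD cImN /= oppr0 addr0.
have h5 := le_trans h3 h4.
have h6 : 2 * (c * `|x0 - y|) <= c * (2 * pi * `|x0 - y|).
  have : 0 <= c * `|x0 - y| by apply: mulr_ge0 => //; exact: ltW.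
  have := pi_ge2 R; nra.
by have := le_trans h6 h5; rewrite ler_pM2l.
Qed.

(** Where the denominator vanishes the quotient takes the default value 0. The identity [h_eq]
    survives there because [chord_bound] forces the numerator to vanish as well. *)
Let h x0 (x : R) : R[i] := (G x - G x0) / (ex (x0 - x) - 1).
Let E x0 (k : int) (x : R) : R[i] := ex (k%:~R * x0 + - k%:~R * x).

Let E_D x0 k l x : E x0 (k + l) x = E x0 k x * E x0 l x.
Proof. by rewrite /E -exD; congr ex; rewrite intrD; ring. Qed.

Let cabs_E x0 k x : cabs (E x0 k x) = 1.
Proof. exact: cabs_ex. Qed.

Let E_1 x0 x : E x0 1 x = ex (x0 - x).
Proof. by rewrite /E; congr ex; ring. Qed.

Let E_0 x0 x : E x0 0 x = 1.
Proof. by rewrite /E !mul0r oppr0 mul0r addr0 (ex_int (x := 0)) ?rpred0. Qed.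

Let h_eq x0 x : h x0 x * (E x0 1 x - 1) = G x - G x0.
Proof.
rewrite E_1 /h; have [e|ne] := eqVneq (ex (x0 - x) - 1) 0; last by rewrite mulfVK.
have [M [M0 hM]] := chord_bound x0; have := hM x.
rewrite e cabs0 !mulr0 => h0.
by rewrite (cabs_eq0 (z := G x - G x0)) //; apply/eqP; rewrite eq_le h0 cabs_ge0.
Qed.

Let h_one x0 x : E x0 1 x = 1 -> h x0 x = 0.
Proof. by rewrite E_1 /h => ->; rewrite subrr invr0 mulr0. Qed.

Let h_bound x0 : exists M : R, 0 <= M /\ forall x, cabs (h x0 x) <= M.
Proof.
have [M [M0 hM]] := chord_bound x0; exists M; split=> // x.
have [e|ne] := eqVneq (E x0 1 x) 1.
  by rewrite h_one // cabs0.
have w0 : 0 < cabs (E x0 1 x - 1).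
  by rewrite cabs_gt0 // subr_eq0.
by rewrite -(ler_pM2r w0) -cabsM h_eq E_1.
Qed.

Let h_meas x0 : cmeas (fun x : measurableTypeR R => h x0 (clamp x)).
Proof.
have cc (c : R[i]) : ccontinuous (fun _ : R => c) by move=> x; exact: ccont_cst.
apply: cmeasM.
  apply: (@ccontinuous_cmeas _ (fun x => G x - G x0)) => x.
  by apply: ccontD; [exact: cder_ccontinuous|exact: cc].
apply: cmeas_inv; apply: (@ccontinuous_cmeas _ (fun x => ex (x0 - x) - 1)) => x.
apply: ccontD; last exact: cc.
have := @ccontinuous_ex x0 (-1) x.
by rewrite (_ : (fun x => ex (x0 + -1 * x)) = (fun x => ex (x0 - x))) //; apply/funext => y; rewrite mulN1r.
Qed.

Let Hk x0 (k : int) := uavg (fun x => h x0 x * E x0 k x).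

Let hE_meas x0 k : cmeas (fun x : measurableTypeR R => h x0 (clamp x) * E x0 k (clamp x)).
Proof.
apply: cmeasM; first exact: h_meas.
exact: (ccontinuous_cmeas (ccontinuous_ex _ _)).
Qed.

Let hE_int x0 k : cintegrable (unitP R) (fun x => h x0 (clamp x) * E x0 k (clamp x)).
Proof.
have [M [M0 hM]] := h_bound x0.
apply: (@unit_cintegrable_bounded _ _ M); first exact: hE_meas.
by move=> x; rewrite cabsM /E cabs_ex mulr1.
Qed.

(** A substitute for the Riemann-Lebesgue lemma. Coefficients that are constant along a half-line of
    frequencies equal their Cesaro means; the averaged integrands are bounded and tend to 0
    pointwise, since a geometric mean of powers of [E x0 s x] tends to 0 unless that number is 1,
    and then [h] is 0. *)
Let cesaro_vanish x0 (k s : int) : s = 1 \/ s = -1 ->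
  (forall n : nat, Hk x0 (k + s * n%:Z) = Hk x0 k) -> Hk x0 k = 0.
Proof.
move=> hs hH; have [M [M0 hM]] := h_bound x0.
pose f (m : nat) x := \sum_(n < m.+1) ((m.+1%:R^-1 : R)%:C * (h x0 x * E x0 (k + s * n%:Z) x)).
have fE m : cintegrable (unitP R) (fun x => f m (clamp x)) /\ uavg (f m) = Hk x0 k.
  have e : Hk x0 k = \sum_(n < m.+1) (m.+1%:R^-1 : R)%:C * Hk x0 k.
    by rewrite sumr_const card_ord -mulrnAl -rmorphMn /= -mulr_natr mulVf ?mul1r // pnatr_eq0.
  rewrite /f [RHS]e; elim: (m.+1) (m.+1%:R^-1) => {e} [|j ih] c.
    split; first by under eq_fun do rewrite big_ord0; apply: (uavg_integrable (f := fun=> 0)) => x; exact: ccont_cst.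
    by rewrite big_ord0 -[RHS](cint0 (unitP R)); apply: eq_cint => x; rewrite big_ord0.
  have [ih1 ih2] := ih c; rewrite big_ord_recr /= -ih2 -(hH j).
  have i2 := cintegrableZ c%:C (hE_int x0 (k + s * j%:Z)).
  split; first by under eq_fun do rewrite big_ord_recr /=; exact: cintegrableD.
  rewrite /Hk /uavg -cintZ // -cintD //.
  by apply: eq_cint => x; rewrite big_ord_recr.
have s1 x : E x0 s x = 1 -> E x0 1 x = 1.
  case: hs => -> // h1; have := E_D x0 (-1) 1 x.
  by rewrite h1 mul1r addNr E_0.
have f_bound m x : cabs (f m x) <= M.
  have : forall j c, 0 <= c -> cabs (\sum_(n < j) (c%:C * (h x0 x * E x0 (k + s * n%:Z) x))) <= j%:R * c * M.
    move=> j c c0; elim: j => [|j ih]; first by rewrite big_ord0 cabs0 !mul0r.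
    rewrite big_ord_recr (le_trans (cabsD _ _)) // -natr1 2!mulrDl mul1r lerD //.
    by rewrite cabsM [cabs (h x0 x * _)]cabsM cabs_real cabs_E (ger0_norm c0) mulr1 ler_wpM2l.
  move=> /(_ m.+1 m.+1%:R^-1); rewrite divff ?pnatr_eq0 // mul1r; apply.
  by rewrite invr_ge0.
(* The sum is geometric in [E x0 s x], so multiplying by [E x0 s x - 1] leaves only its two end
   terms. *)
have f_small m x : cabs (f m x) * cabs (E x0 s x - 1) <= m.+1%:R^-1 * (2 * M).
  have e : f m x * (E x0 s x - 1) = (m.+1%:R^-1 : R)%:C * (h x0 x * (E x0 (k + s * m.+1%:Z) x - E x0 k x)).
    rewrite /f; move: (h x0 x) => hx.
    rewrite -mulr_sumr -mulr_sumr -(mulrA _%:C) -(mulrA hx); congr (_ * (_ * _)).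
    elim: (m.+1) => [|j ih]; first by rewrite big_ord0 mul0r mulr0 addr0 subrr.
    rewrite big_ord_recr /= mulrDl ih.
    have -> : k + s * j.+1%:Z = k + s * j%:Z + s by rewrite intS; ring.
    rewrite (E_D _ _ s); ring.
  rewrite -cabsM e cabsM [cabs (h x0 x * _)]cabsM cabs_real ger0_norm ?invr_ge0 //.
  rewrite ler_wpM2l ?invr_ge0 // mulrC; apply: ler_pM; rewrite ?cabs_ge0 //.
  by rewrite (le_trans (cabsD _ _)) // cabsN !cabs_E.
have f_cvg x : cabs (f m x) @[m --> \oo] --> 0.
  have [e|ne] := eqVneq (E x0 s x) 1.
    rewrite (_ : (fun m => _) = (fun=> 0)); first exact: cvg_cst.
    apply/funext => m; rewrite /f h_one ?s1 // big1 ?cabs0 // => n _.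
    by rewrite mul0r mulr0.
  have w0 : 0 < cabs (E x0 s x - 1).
    by rewrite cabs_gt0 // subr_eq0.
  have hc : (m.+1%:R^-1 * (2 * M / cabs (E x0 s x - 1))) @[m --> \oo] --> (0 : R).
    rewrite -[X in _ --> X](mul0r (2 * M / cabs (E x0 s x - 1))).
    by apply: cvgMl; exact: cvg_harmonic.
  apply: (squeeze_cvgr _ (cvg_cst 0) hc).
  near=> m; rewrite cabs_ge0 /= mulrA ler_pdivlMr //; exact: f_small.
have cz (F : R[i] -> R) : (forall z, `|F z| <= cabs z) ->
   (forall m, measurable_fun [set: measurableTypeR R] (fun x => F (f m (clamp x)))) ->
   \int[unitP R]_x F (f m (clamp x)) @[m --> \oo] --> (0 : R).
  move=> Fz mF.
  have -> : (0 : R) = \int[unitP R]_x 0 by rewrite Rintegral_cst // mul0r.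
  apply: (@dominated_Rintegral _ _ _ (unitP R) (fun m x => F (f m (clamp x))) (fun=> 0) (fun=> M)) => //.
  - exact: finite_measure_integrable_cst.
  - by move=> m x; exact: le_trans (Fz _) (f_bound _ _).
  - move=> x; apply/cvgr0Pnorm_lt => e e0.
    have /cvgr0Pnorm_lt /(_ e e0) := f_cvg (clamp x).
    apply: filterS => m; apply: le_lt_trans.
    by rewrite (ger0_norm (cabs_ge0 _)).
have fm m : cmeas (fun x : measurableTypeR R => f m (clamp x)).
  have [i _] := fE m; case: i => /integrableP[/measurable_EFinP a _] /integrableP[/measurable_EFinP b _].
  by split.
have c1 := cz (fun z => Re z) (@cabs_Re R) (fun m => (fm m).1).
have c2 := cz (fun z => Im z) (@cabs_Im R) (fun m => (fm m).2).
apply: complexRI.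
  apply: (cvg_unique _ _ c1) => //; rewrite (_ : (fun m => _) = (fun=> Re (Hk x0 k))); first exact: cvg_cst.
  by apply/funext => m; rewrite -(fE m).2.
apply: (cvg_unique _ _ c2) => //; rewrite (_ : (fun m => _) = (fun=> Im (Hk x0 k))); first exact: cvg_cst.
by apply/funext => m; rewrite -(fE m).2.
Unshelve. all: by end_near. Qed.

(* Chernoff's argument: dividing G - G(x0) by e(x0 - x) - 1 makes the Fourier
   coefficients telescope. *)
Lemma fourier_uniqueness x0 : G x0 = 0.
Proof.
have Hstep k : Hk x0 (k + 1) - Hk x0 k = - (G x0) * uavg (E x0 k).
  have iE : cintegrable (unitP R) (fun x => E x0 k (clamp x)).
    exact: (uavg_integrable (ccontinuous_ex _ _)).
  have iG : cintegrable (unitP R) (fun x => G (clamp x) * E x0 k (clamp x)).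
    apply: (uavg_integrable (f := fun x => G x * E x0 k x)) => x; apply: ccontM.
      exact: cder_ccontinuous.
    exact: ccontinuous_ex.
  have G0 : uavg (fun x => G x * E x0 k x) = 0.
    have iG2 : cintegrable (unitP R) (fun x => G (clamp x) * ex (- k%:~R * clamp x)).
      apply: (uavg_integrable (f := fun x => G x * ex (- k%:~R * x))) => x; apply: ccontM.
        exact: cder_ccontinuous.
      have := @ccontinuous_ex 0 (- k%:~R) x.
      by under [X in ccont X _ -> _]eq_fun do rewrite add0r.
    rewrite -[RHS](mulr0 (ex (k%:~R * x0))) -(G_coef k) /uavg -cintZ //.
    by apply: eq_cint => x; rewrite /E exD; ring.
  have -> : Hk x0 (k + 1) = uavg (fun x => G x * E x0 k x) + - G x0 * uavg (E x0 k) + Hk x0 k.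
    have i3 := cintegrableZ (- G x0) iE.
    rewrite /Hk /uavg -(cintZ _ iE) -(cintD iG i3) -(cintD (cintegrableD iG i3) (hE_int x0 k)).
    apply: eq_cint => x; rewrite E_D.
    have := h_eq x0 (clamp x); set a := h _ _; set b := E x0 1 _ => hh.
    rewrite (_ : G (clamp x) = a * (b - 1) + G x0); [ring|by rewrite hh subrK].
  by rewrite G0; ring.
(* The average of [E x0 k] vanishes for [k != 0], so by [Hstep] the coefficients are constant from 1
   upwards and from 0 downwards; both constants vanish, and the single jump between 0 and 1 equals
   [- G x0]. *)
have H1 : Hk x0 1 = 0.
  apply: (@cesaro_vanish _ _ 1); first by left.
  elim=> [|n ih]; first by rewrite mulr0 addr0.
  rewrite -ih; apply/eqP; rewrite -subr_eq0.
  have := Hstep (1 + 1 * n%:Z); rewrite uavg_ex ?mulr0; last by rewrite mul1r.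
  by rewrite (_ : 1 + 1 * n.+1%:Z = 1 + 1 * n%:Z + 1) => [->|] //; rewrite intS; ring.
have H0 : Hk x0 0 = 0.
  apply: (@cesaro_vanish _ _ (-1)); first by right.
  elim=> [|n ih]; first by rewrite mulr0 addr0.
  rewrite -ih; apply/eqP; rewrite eq_sym -subr_eq0.
  have := Hstep (0 + -1 * n.+1%:Z); rewrite uavg_ex ?mulr0; last by rewrite add0r mulN1r.
  by rewrite (_ : 0 + -1 * n.+1%:Z + 1 = 0 + -1 * n%:Z) => [->|] //; rewrite intS; ring.
have := Hstep 0; rewrite add0r H1 H0 subrr.
have -> : uavg (E x0 0) = 1.
  rewrite /uavg; under eq_cint do rewrite E_0.
  apply: complexRI => /=; rewrite Rintegral_cst // ?mul0r //.
  rewrite mul1r; transitivity (fine (1%E : \bar R)) => //; congr fine.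
  exact: probability_setT.
by rewrite mulr1 => /eqP; rewrite eq_sym oppr_eq0 => /eqP.
Qed.

End FourierUniqueness.

(** * Jacobi's inversion formula in one variable *)

Section JacobiInversion.
Variable R : realType.

Lemma int_enum : exists g : nat -> int, bijective g.
Proof.
have [h [h' h1 h2]] := lattice_enum 0.
exists (fun j => h j ord0 ord0); exists (fun k => h' (const_mx k)) => [j|k].
  rewrite (_ : const_mx _ = h j) ?h1 //.
  by apply/rowP => i; rewrite mxE (ord1 i).
by rewrite h2 mxE.
Qed.

Lemma cder_line (W : normedModType R) (F : W -> R[i]) (ga : R -> W) (v : W) (s : R) l :
  (forall h, ga (h + s) = h *: v + ga s) -> cder F (ga s) v l ->
  cder (fun s => F (ga s)) s 1 l.
Proof.
move=> hg [/is_derive_dir d1 /is_derive_dir d2].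
have e (H : W -> R) : (fun h : R => H (h *: v + ga s)) =
    (fun h : R => (fun s => H (ga s)) (h *: (1 : R) + s)).
  by apply/funext => h; rewrite /GRing.scale /= mulr1 hg.
split; apply/is_derive_dir.
  by move: d1; rewrite (e (fun t => Re (F t))).
by move: d2; rewrite (e (fun t => Im (F t))).
Qed.

Lemma cder0_segment (f : R -> R[i]) (a b : R) : a <= b ->
  (forall x : R, a <= x <= b -> cder f x 1 0) -> f a = f b.
Proof.
move=> ab df.
have key (u : R -> R) : (forall x : R, a <= x <= b -> is_derive x 1 u 0) -> u a = u b.
  move=> du; have cu : {within `[a, b], continuous u}.
    apply: continuous_in_subspaceT => x; rewrite inE /= in_itv /= => /du.
    exact: is_derive_continuous.
  have du' (x : R) : x \in `]a, b[ -> is_derive x 1 u (cst 0 x).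
    by rewrite in_itv /= => /andP[xa xb]; apply: du; rewrite !ltW.
  have [c _ e] := MVT_segment ab du' cu.
  by apply/esym/eqP; rewrite -subr_eq0 e mul0r.
apply: complexRI.
  by apply: (key (fun x => Re (f x))) => x /df[].
by apply: (key (fun x => Im (f x))) => x /df[].
Qed.

Lemma csum_single (T : choiceType) (t0 : T) (c : R[i]) :
  csum (fun t => if t == t0 then c else 0) = c.
Proof.
rewrite (@csum_inj _ unit _ (fun=> t0)); last 2 first.
- by move=> [] [].
- by move=> t nt; case: eqP => // tt0; case: nt; exists tt.
rewrite eqxx /csum; have key (r : R) : rsum (fun _ : unit => r) = r.
  rewrite /rsum (_ : [set: unit] = [set tt]); last by apply/seteqP; split => // -[].
  rewrite !esum_set1 // funeposE funenegE /= /maxe.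
  by rewrite !lte_fin oppr_lt0; case: (ltrgtP r 0) => /= [r0|r0|->]; rewrite ?sub0r ?opprK ?subr0 ?oppr0.
by rewrite !key; case: c.
Qed.

Lemma abs_summable_single (T : choiceType) (t0 : T) (c : R[i]) :
  abs_summable (fun t => if t == t0 then c else 0).
Proof.
rewrite /abs_summable /summable.
rewrite (_ : (fun t => _) = fun t => if t \in [set t0] then `|(cabs c)%:E|%E else 0%E).
  by rewrite -esum_mkcond esum_set1 ?ltry ?abse_ge0.
by apply/funext => t; rewrite classical_sets.in_set1; case: eqP => // _; rewrite cabs0 abse0.
Qed.

Definition iwt (k : int) : R := (absz k)%:R.

Lemma iwt_ge0 k : 0 <= iwt k. Proof. exact: ler0n. Qed.

Lemma iwtE k : `|k%:~R : R| = iwt k.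
Proof. by rewrite -intr_norm /iwt -natr_absz. Qed.

Lemma iwt_sqr k : iwt k ^+ 2 = (k%:~R : R) ^+ 2.
Proof. by rewrite -iwtE real_normK ?num_real. Qed.

Variables (g : nat -> int).
Hypothesis g_bij : bijective g.

Let K (j : nat) : R := (g j)%:~R.
Let NB (j : nat) := iwt (g j).
Let NA (z : nat * measurableTypeR R) := iwt (g z.1).
Let NB0 j : 0 <= NB j. Proof. exact: iwt_ge0. Qed.
Let NA0 z : 0 <= NA z. Proof. exact: iwt_ge0. Qed.
Let mA : {measure set (nat * measurableTypeR R) -> \bar R} := (@counting nat R \x unitP R)%E.
Let mB : {measure set nat -> \bar R} := @counting nat R.
Let mNB : measurable_fun setT NB. Proof. by []. Qed.
Let mNA : measurable_fun setT NA. Proof. exact: (@measurable_count_fst R _ _ NB). Qed.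
Let HB := @count_weight_integrable R _ iwt g g_bij iwt_ge0 (@summable_int_exp R).
Let unit_fin : (unitP R setT < +oo)%E.
Proof. by rewrite [X in (X < _)%E](_ : _ = 1%E) ?ltry //; exact: probability_setT. Qed.
Let HA := @count_prod_weight_integrable R _ iwt g g_bij iwt_ge0 (@summable_int_exp R) _ _ (unitP R) unit_fin.

(** Unfolding of the real line: an integer plus a point of [0, 1]. Integrals of functions of [X] are
    integrals over the whole line in a form where Fubini expresses them as averages of theta series
    over a period. *)
Let X (z : nat * measurableTypeR R) : R := K z.1 + clamp z.2.

Let mX : measurable_fun setT X.
Proof.
apply: measurable_funD; first exact: (@measurable_count_fst R _ _ K).
by apply: (measurableT_comp (@measurable_clamp R)).
Qed.

Let X_bound z : `|X z| <= 1 * (1 + NA z) ^+ 1.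
Proof.
rewrite mul1r expr1 /X (le_trans (ler_normD _ _)) // addrC lerD //.
  by rewrite ger0_norm ?clamp_ge0 // clamp_le1.
by rewrite /K iwtE.
Qed.

Let WA := (R * R * R)%type.

Let psi (t : WA) : R[i] := (t.1.1)%:C + 'i%C * (t.1.2)%:C.
Let qA (t : WA) z : R[i] :=
  'i%C * ((pi * X z ^+ 2)%:C * psi t + (- (2 * pi) * X z)%:C * (t.2)%:C).

Let gX n : gpol NA (fun (_ : WA) z => (X z ^+ n)%:C).
Proof.
apply: (@gpol_weight _ _ _ NA _ (fun z => X z ^+ n) 1 n); first exact: measurable_funX.
move=> z; rewrite normrX mul1r.
have h := X_bound z; rewrite mul1r expr1 in h.
by apply: lerXn2r => //; rewrite nnegrE // addr_ge0.
Qed.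

Let gXc (c : R) n : gpol NA (fun (_ : WA) z => (c * X z ^+ n)%:C).
Proof.
apply: gpol_ext (gpol_mul (gpol_cst _ _ c%:C) (gX n)) => t z.
by rewrite rmorphM.
Qed.

Let g11 : gpol NA (fun (t : WA) _ => (t.1.1)%:C).
Proof.
apply: (@gpol_lin _ _ _ NA WA (fun t => t.1.1) 1) => // x.
by rewrite mul1r [X in _ <= X]prod_normE [X in _ <= Num.max X _]prod_normE !le_max lexx.
Qed.

Let g12 : gpol NA (fun (t : WA) _ => (t.1.2)%:C).
Proof.
apply: (@gpol_lin _ _ _ NA WA (fun t => t.1.2) 1) => // x.
by rewrite mul1r [X in _ <= X]prod_normE [X in _ <= Num.max X _]prod_normE !le_max lexx orbT.
Qed.

Let g2 : gpol NA (fun (t : WA) _ => (t.2)%:C).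
Proof.
apply: (@gpol_lin _ _ _ NA WA (fun t => t.2) 1) => // x.
by rewrite mul1r [X in _ <= X]prod_normE !le_max lexx orbT.
Qed.

Let gpsi : gpol NA (fun (t : WA) _ => psi t).
Proof. by apply: gpol_add => //; apply: gpol_mul => //; exact: gpol_cst. Qed.

Let gqA : gpol NA qA.
Proof.
apply: gpol_mul; first exact: gpol_cst.
apply: gpol_add (gpol_mul (gXc pi 2) gpsi) (gpol_mul _ g2).
by apply: gpol_ext (gXc (- (2 * pi)) 1) => t z; rewrite expr1.
Qed.

Let dqA v t z : cder (fun t => qA t z) t v (qA v z).
Proof.
have lin (l : WA -> R) : (forall x y, l (x + y) = l x + l y) ->
   (forall a x, l (a *: x) = a * l x) -> cder (fun t => (l t)%:C) t v (l v)%:C.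
  by move=> lD lZ; apply: cder_real; exact: is_derive_linear.
apply: cderZ; apply: cderD; apply: cderZ; last exact: lin.
by apply: cderD; [exact: lin|apply: cderZ; exact: lin].
Qed.

Let gqA_cst v : gpol NA (fun (_ : WA) z => qA v z).
Proof.
apply: gpol_mul; first exact: gpol_cst.
apply: gpol_add; apply: gpol_mul; [exact: gXc|exact: gpol_cst| |exact: gpol_cst].
by apply: gpol_ext (gXc (- (2 * pi)) 1) => t z; rewrite expr1.
Qed.

Let UA : set WA := [set t | 0 < t.1.2].

Let Re_qA t z : Re (qA t z) = - (pi * t.1.2 * X z ^+ 2).
Proof. rewrite /qA /psi !(cReM, cImM, cReD, cImD) /=; ring. Qed.

(** From [(k + 2 x)^2 >= 0]: one has [(k + x)^2 >= k^2 / 2 - x^2], so a bounded shift costs half the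
    rate of decay and a constant. *)
Let shift_decay (k x a : R) : 0 <= a -> - (a * (k + x) ^+ 2) <= a * x ^+ 2 - a / 2 * k ^+ 2.
Proof.
move=> a0; have : 0 <= a * (2^-1 * (k + 2 * x) ^+ 2) by apply: mulr_ge0 => //; apply: mulr_ge0; rewrite ?sqr_ge0 ?invr_ge0.
have -> : a * (2^-1 * (k + 2 * x) ^+ 2) = a * (k + x) ^+ 2 + a * x ^+ 2 - a / 2 * k ^+ 2 by field.
lra.
Qed.

Let qA_decay t0 : UA t0 -> exists r a C : R, [/\ 0 < r, 0 < a &
  forall t, `|t - t0| < r -> UA t /\ forall z, Re (qA t z) <= C - a * NA z ^+ 2].
Proof.
move=> Ut; have t2 : 0 < t0.1.2 by [].
have pi0 := pi_gt0 R.
pose a := pi * (t0.1.2 / 2); have a0 : 0 < a by rewrite mulr_gt0 ?divr_gt0.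
exists (t0.1.2 / 2), (a / 2), a; split; rewrite ?divr_gt0 //.
move=> t; rewrite [X in X < _]prod_normE gt_max => /andP[+ _].
rewrite [X in X < _]prod_normE gt_max => /andP[_ hh].
have /andP[h1 h2] : - (t0.1.2 / 2) < t.1.2 - t0.1.2 < t0.1.2 / 2 by rewrite -ltr_norml; exact: hh.
have ht : t0.1.2 / 2 <= t.1.2 by lra.
split; first (by rewrite /UA; change (0 < t.1.2); lra); move=> z.
rewrite Re_qA; apply: (@le_trans _ _ (- (a * X z ^+ 2))).
  by rewrite lerN2 ler_wpM2r ?sqr_ge0 // /a ler_wpM2l // ltW.
rewrite /X (le_trans (shift_decay _ _ (ltW a0))) // /NA iwt_sqr lerD2r.
rewrite -[X in _ <= X]mulr1 ler_wpM2l ?(ltW a0) //.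
by rewrite expr_le1 ?clamp_ge0 ?clamp_le1.
Qed.

Let UA_int (p : WA -> nat * measurableTypeR R -> R[i]) t : gpol NA p -> UA t ->
  cintegrable mA (fun z => p t z * cexp (qA t z)).
Proof. by move=> gp Ut; exact: (gint_integrable NA0 HA gqA qA_decay gp Ut). Qed.

(** Moments over the line of the Gaussian with exponent [pi i psi X^2 - 2 pi i y X]. Differentiating
    in [psi] raises the degree by 2 and in [y] by 1, so degrees up to 2 yield differential equations
    for [M 0]. *)
Let M n (t : WA) := gint mA qA (fun _ z => (X z ^+ n)%:C) t.

Let Z (x : R) (j : nat) : R[i] := (K j)%:C + x%:C.
Let qB (ps : R[i]) (y : R) (x : R) (j : nat) : R[i] :=
  ((pi%:C * 'i%C) * ps) * (Z x j * Z x j) + ((- (2 * pi) * y)%:C * 'i%C) * Z x j.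
(** Jacobi's theta function in terms of the shift [x] of the summation variable. In this form it has
    period 1 in [x], and its Fourier coefficients are values of [M 0]. *)
Let TH (ps : R[i]) (y x : R) := gint mB (qB ps y) (fun (_ : R) (_ : nat) => 1) x.

Section FixedParameters.
Variables (ps : R[i]) (y : R).
Hypothesis ps0 : 0 < Im ps.
Let t0 : WA := (Re ps, Im ps, y).

Let gZ : gpol NB Z.
Proof.
apply: gpol_add.
  apply: (@gpol_weight _ _ _ NB _ K 1 1%N) => // j.
  by rewrite mul1r expr1 /K iwtE lerDr.
by apply: (@gpol_lin _ _ _ NB R id 1) => // x; rewrite mul1r.
Qed.

Let gqB : gpol NB (qB ps y).
Proof.
apply: gpol_add; apply: gpol_mul => //; try exact: gpol_cst.
exact: gpol_mul.
Qed.

Let dZ x j : cder (Z^~ j) x 1 1.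
Proof.
apply: cder_eq (cderD (cder_cst _ _ _) (cder_real (is_derive_id _ _))) _.
by rewrite add0r.
Qed.

Let qB' (x : R) (j : nat) : R[i] := (2 * pi)%:C * 'i%C * (ps * Z x j - y%:C).

Let dqB x j : cder ((qB ps y)^~ j) x 1 (qB' x j).
Proof.
apply: cder_eq (cderD (cderZ _ (cderM (dZ x j) (dZ x j))) (cderZ _ (dZ x j))) _.
by rewrite /qB' !rmorphM rmorphN !rmorphM rmorph_nat /=; ring.
Qed.

Let gqB' : gpol NB qB'.
Proof.
apply: gpol_mul; first exact: gpol_cst.
apply: gpol_add; last exact: gpol_cst.
by apply: gpol_mul => //; exact: gpol_cst.
Qed.

Let Re_qB x j : Re (qB ps y x j) = - (pi * Im ps * (K j + x) ^+ 2).
Proof. rewrite /qB /Z !(cReM, cImM, cReD, cImD) /=; ring. Qed.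

Let qB_decay x0 : [set: R] x0 -> exists r a C : R, [/\ 0 < r, 0 < a &
  forall x : R, `|x - x0| < r -> [set: R] x /\ forall j, Re (qB ps y x j) <= C - a * NB j ^+ 2].
Proof.
move=> _; pose a := pi * Im ps; have a0 : 0 < a by rewrite mulr_gt0 ?pi_gt0.
exists 1, (a / 2), (a * (`|x0| + 1) ^+ 2); split; rewrite ?divr_gt0 //.
move=> x hx; split=> // j; rewrite Re_qB -/a (le_trans (shift_decay _ _ (ltW a0))) //.
rewrite /NB iwt_sqr lerD2r ler_wpM2l ?(ltW a0) //.
rewrite -[x ^+ 2]real_normK ?num_real //; apply: lerXn2r; rewrite ?nnegrE ?addr_ge0 //.
by rewrite -{1}(subrK x0 x) addrC (le_trans (ler_normD _ _)) // lerD2l ltW.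
Qed.

Let SB (p : R -> nat -> R[i]) x := gint mB (qB ps y) p x.

Let SB_int p x : gpol NB p -> cintegrable mB (fun j => p x j * cexp (qB ps y x j)).
Proof. by move=> gp; exact: (gint_integrable NB0 HB gqB qB_decay gp I). Qed.

Lemma SB_int0 x : cintegrable mB (fun j => 1 * cexp (qB ps y x j)).
Proof. by apply: (@SB_int (fun _ _ => 1)); exact: gpol_cst. Qed.

Let SB_der p p' x : gpol NB p -> gpol NB p' ->
  (forall (t : R) j, cder (p^~ j) t 1 (p' t j)) ->
  cder (SB p) x 1 (SB (fun t j => p' t j + p t j * qB' t j) x).
Proof.
move=> gp gp' dp; refine (gint_is_derive NB0 HB gqB qB_decay gp gp' gqB' _ _ I) => //.
Qed.

Let SB_cont p : gpol NB p -> ccontinuous (SB p).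
Proof. by move=> gp x; exact: (gint_ccont NB0 HB gqB qB_decay gp I). Qed.

Let SB_avg (p : R -> nat -> R[i]) : gpol NB p ->
  gpol NA (fun (_ : WA) z => p (clamp z.2) z.1) ->
  gint mA qA (fun _ z => p (clamp z.2) z.1) t0 = uavg (SB p).
Proof.
move=> gp gpA.
have e z : qA t0 z = qB ps y (clamp z.2) z.1.
  by case: z => j x; rewrite /qA /qB /psi /Z /X /t0 /=; apply: complexRI;
    rewrite !(cReM, cImM, cReD, cImD) /=; ring.
rewrite /gint /uavg /SB /gint.
have h := @cint_Fubini2 _ _ _ _ R (@counting nat R) (unitP R)
  (fun z => p (clamp z.2) z.1 * cexp (qA t0 z)) (@UA_int _ t0 gpA ps0).
rewrite h => [|x].
  by apply: eq_cint => x; apply: eq_cint => j; rewrite e.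
have := SB_int (clamp x) gp.
by rewrite (_ : (fun j => _ * _) = (fun j => p (clamp x) j * cexp (qA t0 (j, x)))) //;
  apply/funext => j; rewrite e.
Qed.

Let SB_sumE p x : gpol NB p -> exists f : int -> R[i],
  [/\ abs_summable f, SB p x = csum f & forall j, f (g j) = p x j * cexp (qB ps y x j)].
Proof.
move=> gp; have [g' gK g'K] := g_bij.
pose f k := p x (g' k) * cexp (qB ps y x (g' k)); exists f.
have fg j : f (g j) = p x j * cexp (qB ps y x j) by rewrite /f gK.
have sf : abs_summable f.
  apply: (@abs_summable_enum R int g g_bij); under eq_fun do rewrite fg.
  exact: (gint_abs_integrable NB0 HB gqB qB_decay gp I).
split=> //; have [_ ->] := csum_enum g_bij sf.
by apply: eq_cint => j; rewrite fg.
Qed.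

Let SB_periodic (P : R[i] -> R[i]) x : gpol NB (fun t j => P (Z t j)) ->
  SB (fun t j => P (Z t j)) (x + 1) = SB (fun t j => P (Z t j)) x.
Proof.
move=> gp; have [f1 [s1 -> h1]] := SB_sumE (x + 1) gp; have [f0 [s0 -> h0]] := SB_sumE x gp.
have sh : bijective (fun k : int => k + 1) by exists (fun k => k - 1) => k; rewrite ?addrK ?subrK.
rewrite (csum_bij f0 sh); congr csum; apply/funext => k.
have [g' gK g'K] := g_bij.
have e : Z (x + 1) (g' k) = Z x (g' (k + 1)).
  by rewrite /Z /K !g'K intrD !rmorphD /= rmorph1; ring.
by rewrite -{1}(g'K k) h1 -{1}(g'K (k + 1)) h0 /qB e.
Qed.

Let gone : gpol NB (fun (_ : R) _ => 1). Proof. exact: gpol_cst. Qed.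

(** Integration by parts on the line: a sum over all integer translates is periodic, and the average
    over a period of the derivative of a periodic function is 0. *)
Let total_derivative (p p' : R -> nat -> R[i]) (P : R[i] -> R[i]) : gpol NB p -> gpol NB p' ->
  (forall (t : R) j, cder (p^~ j) t 1 (p' t j)) -> (forall t j, p t j = P (Z t j)) ->
  uavg (SB (fun (t : R) j => p' t j + p t j * qB' t j)) = 0.
Proof.
move=> gp gp' dp pP.
rewrite (uavg_FTC (F := SB p)); last by move=> x; exact: SB_der.
  have e : p = (fun t j => P (Z t j)) by do 2 apply/funext => ?; rewrite pP.
  have := @SB_periodic P 0; rewrite -e add0r => -> //.
  by rewrite subrr.
apply: SB_cont; apply: gpol_add => //; exact: gpol_mul.
Qed.

Let M_lin (a b : R[i]) n m : gint mA qA (fun _ z => a * (X z ^+ n)%:C + b * (X z ^+ m)%:C) t0 =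
  a * M n t0 + b * M m t0.
Proof.
rewrite /M /gint; have i1 := @UA_int _ t0 (gX n) ps0; have i2 := @UA_int _ t0 (gX m) ps0.
rewrite -(cintZ a i1) -(cintZ b i2) -cintD; [|exact: cintegrableZ..].
by apply: eq_cint => z; rewrite mulrDl !mulrA.
Qed.

Let XZ z : (X z)%:C = Z (clamp z.2) z.1.
Proof. by rewrite /X /Z rmorphD. Qed.

(** [total_derivative] for the constant polynomial 1. It controls the dependence of [M 0] on [y]. *)
Lemma moment1 : ps * M 1 t0 = y%:C * M 0 t0.
Proof.
have h := total_derivative gone (gpol_cst _ _ 0) (fun t j => cder_cst _ _ _) (P := fun=> 1) (fun _ _ => erefl).
have e (t : WA) z : (0 + 1 * qB' (clamp z.2) z.1) =
   ((2 * pi)%:C * 'i%C * ps) * (X z ^+ 1)%:C + (- ((2 * pi)%:C * 'i%C * y%:C)) * (X z ^+ 0)%:C.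
  by rewrite /qB' -XZ expr0 expr1 rmorph1; ring.
have gp : gpol NB (fun t j => 0 + 1 * qB' t j).
  by apply: gpol_add; [exact: gpol_cst|exact: gpol_mul].
have gA : gpol NA (fun (_ : WA) z => 0 + 1 * qB' (clamp z.2) z.1).
  apply: gpol_ext (gpol_add (gpol_mul (gpol_cst _ _ ((2 * pi)%:C * 'i%C * ps)) (gX 1))
    (gpol_mul (gpol_cst _ _ (- ((2 * pi)%:C * 'i%C * y%:C))) (gX 0))) => t z.
  by rewrite e.
have := SB_avg gp gA; rewrite h.
have -> : (fun (_ : WA) z => 0 + 1 * qB' (clamp z.2) z.1) =
  (fun _ z => ((2 * pi)%:C * 'i%C * ps) * (X z ^+ 1)%:C + (- ((2 * pi)%:C * 'i%C * y%:C)) * (X z ^+ 0)%:C).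
  by apply/funext => t; apply/funext => z; rewrite (e t z).
rewrite M_lin => /eqP; rewrite mulNr subr_eq0 -!mulrA => /eqP h2.
have c0 : (2 * pi)%:C * 'i%C != 0 :> R[i].
  by rewrite mulf_neq0 // eq_complex /= ?oner_eq0 ?andbF // eqxx andbT mulf_neq0 // gt_eqF ?pi_gt0.
by apply: (mulfI c0); rewrite -!mulrA.
Qed.

(** [total_derivative] for the polynomial [X]. At [y = 0] it controls the dependence of [M 0] on
    [ps]. *)
Lemma moment2 : M 0 t0 + (2 * pi)%:C * 'i%C * (ps * M 2 t0 - y%:C * M 1 t0) = 0.
Proof.
have h := total_derivative gZ gone dZ (P := id) (fun _ _ => erefl).
have e (t : WA) z : 1 + Z (clamp z.2) z.1 * qB' (clamp z.2) z.1 =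
   ((2 * pi)%:C * 'i%C * ps) * (X z ^+ 2)%:C + (- ((2 * pi)%:C * 'i%C * y%:C)) * (X z ^+ 1)%:C
   + (X z ^+ 0)%:C.
  by rewrite /qB' -XZ expr0 expr1 rmorphXn rmorph1; ring.
have gp : gpol NB (fun t j => 1 + Z t j * qB' t j).
  by apply: gpol_add => //; exact: gpol_mul.
have gA2 : gpol NA (fun (_ : WA) z => ((2 * pi)%:C * 'i%C * ps) * (X z ^+ 2)%:C
    + (- ((2 * pi)%:C * 'i%C * y%:C)) * (X z ^+ 1)%:C).
  by apply: gpol_add; apply: gpol_mul => //; exact: gpol_cst.
have gA : gpol NA (fun (_ : WA) z => 1 + Z (clamp z.2) z.1 * qB' (clamp z.2) z.1).
  by apply: gpol_ext (gpol_add gA2 (gX 0)) => t z; rewrite e.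
have := SB_avg gp gA; rewrite h => h2; rewrite -[RHS]h2.
rewrite mulrBr !mulrA -mulNr -M_lin addrC /M /gint -cintD; last 2 first.
- exact: (@UA_int _ t0 gA2 ps0).
- exact: (@UA_int _ t0 (gX 0) ps0).
by apply: eq_cint => z; rewrite -mulrDl e.
Qed.

Lemma TH_avg : uavg (TH ps y) = M 0 t0.
Proof.
have gp : gpol NA (fun (_ : WA) (z : nat * measurableTypeR R) => 1 : R[i]) by exact: gpol_cst.
rewrite -[LHS](SB_avg gone gp) /M; by congr (gint mA qA _ t0).
Qed.

Lemma TH_per x : TH ps y (x + 1) = TH ps y x.
Proof. exact: (@SB_periodic (fun=> 1) x gone). Qed.

Lemma TH_der : exists d, (forall x : R, cder (TH ps y) x 1 (d x)) /\ ccontinuous d.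
Proof.
exists (SB (fun (t : R) j => 0 + 1 * qB' t j)); split=> [x|].
  apply: SB_der => //; first exact: gpol_cst.
  by move=> t j; exact: cder_cst.
by apply: SB_cont; apply: gpol_add; [exact: gpol_cst|exact: gpol_mul].
Qed.

(** A character of the period is absorbed by an integral shift of [y], because [exp (2 pi i k m)] is
    1 for integers [k] and [m]. With [TH_avg] the Fourier coefficient of index [k] is [M 0] at
    [y + k]. *)
Lemma TH_ex (k : int) x : TH ps y x * ex (- k%:~R * x) = TH ps (y + k%:~R) x.
Proof.
rewrite mulrC /TH /gint -cintZ; last exact: SB_int.
apply: eq_cint => j; rewrite !mul1r.
have -> : qB ps (y + k%:~R) x j = qB ps y x j + ((2 * pi)%:C * 'i%C * (- k%:~R * x)%:C
   + (2 * pi)%:C * 'i%C * (- (k * g j)%:~R)%:C).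
  by rewrite /qB /Z /K intrM; apply: complexRI; rewrite !(cReM, cImM, cReD, cImD) /=; ring.
rewrite !cexpD -/(ee _) -/(ee _) mulrC; congr (_ * _).
by rewrite -/(ex (- (k * g j)%:~R)) (@ex_int _ (- (k * g j)%:~R)) ?mulr1 // rpredN intr_int.
Qed.

Lemma TH_sum x : abs_summable (fun k : int => ee ((2^-1)%:C * ps * (k%:~R + x)%:C ^+ 2 - (y * (k%:~R + x))%:C)) /\
  TH ps y x = csum (fun k : int => ee ((2^-1)%:C * ps * (k%:~R + x)%:C ^+ 2 - (y * (k%:~R + x))%:C)).
Proof.
have [f [sf e fg]] := SB_sumE x gone.
suff -> : (fun k : int => ee ((2^-1)%:C * ps * (k%:~R + x)%:C ^+ 2 - (y * (k%:~R + x))%:C)) = f by [].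
have [g' gK g'K] := g_bij.
apply/funext => k; rewrite -{3}(g'K k) fg mul1r /ee /qB /Z /K g'K; congr cexp.
by apply: complexRI; rewrite !expr2 !(cReM, cImM, cReD, cImD, cReN, cImN) /=; field.
Qed.

End FixedParameters.

Let dM n (t v : WA) : UA t -> cder (M n) t v
  (('i%C * pi%:C * psi v) * M n.+2 t + (- ('i%C * (2 * pi * v.2)%:C)) * M n.+1 t).
Proof.
move=> Ut; have h := gint_is_derive NA0 HA gqA qA_decay (gX n) (gpol_cst NA _ 0) (gqA_cst v)
  (fun t0 z => cder_cst _ _ _) (fun t0 z => dqA v t0 z) Ut.
apply: cder_eq h _; rewrite /M /gint.
have i1 := @UA_int _ t (gX n.+2) Ut; have i2 := @UA_int _ t (gX n.+1) Ut.
rewrite -(cintZ _ i1) -(cintZ _ i2) -cintD; [|exact: cintegrableZ..].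
apply: eq_cint => z; move: (cexp _) => E; rewrite (mulrA _ _ E) (mulrA _ _ E) -mulrDl; congr (_ * _).
rewrite add0r /qA !(exprS _ n.+1) !(exprS _ n).
move: (X z ^+ n) (X z) (psi v) => u w ps.
by apply: complexRI; rewrite !(cReM, cImM, cReD, cImD, cReN, cImN) /=; ring.
Qed.

(** The Gaussian integral of [exp (pi i ps X^2)], a square root of [i / ps] whose branch is fixed by
    the integral itself. *)
Let cc (ps : R[i]) := M 0 (Re ps, Im ps, 0).

Let psi_eta (ps : R[i]) y : psi (Re ps, Im ps, y) = ps.
Proof. by apply: complexRI; rewrite /psi !(cReM, cImM, cReD, cImD) /=; ring. Qed.

Let ps_neq0 (ps : R[i]) : 0 < Im ps -> ps != 0.
Proof. by move=> h; apply/eqP => e; rewrite e ltxx in h. Qed.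

(** Completing the square without moving a contour: along [s y], the product of [M 0] with
    [exp (pi i s^2 y^2 / ps)] has zero derivative by [moment1]; compare [s = 0] and [s = 1]. *)
Let M0_shift (ps : R[i]) (y : R) : 0 < Im ps ->
  M 0 (Re ps, Im ps, y) = cc ps * ee (- (y ^+ 2 / 2)%:C / ps).
Proof.
move=> ps0; have p0 := ps_neq0 ps0.
pose ga (s : R) : WA := (Re ps, Im ps, s * y).
pose w : R[i] := 'i%C * pi%:C / ps * (y ^+ 2)%:C.
pose H (s : R) : R[i] := M 0 (ga s) * cexp (w * (s%:C * s%:C)).
have dH (s : R) : 0 <= s <= 1 -> cder H s 1 0.
  move=> _; have lin (h : R) : ga (h + s) = h *: ((0, 0, y) : WA) + ga s.
    by rewrite /ga mulrDl; congr (_, _, _); rewrite /= ?[_ *: _]mulr0 ?add0r.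
  have d1 := cder_line lin (@dM 0 (ga s) (0, 0, y) ps0).
  have di := @cder_real R R id s 1 1 (is_derive_id _ _).
  have d2 := cder_cexp (cderZ w (cderM di di)).
  apply: cder_eq (cderM d1 d2) _.
  have := @moment1 ps (s * y) ps0; rewrite -/(ga s) => m1.
  have e0 : psi ((0, 0, y) : WA) = 0 by rewrite /psi /= mulr0 addr0.
  have e1 : M 1 (ga s) = (s * y)%:C / ps * M 0 (ga s).
    by apply: (mulfI p0); rewrite m1; field.
  rewrite e0 e1 /w /=; move: (cexp _) (M 0 _) => E m.
  rewrite rmorph1 expr2 !rmorphM /= rmorph_nat; field.
  exact: p0.
have := @cder0_segment H 0 1 ler01 dH.
rewrite /H /ga /cc !mul0r mulr0 cexp0 mulr1 mul1r rmorph1 mulr1 => ->.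
rewrite -mulrA -cexpD -{1}[M 0 _]mulr1; congr (_ * _).
rewrite mulr1 -{1}cexp0 /w; congr cexp.
have -> : - (y ^+ 2 / 2)%:C = - (2^-1 * (y ^+ 2)%:C) :> R[i] by rewrite rmorphM fmorphV rmorph_nat mulrC.
have -> : (2 * pi)%:C = 2 * pi%:C :> R[i] by rewrite rmorphM rmorph_nat.
by field; rewrite p0.
Qed.

(** By [moment2] the function [cc^2] times its argument has zero derivative along the segment from
    [i] to [ps], which stays in the upper half-plane. *)
Let cc_sqr (ps : R[i]) : 0 < Im ps -> cc ps ^+ 2 * ps = cc 'i%C ^+ 2 * 'i%C.
Proof.
move=> ps0.
pose ga (s : R) : WA := (s * Re ps, s * (Im ps - 1) + 1, 0).
pose v : WA := (Re ps, Im ps - 1, 0).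
pose ph (s : R) : R[i] := s%:C * (ps - 'i%C) + 'i%C.
pose H (s : R) : R[i] := (M 0 (ga s) * M 0 (ga s)) * ph s.
have dH (s : R) : 0 <= s <= 1 -> cder H s 1 0.
  move=> /andP[s0 s1]; have Us : UA (ga s).
    by rewrite /UA /ga /=; have : 0 <= s * Im ps by [rewrite mulr_ge0 // ltW];
      case: (ltrP s 1) => [?|?]; [nra|have -> : s = 1 by lra]; lra.
  have lin (h : R) : ga (h + s) = h *: v + ga s.
    by rewrite /ga /v !mulrDl; congr (_, _, _); rewrite /= ?[_ *: _]mulr0 ?add0r // /GRing.scale /= addrA.
  have d1 := cder_line lin (@dM 0 (ga s) v Us).
  have d2 : cder ph s 1 (1 * (ps - 'i%C) + 0).
    apply: cderD (cder_cst _ _ _); rewrite (_ : (fun s : R => _) = fun s : R => (ps - 'i%C) * s%:C); last first.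
      by apply/funext => r; rewrite mulrC.
    by rewrite mul1r -[X in cder _ _ _ X]mulr1; apply: cderZ; exact: cder_real (is_derive_id _ _).
  apply: cder_eq (cderM (cderM d1 d1) d2) _.
  have eg : ga s = (Re (ph s), Im (ph s), 0).
    by rewrite /ga /ph !(cReM, cImM, cReD, cImD, cReN, cImN) /=; congr (_, _, _); ring.
  have Ip : 0 < Im (ph s) by move: Us; rewrite /UA eg.
  have := @moment2 (ph s) 0 Ip; rewrite -eg mul0r subr0 => m2.
  have ev : psi v = ps - 'i%C.
    by rewrite /psi /v; apply: complexRI; rewrite !(cReM, cImM, cReD, cImD, cReN, cImN) /=; ring.
  rewrite ev /= mulr0 (_ : (0 : R)%:C = 0) // mulr0 oppr0 mul0r !addr0 mul1r.
  move: m2; rewrite rmorphM rmorph_nat /= => m2.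
  rewrite (_ : _ + _ = M 0 (ga s) * (ps - 'i%C) *
    (M 0 (ga s) + 2 * pi%:C * 'i%C * (ph s * M 2 (ga s)))); first by rewrite m2 mulr0.
  ring.
have := @cder0_segment H 0 1 ler01 dH.
have e0 : ga 0 = (Re ('i%C : R[i]), Im ('i%C : R[i]), 0) by rewrite /ga /= !mul0r add0r.
have e1 : ga 1 = (Re ps, Im ps, 0) by rewrite /ga /= !mul1r subrK.
by rewrite /H e0 e1 /ph mul0r add0r mul1r subrK /cc !expr2 => ->.
Qed.

Let mex (c : R[i]) (a b : R) : cmeas (fun x : measurableTypeR R => c * ex (b + a * clamp x)).
Proof.
apply: (@cmeasM _ (measurableTypeR R) R (fun=> c)); first exact: cmeas_cst.
apply: (@cmeas_cexp _ (measurableTypeR R) R); apply: (@cmeasM _ (measurableTypeR R) R (fun=> _)).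
  exact: cmeas_cst.
apply: cmeas_real; apply: measurable_funD; first exact: measurable_cst.
by apply: measurable_funM; [exact: measurable_cst|exact: measurable_clamp].
Qed.

Section Dual.
Variables (om : R[i]) (y : R).
Hypothesis om0 : 0 < Im om.

Let qC (x : R) (j : nat) : R[i] :=
  ('i%C * pi%:C * om) * ((K j + y) ^+ 2)%:C + ('i%C * (2 * pi)%:C) * ((K j)%:C * x%:C).
(** The dual theta function, written as a Fourier series in [x] with explicit coefficients; [SC_TH]
    identifies it with a value of [TH] up to a phase. *)
Let SC (x : R) := gint mB qC (fun (_ : R) (_ : nat) => 1) x.

Let gK (W : normedModType R) : gpol NB (fun (_ : W) j => (K j)%:C).
Proof.
by apply: (@gpol_weight _ _ _ NB _ K 1 1%N) => // j; rewrite mul1r expr1 /K iwtE lerDr.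
Qed.

Let gqC : gpol NB qC.
Proof.
apply: gpol_add; apply: gpol_mul; try exact: gpol_cst.
  apply: gpol_ext (gpol_mul (gpol_add (gK R) (gpol_cst _ _ y%:C)) (gpol_add (gK R) (gpol_cst _ _ y%:C))).
  by move=> t j; rewrite expr2 rmorphM rmorphD.
by apply: gpol_mul; [exact: gK|apply: (@gpol_lin _ _ _ NB R id 1) => // x; rewrite mul1r].
Qed.

Let qC' (j : nat) : R[i] := ('i%C * (2 * pi)%:C) * (K j)%:C.

Let dqC x j : cder (qC^~ j) x 1 (qC' j).
Proof.
apply: cder_eq (cderD (cder_cst _ _ _) (cderZ _ (cderZ _ (cder_real (is_derive_id _ _))))) _.
by rewrite add0r rmorph1 mulr1.
Qed.

Let Re_qC x j : Re (qC x j) = - (pi * Im om * (K j + y) ^+ 2).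
Proof. rewrite /qC !(cReM, cImM, cReD, cImD) /=; ring. Qed.

Let qC_decay x0 : [set: R] x0 -> exists r a C : R, [/\ 0 < r, 0 < a &
  forall x : R, `|x - x0| < r -> [set: R] x /\ forall j, Re (qC x j) <= C - a * NB j ^+ 2].
Proof.
move=> _; pose a := pi * Im om; have a0 : 0 < a by rewrite mulr_gt0 ?pi_gt0.
exists 1, (a / 2), (a * y ^+ 2); split; rewrite ?divr_gt0 //.
by move=> x hx; split=> // j; rewrite Re_qC -/a (le_trans (shift_decay _ _ (ltW a0))) // /NB iwt_sqr.
Qed.

Let gone' : gpol NB (fun (_ : R) _ => 1). Proof. exact: gpol_cst. Qed.

Let SC_int x : cintegrable mB (fun j => 1 * cexp (qC x j)).
Proof. exact: (gint_integrable NB0 HB gqC qC_decay gone' I). Qed.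

Let SC_der : exists d, (forall x : R, cder SC x 1 (d x)) /\ ccontinuous d.
Proof.
have gqC' : gpol NB (fun (_ : R) j => qC' j) by apply: gpol_mul; [exact: gpol_cst|exact: gK].
exists (gint mB qC (fun (t : R) j => 0 + 1 * qC' j)); split=> x.
  refine (gint_is_derive NB0 HB gqC qC_decay gone' (gpol_cst _ _ 0) gqC' _ _ I) => // t j.
  exact: cder_cst.
refine (gint_ccont NB0 HB gqC qC_decay _ I).
by apply: gpol_add; [exact: gpol_cst|exact: gpol_mul].
Qed.

Let SC_per x : SC (x + 1) = SC x.
Proof.
apply: eq_cint => j; rewrite !mul1r.
have -> : qC (x + 1) j = qC x j + (2 * pi)%:C * 'i%C * (K j)%:C.
  by rewrite /qC [(x + 1)%:C]rmorphD rmorph1; ring.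
by rewrite cexpD -[X in _ * X]/(ex (K j)) ex_int ?mulr1 // intr_int.
Qed.

(** Orthogonality of characters, after exchanging sum and average; the Gaussian decay of the
    coefficients [E j] justifies the exchange. *)
Let SC_coef (k : int) :
  uavg (fun x => SC x * ex (- k%:~R * x)) = ee ((2^-1)%:C * om * ((k%:~R + y) ^+ 2)%:C).
Proof.
pose E j := ee ((2^-1)%:C * om * ((K j + y) ^+ 2)%:C).
pose F (z : nat * measurableTypeR R) : R[i] := E z.1 * ex ((g z.1 - k)%:~R * clamp z.2).
have qCE x j : cexp (qC x j) = E j * ex (K j * x).
  rewrite /E /ex /ee -cexpD; congr cexp; rewrite /qC !rmorphM /= fmorphV rmorph_nat; by field.
have cE x j : cabs (1 * cexp (qC x j)) = cabs (E j).
  by rewrite mul1r qCE cabsM cabs_ex mulr1.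
have iE : mB.-integrable [set: nat] (fun j => (cabs (E j))%:E).
  have := gint_abs_integrable NB0 HB gqC qC_decay gone' (t := 0) I.
  by under eq_fun do rewrite cE.
have [C [e [_ hE]]] : exists (C : R) e, 0 <= C /\ forall j, cabs (E j) <= C * (1 + NB j) ^+ e * expR (- (pi * Im om / 2) * NB j ^+ 2).
  exists (expR (pi * Im om * y ^+ 2)), 0; split=> [|j]; first exact: expR_ge0.
  have [r [a [D [_ _ _]]]] := @qC_decay 0 I.
  rewrite -(cE 0 j) mul1r cabs_cexp expr0 mulr1 -expRD ler_expR Re_qC.
  have a0 : 0 <= pi * Im om by rewrite mulr_ge0 ?pi_ge0 // ltW.
  rewrite (le_trans (shift_decay _ _ a0)) // /NB iwt_sqr mulNr lerD2l lerN2.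
  by rewrite lexx.
have mF : cmeas F.
  apply: cmeasM.
    have h : cmeas E by split.
    by split; [apply: (@measurable_count_fst R _ _ (fun j => Re (E j)))|apply: (@measurable_count_fst R _ _ (fun j => Im (E j)))].
  apply: cmeas_cexp; apply: cmeasM; first exact: cmeas_cst.
  apply: cmeas_real; apply: measurable_funM; first exact: (@measurable_count_fst R _ _ (fun j => (g j - k)%:~R)).
  by apply: (measurableT_comp (@measurable_clamp R)).
have a0 : 0 < pi * Im om / 2 by rewrite divr_gt0 ?mulr_gt0 ?pi_gt0.
have iF : cintegrable mA F.
  have iG : mA.-integrable setT (EFin \o (fun z => C * ((1 + NA z) ^+ e * expR (- (pi * Im om / 2) * NA z ^+ 2)))).
    exact: (integrableZl measurableT C (HA e a0)).
  apply: (cintegrable_dominated mF iG) => z.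
  by rewrite /F cabsM cabs_ex mulr1 mulrA.
have iF1 x : cintegrable mB (fun j => F (j, x)).
  by apply: cintegrable_dominated iE _ => [|j]; [split|rewrite /F cabsM cabs_ex mulr1].
have iF2 j : cintegrable (unitP R) (fun x => F (j, x)).
  apply: (@unit_cintegrable_bounded _ _ (cabs (E j))) => [|x]; last by rewrite /F cabsM cabs_ex mulr1.
  rewrite (_ : (fun x => _) = (fun x => E j * ex (0 + (g j - k)%:~R * clamp x))); first exact: mex.
  by apply/funext => x; rewrite add0r.
transitivity (cint mA F).
  rewrite (cint_Fubini2 iF iF1) /uavg; apply: eq_cint => x.
  rewrite /SC /gint mulrC -cintZ; last exact: SC_int.
  apply: eq_cint => j.
  have e1 : ex ((g j - k)%:~R * clamp x) = ex (- k%:~R * clamp x) * ex (K j * clamp x).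
    by rewrite -exD; congr ex; rewrite /K intrB; ring.
  rewrite mul1r qCE /F /= e1; move: (E j) (ex (- k%:~R * clamp x)) (ex (K j * clamp x)) => u v w; ring.
rewrite (cint_Fubini1 iF iF2).
have [g' gK' g'K] := g_bij.
transitivity (csum (fun j => if j == g' k then E (g' k) else 0)); last first.
  by rewrite csum_single /E /K g'K.
have [_ ->] := csum_counting (abs_summable_single (g' k) (E (g' k))).
apply: eq_cint => j; case: eqP => [->|njk].
  rewrite (_ : (fun x => _) = fun=> E (g' k)); last first.
    by apply/funext => x; rewrite /F /= g'K subrr mul0r ex_int ?mulr1 // rpred0.
  have hc (r : R) : (\int[unitP R]_(x in setT) r)%R = r.
    rewrite Rintegral_cst // [X in fine X](_ : _ = 1%E) ?mulr1 //.
    exact: probability_setT.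
  by rewrite /cint !hc; case: (E _).
have nk : k - g j != 0 by apply/eqP => /subr0_eq h; apply: njk; rewrite h gK'.
have := uavg_ex 0 nk; rewrite /uavg => h.
transitivity (cint (unitP R) (fun x : measurableTypeR R => E j * ex ((k - g j)%:~R * 0 + - (k - g j)%:~R * clamp x))).
  apply: eq_cint => x; rewrite /F /=; congr (_ * ex _); rewrite mulr0 add0r -mulrNz opprB //.
rewrite cintZ ?h ?mulr0 //.
apply: (@unit_cintegrable_bounded _ _ 1) => [|x]; last by rewrite cabs_ex.
rewrite (_ : (fun x => _) = (fun x => 1 * ex (0 + (- (k - g j)%:~R) * clamp x))); first exact: mex.
by apply/funext => x; rewrite mul1r.
Qed.

Let qC_TH x j : cexp (qC x j) = cexp (qB om (- x) y j) * ex (- (x * y)).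
Proof.
rewrite /ex /ee -cexpD; congr cexp; rewrite /qC /qB /Z.
by apply: complexRI; rewrite ?expr2 !(cReM, cImM, cReD, cImD, cReN, cImN) /=; ring.
Qed.

Let SC_TH x : SC x = TH om (- x) y * ex (- (x * y)).
Proof.
rewrite mulrC /TH /gint -cintZ; last exact: SB_int0.
by apply: eq_cint => j; rewrite !mul1r qC_TH mulrC.
Qed.

Lemma dual_theta : [/\ exists d, (forall x : R, cder (fun x => TH om (- x) y * ex (- (x * y))) x 1 (d x)) /\ ccontinuous d,
  forall x, TH om (- (x + 1)) y * ex (- ((x + 1) * y)) = TH om (- x) y * ex (- (x * y)) &
  forall k : int, uavg (fun x => TH om (- x) y * ex (- (x * y)) * ex (- k%:~R * x)) = ee ((2^-1)%:C * om * ((k%:~R + y) ^+ 2)%:C)].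
Proof.
have e : (fun x => TH om (- x) y * ex (- (x * y))) = SC by apply/funext => x; rewrite SC_TH.
split=> [|x|k].
- have -> : (fun x : R => TH om (- x) y * ex (- (x * y))) = SC by [].
  exact: SC_der.
- by rewrite -!SC_TH SC_per.
- by rewrite -SC_coef; congr uavg; apply/funext => x; rewrite -SC_TH.
Qed.

End Dual.
Let THi (ps : R[i]) (y x : R) : 0 < Im ps -> ccontinuous (TH ps y).
Proof. by move=> ps0; have [d [hd _]] := @TH_der ps y ps0; exact: cder_ccontinuous hd. Qed.

Let THC_c (om : R[i]) (y : R) : 0 < Im om -> ccontinuous (fun x : R => TH om (- x) y * ex (- (x * y))).
Proof. by move=> om0; have [[d [hd _]] _ _] := dual_theta y om0; exact: cder_ccontinuous hd. Qed.

Let uavgD (f h : R -> R[i]) : ccontinuous f -> ccontinuous h ->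
  uavg (fun x => f x + h x) = uavg f + uavg h.
Proof. by move=> cf cg; rewrite /uavg cintD //; exact: uavg_integrable. Qed.

Let uavgZ (c : R[i]) (f : R -> R[i]) : ccontinuous f -> uavg (fun x => c * f x) = c * uavg f.
Proof. by move=> cf; rewrite /uavg cintZ //; exact: uavg_integrable. Qed.

Let Im_oppinv (om : R[i]) : 0 < Im om -> 0 < Im (- om^-1).
Proof.
case: om => a b /= b0; rewrite opprK.
by rewrite divr_gt0 // ltr_wpDl ?sqr_ge0 ?exprn_gt0.
Qed.

(** Both sides are smooth and 1-periodic in [x] and share the Fourier coefficients
    [cc ps * exp (- pi i (y + k)^2 / ps)]: on the left by [TH_ex], [TH_avg] and [M0_shift], on the
    right by [dual_theta]. [fourier_uniqueness] applies to the difference. *)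
Lemma dual_identity (ps : R[i]) (x y : R) : 0 < Im ps ->
  TH ps y x = cc ps * (TH (- ps^-1) (- x) y * ex (- (x * y))).
Proof.
move=> ps0; have om0 := Im_oppinv ps0.
pose SC x : R[i] := TH (- ps^-1) (- x) y * ex (- (x * y)).
have [[d2 [hd2 cd2]] per2 coef2] := dual_theta y om0.
have [d1 [hd1 cd1]] := @TH_der ps y ps0.
have cS : ccontinuous SC := THC_c y om0.
have cT : ccontinuous (TH ps y) by exact: THi.
pose G x := TH ps y x + (- cc ps) * SC x.
pose G' x := d1 x + (- cc ps) * d2 x.
have cex (a : R) : ccontinuous (fun x : R => ex (a * x)).
  by have h := ccontinuous_ex 0 a; under eq_fun do rewrite -[a * _]add0r.
suff : G x = 0 by rewrite /G mulNr => /eqP; rewrite subr_eq0 => /eqP.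
apply: (@fourier_uniqueness _ G G') => [z|z|z|k].
- exact: (cderD (hd1 z) (cderZ _ (hd2 z))).
- exact: (ccontD (cd1 z) (ccontM (ccont_cst _ _) (cd2 z))).
- by rewrite /G TH_per // /SC per2.
have e z : G z * ex (- k%:~R * z) = TH ps y z * ex (- k%:~R * z) + (- cc ps) * (SC z * ex (- k%:~R * z)).
  rewrite /G; move: (ex _) (TH ps y z) (SC z) (cc ps) => a b c d; ring.
rewrite (funext e : (fun z => G z * _) = _).
rewrite uavgD; last 2 first.
- by move=> z; apply: ccontM => //; exact: cex.
- by move=> z; apply: ccontM; [exact: ccont_cst|apply: ccontM => //; exact: cex].
rewrite uavgZ; last by move=> z; apply: ccontM => //; exact: cex.
rewrite coef2 (_ : (fun x => _) = TH ps (y + k%:~R)); last first.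
  by apply/funext => z; exact: TH_ex.
rewrite TH_avg // M0_shift //.
rewrite (_ : - ((y + k%:~R) ^+ 2 / 2)%:C / ps = (2^-1)%:C * - ps^-1 * ((k%:~R + y) ^+ 2)%:C).
  by rewrite mulNr subrr.
rewrite [y + _]addrC rmorphM /=; move: (_ ^+ 2)%:C (2^-1)%:C => a b.
by field; exact: ps_neq0.
Qed.

Let cc_real (t : R) : 0 < t -> Im (cc (0 +i* t)) = 0 /\ 0 <= Re (cc (0 +i* t)).
Proof.
move=> t0; have e z : (X z ^+ 0)%:C * cexp (qA (0, t, 0) z) = (expR (- (pi * t * X z ^+ 2)))%:C.
  rewrite expr0 mul1r -cexp_real; congr cexp.
  by apply: complexRI; rewrite /qA /psi !(cReM, cImM, cReD, cImD) /=; ring.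
rewrite /cc /M /gint (_ : (fun z => _ * _) = fun z => (expR (- (pi * t * X z ^+ 2)))%:C); last exact: funext e.
rewrite /cint /=; split; first by rewrite /Rintegral integral0.
by apply: Rintegral_ge0 => z _; exact: expR_ge0.
Qed.

Let i_opV : - ('i%C : R[i])^-1 = 'i%C.
Proof.
have i0 : 'i%C != 0 :> R[i] by rewrite eq_complex /= oner_eq0 andbF.
by apply: (mulfI i0); rewrite mulrN mulfV // -expr2 sqr_i.
Qed.

Let TH_i_neq0 : TH 'i%C 0 0 != 0.
Proof.
have i1 : 0 < Im ('i%C : R[i]) by exact: ltr01.
have [g' gK g'K] := g_bij.
have e j : 1 * cexp (qB 'i%C 0 0 j) = (expR (- (pi * K j ^+ 2)))%:C.
  rewrite mul1r -cexp_real; congr cexp.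
  by apply: complexRI; rewrite /qB /Z !(cReM, cImM, cReD, cImD) /=; ring.
have le1 : (1 : R) <= Re (TH 'i%C 0 0).
  rewrite /TH /gint (_ : (fun j => _ * _) = fun j => (expR (- (pi * K j ^+ 2)))%:C); last exact: funext e.
  rewrite /cint /=.
  pose h (j : nat) : R[i] := if j == g' 0 then 1 else 0.
  have sh : abs_summable h by exact: abs_summable_single.
  have [ih] := csum_counting sh; rewrite csum_single => /(congr1 (@complex.Re R)); rewrite /cint /= => ->.
  apply: le_Rintegral => //; first by case: ih.
    by have [] := @SB_int0 'i%C 0 i1 0; under eq_fun do rewrite e.
  move=> j _; rewrite /h; case: eqP => [->|_] /=; last exact: expR_ge0.
  by rewrite /K g'K expr0n mulr0 oppr0 expR0.
by apply/eqP => h; rewrite h /= ler10 in le1.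
Qed.

(** At [ps = i] and [x = y = 0] the identity reads [theta = cc i * theta] with [theta] nonzero, so
    the normalisation of the Gaussian integral is read off from the inversion itself. *)
Let cc_i : cc 'i%C = 1.
Proof.
have := @dual_identity 'i%C 0 0 ltr01.
rewrite i_opV oppr0 mul0r oppr0 ex_int ?rpred0 // mulr1.
by rewrite -{1}[TH _ _ _]mul1r => /(mulIf TH_i_neq0).
Qed.

Let cc_sqr1 (ps : R[i]) : 0 < Im ps -> cc ps ^+ 2 * ps = 'i%C.
Proof. by move=> ps0; rewrite cc_sqr // cc_i expr1n mul1r. Qed.

Let cc_neq0 (ps : R[i]) : 0 < Im ps -> cc ps != 0.
Proof.
move=> /cc_sqr1 h; apply/eqP => c0; move: h; rewrite c0 expr0n mul0r => /(congr1 (@complex.Im R)) /= /eqP.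
by rewrite eq_sym oner_eq0.
Qed.

Let cc_cont (f : R -> R[i]) (s : R) : 0 < Im (f s) -> ccont f s -> ccont (fun s => cc (f s)) s.
Proof.
move=> fs [c1 c2].
have := gint_ccont NA0 HA gqA qA_decay (gX 0) (t := (Re (f s), Im (f s), 0)) fs.
have cp : {for s, continuous (fun s => ((Re (f s), Im (f s), 0) : WA))}.
  by refine (cvg_pair (cvg_pair c1 c2) (@cvg_cst _ _ _ _ _)).
move=> [m1 m2]; split.
  exact: (continuous_comp cp m1).
exact: (continuous_comp cp m2).
Qed.

(** The constant is exported only through what the induction on the dimension and the choice of
    branch consume: its square, continuity along paths, and positivity on the imaginary axis. *)
Lemma jacobi_inversion_enum : exists c : R[i] -> R[i],
  [/\ forall ps, 0 < Im ps -> c ps != 0 /\ c ps ^+ 2 * ps = 'i%C,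
      forall (f : R -> R[i]) (s : R), 0 < Im (f s) -> ccont f s -> ccont (fun s => c (f s)) s,
      forall t : R, 0 < t -> Im (c (0 +i* t)) = 0 /\ 0 < Re (c (0 +i* t)) &
      forall om ze, 0 < Im om ->
        [/\ abs_summable (fun k : int => ee (om * k%:~R ^+ 2 / 2 + k%:~R * ze)),
            abs_summable (fun m : int => ee (- ((m%:~R + ze) ^+ 2 / (2 * om)))) &
            csum (fun m : int => ee (- ((m%:~R + ze) ^+ 2 / (2 * om)))) =
            c (- om^-1) * csum (fun k : int => ee (om * k%:~R ^+ 2 / 2 + k%:~R * ze))]].
Proof.
exists cc; split=> [ps ps0|f s fs cf|t t0|om ze om0].
- by split; [exact: cc_neq0|exact: cc_sqr1].
- exact: cc_cont.
- have [h1 h2] := cc_real t0; split=> //; rewrite lt_neqAle h2 andbT eq_sym.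
  have it : 0 < Im (0 +i* t) by [].
  apply: contra (cc_neq0 it) => /eqP h; apply/eqP; apply: complexRI => //=.
have omn := ps_neq0 om0.
(* Since [Im om] is nonzero, 1 and [om] form a real basis of the complex numbers; a complex elliptic
   variable thus reduces to two real characteristics. *)
have [x [y Eze]] : exists x y : R, ze = x%:C + om * y%:C.
  exists (Re ze - Re om * (Im ze / Im om)), (Im ze / Im om); apply: complexRI; rewrite !(cReM, cImM, cReD, cImD) /=; field; exact: (lt0r_neq0 om0).
have ps0 := Im_oppinv om0.
have [s1 e1] := @TH_sum (- om^-1) y ps0 x.
have [s2 e2] := @TH_sum om (- x) om0 y.
have h2 : (2^-1)%:C = 2^-1 :> R[i] by rewrite fmorphV rmorph_nat.
have hm (m : int) (r : R) : (m%:~R + r)%:C = m%:~R + r%:C :> R[i] by rewrite rmorphD rmorph_int.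
have hM (r r' : R) : (r * r')%:C = r%:C * r'%:C :> R[i] by rewrite rmorphM.
have hN (r : R) : (- r)%:C = - r%:C :> R[i] by rewrite rmorphN.
pose D := ee (- (om * y%:C ^+ 2 / 2)).
have E1 (m : int) : ee (- ((m%:~R + ze) ^+ 2 / (2 * om))) =
    D * ee ((2^-1)%:C * (- om^-1) * (m%:~R + x)%:C ^+ 2 - (y * (m%:~R + x))%:C).
  rewrite /D -ee_D; congr ee; rewrite Eze h2 hM !hm; field.
  by rewrite omn.
have E2 (k : int) : ee (om * k%:~R ^+ 2 / 2 + k%:~R * ze) =
    (D * ee (- (x * y))%:C) * ee ((2^-1)%:C * om * (k%:~R + y)%:C ^+ 2 - (- x * (k%:~R + y))%:C).
  rewrite /D -!ee_D; congr ee; rewrite Eze h2 hN !hM hN !hm; by field.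
rewrite (funext E1) (funext E2).
split; [exact: abs_summableZ|exact: abs_summableZ|].
rewrite !csumZ // -e1 -e2 (dual_identity x y ps0) invrN invrK opprK /ex.
move: (cc _) (TH _ _ _) (ee (- (x * y))%:C) => u v w; rewrite -/D; ring.
Qed.
End JacobiInversion.

Lemma jacobi_inversion (R : realType) : exists c : R[i] -> R[i],
  [/\ forall ps, 0 < Im ps -> c ps != 0 /\ c ps ^+ 2 * ps = 'i%C,
      forall (f : R -> R[i]) (s : R), 0 < Im (f s) -> ccont f s -> ccont (fun s => c (f s)) s,
      forall t : R, 0 < t -> Im (c (0 +i* t)) = 0 /\ 0 < Re (c (0 +i* t)) &
      forall om ze, 0 < Im om ->
        [/\ abs_summable (fun k : int => ee (om * k%:~R ^+ 2 / 2 + k%:~R * ze)),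
            abs_summable (fun m : int => ee (- ((m%:~R + ze) ^+ 2 / (2 * om)))) &
            csum (fun m : int => ee (- ((m%:~R + ze) ^+ 2 / (2 * om)))) =
            c (- om^-1) * csum (fun k : int => ee (om * k%:~R ^+ 2 / 2 + k%:~R * ze))]].
Proof. by have [g gb] := int_enum; exact: (jacobi_inversion_enum R gb). Qed.

(** * Coercivity of positive definite forms by compactness *)

Section Coercivity.
Variable R : realType.

Definition nsq n (x : 'rV[R]_n) : R := \sum_i x 0 i ^+ 2.

Lemma nsq_ge0 n (x : 'rV[R]_n) : 0 <= nsq x.
Proof. by apply: sumr_ge0 => i _; exact: sqr_ge0. Qed.

Lemma nsqZ n a (x : 'rV[R]_n) : nsq (a *: x) = a ^+ 2 * nsq x.
Proof. by rewrite /nsq mulr_sumr; apply: eq_bigr => i _; rewrite mxE exprMn. Qed.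

Lemma nsq0 n : nsq (0 : 'rV[R]_n) = 0.
Proof. by rewrite -(scale0r 0) nsqZ expr0n mul0r. Qed.

Lemma nsq_eq0 n (x : 'rV[R]_n) : nsq x = 0 -> x = 0.
Proof.
move=> /eqP; rewrite psumr_eq0 => [|i _]; last exact: sqr_ge0.
move=> /allP h; apply/rowP => i; rewrite mxE; apply/eqP.
by have := h i (mem_index_enum _); rewrite /= sqrf_eq0.
Qed.

Lemma coord_le_norm n (x : 'rV[R]_n) i : `|x 0 i| <= `|x|.
Proof. by rewrite [leRHS]/Num.norm /= mx_normrE; apply/bigmax_geP; right => /=; exists (0, i). Qed.

Lemma nsq_continuous n : continuous (@nsq n).
Proof.
rewrite /nsq; elim: (index_enum 'I_n) => [|i r IH].
  by under eq_fun do rewrite big_nil; exact: cst_continuous.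
under eq_fun do rewrite big_cons; move=> x.
apply: (@continuousD _ _ _ (fun x : 'rV[R]_n => x 0 i ^+ 2) (fun x : 'rV[R]_n => \sum_(j <- r) x 0 j ^+ 2)).
  by apply: (@continuous_comp _ _ _ (fun x : 'rV[R]_n => x 0 i) (fun r => r ^+ 2));
    [exact: coord_continuous|exact: exprn_continuous].
exact: IH.
Qed.

Lemma sphere_compact n : compact [set x : 'rV[R]_n | nsq x = 1].
Proof.
apply: bounded_closed_compact.
  exists 1; split=> // M M1 x /= x1; rewrite (le_trans _ (ltW M1)) //.
  rewrite [leLHS]/Num.norm /= mx_normrE; apply/bigmax_leP; split=> // -[i j] _ /=.
  rewrite (ord1 i) -(@expr_le1 _ 2) // real_normK ?num_real // -x1 /nsq (bigD1 j) //=.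
  by rewrite lerDl; apply: sumr_ge0 => k _; exact: sqr_ge0.
rewrite (_ : [set x | _] = (@nsq n) @^-1` [set 1]) //.
by apply: closed_comp => [x _|]; [exact: nsq_continuous|exact: closed_eq].
Qed.

(** The constant is the minimum of [f] on the compact product of the unit square and the unit
    sphere; homogeneity of degree 2 extends the bound to all [x]. *)
Lemma uniform_posdef n (f : R * R * 'rV[R]_n -> R) : continuous f ->
  (forall s u a x, f (s, u, a *: x) = a ^+ 2 * f (s, u, x)) ->
  (forall s u x, 0 <= s <= 1 -> 0 <= u <= 1 -> x != 0 -> 0 < f (s, u, x)) ->
  exists2 e, 0 < e & forall s u x, 0 <= s <= 1 -> 0 <= u <= 1 -> e * nsq x <= f (s, u, x).
Proof.
move=> cf fZ fpos.
have f0 s u : f (s, u, 0) = 0 by rewrite -(scale0r 0) fZ expr0n mul0r.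
pose K : set (R * R * 'rV[R]_n) := (`[0, 1]%classic `*` `[0, 1]%classic) `*` [set x : 'rV[R]_n | nsq x = 1].
(* [K] is empty only in dimension zero, where [x] is zero and any constant works. *)
have [K0|K0] := pselect (K !=set0); last first.
  exists 1 => // s u x s01 u01; have [->|x0] := eqVneq x 0.
    by rewrite nsq0 f0 mulr0.
  have n0 : nsq x != 0 by apply: contra x0 => /eqP /nsq_eq0 ->.
  case: K0; exists (s, u, (Num.sqrt (nsq x))^-1 *: x).
  rewrite /K /= !in_itv /=; split=> //.
  by rewrite nsqZ exprVn sqr_sqrtr ?nsq_ge0 // mulVf.
have cK : compact K.
  by apply: compact_setX; [apply: compact_setX; exact: segment_compact|exact: sphere_compact].
have [[[s0 u0] x0]] := compact_EVT_min K0 cK (continuous_subspaceT cf).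
rewrite inE => -[[/= hs hu] hx] hmin.
rewrite !in_itv /= in hs hu.
have x00 : x0 != 0.
  apply/eqP => e; move: hx; rewrite e nsq0.
  by move=> /eqP; rewrite eq_sym oner_eq0.
exists (f (s0, u0, x0)); first exact: fpos.
move=> s u x s01 u01; have [->|xn0] := eqVneq x 0.
  by rewrite nsq0 f0 mulr0.
have n0 : nsq x != 0 by apply: contra xn0 => /eqP /nsq_eq0 ->.
have n1 : Num.sqrt (nsq x) != 0.
  by apply: contra n0 => /eqP h; rewrite -[nsq x]sqr_sqrtr ?nsq_ge0 // h expr0n.
have -> : x = Num.sqrt (nsq x) *: ((Num.sqrt (nsq x))^-1 *: x) by rewrite scalerA mulfV // scale1r.
rewrite nsqZ fZ mulrCA ler_wpM2l ?sqr_ge0 //.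
set y := _^-1 *: x; have y1 : nsq y = 1 by rewrite nsqZ exprVn sqr_sqrtr ?nsq_ge0 // mulVf.
rewrite y1 mulr1; apply: hmin; rewrite inE /K /= !in_itv /=; split=> //.
Qed.

End Coercivity.

(** * Quadratic forms and elimination of the first variable *)

Definition qf (F : comNzRingType) n (Om : 'M[F]_n) (v : 'rV[F]_n) : F := (v *m Om *m v^T) 0 0.
Definition dotp (F : comNzRingType) n (v w : 'rV[F]_n) : F := (v *m w^T) 0 0.

Section QuadraticForms.
Variable F : comNzRingType.

Lemma qfE n (Om : 'M[F]_n) v : qf Om v = \sum_i \sum_j v 0 i * Om i j * v 0 j.
Proof.
rewrite /qf mxE exchange_big /=; apply: eq_bigr => j _.
by rewrite !mxE mulr_suml; apply: eq_bigr => i _.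
Qed.

Lemma dotpE n (v w : 'rV[F]_n) : dotp v w = \sum_i v 0 i * w 0 i.
Proof. by rewrite /dotp mxE; apply: eq_bigr => i _; rewrite mxE. Qed.

Lemma dotpC n (v w : 'rV[F]_n) : dotp v w = dotp w v.
Proof. by rewrite !dotpE; apply: eq_bigr => i _; rewrite mulrC. Qed.

Lemma dotpDr n (v w w' : 'rV[F]_n) : dotp v (w + w') = dotp v w + dotp v w'.
Proof. by rewrite /dotp linearD mulmxDr mxE. Qed.

Lemma dotpZr n a (v w : 'rV[F]_n) : dotp v (a *: w) = a * dotp v w.
Proof. by rewrite /dotp linearZ /= -scalemxAr mxE. Qed.

Lemma dotp_row n (a b : F) (v w : 'rV[F]_n) :
  dotp (row_mx a%:M v : 'rV[F]_(1 + n)) (row_mx b%:M w) = a * b + dotp v w.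
Proof.
rewrite /dotp tr_row_mx mul_row_col mxE; congr (_ + _).
by rewrite tr_scalar_mx -scalar_mxM mxE eqxx mulr1n.
Qed.

Lemma addmxE (M N : 'M[F]_1) : (M + N) 0 0 = M 0 0 + N 0 0.
Proof. by rewrite mxE. Qed.

Lemma qfD n (Om : 'M[F]_n) v w : Om^T = Om ->
  qf Om (v + w) = qf Om v + 2 * dotp (v *m Om) w + qf Om w.
Proof.
move=> Os; rewrite /qf !mulmxDl linearD /= !mulmxDr !addmxE.
rewrite -[(w *m Om *m v^T) 0 0]/(dotp (w *m Om) v) -[(v *m Om *m w^T) 0 0]/(dotp (v *m Om) w).
have -> : dotp (w *m Om) v = dotp (v *m Om) w.
  by rewrite dotpC /dotp trmx_mul Os mulmxA.
ring.
Qed.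

Lemma qfZ n (Om : 'M[F]_n) a v : qf Om (a *: v) = a ^+ 2 * qf Om v.
Proof. by rewrite /qf linearZ /= -!scalemxAl -scalemxAr !mxE expr2 mulrA. Qed.

Lemma qf_scale n (Om : 'M[F]_n) a v : qf (a *: Om) v = a * qf Om v.
Proof. by rewrite /qf -scalemxAr -scalemxAl mxE. Qed.

Lemma qfN n (Om : 'M[F]_n) v : qf (- Om) v = - qf Om v.
Proof. by rewrite /qf mulmxN mulNmx mxE. Qed.

Lemma qfDm n (Om Om' : 'M[F]_n) v : qf (Om + Om') v = qf Om v + qf Om' v.
Proof. by rewrite /qf mulmxDr mulmxDl mxE. Qed.

Lemma qf_rank1 n (u v : 'rV[F]_n) : qf (u^T *m u) v = dotp v u ^+ 2.
Proof.
rewrite /qf !mulmxA -mulmxA -[u *m v^T]trmxK trmx_mul trmxK.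
rewrite [v *m u^T]mx11_scalar tr_scalar_mx -scalar_mxM mxE eqxx mulr1n.
by rewrite expr2 /dotp.
Qed.

Lemma qf_block n (a : F) (u : 'rV[F]_n) (D : 'M[F]_n) (m : F) (v : 'rV[F]_n) :
  qf (block_mx a%:M u (u^T) D : 'M[F]_(1 + n)) (row_mx m%:M v) = a * m ^+ 2 + 2 * (m * dotp v u) + qf D v.
Proof.
rewrite /qf mul_row_block tr_row_mx mul_row_col tr_scalar_mx !mulmxDl !addmxE.
rewrite -!scalar_mxM mul_mx_scalar mul_scalar_mx -scalemxAl !mxE eqxx mulr1n.
rewrite -[\sum_j v 0 j * _](_ : dotp v u = _); last by rewrite /dotp mxE.
rewrite -[\sum_j u 0 j * _](_ : dotp u v = _); last by rewrite /dotp mxE.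
rewrite (dotpC u v) -[\sum_j _]/(\sum_j (v *m D) 0 j * v^T j 0); ring.
Qed.

End QuadraticForms.

(** The Schur complement of the top left entry: the form in the remaining variables after completing
    the square in the first one. *)
Definition schur (K : fieldType) n (Om : 'M[K]_(1 + n)) : 'M[K]_n :=
  drsubmx Om - (Om 0 0)^-1 *: ((ursubmx Om)^T *m ursubmx Om).

Section Schur.
Variables (K : fieldType) (n : nat) (Om : 'M[K]_(1 + n)).
Hypothesis Os : Om^T = Om.
Let om := Om 0 0.
Let u := ursubmx Om.

Lemma pivot_block : Om = block_mx om%:M u (u^T) (drsubmx Om).
Proof.
rewrite -[LHS]submxK; congr block_mx; last by rewrite /u trmx_ursub Os.
rewrite [LHS]mx11_scalar; congr (_%:M); rewrite !mxE /om; congr (Om _ _); exact: val_inj.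
Qed.

Lemma pivot_dr_sym : (drsubmx Om)^T = drsubmx Om.
Proof. by rewrite trmx_drsub Os. Qed.

Lemma schur_sym : (schur Om)^T = schur Om.
Proof.
by rewrite /schur linearB linearZ /= pivot_dr_sym trmx_mul trmxK.
Qed.

Lemma qf_pivot m v : qf Om (row_mx m%:M v) = om * m ^+ 2 + 2 * (m * dotp v u) + qf (drsubmx Om) v.
Proof. by rewrite {1}pivot_block qf_block. Qed.

Lemma qf_schur v : qf (schur Om) v = qf (drsubmx Om) v - om^-1 * dotp v u ^+ 2.
Proof. by rewrite /schur qfDm -scaleNr qf_scale qf_rank1 mulNr. Qed.

(** The form reached when only the first variable has been inverted, see [qf_dual_pivot]. The double
    sum halfway through [gauss_inversion] is a theta series for this matrix. *)
Definition dual_pivot : 'M[K]_(1 + n) :=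
  block_mx (- om^-1)%:M (- om^-1 *: u) (- om^-1 *: u)^T (schur Om).

Lemma dual_pivot_sym : dual_pivot^T = dual_pivot.
Proof. by rewrite /dual_pivot tr_block_mx tr_scalar_mx trmxK schur_sym. Qed.

Lemma qf_dual_pivot m v : qf dual_pivot (row_mx m%:M v) = - ((m + dotp v u) ^+ 2 / om) + qf (drsubmx Om) v.
Proof. by rewrite qf_block qf_schur dotpZr; ring. Qed.

Hypothesis om0 : om != 0.

Lemma det_schur : \det Om = om * \det (schur Om).
Proof.
have e : Om = block_mx 1%:M 0 (om^-1 *: u^T) 1%:M *m block_mx om%:M u 0 (schur Om).
  rewrite mulmx_block !mul1mx !mul0mx !addr0 -!scalemxAl mul_mx_scalar scalerA mulVf // scale1r.
  by rewrite addrC subrK -pivot_block.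
by rewrite {1}e det_mulmx det_lblock det_ublock !det1 !mul1r det_scalar1.
Qed.

Hypothesis S_unit : schur Om \in unitmx.

Lemma pivot_unit : Om \in unitmx.
Proof. by rewrite unitmxE det_schur unitfE mulf_neq0 // -unitfE -unitmxE. Qed.

End Schur.

Lemma qf_inv (K : fieldType) n (M : 'M[K]_n) v : M^T = M -> M \in unitmx -> qf (invmx M) (v *m M) = qf M v.
Proof. by move=> Ms Mu; rewrite /qf trmx_mul Ms !mulmxA mulmxK. Qed.

(** Writing the argument as [z *m Om] replaces the inverse form by [Om] itself, where [qf_pivot] and
    [qf_schur] complete the square. *)
Lemma qf_inv_pivot (K : fieldType) n (Om : 'M[K]_(1 + n)) (m : K) (v : 'rV[K]_n) :
  Om^T = Om -> Om 0 0 != 0 -> schur Om \in unitmx ->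
  qf (invmx Om) (row_mx m%:M v) =
  m ^+ 2 / Om 0 0 + qf (invmx (schur Om)) (v - (m / Om 0 0) *: ursubmx Om).
Proof.
move=> Os om0 Su; have Ou := pivot_unit Os om0 Su.
set w := row_mx _ _; set om := Om 0 0 in om0 *; set u := ursubmx Om.
pose z := w *m invmx Om; have wz : w = z *m Om by rewrite /z mulmxKV.
rewrite wz qf_inv //.
have [z0 [z' ez]] : exists z0 z', z = row_mx z0%:M z'.
  by exists (lsubmx z 0 0), (rsubmx z); rewrite -mx11_scalar hsubmxK.
have : w = row_mx (z0 * om + dotp z' u)%:M (z0 *: u + z' *m drsubmx Om).
  rewrite wz ez {1}(pivot_block Os) mul_row_block -scalar_mxM mul_scalar_mx -/om -/u; congr row_mx.
  by rewrite [z' *m u^T]mx11_scalar -[_ 0 0]/(dotp z' u) -raddfD.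
rewrite /w => /eq_row_mx [/(congr1 (fun M : 'M[K]_1 => M 0 0))]; rewrite !mxE eqxx !mulr1n => -> ->.
have -> : z0 *: u + z' *m drsubmx Om - ((z0 * om + dotp z' u) / om) *: u = z' *m schur Om.
  rewrite /schur -/om -/u mulmxBr -scalemxAr mulmxA [z' *m u^T]mx11_scalar mul_scalar_mx -[_ 0 0]/(dotp z' u).
  by rewrite scalerA mulrDl mulfK // scalerDl opprD addrA [z0 *: u + _]addrC addrK (mulrC om^-1).
rewrite qf_inv //; last exact: schur_sym.
by rewrite ez (qf_pivot Os) qf_schur -/om -/u; field.
Qed.

(** * The Siegel upper half-space *)

Section PositiveImaginaryPart.
Variable R : realType.
Local Notation C := R[i].
Local Notation rC := (map_mx (real_complex R)).

(** The Siegel upper half-space of degree [n]. *)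
Definition posIm n (Om : 'M[C]_n) : Prop :=
  Om^T = Om /\ forall x : 'rV[R]_n, x != 0 -> 0 < Im (qf Om (rC x)).

Lemma Im_sum (I : Type) (r : seq I) (f : I -> C) : Im (\sum_(i <- r) f i) = \sum_(i <- r) Im (f i).
Proof. by rewrite raddf_sum. Qed.

Lemma Im_qf n (Om : 'M[C]_n) x : Im (qf Om (rC x)) = qf (map_mx (@complex.Im R) Om) x.
Proof.
rewrite !qfE Im_sum; apply: eq_bigr => i _; rewrite Im_sum; apply: eq_bigr => j _.
by rewrite !mxE !(cImM, cReM) /=; ring.
Qed.

Lemma qf_continuous n (M : 'M[R]_n) : continuous (qf M).
Proof.
have cz (f g : 'rV[R]_n -> R) : continuous f -> continuous g -> continuous (fun x => f x + g x).
  by move=> cf cg x; exact: (@continuousD _ _ _ f g x (cf x) (cg x)).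
have cs (F : 'I_n -> 'rV[R]_n -> R) : (forall i, continuous (F i)) -> continuous (fun x => \sum_i F i x).
  move=> cF; elim: (index_enum 'I_n) => [|i r IH].
    by under eq_fun do rewrite big_nil; exact: cst_continuous.
  by under eq_fun do rewrite big_cons; exact: cz.
rewrite (_ : qf M = fun x => \sum_i \sum_j x 0 i * M i j * x 0 j); last by apply/funext => x; rewrite qfE.
apply: (cs (fun i x => \sum_j x 0 i * M i j * x 0 j)) => i.
apply: (cs (fun j x => x 0 i * M i j * x 0 j)) => j x.
apply: (@continuousM _ _ (fun x : 'rV[R]_n => x 0 i * M i j) (fun x : 'rV[R]_n => x 0 j)).
  apply: (@continuousM _ _ (fun x : 'rV[R]_n => x 0 i) (fun=> M i j)); last exact: cst_continuous.
  exact: coord_continuous.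
exact: coord_continuous.
Qed.

Lemma posdef_coercive n (M : 'M[R]_n) : (forall x, x != 0 -> 0 < qf M x) ->
  exists2 e, 0 < e & forall x, e * nsq x <= qf M x.
Proof.
move=> h; have [|s u a x|s u x _ _|e e0 he] := @uniform_posdef R n (fun t => qf M t.2).
- by move=> x; apply: (@continuous_comp _ _ _ snd (qf M)); [exact: cvg_snd|exact: qf_continuous].
- by rewrite /= qfZ.
- exact: h.
by exists e => // x; apply: (he 0 0); rewrite lexx ler01.
Qed.

Lemma posIm_coercive n (Om : 'M[C]_n) : posIm Om ->
  exists2 e, 0 < e & forall x, e * nsq x <= Im (qf Om (rC x)).
Proof.
move=> [_ h]; have [x x0|e e0 he] := @posdef_coercive n (map_mx (@complex.Im R) Om); first by rewrite -Im_qf h.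
by exists e => // x; rewrite Im_qf.
Qed.

Definition latC n (k : 'rV[int]_n) : 'rV[C]_n := map_mx intr k.

Lemma latC_real n (k : 'rV[int]_n) : latC k = rC (map_mx intr k).
Proof. by apply/rowP => i; rewrite !mxE rmorph_int. Qed.

Lemma latC_cons n (t : int * 'rV[int]_n) : latC (zcons t) = row_mx (t.1%:~R)%:M (latC t.2).
Proof.
rewrite /latC /zcons map_row_mx; congr row_mx.
by apply/matrixP => i j; rewrite !mxE !ord1 eqxx.
Qed.

Definition theta_summand n (Om : 'M[C]_n) z (k : 'rV[int]_n) : C :=
  ee (qf Om (latC k) / 2 + dotp (latC k) z).

Lemma Im_div2 (w : C) : Im (w / 2) = Im w / 2.
Proof.
have -> : 2^-1 = (2^-1 : R)%:C :> C by rewrite fmorphV rmorph_nat.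
by rewrite cImM /= mulr0 add0r.
Qed.

Lemma theta_summable_posIm n (Om : 'M[C]_n) z : posIm Om -> abs_summable (theta_summand Om z).
Proof.
move=> /posIm_coercive [e e0 he].
pose L : R := \sum_i `|Im (z 0 i)|.
have L0 : 0 <= L by apply: sumr_ge0.
(* Completing the square gives [(2 pi L + 1) t <= pi e t^2 + D] in each coordinate, so the quadratic
   decay pays for the linear term in [z] and leaves a spare [exp (- zwt k)]. *)
pose D : R := (2 * pi * L + 1) ^+ 2 / (4 * pi * e).
have pi0 := pi_gt0 R.
apply: (@abs_summable_le _ _ _ (fun k => expR (n%:R * D) * expR (- zwt R k))).
  exact: summableZ (summable_lattice_exp R n).
move=> k; rewrite cabs_ee -expRD ler_expR cImD Im_div2.
have h1 : - (L * zwt R k) <= Im (dotp (latC k) z).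
  rewrite dotpE Im_sum /zwt mulr_sumr -sumrN; apply: ler_sum => i _.
  have -> : Im (latC k 0 i * z 0 i) = (k 0 i)%:~R * Im (z 0 i).
    have -> : latC k 0 i = ((k 0 i)%:~R : R)%:C by rewrite mxE rmorph_int.
    by rewrite cImM /= mul0r addr0.
  have : `|(k 0 i)%:~R * Im (z 0 i)| <= L * `|k 0 i|%:R.
    rewrite normrM mulrC -intr_norm natr_absz; apply: ler_wpM2r; first by rewrite ler0z.
    by rewrite /L (bigD1 i) //= lerDl sumr_ge0.
  by rewrite ler_norml => /andP[].
have h2 : e * nsq (map_mx intr k : 'rV[R]_n) <= Im (qf Om (latC k)) by rewrite latC_real.
have h3 : (2 * pi * L + 1) * zwt R k <= pi * e * nsq (map_mx intr k : 'rV[R]_n) + n%:R * D.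
  have -> : n%:R * D = \sum_(i < n) D by rewrite sumr_const card_ord mulr_natl.
  rewrite /zwt /nsq [_ * \sum_i _%:R]mulr_sumr [pi * e * _]mulr_sumr -big_split /=.
  apply: ler_sum => i _; rewrite !mxE natr_absz intr_norm.
  set x := `|_|; have -> : (k 0 i)%:~R ^+ 2 = x ^+ 2 :> R by rewrite real_normK ?num_real.
  have pe : 0 < pi * e by rewrite mulr_gt0.
  rewrite -subr_ge0 (_ : _ - _ = (pi * e * x - (2 * pi * L + 1) / 2) ^+ 2 / (pi * e)); last first.
    rewrite /D; move: (pi : R) pi0 pe => P P0 pe; field.
    by rewrite (lt0r_neq0 e0) (lt0r_neq0 P0).
  by rewrite divr_ge0 ?sqr_ge0 // ltW.
have : 2 * pi * (- (L * zwt R k)) <= 2 * pi * Im (dotp (latC k) z).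
  by rewrite ler_wpM2l ?mulr_ge0 // ltW.
have : pi * (e * nsq (map_mx intr k : 'rV[R]_n)) <= pi * Im (qf Om (latC k)).
  by rewrite ler_wpM2l // ltW.
move: h3; set zw := zwt R k; set q := nsq _; set i1 := Im _; set i2 := Im _ => h3.
rewrite mulrA => h4; rewrite mulrN mulrA => h5.
have -> : 2 * pi * (i1 / 2 + i2) = pi * i1 + 2 * pi * i2 by field.
move: h3; rewrite mulrDl mul1r => h3; lra.
Qed.

Section PosPivot.
Variables (n : nat) (Om : 'M[C]_(1 + n)).
Hypothesis hOm : posIm Om.
Let om := Om 0 0.

Lemma row_mx_neq0 (m : R) (v : 'rV[R]_n) : (m != 0) || (v != 0) -> (row_mx m%:M v : 'rV[R]_(1 + n)) != 0.
Proof.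
apply: contraL => /eqP h; rewrite negb_or !negbK.
have := h; rewrite -[0 in RHS]row_mx0 => /eq_row_mx [/(congr1 (fun M : 'M[R]_1 => M 0 0)) + ->].
by rewrite !mxE eqxx mulr1n => ->; rewrite !eqxx.
Qed.

Lemma Im_pivot (m : R) (v : 'rV[R]_n) : Im (qf Om (rC (row_mx m%:M v))) =
  Im om * m ^+ 2 + 2 * (m * Im (dotp (rC v) (ursubmx Om))) + Im (qf (drsubmx Om) (rC v)).
Proof.
rewrite map_row_mx map_scalar_mx (qf_pivot (proj1 hOm)) -/om.
have -> : 2 = (2 : R)%:C :> C by rewrite rmorph_nat.
move: om (dotp _ _) (qf _ _) => o d W.
rewrite !expr2 !(cImD, cImM, cReM) /=; ring.
Qed.

Lemma pivot_pos : 0 < Im om.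
Proof.
have := (proj2 hOm) (row_mx 1%:M 0) (row_mx_neq0 _); rewrite oner_eq0 => /(_ isT).
rewrite Im_pivot expr1n mulr1 map_mx0 /dotp /qf !mul0mx !mxE /= mulr0 mulr0 !addr0; exact.
Qed.

Lemma Im_pivot_complement (v : 'rV[R]_n) : v != 0 ->
  Im (dotp (rC v) (ursubmx Om)) ^+ 2 / Im om < Im (qf (drsubmx Om) (rC v)).
Proof.
move=> v0; have o0 := pivot_pos; set b := Im (dotp _ _); set W := Im (qf _ _).
have := (proj2 hOm) (row_mx (- (b / Im om))%:M v) (row_mx_neq0 _); rewrite v0 orbT => /(_ isT).
rewrite Im_pivot -/b -/W => h; rewrite -subr_gt0; apply: (lt_le_trans h).
by rewrite le_eqVlt; apply/orP; left; apply/eqP; field; rewrite gt_eqF.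
Qed.

(** Inverting one variable preserves the upper half-space. The imaginary part splits into a positive
    multiple of a square and the quantity that [Im_pivot_complement] makes positive; the case
    [v = 0] is left to the square. *)
Lemma dual_pivot_posIm : posIm (dual_pivot Om).
Proof.
have o0 := pivot_pos.
split; first exact: dual_pivot_sym (proj1 hOm).
move=> x x0; have ex : x = row_mx (lsubmx x 0 0)%:M (rsubmx x) by rewrite -mx11_scalar hsubmxK.
set m := lsubmx x 0 0 in ex; set v := rsubmx x in ex.
rewrite ex map_row_mx map_scalar_mx qf_dual_pivot.
have cv := @Im_pivot_complement v.
have v00 : v = 0 -> dotp (rC v) (ursubmx Om) = 0 by move=> ->; rewrite map_mx0 /dotp mul0mx mxE.
have q00 : v = 0 -> qf (drsubmx Om) (rC v) = 0 by move=> ->; rewrite map_mx0 /qf mul0mx mul0mx mxE.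
move: cv v00 q00; rewrite -/om; set d := dotp _ _; set W := qf _ _ => cv v00 q00.
have nom : 0 < Re om ^+ 2 + Im om ^+ 2 by rewrite ltr_wpDl ?sqr_ge0 ?exprn_gt0.
have -> : Im (- ((m%:C + d) ^+ 2 / om) + W) =
  Im om / (Re om ^+ 2 + Im om ^+ 2) * (m + Re d - Im d * Re om / Im om) ^+ 2 + (Im W - Im d ^+ 2 / Im om).
  have -> : om^-1 = (Re om / (Re om ^+ 2 + Im om ^+ 2)) +i* (- (Im om / (Re om ^+ 2 + Im om ^+ 2))).
    by case: (om).
  rewrite expr2 !(cImD, cImN, cImM, cReM, cReD) /=; field.
  by rewrite !gt_eqF.
have [v0|v0] := eqVneq v 0.
  rewrite v00 // q00 //= mul0r expr0n mul0r !subr0 !addr0 mulr_gt0 ?divr_gt0 // exprn_even_gt0 //=.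
  by move: x0; rewrite ex v0; apply: contra => /eqP ->; rewrite raddf0 row_mx0.
rewrite ltr_wpDl ?subr_gt0 ?cv // mulr_ge0 ?sqr_ge0 // divr_ge0 // ltW //.
Qed.

(** The Schur complement is the restriction of [dual_pivot] to [m = 0]. *)
Lemma schur_posIm : posIm (schur Om).
Proof.
split=> [|v v0]; first exact: schur_sym (proj1 hOm).
have := (proj2 dual_pivot_posIm) (row_mx 0%:M v) (row_mx_neq0 _); rewrite v0 orbT => /(_ isT).
rewrite map_row_mx map_scalar_mx qf_dual_pivot qf_schur rmorph0 add0r.
by rewrite addrC [X in _ - X]mulrC; congr (0 < Im _).
Qed.

Lemma pivot_neq0 : om != 0.
Proof. by apply/eqP => e; have := pivot_pos; rewrite e ltxx. Qed.

End PosPivot.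

Lemma posIm_unit n (Om : 'M[C]_n) : posIm Om -> Om \in unitmx.
Proof.
elim: n Om => [|n IH] Om hOm; first by rewrite unitmxE det_mx00 unitr1.
by apply: (@pivot_unit _ n Om (proj1 hOm) (pivot_neq0 hOm)); apply: IH; exact: schur_posIm.
Qed.

(** Write [v Om^-1 = a + i b]. As [v] is real it also equals the conjugate of [a + i b] times the
    conjugate of [Om], which gives [Im (- Om^-1 [v]) = Im Om[a] + Im Om[b]]; and [a], [b] cannot
    both vanish unless [v] does. *)
Lemma posIm_neg_inv n (Om : 'M[C]_n) : posIm Om -> posIm (- invmx Om).
Proof.
move=> hOm; have Ou := posIm_unit hOm; have Os := proj1 hOm.
split=> [|v v0]; first by rewrite linearN /= trmx_inv Os.
pose z := rC v *m invmx Om; pose a := map_mx (@complex.Re R) z; pose b := map_mx (@complex.Im R) z.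
have vz : rC v = z *m Om by rewrite /z mulmxKV.
have za : z = rC a + 'i%C *: rC b.
  by apply/rowP => i; rewrite !mxE; apply: complexRI; rewrite !(cReD, cImD, cReM, cImM) /=; ring.
have zv : qf (- invmx Om) (rC v) = - dotp z (rC v) by rewrite /qf mulmxN mulNmx mxE.
pose zc := rC a - 'i%C *: rC b.
have conj : rC v = zc *m map_mx (@conjc R) Om.
  have e : zc = map_mx (@conjc R) z.
    have ge (w : 'rV[C]_n) : rC (map_mx (@complex.Re R) w) - 'i%C *: rC (map_mx (@complex.Im R) w) = map_mx (@conjc R) w.
      apply/rowP => i; rewrite !mxE; case: (w 0 i) => x y; apply: complexRI.
        by rewrite cReD cReN cReM /=; ring.
      by rewrite cImD cImN cImM /=; ring.
    exact: ge.
  by rewrite e -map_mxM -vz -map_mx_comp; apply/rowP => i; rewrite !mxE; apply: complexRI; rewrite /= ?oppr0.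
have key : dotp z (rC v) = conjc (qf Om (rC a) + qf Om (rC b)).
  rewrite dotpC {1}conj /dotp za linearD linearZ /= mulmxDr -scalemxAr.
  have ec (x : 'rV[R]_n) : map_mx (@conjc R) (rC x) = rC x.
    by apply/rowP => i; rewrite !mxE; apply: complexRI; rewrite /= ?oppr0.
  have eq2 (x y : 'rV[R]_n) : (rC x *m map_mx (@conjc R) Om *m (rC y)^T) 0 0 = conjc ((rC x *m Om *m (rC y)^T) 0 0).
    by rewrite -{1}(ec x) -{1}(ec y) matrix.map_trmx -!map_mxM mxE.
  have sE (c : C) (M : 'M[C]_1) : (c *: M) 0 0 = c * M 0 0 by rewrite mxE.
  have NE (M : 'M[C]_1) : (- M) 0 0 = - M 0 0 by rewrite mxE.
  have bl (w : 'rV[R]_n) : (zc *m map_mx (@conjc R) Om *m (rC w)^T) 0 0 =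
      (rC a *m map_mx (@conjc R) Om *m (rC w)^T) 0 0 - 'i%C * (rC b *m map_mx (@conjc R) Om *m (rC w)^T) 0 0.
    rewrite /zc [(rC a - _) *m _]mulmxBl [(_ - _) *m (rC w)^T]mulmxBl addmxE NE.
    by rewrite -!scalemxAl sE.
  rewrite addmxE sE !bl !eq2.
  have cross : (rC b *m Om *m (rC a)^T) 0 0 = (rC a *m Om *m (rC b)^T) 0 0.
    rewrite -[LHS]/(dotp (rC b *m Om) (rC a)) dotpC /dotp trmx_mul Os mulmxA //.
  rewrite -[qf Om (rC a)]/((rC a *m Om *m (rC a)^T) 0 0) -[qf Om (rC b)]/((rC b *m Om *m (rC b)^T) 0 0) cross.
  rewrite rmorphD /=; move: (conjc _) (conjc _) (conjc _) => x y t.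
  have i2 : 'i%C * 'i%C = -1 :> C by rewrite -expr2 sqr_i.
  move: 'i%C i2 => i i2; rewrite (_ : _ + _ = t - i * i * x); [|ring]; rewrite i2; ring.
have nab : (a != 0) || (b != 0).
  rewrite -negb_and; apply: contra v0 => /andP[/eqP a0 /eqP b0].
  have : rC v = 0 by rewrite vz za a0 b0 !map_mx0 scaler0 addr0 mul0mx.
  by move=> /(congr1 (map_mx (@complex.Re R))) h; apply/eqP/rowP => i; move/rowP/(_ i): h; rewrite !mxE.
have ge x : 0 <= Im (qf Om (rC x)).
  by have [->|/(proj2 hOm)/ltW//] := eqVneq x 0; rewrite map_mx0 /qf !mul0mx mxE.
have -> : Im (qf (- invmx Om) (rC v)) = Im (qf Om (rC a)) + Im (qf Om (rC b)).
  by rewrite zv cImN key -cImD; case: (_ + _) => ? ? /=; rewrite opprK.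
by case/orP: nab => /(proj2 hOm) h; [apply: ltr_pwDl|apply: ltr_wpDl].
Qed.

End PositiveImaginaryPart.

Lemma ccontV (R : realType) (W : normedModType R) (f : W -> R[i]) t :
  f t != 0 -> ccont f t -> ccont (fun t => (f t)^-1) t.
Proof.
move=> f0 [c1 c2].
have n0 : Re (f t) ^+ 2 + Im (f t) ^+ 2 != 0.
  apply: contra f0; rewrite paddr_eq0 ?sqr_ge0 // !sqrf_eq0 => /andP[/eqP a /eqP b].
  by apply/eqP; apply: complexRI.
have cn : {for t, continuous (fun t => (Re (f t) ^+ 2 + Im (f t) ^+ 2)^-1)}.
  apply: (@cvgV _ _ _ _ (fun t => Re (f t) ^+ 2 + Im (f t) ^+ 2)) => //.
  by apply: cvgD; apply: cvgM.
have -> : (fun t => (f t)^-1) = fun t =>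
    (Re (f t) * (Re (f t) ^+ 2 + Im (f t) ^+ 2)^-1) +i* (- (Im (f t) * (Re (f t) ^+ 2 + Im (f t) ^+ 2)^-1)).
  by apply/funext => s; case: (f s).
split => /=; first exact: cvgM.
by apply: cvgN; exact: cvgM.
Qed.

(** * Inversion of theta series in several variables *)

Section GaussInversion.
Variable R : realType.
Local Notation C := R[i].
Variable c : C -> C.
Hypothesis c_sqr : forall ps, 0 < Im ps -> c ps != 0 /\ c ps ^+ 2 * ps = 'i%C.
Hypothesis c_cont : forall (f : R -> C) (s : R), 0 < Im (f s) -> ccont f s -> ccont (fun s => c (f s)) s.
Hypothesis c_pos : forall t : R, 0 < t -> Im (c (0 +i* t)) = 0 /\ 0 < Re (c (0 +i* t)).
Hypothesis c_inv : forall om ze, 0 < Im om ->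
  [/\ abs_summable (fun k : int => ee (om * k%:~R ^+ 2 / 2 + k%:~R * ze)),
      abs_summable (fun m : int => ee (- ((m%:~R + ze) ^+ 2 / (2 * om)))) &
      csum (fun m : int => ee (- ((m%:~R + ze) ^+ 2 / (2 * om)))) =
      c (- om^-1) * csum (fun k : int => ee (om * k%:~R ^+ 2 / 2 + k%:~R * ze))].

(** A branch of [det (Om / i)^(-1/2)], assembled pivot by pivot from the one-variable constants, so
    that its branch is tied to that of [c]. *)
Fixpoint kappa n : 'M[C]_n -> C :=
  match n with
  | 0 => fun=> 1
  | n'.+1 => fun Om : 'M[C]_(1 + n') => (c (- (Om 0 0)^-1))^-1 * kappa (schur Om)
  end.

Lemma Im_negV (om : C) : 0 < Im om -> 0 < Im (- om^-1).
Proof.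
case: om => a b /= b0; rewrite opprK.
by rewrite divr_gt0 // ltr_wpDl ?sqr_ge0 ?exprn_gt0.
Qed.

Lemma csum_unit_like (T : choiceType) (t0 : T) (f : T -> C) : (forall t, t = t0) -> csum f = f t0.
Proof.
move=> ht; rewrite -[RHS](csum_single t0); congr csum; apply/funext => t.
by rewrite (ht t) eqxx.
Qed.

(** Expanding the square shows a constant times a theta summand for [- Om^-1], which lies in the
    upper half-space. *)
Lemma dual_summable n (Om : 'M[C]_n) z : posIm Om ->
  abs_summable (fun m : 'rV[int]_n => ee (- (qf (invmx Om) (latC R m + z) / 2))).
Proof.
move=> hOm; have hN := posIm_neg_inv hOm; have Os := proj1 hOm.
have := abs_summableZ (ee (qf (- invmx Om) z / 2)) (theta_summable_posIm (z *m (- invmx Om)) hN).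
congr abs_summable; apply/funext => m; rewrite /theta_summand -ee_D; congr ee.
have -> : - (qf (invmx Om) (latC R m + z) / 2) = qf (- invmx Om) (latC R m + z) / 2.
  by rewrite qfN mulNr.
rewrite (qfD _ _ (proj1 hN)) (_ : dotp (latC R m *m - invmx Om) z = dotp (latC R m) (z *m - invmx Om)); first by field.
by rewrite /dotp trmx_mul (proj1 hN) mulmxA.
Qed.

(** Induction on the dimension. For fixed remaining variables Jacobi's formula replaces the first
    summation variable by its dual; after exchanging the sums, the inner sum is a theta series for
    the Schur complement, and [qf_inv_pivot] reassembles the inverse form. *)
Theorem gauss_inversion n (Om : 'M[C]_n) z : posIm Om ->
  csum (theta_summand Om z) =
  kappa Om * csum (fun m : 'rV[int]_n => ee (- (qf (invmx Om) (latC R m + z) / 2))).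
Proof.
elim: n Om z => [|n IH] Om z hOm.
  rewrite mul1r !(@csum_unit_like _ 0) => [|t|t]; rewrite ?[t]flatmx0 ?[t]thinmx0 //.
  rewrite /theta_summand; congr ee; rewrite /qf /dotp !(@thinmx0 _ 1) !mul0mx !mxE.
  by rewrite mul0r oppr0 add0r.
move: Om z hOm; rewrite -[n.+1]/(1 + n)%N => Om z hOm; set om := Om 0 0; set u := ursubmx Om; set Om' := drsubmx Om.
have Os := proj1 hOm; have o0 := pivot_pos hOm; have on0 := pivot_neq0 hOm.
have hS := schur_posIm hOm; have Su := posIm_unit hS.
have [z0 [z' ez]] : exists z0 z', z = row_mx z0%:M z'.
  by exists (lsubmx z 0 0), (rsubmx z); rewrite -mx11_scalar hsubmxK.
have zi : injective (@zcons n) by exact: bij_inj (@zcons_bij n).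
pose f2 (m : int) (k : 'rV[int]_n) : C :=
  ee (- ((m%:~R + (dotp (latC R k) u + z0)) ^+ 2 / (2 * om))) * ee (qf Om' (latC R k) / 2 + dotp (latC R k) z').
have cn0 : c (- om^-1) != 0 by exact: (proj1 (c_sqr (Im_negV o0))).
pose f3 m k := (c (- om^-1))^-1 * f2 m k.
pose zt : 'rV[C]_(1 + n) := row_mx (- (z0 / om))%:M (z' + (- (z0 / om)) *: u).
have ef2 m k : f2 m k = ee (- (z0 ^+ 2 / (2 * om))) * theta_summand (dual_pivot Om) zt (zcons (m, k)).
  rewrite /f2 /theta_summand -!ee_D latC_cons qf_dual_pivot dotp_row dotpDr dotpZr -/om -/u -/Om' /=; congr ee.
  move: (dotp _ u) (dotp _ z') (qf _ _) => d d' q; field; exact: on0.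
(* The exchange of sums is licit because the half-inverted double series is itself a theta series,
   for [dual_pivot Om]. *)
have s3 : abs_summable (fun t : int * 'rV[int]_n => f3 t.1 t.2).
  rewrite /f3; apply: abs_summableZ; rewrite (_ : (fun t => _) = fun t =>
    ee (- (z0 ^+ 2 / (2 * om))) * theta_summand (dual_pivot Om) zt (zcons t)); last first.
    by apply/funext => -[m k]; rewrite ef2.
  by apply: abs_summableZ; exact: (abs_summable_inj zi (theta_summable_posIm zt (dual_pivot_posIm hOm))).
have step1 : csum (theta_summand Om z) = csum (fun k => csum (fun m => f3 m k)).
  rewrite (csum_bij (theta_summand Om z) (@zcons_bij n)).
  have s1 := abs_summable_inj zi (theta_summable_posIm z hOm).
  have s1' : abs_summable (fun t : 'rV[int]_n * int => theta_summand Om z (zcons (t.2, t.1))).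
    by apply: (abs_summable_inj _ s1 (e := fun t : 'rV[int]_n * int => (t.2, t.1))) => -[a b] [a' b'] [-> ->].
  rewrite (csum_bij (T := ('rV[int]_n * int)%type) (e := fun t => (t.2, t.1))); last first.
    by exists (fun t => (t.2, t.1)) => -[].
  have [_ ->] := csum_pair s1'; congr csum; apply/funext => k.
  have e1 (k0 : int) : theta_summand Om z (zcons (k0, k)) =
      ee (qf Om' (latC R k) / 2 + dotp (latC R k) z') *
      ee (om * k0%:~R ^+ 2 / 2 + k0%:~R * (dotp (latC R k) u + z0)).
    rewrite /theta_summand -ee_D latC_cons ez dotp_row (qf_pivot Os) -/om -/u -/Om' /=; congr ee.
    by move: (dotp _ u) (dotp _ z') (qf _ _) => d d' q; field.
  have [s2 s4 h] := c_inv (dotp (latC R k) u + z0) o0.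
  rewrite (funext e1) csumZ // /f3 /f2.
  pose g0 m := ((c (- om^-1))^-1 * ee (qf Om' (latC R k) / 2 + dotp (latC R k) z')) *
    ee (- ((m%:~R + (dotp (latC R k) u + z0)) ^+ 2 / (2 * om))).
  rewrite (_ : (fun m => _ * (_ * _)) = g0); last first.
    by apply/funext => m; rewrite /g0 -mulrA; congr (_ * _); rewrite mulrC.
  rewrite /g0 csumZ // h -/om; move: (csum _) (ee _) cn0; move: (c (- om^-1)) => cv S E cn0.
  by field.
have [kO ekO] : {k | k = kappa (n := n.+1) Om} by exists (kappa (n := n.+1) Om).
rewrite step1 -(csum_swap s3) -ekO.
pose G (t : 'rV[int]_(1 + n)) : C := ee (- (qf (invmx Om) (latC R t + z) / 2)).
have sG : abs_summable G by exact: dual_summable.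
rewrite -/G -(csumZ (kO) sG).
rewrite (csum_bij (fun t => kO * G t) (@zcons_bij n)).
have sG1 : abs_summable (fun t : int * 'rV[int]_n => kO * G (zcons t)).
  by apply: abs_summableZ; exact: (abs_summable_inj zi sG).
have [_ ->] := csum_pair sG1; congr csum; apply/funext => m.
(* For fixed [m], the cross term of the square in the first variable is linear in [k] and shifts the
   elliptic variable of the Schur complement to [w]; the rest is the constant [D]. *)
pose w := z' + (- ((m%:~R + z0) / om)) *: u.
pose D := ee (- ((m%:~R + z0) ^+ 2 / (2 * om))).
have e4 k : f3 m k = ((c (- om^-1))^-1 * D) * theta_summand (schur Om) w k.
  rewrite /f3 /f2 /D -mulrA /theta_summand -!ee_D; congr (_ * ee _).
  rewrite qf_schur -/om -/u -/Om' dotpDr dotpZr.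
  by move: (dotp _ u) (dotp _ z') (qf _ _) => d d' q; field; exact: on0.
transitivity (csum (fun k => ((c (- om^-1))^-1 * D) * theta_summand (schur Om) w k)).
  by congr csum; apply/funext => k; exact: e4.
rewrite (csumZ ((c (- om^-1))^-1 * D) (theta_summable_posIm w hS)).
rewrite (IH _ w hS).
have e5 m' : kO * G (zcons (m, m')) =
    (kO * D) * ee (- (qf (invmx (schur Om)) (latC R m' + w) / 2)).
  rewrite -mulrA /G /D -ee_D latC_cons ez add_row_mx -raddfD /=.
  congr (_ * ee _); rewrite (qf_inv_pivot _ _ Os on0 Su) -/om -/u.
  rewrite /w addrA scaleNr; move: (qf _ _) => q; field; exact: on0.
transitivity (csum (fun m' => (kO * D) * ee (- (qf (invmx (schur Om)) (latC R m' + w) / 2)))); last first.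
  by congr csum; apply/funext => m'; exact: (esym (e5 m')).
rewrite (csumZ (kO * D) (dual_summable w hS)).
by rewrite ekO [kappa (n := n.+1) Om]/= -/om; move: (c _)^-1 => ci; ring.
Qed.

(** Each factor satisfies [c (- 1 / om)^2 = - i om], and the pivots multiply to the determinant by
    [det_schur]. *)
Lemma kappa_sqr n (Om : 'M[C]_n) : posIm Om -> kappa Om ^+ 2 * ((- 'i%C) ^+ n * \det Om) = 1.
Proof.
elim: n Om => [|n IH] Om hOm; first by rewrite det_mx00 !expr1n expr0 !mulr1.
move: Om hOm; rewrite -[n.+1]/(1 + n)%N => Om hOm.
have on0 := pivot_neq0 hOm; have o0 := pivot_pos hOm.
rewrite [kappa (n := 1 + n) Om]/= (det_schur (proj1 hOm) on0).
have hS := IH _ (schur_posIm hOm).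
have [cn cs] := c_sqr (Im_negV o0).
rewrite exprMn exprVn (exprD _ 1 n) expr1.
have -> : c (- (Om 0 0)^-1) ^+ 2 = - 'i%C * Om 0 0.
  have p0 : - (Om 0 0)^-1 != 0 by rewrite oppr_eq0 invr_eq0.
  by apply: (mulIf p0); rewrite cs mulrN -mulrA mulfV // mulNr mulr1 opprK.
move: hS; move: (kappa _) (\det (schur Om)) (_ ^+ n) => k d x <-.
have i0 : 'i%C != 0 :> C by rewrite eq_complex /= oner_eq0 andbF.
by field; rewrite on0 i0.
Qed.

Lemma kappa_cont n (f : R -> 'M[C]_n) (s : R) :
  (forall i j, ccont (fun t => f t i j) s) -> posIm (f s) -> ccont (fun t => kappa (f t)) s.
Proof.
elim: n f => [|n IH] f cf hf; first exact: ccont_cst.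
move: f cf hf; rewrite -[n.+1]/(1 + n)%N => f cf hf.
have on0 := pivot_neq0 hf; have o0 := pivot_pos hf.
have cV : ccont (fun t => (f t 0 0)^-1) s by exact: ccontV.
have cN : ccont (fun t => - (f t 0 0)^-1) s.
  by have := ccontM (ccont_cst (-1) s) cV; under eq_fun do rewrite mulN1r.
apply: (@ccontM _ _ (fun t => (c (- (f t 0 0)^-1))^-1) (fun t => kappa (schur (f t)))).
  apply: (@ccontV _ _ (fun t => c (- (f t 0 0)^-1))); last by apply: c_cont => //; exact: Im_negV.
  exact: (proj1 (c_sqr (Im_negV o0))).
apply: IH; last exact: schur_posIm.
move=> i j; have -> : (fun t => schur (f t) i j) =
    fun t => f t (rshift 1 i) (rshift 1 j) + (-1) * ((f t 0 0)^-1 * (f t (lshift n 0) (rshift 1 i) * f t (lshift n 0) (rshift 1 j))).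
  apply/funext => t; rewrite /schur !mxE big_ord1 !mxE mulN1r //.
by apply: ccontD => //; apply: ccontM; [exact: ccont_cst|apply: ccontM => //; exact: ccontM].
Qed.

(** Schur complements of a purely imaginary matrix are purely imaginary, so every factor is
    evaluated on the positive imaginary axis. *)
Lemma kappa_pos n (Om : 'M[C]_n) : posIm Om -> (forall i j, Re (Om i j) = 0) ->
  Im (kappa Om) = 0 /\ 0 < Re (kappa Om).
Proof.
elim: n Om => [|n IH] Om hOm r0; first by rewrite /= ltr01.
move: Om hOm r0; rewrite -[n.+1]/(1 + n)%N => Om hOm r0.
have o0 := pivot_pos hOm.
have eo : Om 0 0 = 0 +i* Im (Om 0 0) by move: (r0 0 0); case: (Om 0 0) => a b /= ->.
have eV : - (Om 0 0)^-1 = 0 +i* (Im (Om 0 0))^-1.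
  rewrite eo /= ; apply: complexRI; rewrite ?(cReN, cImN) /=.
    by rewrite mul0r oppr0.
  by rewrite expr0n add0r opprK expr2 invfM mulrA mulfV ?mul1r // gt_eqF.
have [|ci cr] := c_pos (t := (Im (Om 0 0))^-1); first by rewrite invr_gt0.
have [|ki kr] := IH _ (schur_posIm hOm).
  move=> i j; rewrite /schur !mxE big_ord1 !mxE -[(Om 0 0)^-1]opprK eV.
  by rewrite !(cReD, cReN, cReM, cImM, cImN) /= !r0; ring.
rewrite [kappa (n := 1 + n) Om]/= eV.
have -> : c (0 +i* (Im (Om 0 0))^-1) = (Re (c (0 +i* (Im (Om 0 0))^-1)))%:C.
  by move: ci; case: (c _) => a b /= ->.
rewrite -fmorphV cImM cReM /= ki !mulr0 mul0r addr0 subr0; split=> //.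
by rewrite mulr_gt0 ?invr_gt0.
Qed.

End GaussInversion.

(** * Gaussian integrals on the line *)

Section GaussianIntegrals.
Variable R : realType.
Local Notation mu := (@lebesgue_measure R).

Lemma gauss_integrable (a : R) : 0 < a ->
  mu.-integrable setT (EFin \o (fun t : R => expR (- a * t ^+ 2))).
Proof.
move=> a0; pose s := Num.sqrt (2 * a)^-1.
have s0 : s != 0 by rewrite gt_eqF // sqrtr_gt0 invr_gt0 mulr_gt0.
have s2 : s ^+ 2 = (2 * a)^-1 by rewrite sqr_sqrtr // invr_ge0 mulr_ge0 // ltW.
have h := integrableZl measurableT (normal_peak s)^-1 (integrable_normal_pdf 0 s).
apply: eq_integrable h => // t _; rewrite /= -EFinM /normal_pdf (negbTE s0) mulrA mulVf ?mul1r; last first.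
  by rewrite gt_eqF // normal_peak_gt0.
rewrite /normal_fun subr0 s2; congr (expR _)%:E; rewrite -mulr_natr; field.
by rewrite gt_eqF.
Qed.

Lemma gauss_weight_integrable (e : nat) (a : R) : 0 < a ->
  mu.-integrable setT (EFin \o (fun t : R => (1 + `|t|) ^+ e * expR (- a * `|t| ^+ 2))).
Proof.
move=> a0; have a20 : 0 < a / 2 by rewrite divr_gt0.
have [C [C0 hC]] := @weight_dominated R e (a / 2) a20.
have h := integrableZl measurableT C (gauss_integrable a20).
apply: le_integrable h => //=.
  apply/measurable_EFinP; apply: measurable_funM.
    apply: measurable_funX; apply: measurable_funD => //; exact: (@continuous_measurable_fun R (fun x : R => `|x|) (@norm_continuous _ R)).
  apply: (measurableT_comp (@measurable_expR R)); apply: measurable_funM => //.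
  by apply: measurable_funX; exact: (@continuous_measurable_fun R (fun x : R => `|x|) (@norm_continuous _ R)).
move=> t _; rewrite lee_fin [X in X <= _]ger0_norm; last by rewrite mulr_ge0 ?expR_ge0 // exprn_ge0 // addr_ge0.
rewrite [X in _ <= X]ger0_norm; last by rewrite mulr_ge0 ?expR_ge0.
rewrite (_ : - a * `|t| ^+ 2 = - (a / 2) * `|t| ^+ 2 + - (a / 2) * t ^+ 2); last first.
  by rewrite real_normK ?num_real //; field.
rewrite expRD mulrA ler_wpM2r ?expR_ge0 // (le_trans (hC _ (normr_ge0 t))) //.
by rewrite ler_piMr // expR_le1 oppr_le0.
Qed.

Lemma linear_seq_cvgy (r a : R) : 0 < r -> (r * n%:R + a) @[n --> \oo] --> +oo%R.
Proof.
move=> r0; apply/cvgryPge => A; near=> n.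
rewrite -lerBlDr -ler_pdivrMl // mulrC.
by near: n; exact: nbhs_infty_ger.
Unshelve. all: by end_near. Qed.

Lemma sgrB (t c : R) : Num.sg (t - c) = (c < t)%R%:R - (t < c)%R%:R.
Proof.
case: (ltrgtP t c) => [tc|tc|->].
- by rewrite ltr0_sg ?subr_lt0 //= sub0r.
- by rewrite gtr0_sg ?subr_gt0 //= subr0.
- by rewrite subrr sgr0 subr0.
Qed.

(** The integral is [(G(+oo) - G c) - (G c - G(-oo))]. Only the sum of the two end values has to
    vanish, so the primitive need not be normalised at infinity; symmetric truncation to [[-n, n]]
    makes this rigorous. *)
Lemma sg_integral (f G : R -> R) (c : R) : continuous f ->
  (forall x : R, is_derive x 1 G (f x)) -> mu.-integrable setT (EFin \o f) ->
  (G n%:R + G (- n%:R)) @[n --> \oo] --> (0 : R) ->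
  \int[mu]_t (Num.sg (t - c) * f t) = - 2 * G c.
Proof.
move=> cf dG intf hG.
pose Fn (n : nat) (t : R) := \1_(`]c, n%:R]%classic : set R) t * f t - \1_(`[- n%:R, c[%classic : set R) t * f t.
have mf : measurable_fun setT f by apply/measurable_EFinP; exact: measurable_int intf.
have mI (A : set R) : measurable A -> measurable_fun setT (fun t => \1_A t * f t).
  by move=> mA; apply: measurable_funM => //; exact: measurable_indic.
have msg : measurable_fun setT (fun t : R => Num.sg (t - c) * f t).
  rewrite (_ : (fun t : R => _) = fun t : R => \1_(`]c, +oo[%classic : set R) t * f t - \1_(`]-oo, c[%classic : set R) t * f t).
    by apply: measurable_funB; exact: mI.
  apply/funext => t; rewrite !indicE !mem_setE !in_itv /= andbT.
  by rewrite sgrB; ring.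
have bFn n t : `|Fn n t| <= `|f t|.
  rewrite /Fn !indicE !mem_setE !in_itv /=.
  case: (ltrgtP t c) => /= tc; rewrite ?andbF ?andbT /=; [case: (- n%:R <= t)|case: (t <= n%:R)|];
    by rewrite /= ?(mul1r, mul0r, subr0, sub0r, normr0, normrN).
have h1 : (\int[mu]_t Fn n t)%R @[n --> \oo] --> \int[mu]_t (Num.sg (t - c) * f t).
  apply: (@dominated_Rintegral _ _ _ mu Fn _ (fun t => `|f t|)) => //.
  - by move=> m; apply: measurable_funB; exact: mI.
  - exact: integrable_abse intf.
  move=> t; apply: cvg_near_cst; near=> n.
  have hn : `|t| <= n%:R by near: n; exact: nbhs_infty_ger.
  move: hn; rewrite ler_norml => /andP[n1 n2].
  rewrite /Fn !indicE !mem_setE !in_itv /= n1 n2 /= andbT.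
  by rewrite sgrB; ring.
have FTC (a b : R) : a < b -> \int[mu]_(t in `[a, b]) f t = G b - G a.
  move=> ab; have cG : continuous G by move=> x; exact: is_derive_continuous (dG x).
  rewrite /Rintegral (@continuous_FTC2 _ f G) //.
  - exact: continuous_subspaceT.
  - split=> [x _||]; first by have [] := dG x.
      by apply: cvg_at_right_filter; exact: cG.
    by apply: cvg_at_left_filter; exact: cG.
  - by move=> x _; rewrite derive1E; exact: derive_val.
have iS (A : set R) : measurable A -> mu.-integrable A (EFin \o f).
  by move=> mA; exact: integrableS intf.
have indR (A : set R) : measurable A -> \int[mu]_t (\1_A t * f t) = \int[mu]_(t in A) f t.
  move=> mA; rewrite [in RHS]Rintegral_mkcond; apply: eq_Rintegral => t _.
  by rewrite patchE indicE; case: (t \in A); rewrite ?mul1r ?mul0r.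
have indI (A : set R) : measurable A -> mu.-integrable setT (EFin \o (fun t => \1_A t * f t)).
  move=> mA; apply: le_integrable intf => //; first by apply/measurable_EFinP; exact: mI.
  move=> t _; rewrite /= lee_fin indicE; case: (t \in A); rewrite ?mul1r ?mul0r ?normr0 //.
have h2 : (\int[mu]_t Fn n t)%R @[n --> \oo] --> - 2 * G c.
  have -> : - 2 * G c = 0 - 2 * G c by ring.
  apply: cvg_trans (cvgB hG (cvg_cst (2 * G c))); apply: near_eq_cvg; near=> n.
  have n1 : `|c| + 1 <= n%:R by near: n; exact: nbhs_infty_ger.
  have [/lt_le_trans/(_ n1) c1] : `|c| < `|c| + 1 by rewrite ltrDl.
  have /andP[c2 c3] : - n%:R < c < n%:R by rewrite -ltr_norml.
  rewrite /Fn RintegralB //; [|exact: indI|exact: indI].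
  rewrite !indR // Rintegral_itv_obnd_cbnd; last exact: iS.
  rewrite Rintegral_itv_bndo_bndc; last exact: iS.
  by rewrite !FTC //; change (G n%:R + G (- n%:R) - 2 * G c = G n%:R - G c - (G c - G (- n%:R))); ring.
exact: (cvg_unique _ h1 h2).
Unshelve. all: by end_near. Qed.

End GaussianIntegrals.

(** * The error function, the double error function and its derivatives *)

Section ErrorFunction.
Variable R : realType.
Local Notation mu := (@lebesgue_measure R).

(** The error function in the scaling of [E1], with derivative [2 exp (- pi z^2)]. *)
Definition gerf (z : R) : R := Erf (Num.sqrt pi * z).

Let J (u : R) : R := \int[mu]_(t in `]-oo, u]) gauss_fun t.

Let sp0 : 0 < Num.sqrt (pi : R).
Proof. by rewrite sqrtr_gt0 pi_gt0. Qed.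

Let dJ (u : R) : is_derive u 1 J (gauss_fun u).
Proof.
have iJ : mu.-integrable `]-oo, u + 1] (EFin \o (@gauss_fun R)).
  by apply: integrableS (@integrableT_gauss R).
have [||d1 d2] := @continuous_FTC1 R (@gauss_fun R) (BInfty R true) u (u + 1) _ iJ _ (@continuous_gauss_fun R u).
  by rewrite ltrDl.
  by first [exact: ltBSide|rewrite ltEitv //|exact: ltNyr|exact: Order.POrderTheory.lt_def].
by apply: DeriveDef; [exact: d1|rewrite -derive1E; exact: d2].
Qed.

Lemma is_derive0_const (f : R -> R) : (forall x : R, is_derive x 1 f 0) -> forall a b, f a = f b.
Proof.
move=> df; suff key (a b : R) : a <= b -> f a = f b.
  by move=> a b; case: (leP a b) => [/key//|/ltW/key ->].
move=> ab; have cf : continuous f by move=> x; exact: is_derive_continuous (df x).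
have [c _ e] := MVT_segment ab (fun x _ => df x) (continuous_subspaceT cf).
by apply/esym/eqP; rewrite -subr_eq0 e mul0r.
Qed.

Let J_sym (u : R) : J u + J (- u) = 2 * J 0.
Proof.
have dK (x : R) : is_derive x 1 (fun u => J u + J (- u)) 0.
  have d1 := dJ x; have d2 := dJ (- x).
  have d3 : is_derive x 1 (fun u => J (- u)) (- gauss_fun (- x)).
    have h := @is_derive1_comp R J (fun u => - u) x _ _ d2 (is_deriveN (is_derive_id x 1)).
    by rewrite mulrN1 in h.
  apply: is_derive_eq; rewrite /gauss_fun sqrrN; exact: subrr.
by rewrite (is_derive0_const dK u 0) oppr0; ring.
Qed.

Let J_itv (u : R) : 0 <= u -> \int[mu]_(t in `[0, u]) gauss_fun t = J u - J 0.
Proof.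
move=> u0; have iS (A : set R) : measurable A -> mu.-integrable A (EFin \o @gauss_fun R).
  by move=> mA; exact: integrableS (@integrableT_gauss R).
rewrite -Rintegral_itv_obnd_cbnd; last exact: iS.
by rewrite -(@Rintegral_itvB R _ -oo%O (BRight u) 0) //; exact: iS.
Qed.

Lemma ErfE (u : R) : Erf u = 2 / Num.sqrt pi * (J u - J 0).
Proof.
rewrite /Erf; case: (ltrgtP u 0) => [u0|u0|->].
- rewrite ltr0_sg // J_itv // ltr0_norm //.
  have := J_sym u; move: (J u) (J (- u)) (J 0) => a b d h.
  by rewrite mulN1r mulNr -mulrN; congr (_ * _); lra.
- by rewrite gtr0_sg // J_itv // gtr0_norm // mul1r.
- by rewrite sgr0 !mul0r subrr mulr0.
Qed.

Lemma gerfE (z : R) : gerf z = 2 / Num.sqrt pi * (J (Num.sqrt pi * z) - J 0).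
Proof. exact: ErfE. Qed.

Lemma is_derive_gerf (z : R) : is_derive z 1 gerf (2 * expR (- pi * z ^+ 2)).
Proof.
have d1 : is_derive z 1 (fun z : R => Num.sqrt pi * z) (Num.sqrt pi).
  by apply: is_derive_eq; rewrite /GRing.scale /= mulr1.
have h := @is_derive1_comp R J (fun z : R => Num.sqrt pi * z) z _ _ (dJ _) d1.
rewrite (_ : gerf = fun z => (2 / Num.sqrt pi) *: ((J \o (fun z : R => Num.sqrt pi * z)) z - J 0)); last first.
  by apply/funext => x; rewrite gerfE.
apply: is_derive_eq; rewrite subr0 /GRing.scale /= /gauss_fun exprMn sqr_sqrtr ?pi_ge0 // mulNr.
by field; rewrite gt_eqF.
Qed.

Lemma gerfN (z : R) : gerf (- z) = - gerf z.
Proof.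
rewrite !gerfE mulrN; have := J_sym (Num.sqrt pi * z); move: (J _) (J (- _)) (J 0) => a b d h.
by rewrite -mulrN; congr (_ * _); lra.
Qed.

Let J_bnd (u : R) : 0 <= J u <= Num.sqrt pi.
Proof.
apply/andP; split; first by apply: Rintegral_ge0 => t _; exact: gauss_fun_ge0.
have -> : Num.sqrt pi = \int[mu]_t gauss_fun t by rewrite /Rintegral integralT_gauss.
rewrite /J Rintegral_mkcond; apply: le_Rintegral => //.
- have iS : mu.-integrable (`]-oo, u] : set R) (EFin \o @gauss_fun R).
    by apply: integrableS (@integrableT_gauss R).
  by rewrite -restrict_EFin; apply/(integrable_mkcond _ _).1.
- exact: integrableT_gauss.
- by move=> t _; rewrite patchE; case: ifP => // _; exact: gauss_fun_ge0.
Qed.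

Lemma gerf_bound (z : R) : `|gerf z| <= 2.
Proof.
rewrite gerfE normrM ger0_norm; last by rewrite divr_ge0 // ltW.
have /andP[a1 a2] := J_bnd (Num.sqrt pi * z); have /andP[b1 b2] := J_bnd 0.
rewrite -mulrA -[leRHS]mulr1 ler_wpM2l // ler_pdivrMl // mulr1 ler_norml.
by apply/andP; split; lra.
Qed.

Lemma gerf_cvgy : exists l : R, gerf x @[x --> +oo%R] --> l.
Proof.
exists (sup (range gerf)); apply: nondecreasing_cvgr.
  move=> x y xy; have cf : continuous gerf by move=> z; exact: is_derive_continuous (is_derive_gerf z).
  have [c _ e] := MVT_segment xy (fun x _ => is_derive_gerf x) (continuous_subspaceT cf).
  by rewrite -subr_ge0 e mulr_ge0 ?subr_ge0 // mulr_ge0 ?expR_ge0.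
by exists 2 => _ [z _ <-]; rewrite (le_trans (ler_norm _)) // gerf_bound.
Qed.

(** By oddness this is a difference of two sequences with the same limit, and the value of the limit
    drops out. *)
Lemma gerf_tails (r w : R) : 0 < r ->
  (gerf (r * n%:R - w) + gerf (r * (- n%:R) - w)) @[n --> \oo] --> (0 : R).
Proof.
move=> r0; have [l hl] := gerf_cvgy.
have h1 := cvg_comp _ _ (linear_seq_cvgy (- w) r0) hl.
have h2 := cvg_comp _ _ (linear_seq_cvgy w r0) hl.
have h := cvgB h1 h2; rewrite subrr in h.
rewrite (_ : (fun n : nat => _) = (fun n : nat => gerf (r * n%:R - w) - gerf (r * n%:R + w))); first exact: (h _).
by apply/funext => n; rewrite -gerfN; congr (_ + gerf _); ring.
Qed.

Lemma gauss_tail (r w : R) : 0 < r -> expR (- pi * (r * n%:R + w) ^+ 2) @[n --> \oo] --> (0 : R).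
Proof.
move=> r0; have r1 : 0 < Num.sqrt pi * r by rewrite mulr_gt0.
have h := cvg_comp _ _ (linear_seq_cvgy (Num.sqrt pi * w) r1) (@cvg_gauss_fun R).
apply: cvg_trans h; apply: near_eq_cvg; near=> n.
rewrite /= /gauss_fun -mulrA -mulrDr exprMn sqr_sqrtr ?pi_ge0 // mulNr //.
Unshelve. all: by end_near. Qed.

Lemma gauss_tailN (r w : R) : 0 < r -> expR (- pi * (r * (- n%:R) + w) ^+ 2) @[n --> \oo] --> (0 : R).
Proof.
move=> r0; apply: cvg_trans (gauss_tail (- w) r0); apply: near_eq_cvg; near=> n.
by congr expR; ring.
Unshelve. all: by end_near. Qed.

Lemma gauss_shift_bound (u t : R) : expR (- pi * (u - t) ^+ 2) <= expR (pi * u ^+ 2) * expR (- (pi / 2) * t ^+ 2).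
Proof.
rewrite -expRD ler_expR; have p0 := pi_ge0 R.
have : 0 <= pi * (2^-1 * (2 * u - t) ^+ 2) by apply: mulr_ge0 => //; apply: mulr_ge0; rewrite ?invr_ge0 ?sqr_ge0.
have -> : pi * (2^-1 * (2 * u - t) ^+ 2) = pi * u ^+ 2 + - (pi / 2) * t ^+ 2 - (- pi * (u - t) ^+ 2) by field.
by rewrite subr_ge0.
Qed.

Lemma gauss_shift_integrable (u : R) : mu.-integrable setT (EFin \o (fun t : R => expR (- pi * (u - t) ^+ 2))).
Proof.
have p2 : 0 < pi / 2 :> R by rewrite divr_gt0 ?pi_gt0.
apply: le_integrable (integrableZl measurableT (expR (pi * u ^+ 2)) (gauss_integrable p2)) => //=.
  apply/measurable_EFinP; apply: (measurableT_comp (@measurable_expR R)); apply: measurable_funM => //.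
  by apply: measurable_funX; apply: measurable_funB.
move=> t _; rewrite lee_fin !ger0_norm ?mulr_ge0 ?expR_ge0 //.
exact: gauss_shift_bound.
Qed.

Lemma sg_gauss_integral (u c : R) :
  \int[mu]_t (Num.sg (t - c) * expR (- pi * (u - t) ^+ 2)) = gerf (u - c).
Proof.
have dG (t : R) : is_derive t 1 (fun t : R => 2^-1 *: gerf (t - u)) (expR (- pi * (u - t) ^+ 2)).
  have d1 : is_derive t 1 (fun t : R => t - u) 1 by apply: is_derive_eq; rewrite subr0.
  have h := @is_derive1_comp R gerf (fun t : R => t - u) t _ _ (is_derive_gerf _) d1.
  apply: is_derive_eq; rewrite /GRing.scale /= mulr1 mulrA mulVf // mul1r.
  by congr (expR (_ * _)); ring.
rewrite (sg_integral (G := fun t : R => 2^-1 *: gerf (t - u))) //.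
- by rewrite (_ : u - c = - (c - u)) ?gerfN /GRing.scale /=; [field|ring].
- move=> t; apply: continuous_comp; last exact: continuous_expR.
  apply: cvgM; first exact: cvg_cst.
  by apply: (@continuous_comp _ _ _ (fun t : R => u - t) (fun t => t ^+ 2)); [apply: cvgB; [exact: cvg_cst|exact: cvg_id]|exact: exprn_continuous].
- exact: gauss_shift_integrable.
have h := cvgM (@cvg_cst _ (2^-1 : R) nat \oo _) (gerf_tails u (@ltr01 R)); rewrite mulr0 in h.
rewrite (_ : (fun n : nat => _) = (fun n : nat => 2^-1 * (gerf (1 * n%:R - u) + gerf (1 * (- n%:R) - u)))); first exact: (h _ _).
by apply/funext => n; rewrite /GRing.scale /= !mul1r mulrDr.
Qed.

Lemma sg_measurable d (T : measurableType d) (f : T -> R) : measurable_fun setT f -> measurable_fun setT (fun t => Num.sg (f t)).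
Proof.
move=> mf; rewrite (_ : (fun t => _) = fun t => \1_(`]0, +oo[%classic : set R) (f t) - \1_(`]-oo, 0[%classic : set R) (f t)).
  have mi (A : set R) : measurable A -> measurable_fun setT (fun t => \1_A (f t) : R).
    by move=> mA; apply: (measurableT_comp _ mf); exact: measurable_indic.
  by apply: measurable_funB; exact: mi.
by apply/funext => t; rewrite !indicE !mem_setE !in_itv /= andbT -[f t in LHS]subr0 sgrB.
Qed.

Lemma sg_le1 (x : R) : `|Num.sg x| <= 1.
Proof. by rewrite normr_sg; case: (x != 0). Qed.

Lemma measurable_gerf : measurable_fun setT gerf.
Proof.
apply: continuous_measurable_fun => z; exact: is_derive_continuous (is_derive_gerf z).
Qed.

(** Integrating out the first variable turns its sign into a [gerf]. The sign that remains has a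
    fixed jump at 0, so the integrand can be differentiated in all parameters. *)
Lemma double_erfE (al u1 u2 : R) :
  double_erf al u1 u2 = \int[mu]_t (Num.sg t * expR (- pi * (u2 - t) ^+ 2) * gerf (u1 + al * t)).
Proof.
pose F (t : measurableTypeR R * measurableTypeR R) : R :=
  expR (- pi * (u1 - t.1) ^+ 2 - pi * (u2 - t.2) ^+ 2) * Num.sg t.2 * Num.sg (t.1 + al * t.2).
pose G1 (t : measurableTypeR R) : R := expR (- pi * (u1 - t) ^+ 2).
pose G2 (t : measurableTypeR R) : R := expR (- pi * (u2 - t) ^+ 2).
have mG (u : R) : measurable_fun setT (fun t : measurableTypeR R => expR (- pi * (u - t) ^+ 2)).
  by have /measurable_EFinP := measurable_int _ (gauss_shift_integrable u).
have m1 : measurable_fun setT (fun t : measurableTypeR R * measurableTypeR R => t.1) by exact: measurable_fst.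
have m2 : measurable_fun setT (fun t : measurableTypeR R * measurableTypeR R => t.2) by exact: measurable_snd.
have mGG : measurable_fun setT (fun t : measurableTypeR R * measurableTypeR R => G1 t.1 * G2 t.2).
  by apply: measurable_funM; [apply: (measurableT_comp (mG u1))|apply: (measurableT_comp (mG u2))].
have FE t : F t = G1 t.1 * G2 t.2 * Num.sg t.2 * Num.sg (t.1 + al * t.2).
  by rewrite /F /G1 /G2 -expRD mulNr mulNr.
have mF : measurable_fun setT F.
  rewrite (funext FE); apply: measurable_funM; first apply: measurable_funM => //.
    exact: (sg_measurable m2).
  apply: sg_measurable; apply: measurable_funD => //; exact: measurable_funM.
have iGG : (mu \x mu)%E.-integrable setT (EFin \o (fun t : measurableTypeR R * measurableTypeR R => G1 t.1 * G2 t.2)).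
  apply: (@integrable12ltyP _ _ _ _ R mu mu _ _).2; first by apply/measurable_EFinP.
  have i2 := gauss_shift_integrable u2; have /integrableP[_ i2'] := i2.
  have /integrableP[_ i1'] := gauss_shift_integrable u1.
  pose c := fine (\int[mu]_y (G2 y)%:E)%E.
  have cE : (\int[mu]_y (G2 y)%:E)%E = c%:E by rewrite fineK //; exact: integrable_fin_num.
  rewrite (eq_integral (fun x => c%:E * `|(G1 x)%:E|)%E); last first.
    move=> x _; rewrite -cE muleC -ge0_integralZl //=.
    - by apply: eq_integral => y _; rewrite /= normrM (@ger0_norm _ (G2 y)) ?expR_ge0 // EFinM.
    - by apply/measurable_EFinP; exact: (mG u2).
    - by move=> y _; rewrite lee_fin expR_ge0.
  have c0 : (0 <= c%:E)%E by rewrite -cE integral_ge0 // => y _; rewrite lee_fin expR_ge0.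
  rewrite ge0_integralZl //; last by apply/measurable_EFinP; apply: measurableT_comp => //; exact: mG.
  exact: lte_mul_pinfty.
have FG t : `|F t| <= G1 t.1 * G2 t.2.
  rewrite FE normrM -[leRHS]mulr1 ler_pM ?sg_le1 // normrM -[leRHS]mulr1 ler_pM ?sg_le1 //.
  by rewrite ger0_norm // mulr_ge0 ?expR_ge0.
have iF : (mu \x mu)%E.-integrable setT (EFin \o F).
  apply: le_integrable iGG => //; first exact/measurable_EFinP.
  by move=> t _; rewrite /= lee_fin (le_trans (FG t)) // ler_norm.
have iF1 y : mu.-integrable setT (fun x => (F (x, y))%:E).
  apply: le_integrable (integrableZl measurableT (G2 y) (gauss_shift_integrable u1)) => //.
    by apply/measurable_EFinP; apply: (measurableT_comp mF); exact: measurable_pair2.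
  by move=> t _; rewrite /= lee_fin (le_trans (FG _)) // mulrC ler_norm.
have h := @Rintegral_Fubini2 _ _ _ _ R mu mu F iF iF1.
rewrite [LHS]h; apply: eq_Rintegral => y _.
rewrite (_ : u1 + al * y = u1 - (- (al * y))); last by rewrite opprK.
rewrite -sg_gauss_integral -RintegralZl //.
  by apply: eq_Rintegral => x _; rewrite FE /G1 /G2 /= opprK; ring.
apply: le_integrable (gauss_shift_integrable u1) => //.
  apply/measurable_EFinP; apply: measurable_funM; last exact: mG.
  by apply: sg_measurable; exact: measurable_funB.
by move=> t _; rewrite /= lee_fin normrM ler_piMl ?sg_le1.
Qed.

Lemma is_derive_gerf_comp (f : R -> R) (s f' : R) : is_derive s 1 f f' ->
  is_derive s 1 (fun s => gerf (f s)) (2 * expR (- pi * f s ^+ 2) * f').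
Proof. by move=> df; exact: (@is_derive1_comp R gerf f s _ _ (is_derive_gerf _) df). Qed.

Lemma is_derive_gauss_comp (f : R -> R) (s f' : R) : is_derive s 1 f f' ->
  is_derive s 1 (fun s => expR (- pi * f s ^+ 2)) (- (2 * pi * f s * f') * expR (- pi * f s ^+ 2)).
Proof.
move=> df; have d1 : is_derive s 1 (fun s => - pi * f s ^+ 2) (- (2 * pi * f s * f')).
  have d2 := is_deriveM df df.
  rewrite (_ : (fun s => _) = fun s => (- pi) *: (f s * f s)); last by apply/funext => x; rewrite expr2.
  by apply: is_derive_eq; rewrite /GRing.scale /=; ring.
have h := @is_derive1_comp R (@expR R) (fun s => - pi * f s ^+ 2) s _ _ (is_derive_expR _) d1.
by apply: is_derive_eq; rewrite mulrC.
Qed.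

(** Away from the sign the differentiated integrand has an explicit primitive, which [sg_integral]
    evaluates at the jump. The numbers [w1], [w2] are the coordinates of [(u1, u2)] in the
    orthonormal frame whose first vector is [(1, al) / rho]. *)
Lemma double_erf_path (al u1 u2 al' u1' u2' : R -> R) (s0 e K : R) : 0 < e ->
  (forall s : R, `|s - s0| < e -> [/\ is_derive s 1 al (al' s), is_derive s 1 u1 (u1' s) & is_derive s 1 u2 (u2' s)]) ->
  (forall s : R, `|s - s0| < e -> [/\ `|al' s| <= K, `|u1' s| <= K, `|u2' s| <= K & `|u2 s| <= K]) ->
  let rho := Num.sqrt (1 + al s0 ^+ 2) in
  let w1 := (u1 s0 + al s0 * u2 s0) / rho in
  let w2 := (u2 s0 - al s0 * u1 s0) / rho in
  is_derive s0 1 (fun s => double_erf (al s) (u1 s) (u2 s))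
    (2 * u2' s0 * expR (- pi * u2 s0 ^+ 2) * gerf (u1 s0) +
     2 * expR (- pi * w1 ^+ 2) *
       (gerf w2 * ((u1' s0 + al s0 * u2' s0) / rho + al' s0 * w2 / rho ^+ 2)
        + al' s0 / (pi * rho ^+ 2) * expR (- pi * w2 ^+ 2))).
Proof.
move=> e0 hd hb rho w1 w2.
have K0 : 0 <= K by have [|h _ _ _] := hb s0; [rewrite subrr normr0|exact: le_trans (normr_ge0 _) h].
pose E (s t : R) := expR (- pi * (u2 s - t) ^+ 2).
pose f (s t : R) := Num.sg t * E s t * gerf (u1 s + al s * t).
pose f0 (s t : R) := - (2 * pi * (u2 s - t) * u2' s) * E s t * gerf (u1 s + al s * t)
  + E s t * (2 * expR (- pi * (u1 s + al s * t) ^+ 2) * (u1' s + al' s * t)).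
(* [M] collects the bounds for [f] and [f0]: [gerf] is at most 2, the data at most [K], and
   [gauss_shift_bound] recentres the Gaussian at the price of [exp (pi K^2)] and half its rate. *)
pose M := (2 + 4 * pi * K * (K + 1) + 2 * K) * expR (pi * K ^+ 2).
have p0 := pi_gt0 R; have p00 := ltW p0.
have p2 : 0 < pi / 2 :> R by rewrite divr_gt0.
pose G (t : R) := M * ((1 + `|t|) ^+ 1 * expR (- (pi / 2) * `|t| ^+ 2)).
have iG : mu.-integrable setT (EFin \o (fun t : R => M * ((1 + `|t|) ^+ 1 * expR (- (pi / 2) * `|t| ^+ 2)))).
  exact: (integrableZl measurableT M (gauss_weight_integrable 1 p2)).
have hE s t : `|s - s0| < e -> E s t <= expR (pi * K ^+ 2) * expR (- (pi / 2) * `|t| ^+ 2).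
  move=> hs; apply: (le_trans (gauss_shift_bound _ _)); rewrite real_normK ?num_real // ler_wpM2r ?expR_ge0 //.
  rewrite ler_expR ler_wpM2l // -[u2 s ^+ 2]real_normK ?num_real //; apply: lerXn2r; rewrite ?nnegrE //.
  by have [] := hb s hs.
have E0 s t : 0 <= E s t by exact: expR_ge0.
have bnd s t (x : R) : `|s - s0| < e -> `|x| <= E s t * ((2 + 4 * pi * K * (K + 1) + 2 * K) * (1 + `|t|)) -> `|x| <= G t.
  move=> hs h; apply: (le_trans h); rewrite /G /M expr1.
  have -> : (2 + 4 * pi * K * (K + 1) + 2 * K) * expR (pi * K ^+ 2) * ((1 + `|t|) * expR (- (pi / 2) * `|t| ^+ 2)) =
    expR (pi * K ^+ 2) * expR (- (pi / 2) * `|t| ^+ 2) * ((2 + 4 * pi * K * (K + 1) + 2 * K) * (1 + `|t|)) by ring.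
  apply: ler_wpM2r; last exact: hE.
  apply: mulr_ge0; last by rewrite addr_ge0.
  apply: addr_ge0; last by rewrite mulr_ge0.
  apply: addr_ge0 => //; apply: mulr_ge0; last by rewrite addr_ge0.
  by rewrite !mulr_ge0.
have t0 (t : R) : 0 <= `|t| by [].
have fG s t : `|s - s0| < e -> `|f s t| <= G t.
  move=> hs; apply: (bnd s) => //; rewrite /f normrM normrM (ger0_norm (E0 s t)).
  have h1 := sg_le1 t; have h2 := gerf_bound (u1 s + al s * t).
  apply: (@le_trans _ _ (E s t * 2)).
    by apply: ler_pM => //; rewrite ?mulr_ge0 // ler_piMl.
  apply: ler_wpM2l => //; have := t0 t; have : 0 <= 4 * pi * K * (K + 1) by rewrite !mulr_ge0 // addr_ge0.
  move: (4 * pi * K * (K + 1)) `|t| => A B hA hB.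
  have : 0 <= (A + 2 * K) * (1 + B) by rewrite mulr_ge0 ?addr_ge0 ?mulr_ge0.
  by rewrite -addrA mulrDl; lra.
have f0G' s t : `|s - s0| < e -> `|f0 s t| <= G t.
  move=> hs; apply: (bnd s) => //; have [b1 b2 b3 b4] := hb s hs.
  have -> : f0 s t = E s t * (- (2 * pi * (u2 s - t) * u2' s) * gerf (u1 s + al s * t)
     + 2 * expR (- pi * (u1 s + al s * t) ^+ 2) * (u1' s + al' s * t)) by rewrite /f0; ring.
  rewrite normrM (ger0_norm (E0 s t)); apply: ler_wpM2l => //.
  apply: (le_trans (ler_normD _ _)).
  have k1 : `|- (2 * pi * (u2 s - t) * u2' s) * gerf (u1 s + al s * t)| <= 2 * pi * (K + `|t|) * K * 2.
    rewrite normrM normrN; apply: ler_pM => //; last exact: gerf_bound.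
    rewrite normrM; apply: ler_pM => //; rewrite normrM (@ger0_norm _ (2 * pi)) ?mulr_ge0 //.
    by apply: ler_wpM2l; rewrite ?mulr_ge0 // (le_trans (ler_normB _ _)) // lerD2r.
  have k2 : `|2 * expR (- pi * (u1 s + al s * t) ^+ 2) * (u1' s + al' s * t)| <= 2 * (K + K * `|t|).
    rewrite normrM; apply: ler_pM => //.
      rewrite ger0_norm ?mulr_ge0 ?expR_ge0 // ler_piMr // expR_le1 mulNr oppr_le0.
      by rewrite mulr_ge0 ?sqr_ge0.
    rewrite (le_trans (ler_normD _ _)) // lerD // normrM; exact: ler_wpM2r.
  apply: (le_trans (lerD k1 k2)).
  have := t0 t; move: `|t| => B hB.
  have q1 : 0 <= pi * K * K * B by rewrite !mulr_ge0.
  have q2 : 0 <= pi * K by rewrite mulr_ge0.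
  have q3 : 0 <= pi * K * K by rewrite !mulr_ge0.
  rewrite -subr_ge0 (_ : _ - _ = 2 * (1 + B) + 4 * (pi * K) + 4 * (pi * K * K * B)); last by ring.
  by rewrite !addr_ge0 // mulr_ge0 // addr_ge0.
have f0G s t : `|s - s0| < e -> `|Num.sg t * f0 s t| <= G t.
  move=> hs; apply: le_trans (f0G' s t hs).
  by rewrite normrM ler_piMl // sg_le1.
have mE s : measurable_fun setT (E s).
  by have /measurable_EFinP := measurable_int _ (gauss_shift_integrable (u2 s)).
have mf s : measurable_fun setT (f s).
  apply: measurable_funM; first by apply: measurable_funM => //; exact: sg_measurable.
  by apply: (measurableT_comp measurable_gerf); apply: measurable_funD => //; exact: measurable_funM.
have df s t : `|s - s0| < e -> is_derive s 1 (f^~ t) (Num.sg t * f0 s t).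
  move=> hs; have [d1 d2 d3] := hd s hs.
  have dl : is_derive s 1 (fun s => u1 s + al s * t) (u1' s + al' s * t).
    by apply: is_derive_eq; rewrite /GRing.scale /=; ring.
  have dr : is_derive s 1 (fun s => u2 s - t) (u2' s) by apply: is_derive_eq; rewrite subr0.
  have dg := is_derive_gerf_comp dl; have de := is_derive_gauss_comp dr.
  have dm := is_deriveM de dg.
  have dz := @is_deriveZ _ _ _ _ (Num.sg t) s 1 _ dm.
  rewrite (_ : f^~ t = fun s => Num.sg t *: (expR (- pi * (u2 s - t) ^+ 2) * gerf (u1 s + al s * t))); last first.
    by apply/funext => r; rewrite /f /E /GRing.scale /=; ring.
  by apply: is_derive_eq; rewrite /f0 /E /GRing.scale /=; ring.
have := @Rintegral_is_derive _ _ R mu R f (fun s t => Num.sg t * f0 s t) s0 1 e G e0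
  (fun s _ => mf s) iG (fun s hs t => fG s t hs) (fun s hs t => f0G s t hs) (fun s hs t => df s t hs).
rewrite (_ : (fun s => \int[mu]_t f s t) = fun s => double_erf (al s) (u1 s) (u2 s)); last first.
  by apply/funext => s; rewrite double_erfE.
move=> h; apply: is_derive_eq h _.
have r0 : 0 < rho by rewrite sqrtr_gt0 ltr_pwDl ?sqr_ge0.
have r2 : rho ^+ 2 = 1 + al s0 ^+ 2 by rewrite sqr_sqrtr // addr_ge0 ?sqr_ge0.
pose a := u1' s0 + al s0 * u2' s0; pose b := al' s0.
pose ca := (a / rho + b * w2 / rho ^+ 2) / 2; pose cb := - (b / (2 * pi * rho ^+ 2)).
pose X := 2 * expR (- pi * w1 ^+ 2).
(* A primitive of [f0 s0]. The first summand absorbs the terms with [gerf]; what is left is a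
   Gaussian centred where [rho * t = w2], times the affine function [a + b t], and integrates to a
   [gerf] with coefficient [ca] plus a Gaussian with coefficient [cb]. *)
pose Gf (t : R) := (- u2' s0) * (E s0 t * gerf (u1 s0 + al s0 * t))
  + X * (ca * gerf (rho * t - w2) + cb * expR (- pi * (rho * t - w2) ^+ 2)).
have rn0 : rho != 0 by rewrite gt_eqF.
have dGf (t : R) : is_derive t 1 Gf (f0 s0 t).
  have l1 : is_derive t 1 (fun t => u2 s0 - t) (- 1).
    have h := is_deriveD (@is_derive_cst R R R (u2 s0) t 1) (is_deriveNid t (1 : R)).
    by apply: is_derive_eq h _; rewrite add0r.
  have l2 : is_derive t 1 (fun t => u1 s0 + al s0 * t) (al s0).
    by apply: is_derive_eq; rewrite /GRing.scale /=; ring.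
  have l3 : is_derive t 1 (fun t => rho * t - w2) rho.
    by apply: is_derive_eq; rewrite /GRing.scale /=; ring.
  have g1 := is_deriveM (is_derive_gauss_comp l1) (is_derive_gerf_comp l2).
  have g2 := is_deriveD (@is_deriveZ _ _ _ _ ca t 1 _ (is_derive_gerf_comp l3)) (@is_deriveZ _ _ _ _ cb t 1 _ (is_derive_gauss_comp l3)).
  have g3 := is_deriveD (@is_deriveZ _ _ _ _ (- u2' s0) t 1 _ g1) (@is_deriveZ _ _ _ _ X t 1 _ g2).
  apply: is_derive_eq g3 _; rewrite /f0 /E /GRing.scale /=.
  (* The rotation preserves [u1^2 + u2^2], which separates the product of the two Gaussians into a
     factor in [w1] free of [t] and one in [rho t - w2]. *)
  have ex : E s0 t * expR (- pi * (u1 s0 + al s0 * t) ^+ 2) = expR (- pi * w1 ^+ 2) * expR (- pi * (rho * t - w2) ^+ 2).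
    rewrite /E -!expRD; congr expR.
    have w1r : w1 * rho = u1 s0 + al s0 * u2 s0 by rewrite /w1 divfK.
    have w2r : w2 * rho = u2 s0 - al s0 * u1 s0 by rewrite /w2 divfK.
    have hw : (w1 ^+ 2 + w2 ^+ 2) * rho ^+ 2 = (u1 s0 ^+ 2 + u2 s0 ^+ 2) * rho ^+ 2.
      rewrite mulrDl -!exprMn w1r w2r r2; ring.
    have {}hw : w1 ^+ 2 + w2 ^+ 2 = u1 s0 ^+ 2 + u2 s0 ^+ 2.
      by apply: (mulIf _ hw); rewrite sqrf_eq0.
    have -> : - pi * w1 ^+ 2 + - pi * (rho * t - w2) ^+ 2 =
      - pi * ((w1 ^+ 2 + w2 ^+ 2) + rho ^+ 2 * t ^+ 2 - 2 * t * (w2 * rho)) by ring.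
    by rewrite hw w2r r2; ring.
  move: ex; rewrite /X; set e1 := E s0 t; rewrite -/(E s0 t) -/e1.
  set e2 := expR (- pi * (u1 s0 + _) ^+ 2); set e3 := expR (- pi * w1 ^+ 2); set e4 := expR _ => ex.
  have -> : e1 * (2 * e2 * (u1' s0 + al' s0 * t)) = 2 * (e1 * e2) * (u1' s0 + al' s0 * t) by ring.
  have -> : - u2' s0 * (e1 * (2 * e2 * al s0) + gerf (u1 s0 + al s0 * t) * (- (2 * pi * (u2 s0 - t) * -1) * e1)) =
     - u2' s0 * (2 * (e1 * e2) * al s0 + gerf (u1 s0 + al s0 * t) * (2 * pi * (u2 s0 - t) * e1)) by ring.
  rewrite ex /ca /cb /a /b; move: (lt0r_neq0 p0); move: (pi : R) => P Pn; field.
  by rewrite rn0 Pn.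
rewrite (_ : \int[mu]_t (Num.sg t * f0 s0 t) = \int[mu]_t (Num.sg (t - 0) * f0 s0 t)); last first.
  by apply: eq_Rintegral => t _; rewrite subr0.
rewrite (@sg_integral R (f0 s0) Gf 0) //.
- rewrite /Gf /E /X /ca /cb /a /b !mulr0 subr0 addr0 sub0r gerfN sqrrN.
  move: (expR _) (expR (- pi * w1 ^+ 2)) (expR _) (lt0r_neq0 p0) => e1 e2 e3; move: (pi : R) => P Pn; field.
  by rewrite rn0 Pn.
- have cl (c r : R) : continuous (fun t : R => c + r * t).
    move=> t; apply: cvgD; first exact: cvg_cst.
    by apply: cvgM; [exact: cvg_cst|exact: cvg_id].
  have cgs (c r : R) : continuous (fun t : R => expR (- pi * (c + r * t) ^+ 2)).
    move=> t; have d : is_derive t 1 (fun t => c + r * t) r by apply: is_derive_eq; rewrite /GRing.scale /=; ring.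
    exact: is_derive_continuous (is_derive_gauss_comp d).
  have cge (c r : R) : continuous (fun t : R => gerf (c + r * t)).
    move=> t; have d : is_derive t 1 (fun t => c + r * t) r by apply: is_derive_eq; rewrite /GRing.scale /=; ring.
    exact: is_derive_continuous (is_derive_gerf_comp d).
  have ee1 : (fun t => u2 s0 - t) = fun t => u2 s0 + (-1) * t by apply/funext => t; rewrite mulN1r.
  have cE : continuous (E s0).
    by rewrite (_ : E s0 = fun t => expR (- pi * (u2 s0 + (-1) * t) ^+ 2)) //; apply/funext => t; rewrite /E mulN1r.
  have cM (h k : R -> R) : continuous h -> continuous k -> continuous (fun t => h t * k t).
    by move=> ch ck t; exact: (continuousM (ch t) (ck t)).
  have c1 : continuous (fun t => - (2 * pi * (u2 s0 - t) * u2' s0)).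
    rewrite (_ : (fun t => _) = fun t => - (2 * pi * u2' s0 * u2 s0) + (2 * pi * u2' s0) * t); first exact: cl.
    by apply/funext => r; ring.
  have c2 := cM _ _ (cM _ _ c1 cE) (cge (u1 s0) (al s0)).
  have cst2 : continuous (fun _ : R => 2 : R) by exact: cst_continuous.
  have c3 := cM _ _ cE (cM _ _ (cM _ _ cst2 (cgs (u1 s0) (al s0))) (cl (u1' s0) (al' s0))).
  by move=> t; exact: (continuousD (c2 t) (c3 t)).
- have mf0 : measurable_fun setT (f0 s0).
    rewrite /f0; apply: measurable_funD; apply: measurable_funM.
    + apply: measurable_funM => //; apply: measurable_funN; apply: measurable_funM => //; apply: measurable_funM => //; exact: measurable_funB.
    + by apply: (measurableT_comp measurable_gerf); apply: measurable_funD => //; exact: measurable_funM.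
    + exact: mE.
    + apply: measurable_funM; last by apply: measurable_funD => //; exact: measurable_funM.
      apply: measurable_funM => //; apply: (measurableT_comp (@measurable_expR R)); apply: measurable_funM => //.
      by apply: measurable_funX; apply: measurable_funD => //; exact: measurable_funM.
  apply: le_integrable iG => //; first exact/measurable_EFinP.
  by move=> t _; rewrite /= lee_fin (le_trans (f0G' s0 t _)) ?subrr ?normr0 // ler_norm.
have sq (x y : nat -> R) : (forall n, `|x n| <= 2 * y n) -> y n @[n --> \oo] --> (0 : R) -> x n @[n --> \oo] --> (0 : R).
  move=> xy b0; have b2 := cvgM (@cvg_cst _ (2 : R) nat \oo _) b0; rewrite mulr0 in b2.
  have {}b2 : (2 * y n) @[n --> \oo] --> (0 : R) by exact: (b2 _ _).
  apply: norm_cvg0; apply: (@squeeze_cvgr _ _ _ _ (fun=> 0) (fun n => 2 * y n)) => //; last exact: cvg_cst.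
  by near=> n; rewrite normr_ge0 xy.
have k1 : (E s0 n%:R * gerf (u1 s0 + al s0 * n%:R)) @[n --> \oo] --> (0 : R).
  apply: (sq _ (fun n => expR (- pi * (1 * (- n%:R) + u2 s0) ^+ 2))) => [n|]; last exact: gauss_tailN.
  rewrite normrM mulrC ler_pM ?gerf_bound // ger0_norm ?expR_ge0 // /E mul1r [- n%:R + _]addrC //.
have k2 : (E s0 (- n%:R) * gerf (u1 s0 + al s0 * (- n%:R))) @[n --> \oo] --> (0 : R).
  apply: (sq _ (fun n => expR (- pi * (1 * n%:R + u2 s0) ^+ 2))) => [n|]; last exact: gauss_tail.
  rewrite normrM mulrC ler_pM ?gerf_bound // ger0_norm ?expR_ge0 // /E mul1r opprK [n%:R + _]addrC //.
have k3 := gerf_tails w2 r0; have k4 := gauss_tail (- w2) r0; have k5 := gauss_tailN (- w2) r0.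
have cM (c : R) (x : nat -> R) : x n @[n --> \oo] --> (0 : R) -> (c * x n) @[n --> \oo] --> (0 : R).
  by move=> h; have h' := cvgM (@cvg_cst _ c nat \oo _) h; rewrite mulr0 in h'; exact: (h' _ _).
have cD (x y : nat -> R) : x n @[n --> \oo] --> (0 : R) -> y n @[n --> \oo] --> (0 : R) ->
    (x n + y n) @[n --> \oo] --> (0 : R).
  by move=> h h'; have h2 := cvgD h h'; rewrite addr0 in h2; exact: (h2 _).
rewrite (_ : (fun n : nat => _) = fun n : nat =>
   (- u2' s0) * (E s0 n%:R * gerf (u1 s0 + al s0 * n%:R) + E s0 (- n%:R) * gerf (u1 s0 + al s0 * (- n%:R)))
   + X * (ca * (gerf (rho * n%:R - w2) + gerf (rho * (- n%:R) - w2)) +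
     cb * (expR (- pi * (rho * n%:R + - w2) ^+ 2) + expR (- pi * (rho * (- n%:R) + - w2) ^+ 2)))); last first.
  by apply/funext => n; rewrite /Gf; ring.
exact: (cD _ _ (cM _ _ (cD _ _ k1 k2)) (cM _ _ (cD _ _ (cM _ _ k3) (cM _ _ (cD _ _ k4 k5))))).
Unshelve. all: by end_near. Qed.

End ErrorFunction.

Lemma ker_nontrivial (F : fieldType) m n (M : 'M[F]_(m, n)) : (n < m)%N ->
  exists2 v : 'rV[F]_m, v != 0 & v *m M = 0.
Proof.
move=> nm; have : kermx M != 0.
  by rewrite -mxrank_eq0 mxrank_ker subn_eq0 -ltnNge (leq_ltn_trans (rank_leq_col M)).
by move=> /rowV0Pn[v /sub_kermxP v0 vn]; exists v.
Qed.

(** * The bilinear form and its signature *)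

Section Bilinear.
Variables (R : realType) (n : nat) (A : 'M[R]_n).
Implicit Types v w x y : 'rV[R]_n.

Lemma BDl v w x : B A (v + w) x = B A v x + B A w x.
Proof. by rewrite /B !mulmxDl mxE. Qed.
Lemma BDr v w x : B A x (v + w) = B A x v + B A x w.
Proof. by rewrite /B linearD mulmxDr mxE. Qed.
Lemma BZl a v x : B A (a *: v) x = a * B A v x.
Proof. by rewrite /B -!scalemxAl mxE. Qed.
Lemma BZr a v x : B A x (a *: v) = a * B A x v.
Proof. by rewrite /B linearZ /= -scalemxAr mxE. Qed.
Lemma BNl v x : B A (- v) x = - B A v x.
Proof. by rewrite -scaleN1r BZl mulN1r. Qed.
Lemma BNr v x : B A x (- v) = - B A x v.
Proof. by rewrite -scaleN1r BZr mulN1r. Qed.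
Lemma B0l x : B A 0 x = 0. Proof. by rewrite -(scale0r 0) BZl mul0r. Qed.

Hypothesis A_sym : A^T = A.

Lemma BC v w : B A v w = B A w v.
Proof.
have e : (w *m A *m v^T) = (v *m A *m w^T)^T by rewrite !trmx_mul trmxK A_sym mulmxA.
by rewrite /B e [in RHS]mxE.
Qed.

Lemma QD v w : Q A (v + w) = Q A v + 2 * B A v w + Q A w.
Proof. by rewrite /Q !(BDl, BDr) (BC w v); ring. Qed.

Lemma QZ a v : Q A (a *: v) = a ^+ 2 * Q A v.
Proof. by rewrite /Q BZl BZr mulrA expr2. Qed.

(** Gram-Schmidt without square roots: [Bt] is the form on the components orthogonal to [c1], [Bp]
    on those orthogonal to [c1] and [c2], and [Qp] is the square of the projection to their span. *)
Definition Bt c1 v w : R := B A v w - B A v c1 * B A c1 w / Q A c1.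
Definition Bp c1 c2 v w : R := Bt c1 v w - Bt c1 v c2 * Bt c1 c2 w / Bt c1 c2 c2.
Definition Qp c1 c2 x : R := B A c1 x ^+ 2 / Q A c1 + Bt c1 c2 x ^+ 2 / Bt c1 c2 c2.

Lemma Bt_sym c1 v w : Bt c1 v w = Bt c1 w v.
Proof. by rewrite /Bt (BC v w) (BC v c1) (BC c1 w) [B A c1 v * _]mulrC. Qed.

Lemma Qp_Bp c1 c2 x : Q A x = Qp c1 c2 x + Bp c1 c2 x x.
Proof.
have -> : Q A x = B A c1 x ^+ 2 / Q A c1 + Bt c1 x x by rewrite /Q /Bt (BC x c1); ring.
by rewrite /Qp /Bp (Bt_sym c1 x c2); ring.
Qed.

Section Signature.
Hypothesis A_sig : has_signature A 2 (n - 2).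

Lemma signature_coordinates : exists P : 'M[R]_n, P \in unitmx /\
  forall y : 'rV[R]_n, Q A (y *m P) = \sum_(i < n) (if (i < 2)%N then 1 else -1) * y 0 i ^+ 2.
Proof.
have [_ [P Pu hP]] := A_sig; exists P; split=> // y.
have -> : Q A (y *m P) = qf (P *m A *m P^T) y by rewrite /Q /B /qf trmx_mul !mulmxA.
rewrite hP qfE; apply: eq_bigr => i _; rewrite (bigD1 i) //= big1 => [|j ji]; last first.
  by rewrite !mxE [i == j]eq_sym (negbTE ji) mulr0n mulr0 mul0r.
by rewrite !mxE eqxx mulr1n addr0 expr2; ring.
Qed.

Lemma sig_n2 : (2 <= n)%N.
Proof. by have [h _] := A_sig; lia. Qed.

(** Otherwise [c1], [c2], [z] would span a space of dimension 3 on which the form is nonnegative,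
    and this space meets the negative definite subspace of codimension 2 where the first two
    diagonal coordinates vanish. *)
Lemma neg_complement c1 c2 z : 0 < Q A c1 -> 0 < Q A c1 * Q A c2 - B A c1 c2 ^+ 2 ->
  z != 0 -> B A c1 z = 0 -> B A c2 z = 0 -> Q A z < 0.
Proof.
move=> q1 d12 z0 o1 o2; rewrite ltNge; apply/negP => qz.
have [P [Pu hP]] := signature_coordinates; have n2 := sig_n2.
pose i0 : 'I_n := Ordinal (ltnW n2); pose i1 : 'I_n := Ordinal n2.
have [co [coD coZ coP]] : exists co : 'rV[R]_n -> 'rV[R]_n, [/\ forall v w, co (v + w) = co v + co w,
    forall a v, co (a *: v) = a *: co v & forall v, co v *m P = v].
  exists (fun v => v *m invmx P); split=> [v w|a v|v]; first by rewrite mulmxDl.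
    by rewrite scalemxAl.
  by rewrite mulmxKV.
(* A kernel vector of the three pairs of positive coordinates is a nontrivial combination of [c1],
   [c2], [z] lying in the negative definite subspace. *)
pose M : 'M[R]_(3, 2) := \matrix_(i, j) co (nth 0 [:: c1; c2; z] i) 0 (if j == 0 then i0 else i1).
have [v v0 vM] := ker_nontrivial M (ltnSn 2).
pose a := v 0 0; pose b := v 0 1; pose t := v 0 2.
pose w := a *: c1 + b *: c2 + t *: z.
have cw i : co w 0 i = a * co c1 0 i + b * co c2 0 i + t * co z 0 i.
  by rewrite /w !coD !coZ !mxE.
have hc (j : 'I_2) : co w 0 (if j == 0 then i0 else i1) = 0.
  move/rowP/(_ j): vM; rewrite !mxE !big_ord_recl big_ord0 !mxE /= => e.
  rewrite cw -[RHS]e addr0 !addrA /a /b /t.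
  have -> : lift ord0 (ord0 : 'I_2) = 1 :> 'I_3 by exact: val_inj.
  have -> : lift ord0 (lift ord0 (ord0 : 'I_1)) = 2 :> 'I_3 by exact: val_inj.
  by [].
have qw : Q A w <= 0.
  rewrite -(coP w) hP; apply: sumr_le0 => i _; case: ifP => i2; last by rewrite mulN1r oppr_le0 sqr_ge0.
  have [e|e] : i = i0 \/ i = i1.
    case: i i2 => -[|[|k]] hk // _; [left|right]; exact: val_inj.
    by rewrite e (hc 0) expr0n mulr0.
  by rewrite e (hc 1) expr0n mulr0.
have qw2 : Q A w = Q A (a *: c1 + b *: c2) + t ^+ 2 * Q A z.
  by rewrite /w QD QZ BDl !BZl !BZr o1 o2; ring.
have qab : Q A c1 * Q A (a *: c1 + b *: c2) = (a * Q A c1 + b * B A c1 c2) ^+ 2 + b ^+ 2 * (Q A c1 * Q A c2 - B A c1 c2 ^+ 2).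
  by rewrite QD !QZ BZl BZr; ring.
have ge1 : 0 <= Q A (a *: c1 + b *: c2).
  by rewrite -(pmulr_rge0 _ q1) qab addr_ge0 ?sqr_ge0 // mulr_ge0 ?sqr_ge0 // ltW.
have ge2 : 0 <= t ^+ 2 * Q A z by rewrite mulr_ge0 ?sqr_ge0.
have e1 : Q A (a *: c1 + b *: c2) = 0 by lra.
have qab1 := qab; rewrite e1 mulr0 in qab1.
have b0 : b = 0.
  have hb : b ^+ 2 * (Q A c1 * Q A c2 - B A c1 c2 ^+ 2) = 0.
    have := sqr_ge0 (a * Q A c1 + b * B A c1 c2); have := mulr_ge0 (sqr_ge0 b) (ltW d12); lra.
  by move/eqP: hb; rewrite mulf_eq0 (gt_eqF d12) orbF sqrf_eq0 => /eqP.
have a0 : a = 0.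
  move: qab1; rewrite b0 expr0n !mul0r !addr0 => /esym/eqP.
  by rewrite sqrf_eq0 mulf_eq0 (gt_eqF q1) orbF => /eqP.
have w0 : w = 0.
  have qw0 : Q A w = 0 by rewrite qw2 e1 add0r; move: qw; rewrite qw2 e1; lra.
  have ew : w = co w *m P by rewrite coP.
  suff : co w = 0 by move=> hc0; rewrite ew hc0 mul0mx.
  have := qw0; rewrite ew hP.
  have h (k : 'I_n) : (if (k < 2)%N then 1 else -1) * co w 0 k ^+ 2 = - (co w 0 k ^+ 2).
    case: ifP => k2; last by rewrite mulN1r.
    have [e|e] : k = i0 \/ k = i1.
      case: k k2 => -[|[|k]] hk // _; [left|right]; exact: val_inj.
      by rewrite e (hc 0) expr0n mulr0 oppr0.
    by rewrite e (hc 1) expr0n mulr0 oppr0.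
  under eq_bigr do rewrite h; rewrite sumrN => /eqP; rewrite oppr_eq0 => /eqP.
  move=> hs; have c0 : co w = 0 by apply: nsq_eq0.
  by rewrite -ew.
have t0 : t = 0.
  move: w0; rewrite /w a0 b0 !scale0r !add0r => /eqP; rewrite scaler_eq0 (negbTE z0) orbF => /eqP //.
case/negP: v0; apply/eqP/rowP => i; rewrite mxE.
by case: i => -[|[|[|k]]] hk //; [rewrite -[RHS]a0|rewrite -[RHS]b0|rewrite -[RHS]t0]; congr (v 0 _); exact: val_inj.
Qed.

(** A converse of [neg_complement]. A fixed positive plane pairs nondegenerately with [c1], [c2], so
    it contains a vector [p] with the same pairings as [c]. The difference is orthogonal to [c],
    giving [Q c = Q p - Q (p - c) >= 0], and equality would place [c] in its own orthogonal
    complement. *)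
Lemma span_pos c1 c2 (K1 : forall x, x != 0 -> B A c1 x = 0 -> B A c2 x = 0 -> Q A x < 0) a b :
  (a != 0) || (b != 0) -> 0 < Q A (a *: c1 + b *: c2).
Proof.
move=> ab; have [P [Pu hP]] := signature_coordinates; have n2 := sig_n2.
pose i0 : 'I_n := Ordinal (ltnW n2); pose i1 : 'I_n := Ordinal n2.
pose e (y0 y1 : R) : 'rV[R]_n := \row_i (if i == i0 then y0 else if i == i1 then y1 else 0).
pose p (y0 y1 : R) := e y0 y1 *m P.
have qp (y0 y1 : R) : Q A (p y0 y1) = y0 ^+ 2 + y1 ^+ 2.
  rewrite hP (bigD1 i0) //= (bigD1 i1) //= big1 => [|i /andP[h0 h1]].
    by rewrite !mxE !mul1r eqxx addr0.
  by rewrite !mxE (negbTE h0) (negbTE h1) expr0n mulr0.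
have pl (y0 y1 : R) : p y0 y1 = y0 *: p 1 0 + y1 *: p 0 1.
  rewrite /p !scalemxAl -mulmxDl; congr (_ *m P); apply/rowP => i; rewrite !mxE.
  by case: (i == i0); case: (i == i1); rewrite ?(mulr1, mulr0, addr0, add0r).
pose t11 := B A c1 (p 1 0); pose t12 := B A c1 (p 0 1).
pose t21 := B A c2 (p 1 0); pose t22 := B A c2 (p 0 1).
have B1 (y0 y1 : R) : B A c1 (p y0 y1) = y0 * t11 + y1 * t12 by rewrite pl BDr !BZr.
have B2 (y0 y1 : R) : B A c2 (p y0 y1) = y0 * t21 + y1 * t22 by rewrite pl BDr !BZr.
have key (y0 y1 : R) : y0 * t11 + y1 * t12 = 0 -> y0 * t21 + y1 * t22 = 0 -> y0 = 0 /\ y1 = 0.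
  move=> h1 h2; have [pz|pn] := eqVneq (p y0 y1) 0.
    have := qp y0 y1; rewrite pz /Q B0l => /esym/eqP; rewrite paddr_eq0 ?sqr_ge0 // !sqrf_eq0.
    by move=> /andP[/eqP -> /eqP ->].
  have := K1 _ pn; rewrite B1 B2 => /(_ h1 h2); rewrite qp ltNge addr_ge0 ?sqr_ge0 //.
pose d := t11 * t22 - t12 * t21.
have d0 : d != 0.
  apply/eqP => hd; have [h1 h2] := key t22 (- t21) ltac:(rewrite -[RHS]hd /d; ring) ltac:(ring).
  have [h3 h4] := key (- t12) t11 ltac:(ring) ltac:(rewrite -[RHS]hd /d; ring).
  have h21 : t21 = 0 by apply/eqP; rewrite -oppr_eq0 h2.
  have h12 : t12 = 0 by apply/eqP; rewrite -oppr_eq0 h3.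
  have [/eqP] := key 1 0 ltac:(rewrite h4; ring) ltac:(rewrite h21; ring).
  by rewrite oner_eq0.
set c := a *: c1 + b *: c2.
have c0 : c != 0.
  apply/eqP => hc.
  have e1 : a * t11 + b * t21 = 0 by rewrite -!BZl -BDl -/c hc B0l.
  have e2 : a * t12 + b * t22 = 0 by rewrite -!BZl -BDl -/c hc B0l.
  have ad : a * d = 0.
    have -> : a * d = t22 * (a * t11 + b * t21) - t21 * (a * t12 + b * t22) by rewrite /d; ring.
    by rewrite e1 e2 !mulr0 subrr.
  have bd : b * d = 0.
    have -> : b * d = t11 * (a * t12 + b * t22) - t12 * (a * t11 + b * t21) by rewrite /d; ring.
    by rewrite e1 e2 !mulr0 subrr.
  move: ab; move/eqP: ad; move/eqP: bd; rewrite !mulf_eq0 (negbTE d0) !orbF => /eqP -> /eqP ->.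
  by rewrite !eqxx.
pose g1 := B A c1 c; pose g2 := B A c2 c.
pose y0 : R := (g1 * t22 - g2 * t12) / d; pose y1 : R := (t11 * g2 - t21 * g1) / d.
pose x := p y0 y1 - c.
have o1 : B A c1 x = 0 by rewrite BDr BNr B1 -/g1 /y0 /y1 /d; field; exact: d0.
have o2 : B A c2 x = 0 by rewrite BDr BNr B2 -/g2 /y0 /y1 /d; field; exact: d0.
have ox : B A c x = 0 by rewrite /c BDl !BZl o1 o2 !mulr0 addr0.
have qx : Q A x <= 0.
  by have [->|/K1 h] := eqVneq x 0; [rewrite /Q B0l|exact: ltW (h o1 o2)].
have qc : Q A c = y0 ^+ 2 + y1 ^+ 2 - Q A x.
  by rewrite -qp (_ : p y0 y1 = c + x) ?QD ?ox; [ring|rewrite /x addrC subrK].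
rewrite lt_neqAle; apply/andP; split; last by rewrite qc addr_ge0 ?addr_ge0 ?sqr_ge0 ?oppr_ge0.
apply/eqP => q0.
have y00 : y0 ^+ 2 + y1 ^+ 2 = 0.
  apply/eqP; rewrite eq_le addr_ge0 ?sqr_ge0 // andbT; lra.
have : p y0 y1 = 0.
  move/eqP: y00; rewrite paddr_eq0 ?sqr_ge0 // !sqrf_eq0 => /andP[/eqP -> /eqP ->].
  by rewrite pl !scale0r addr0.
move=> pz; have g10 : g1 = 0 by move: o1; rewrite /x pz sub0r BNr -/g1; lra.
have g20 : g2 = 0 by move: o2; rewrite /x pz sub0r BNr -/g2; lra.
by have := K1 c c0 g10 g20; rewrite -q0 ltxx.
Qed.

End Signature.
End Bilinear.

(** * Sign conditions: every plane over the square is positive definite *)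

Section GoodPosition.
Variables (R : realType) (n : nat) (A : 'M[R]_n) (C1 C1' C2 C2' : 'rV[R]_n).
Hypothesis A_sym : A^T = A.
Hypothesis A_sig : has_signature A 2 (n - 2).
Let s4 := [:: C1; C1'; C2; C2'].
Let G : 'M[R]_4 := gram A s4.

Lemma det22 (M : 'M[R]_2) : \det M = M 0 0 * M 1 1 - M 0 1 * M 1 0.
Proof.
rewrite (expand_det_row _ 0) !big_ord_recl big_ord0 addr0 /cofactor !det_mx11 !mxE /=.
have -> : lift ord0 (ord0 : 'I_1) = 1 :> 'I_2 by exact: val_inj.
have -> : lift (1 : 'I_2) (0 : 'I_1) = 0 :> 'I_2 by exact: val_inj.
by rewrite /= expr0 expr1; ring.
Qed.

Lemma Delta2 v w : Delta A [:: v; w] = Q A v * Q A w - B A v w ^+ 2.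
Proof. by rewrite /Delta (det22 (gram A [:: v; w])) !mxE /= /Q (BC A_sym w v); ring. Qed.

Lemma gram_sym : G^T = G.
Proof. by apply/matrixP => i j; rewrite !mxE BC. Qed.

Lemma cofactor_sym i j : cofactor G i j = cofactor G j i.
Proof. by rewrite -cofactor_tr gram_sym. Qed.

Lemma inord_id m (i : 'I_m.+1) k : nat_of_ord i = k -> inord k = i.
Proof. by move=> <-; rewrite inord_val. Qed.

Lemma cofactor_diag (i : 'I_4) :
  cofactor G i i = Delta A (nth [::] [:: [:: C1'; C2; C2']; [:: C1; C2; C2']; [:: C1; C1'; C2']; [:: C1; C1'; C2]] i).
Proof.
case: i => -[|[|[|[|k]]]] hk //; rewrite /cofactor addnn -signr_odd odd_double expr0 mul1r /Delta;
  congr (\det _); apply/matrixP => -[[|[|[|a]]] ha] -[[|[|[|b]]] hb] //; rewrite !mxE; reflexivity.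
Qed.

Hypothesis Delta_pos : 0 < Delta A s4.
Hypothesis D_11' : 0 <= cofactor G (inord 0) (inord 1).
Hypothesis D_22' : 0 <= cofactor G (inord 2) (inord 3).
Hypothesis M_neg : neg_definite (matrixM A C1 C1' C2 C2').
Hypothesis Q_C1 : 0 < Q A C1.
Hypothesis Delta_12 : 0 < Delta A [:: C1; C2].

(** Split [x] into its projection to the span of the four vectors and an orthogonal remainder, where
    the form is nonpositive. On the span the form is the inverse Gram matrix evaluated on the four
    pairings; its adjugate is [matrixM] plus the two entries that [matrixM] omits, and these
    multiply exactly the products assumed nonpositive. *)
Lemma neg_on_orthogonal x : x != 0 ->
  B A C1 x * B A C1' x <= 0 -> B A C2 x * B A C2' x <= 0 -> Q A x < 0.
Proof.
move=> x0 h1 h2.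
pose Cm : 'M[R]_(4, n) := \matrix_i s4`_i.
have CmE i : row i Cm = s4`_i by rewrite rowK.
have dotrow (y : 'rV[R]_n) i : (y *m (row i Cm)^T) 0 0 = (y *m Cm^T) 0 i.
  by rewrite !mxE; apply: eq_bigr => k _; rewrite !mxE.
have GE : G = Cm *m A *m Cm^T.
  by apply/matrixP => i j; rewrite [LHS]mxE -!CmE /B dotrow -!row_mul [LHS]mxE.
have Gu : G \in unitmx by rewrite unitmxE unitfE gt_eqF.
pose xi := x *m A *m Cm^T.
have xiE i : xi 0 i = B A s4`_i x.
  by rewrite (BC A_sym) -CmE /B dotrow.
pose xp := xi *m invmx G *m Cm; pose xo := x - xp.
have oA : xo *m A *m Cm^T = 0.
  have e : xp *m A *m Cm^T = xi.
    by rewrite /xp -2!mulmxA (mulmxA Cm) -GE -mulmxA mulVmx // mulmx1.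
  have -> : xo *m A *m Cm^T = xi - xp *m A *m Cm^T by rewrite /xo /xi; move: (Cm^T) => T; rewrite mulmxBl mulmxBl.
  by rewrite e subrr.
have Bo (i : 'I_4) : B A s4`_i xo = 0.
  by rewrite (BC A_sym) -CmE /B dotrow oA mxE.
have Bpo : B A xp xo = 0.
  rewrite (BC A_sym) /B /xp trmx_mul mulmxA oA mul0mx mxE //.
have qx : Q A x = Q A xp + Q A xo.
  by rewrite -{1}(subrK xp x) -/xo addrC QD // Bpo mulr0 addr0.
have qp : Q A xp = qf (invmx G) xi.
  rewrite /Q /B /xp /qf !trmx_mul trmx_inv gram_sym !mulmxA -(mulmxA _ Cm) -(mulmxA _ (Cm *m A)).
  by rewrite -!mulmxA (mulmxA Cm) (mulmxA (Cm *m A)) -GE !mulmxA mulmxK.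
(* The adjugate of the Gram matrix, with the entries [D_11'] and [D_22'] separated from
   [matrixM]. *)
have qp2 : \det G * Q A xp = (xi *m matrixM A C1 C1' C2 C2' *m xi^T) 0 0
     + 2 * cofactor G (inord 0) (inord 1) * (B A C1 x * B A C1' x)
     + 2 * cofactor G (inord 2) (inord 3) * (B A C2 x * B A C2' x).
  rewrite qp /invmx Gu qf_scale mulrA mulfV ?mul1r; last by rewrite gt_eqF.
  rewrite -[(xi *m _ *m _) 0 0]/(qf _ xi) !qfE !big_ord_recl !big_ord0 !addr0.
  have i0 : inord 0 = ord0 :> 'I_4 by exact: inord_id.
  have i1 : inord 1 = lift ord0 ord0 :> 'I_4 by exact: inord_id.
  have i2 : inord 2 = lift ord0 (lift ord0 ord0) :> 'I_4 by exact: inord_id.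
  have i3 : inord 3 = lift ord0 (lift ord0 (lift ord0 ord0)) :> 'I_4 by exact: inord_id.
  rewrite !xiE /matrixM /matrix4 -/s4 -/G i0 i1 i2 i3.
  set o1 := lift ord0 ord0; set o2 := lift ord0 (lift ord0 ord0); set o3 := lift ord0 (lift _ _).
  rewrite ![(\adj G) _ _]mxE ![(\matrix_(i, j) _) _ _]mxE /=.
  rewrite (cofactor_diag ord0) (cofactor_diag o1) (cofactor_diag o2) (cofactor_diag o3) /=.
  rewrite (cofactor_sym o1 ord0) (cofactor_sym o2 ord0) (cofactor_sym o3 ord0) (cofactor_sym o2 o1) (cofactor_sym o3 o1) (cofactor_sym o3 o2).
  ring.
have qo : Q A xo <= 0.
  have [->|xo0] := eqVneq xo 0; first by rewrite /Q B0l.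
  apply: ltW; apply: (neg_complement A_sym A_sig Q_C1 _ xo0 (Bo 0) (Bo 2)).
  by rewrite -Delta2.
have [xi0|xin] := eqVneq xi 0.
  have ex : x = xo by rewrite /xo /xp xi0 !mul0mx subr0.
  rewrite ex in x0 *; apply: (neg_complement A_sym A_sig Q_C1 _ x0 (Bo 0) (Bo 2)).
  by rewrite -Delta2.
rewrite qx; suff : Q A xp < 0 by lra.
have dG : 0 < \det G by [].
rewrite -(pmulr_rlt0 _ dG) qp2.
have := M_neg xin; have := mulr_ge0_le0 D_11' h1; have := mulr_ge0_le0 D_22' h2.
move: ((_ *m _ *m _) 0 0) (cofactor _ _ _) (cofactor _ _ _) (_ * B A C1' x) (_ * B A C2' x) => a d1 d2 e1 e2 f1 f2 a0.
rewrite -!mulrA; lra.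
Qed.

Lemma between_signs (s a b : R) : 0 <= s <= 1 -> (1 - s) * a + s * b = 0 -> a * b <= 0.
Proof.
move=> /andP[s0 s1] h; case: (ltrgtP s 1) s1 => // [s1 _|e _]; last first.
  by move: h; rewrite e subrr mul0r add0r mul1r => ->; rewrite mulr0.
have t0 : 0 < 1 - s by lra.
rewrite -(pmulr_rle0 _ t0) mulrA (_ : (1 - s) * a = - (s * b)); last by lra.
by rewrite mulNr oppr_le0 -mulrA mulr_ge0 // -expr2 sqr_ge0.
Qed.

Definition seg (v v' : 'rV[R]_n) (s : R) := v + s *: (v' - v).

Lemma B_seg v v' s x : B A (seg v v' s) x = B A v x + s * B A (v' - v) x.
Proof. by rewrite /seg BDl BZl. Qed.

(** If [x] is orthogonal to a point of a segment, its pairings with the two ends have opposite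
    signs, which is what [neg_on_orthogonal] asks for. *)
Lemma good_K1 (s u : R) x : 0 <= s <= 1 -> 0 <= u <= 1 -> x != 0 ->
  B A (seg C1 C1' s) x = 0 -> B A (seg C2 C2' u) x = 0 -> Q A x < 0.
Proof.
move=> s01 u01 x0 h1 h2; apply: neg_on_orthogonal => //.
  by apply: (between_signs s01); rewrite -[RHS]h1 B_seg BDl BNl; ring.
by apply: (between_signs u01); rewrite -[RHS]h2 B_seg BDl BNl; ring.
Qed.

Section Square.
Variables s u : R.
Hypotheses (s01 : 0 <= s <= 1) (u01 : 0 <= u <= 1).
Let c1 := seg C1 C1' s.
Let c2 := seg C2 C2' u.
Let sp := span_pos A_sym A_sig (fun x x0 => @good_K1 s u x s01 u01 x0).

Lemma good_Q1 : 0 < Q A c1.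
Proof. by have := @sp 1 0; rewrite oner_eq0 scale1r scale0r addr0 => /(_ isT). Qed.

Lemma good_Q2 : 0 < Q A c2.
Proof. by have := @sp 0 1; rewrite oner_eq0 orbT scale1r scale0r add0r => /(_ isT). Qed.

Lemma good_D : 0 < Bt A c1 c2 c2.
Proof.
have q1 := good_Q1; have := @sp (- (B A c1 c2 / Q A c1)) 1; rewrite oner_eq0 orbT => /(_ isT).
rewrite -/c1 -/c2 scale1r QD // QZ // BZl.
rewrite (_ : _ + _ = Bt A c1 c2 c2) // /Bt (BC A_sym c2 c1) -/(Q A c2); field.
by rewrite gt_eqF.
Qed.

(** With [xo] the component of [x] orthogonal to the plane, [2 Qp - Q = Qp - Q xo]: the second term
    is positive unless [xo = 0], and then the first one is. *)
Lemma good_majorant x : x != 0 -> 0 < 2 * Qp A c1 c2 x - Q A x.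
Proof.
move=> x0; have q1 := good_Q1; have d0 := good_D.
pose t := Bt A c1 c2 x / Bt A c1 c2 c2; pose r := (B A c1 x - t * B A c1 c2) / Q A c1.
pose xo := x - r *: c1 - t *: c2.
have o1 : B A c1 xo = 0.
  rewrite /xo !BDr !BNr !BZr -/(Q A c1) /r; field; by rewrite gt_eqF.
have o2 : B A c2 xo = 0.
  have e : B A c2 xo = Bt A c1 c2 x - t * Bt A c1 c2 c2.
    rewrite /xo !BDr !BNr !BZr /r /Bt (BC A_sym c2 c1); field; by rewrite gt_eqF.
  by rewrite e /t divfK ?subrr // gt_eqF.
have Qp0 : 0 <= Qp A c1 c2 x.
  by rewrite /Qp addr_ge0 // divr_ge0 ?sqr_ge0 // ltW.
have bp : Bp A c1 c2 x x = Q A xo.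
  have h : Q A x = Qp A c1 c2 x + Q A xo.
    have -> : Q A x = Q A ((r *: c1 + t *: c2) + xo) by congr (Q A _); rewrite /xo; apply/rowP => i; rewrite !mxE; ring.
    rewrite [LHS]QD // BDl !BZl o1 o2 !mulr0 addr0 mulr0 addr0; congr (_ + _).
    rewrite QD // !QZ // BZl BZr /Qp /r.
    have -> : Bt A c1 c2 x = t * Bt A c1 c2 c2 by rewrite /t divfK // gt_eqF.
    have -> : Q A c2 = Bt A c1 c2 c2 + B A c1 c2 ^+ 2 / Q A c1.
      by rewrite /Bt (BC A_sym c2 c1) -/(Q A c2); ring.
    by field; rewrite !gt_eqF.
  by move: h; rewrite (Qp_Bp A_sym c1 c2 x) => /addrI.
rewrite (Qp_Bp A_sym c1 c2 x) bp.
have [xo0|xon] := eqVneq xo 0; last first.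
  by have := @good_K1 s u xo s01 u01 xon o1 o2; lra.
have q0 : Q A xo = 0 by rewrite xo0 /Q B0l.
suff h : Qp A c1 c2 x != 0.
  have h0 : 0 < Qp A c1 c2 x by rewrite lt_neqAle eq_sym h Qp0.
  by rewrite q0; move: h0; move: (Qp _ _ _ _) => z; lra.
apply/negP => /eqP h; move: h; rewrite /Qp => /eqP.
rewrite paddr_eq0; [|by rewrite divr_ge0 ?sqr_ge0 // ltW|by rewrite divr_ge0 ?sqr_ge0 // ltW].
rewrite !mulf_eq0 !invr_eq0 (gt_eqF q1) (gt_eqF d0) !orbF !orbb => /andP[/eqP b1 /eqP b2].
have bt0 : t = 0 by rewrite /t b2 mul0r.
have br0 : r = 0 by rewrite /r b1 bt0 mul0r subr0 mul0r.
have ex : x = xo by rewrite /xo br0 bt0 !scale0r !subr0.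
by move: x0; rewrite ex xo0 eqxx.
Qed.

End Square.
End GoodPosition.

(** * Continuity of the Gram-Schmidt data *)

Section PointwiseContinuity.
Variables (R : realType) (T : topologicalType).
Implicit Types (f g : T -> R) (t : T).

Definition ctn f t := {for t, continuous f}.

Lemma ctn_cst (a : R) t : ctn (fun=> a) t. Proof. exact: cvg_cst. Qed.
Lemma ctnD f g t : ctn f t -> ctn g t -> ctn (fun t => f t + g t) t.
Proof. exact: cvgD. Qed.
Lemma ctnM f g t : ctn f t -> ctn g t -> ctn (fun t => f t * g t) t.
Proof. exact: cvgM. Qed.
Lemma ctnN f t : ctn f t -> ctn (fun t => - f t) t.
Proof. exact: cvgN. Qed.
Lemma ctnV f t : f t != 0 -> ctn f t -> ctn (fun t => (f t)^-1) t.
Proof. by move=> f0 cf; exact: cvgV. Qed.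
Lemma ctnX f k t : ctn f t -> ctn (fun t => f t ^+ k) t.
Proof.
move=> cf; elim: k => [|k ih]; first by under eq_fun do rewrite expr0; exact: ctn_cst.
by under eq_fun do rewrite exprS; exact: ctnM.
Qed.
Lemma ctn_comp (h : R -> R) f t : ctn f t -> {for f t, continuous h} -> ctn (fun t => h (f t)) t.
Proof. exact: continuous_comp. Qed.
Lemma ctn_sqrt f t : ctn f t -> ctn (fun t => Num.sqrt (f t)) t.
Proof. by move=> cf; apply: (ctn_comp cf); exact: sqrt_continuous. Qed.
Lemma ctn_expR f t : ctn f t -> ctn (fun t => expR (f t)) t.
Proof. by move=> cf; apply: (ctn_comp cf); exact: continuous_expR. Qed.
Lemma ctn_gerf f t : ctn f t -> ctn (fun t => gerf (f t)) t.
Proof. by move=> cf; apply: (ctn_comp cf); exact: is_derive_continuous (is_derive_gerf _). Qed.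
Lemma ctn_sum (I : finType) (F : I -> T -> R) t : (forall i, ctn (F i) t) -> ctn (fun t => \sum_i F i t) t.
Proof.
move=> h; elim: (index_enum I) => [|i s ih]; first by under eq_fun do rewrite big_nil; exact: ctn_cst.
by under eq_fun do rewrite big_cons; exact: ctnD.
Qed.

Lemma ctn_near (a : R) f t : ctn f t -> a < f t -> \forall s \near t, a < f s.
Proof. by move=> cf; exact: cvgr_gt. Qed.

Variables (n : nat) (A : 'M[R]_n).

Definition vct (c : T -> 'rV[R]_n) t := forall i, ctn (fun t => c t 0 i) t.

Lemma vct_cst v t : vct (fun=> v) t. Proof. by move=> i; exact: ctn_cst. Qed.

Lemma vct_seg v v' f t : ctn f t -> vct (fun t => seg v v' (f t)) t.
Proof.
move=> cf i; rewrite (_ : (fun _ => _) = (fun t => v 0 i + f t * (v' - v) 0 i)).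
  by apply: ctnD; [exact: ctn_cst|apply: ctnM => //; exact: ctn_cst].
by apply/funext => x; rewrite /seg !mxE.
Qed.

Lemma ctn_B c d t : vct c t -> vct d t -> ctn (fun t => B A (c t) (d t)) t.
Proof.
move=> cc cd; rewrite (_ : (fun _ => _) = (fun t => \sum_j (\sum_i c t 0 i * A i j) * d t 0 j)).
  apply: ctn_sum => j; apply: ctnM => //; apply: ctn_sum => i; apply: ctnM => //; exact: ctn_cst.
by apply/funext => x; rewrite /B mxE; apply: eq_bigr => j _; rewrite !mxE.
Qed.

Lemma ctn_Q c t : vct c t -> ctn (fun t => Q A (c t)) t.
Proof. by move=> h; exact: ctn_B. Qed.

Lemma ctn_Bt c v w t : vct c t -> vct v t -> vct w t -> Q A (c t) != 0 -> ctn (fun t => Bt A (c t) (v t) (w t)) t.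
Proof.
move=> cc cv cw q0; apply: ctnD; first exact: ctn_B.
by apply: ctnN; apply: ctnM; [apply: ctnM; exact: ctn_B|apply: ctnV => //; exact: ctn_Q].
Qed.

Lemma ctn_Bp c d v w t : vct c t -> vct d t -> vct v t -> vct w t -> Q A (c t) != 0 -> Bt A (c t) (d t) (d t) != 0 ->
  ctn (fun t => Bp A (c t) (d t) (v t) (w t)) t.
Proof.
move=> cc cd cv cw q0 D0; apply: ctnD; first exact: ctn_Bt.
by apply: ctnN; apply: ctnM; [apply: ctnM; exact: ctn_Bt|apply: ctnV => //; exact: ctn_Bt].
Qed.

Lemma ctn_Qp c d w t : vct c t -> vct d t -> vct w t -> Q A (c t) != 0 -> Bt A (c t) (d t) (d t) != 0 ->
  ctn (fun t => Qp A (c t) (d t) (w t)) t.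
Proof.
move=> cc cd cw q0 D0; apply: ctnD; apply: ctnM.
- by apply: ctnX; exact: ctn_B.
- by apply: ctnV => //; exact: ctn_Q.
- by apply: ctnX; exact: ctn_Bt.
- by apply: ctnV => //; exact: ctn_Bt.
Qed.

End PointwiseContinuity.

(** * Derivatives of error functions along one-parameter families *)

Section ScalarPaths.
Variable R : realType.

Lemma ctn_id (t : R) : ctn (fun t => t) t. Proof. exact: cvg_id. Qed.

(** Regularity is known only for parameters in [0, 1], where the planes are positive definite;
    composing with [clamp] restores continuity on the whole line. *)
Lemma unit_FTC_on (f F : R -> R) : (forall x, 0 <= x <= 1 -> ctn f x) ->
  (forall x : R, 0 <= x <= 1 -> is_derive x 1 F (f x)) -> \int[unitP R]_x f (clamp x) = F 1 - F 0.
Proof.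
move=> cf dF; pose g x := f (clamp x).
have cl (x : R) : 0 <= clamp x <= 1 by rewrite clamp_ge0 clamp_le1.
have cg : continuous g by move=> x; apply: continuous_comp; [exact: continuous_clamp|exact: cf].
transitivity (\int[unitP R]_x g (clamp x)).
  by apply: eq_Rintegral => x _; rewrite /g (clamp_id (cl x)).
rewrite Rintegral_unit // /Rintegral.
have cF (x : R) : 0 <= x <= 1 -> {for x, continuous F} by move=> x01; exact: is_derive_continuous (dF x x01).
have o01 (x : R) : x \in `]0, 1[ -> 0 <= x <= 1 by rewrite in_itv /= => /andP[x0 x1]; rewrite !ltW.
rewrite (@continuous_FTC2 _ _ F) ?ltr01 //.
- exact: continuous_subspaceT.
- split=> [x x01||]; first by have [] := dF x (o01 x x01).
    by apply: cvg_at_right_filter; apply: cF; rewrite lexx ler01.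
  by apply: cvg_at_left_filter; apply: cF; rewrite lexx ler01.
- move=> x x01; rewrite derive1E /g clamp_id; last exact: o01.
  by have d := dF x (o01 x x01); exact: derive_val.
Qed.

Lemma is_derive_sqrt_comp (f : R -> R) (s f' : R) : 0 < f s -> is_derive s 1 f f' ->
  is_derive s 1 (fun s => Num.sqrt (f s)) (f' / (2 * Num.sqrt (f s))).
Proof.
move=> f0 df; have ds := is_derive1_sqrt f0.
by have d := @is_derive1_comp R (@Num.sqrt R) f s _ _ ds df; rewrite mulrC.
Qed.

Lemma is_derive_div (f g : R -> R) (s f' g' : R) : g s != 0 -> is_derive s 1 f f' -> is_derive s 1 g g' ->
  is_derive s 1 (fun s => f s / g s) ((f' * g s - f s * g') / g s ^+ 2).
Proof.
move=> g0 df dg; have dV := is_deriveV g0 dg; have d := is_deriveM df dV.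
apply: is_derive_eq d _; rewrite /GRing.scale /=; field; exact: g0.
Qed.

Lemma is_derive_mul (f g : R -> R) (s f' g' : R) : is_derive s 1 f f' -> is_derive s 1 g g' ->
  is_derive s 1 (fun s => f s * g s) (f' * g s + f s * g').
Proof.
by move=> df dg; have d := is_deriveM df dg; apply: is_derive_eq d _; rewrite /GRing.scale /=; ring.
Qed.

(** Continuity of the derivatives at [s0] supplies the uniform bound and the radius for
    [double_erf_path]. *)
Lemma double_erf_path_near (al u1 al' u1' : R -> R) (u2 s0 : R) :
  (\forall s \near s0, is_derive s (1 : R) al (al' s)) -> (\forall s \near s0, is_derive s (1 : R) u1 (u1' s)) ->
  ctn al' s0 -> ctn u1' s0 ->
  let rho := Num.sqrt (1 + al s0 ^+ 2) in
  let w1 := (u1 s0 + al s0 * u2) / rho in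
  let w2 := (u2 - al s0 * u1 s0) / rho in
  is_derive s0 1 (fun s => double_erf (al s) (u1 s) u2)
    (2 * expR (- pi * w1 ^+ 2) *
       (gerf w2 * (u1' s0 / rho + al' s0 * w2 / rho ^+ 2)
        + al' s0 / (pi * rho ^+ 2) * expR (- pi * w2 ^+ 2))).
Proof.
move=> dal du cal cu rho w1 w2.
have nb (f : R -> R) : ctn f s0 -> \forall s \near s0, `|f s| <= `|f s0| + 1.
  move=> /cvgrPdist_le /(_ 1 ltr01); apply: filterS => s h.
  have := ler_distD (f s) 0 (f s0); rewrite !sub0r !normrN distrC => hh.
  have := ler_normD (f s0) (f s - f s0); rewrite subrKC distrC; lra.
have [e e0 he] : exists2 e, 0 < e & forall s, `|s - s0| < e ->
    [/\ is_derive s (1 : R) al (al' s), is_derive s (1 : R) u1 (u1' s), `|al' s| <= `|al' s0| + 1 & `|u1' s| <= `|u1' s0| + 1].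
  have : \forall s \near s0, [/\ is_derive s (1 : R) al (al' s), is_derive s (1 : R) u1 (u1' s), `|al' s| <= `|al' s0| + 1 & `|u1' s| <= `|u1' s0| + 1].
    near=> s; split; near: s => //; exact: nb.
  by move=> /nbhs_ballP[e e0 he]; exists e => // s hs; apply: he; rewrite -ball_normE /= distrC.
pose K := `|al' s0| + 1 + (`|u1' s0| + 1) + `|u2|.
have K1 : `|al' s0| + 1 <= K by rewrite /K -addrA lerDl !addr_ge0.
have K2 : `|u1' s0| + 1 <= K by rewrite /K [_ + (`|u1' s0| + 1)]addrC -addrA lerDl !addr_ge0.
have K3 : `|u2| <= K by rewrite /K lerDr !addr_ge0.
have p1 (s : R) : `|s - s0| < e -> [/\ is_derive s 1 al (al' s), is_derive s 1 u1 (u1' s) & is_derive s 1 (fun=> u2) (0 : R)].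
  by move=> hs; have [h1 h2 _ _] := he s hs; split=> //; exact: is_derive_cst.
have p2 (s : R) : `|s - s0| < e -> [/\ `|al' s| <= K, `|u1' s| <= K, `|0 : R| <= K & `|u2| <= K].
  move=> hs; have [_ _ h3 h4] := he s hs; split=> //; [exact: le_trans h3 K1|exact: le_trans h4 K2|].
  by rewrite normr0 (le_trans _ K3).
have d := double_erf_path e0 p1 p2; apply: is_derive_eq d _.
by rewrite -/rho -/w1 -/w2 mulr0 !mul0r add0r mulr0 addr0.
Unshelve. all: by end_near. Qed.

(** To be read with [a = Q c1], [q = Q c2], [m = B c1 c2], [b = B c1 x], [b2 = B c2 x], where [c1]
    moves and [c2] is fixed; then [d] is the root of the Gram determinant. The result is a Gaussian
    in the direction of [c1] times one-variable functions of the orthogonal direction. *)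
Lemma double_erf_ds (a m b a' : R -> R) (m' b' q b2 s0 : R) : 0 < q -> 0 < a s0 * q - m s0 ^+ 2 ->
  (forall s : R, is_derive s 1 a (a' s)) -> (forall s : R, is_derive s 1 m m') -> (forall s : R, is_derive s 1 b b') ->
  ctn a' s0 ->
  let d s := Num.sqrt (a s * q - m s ^+ 2) in
  let w2 := (a s0 * b2 - m s0 * b s0) / (d s0 * Num.sqrt (a s0)) in
  is_derive s0 1 (fun s => double_erf (m s / d s) ((q * b s - m s * b2) / (Num.sqrt q * d s)) (b2 / Num.sqrt q))
   (2 * expR (- pi * (b s0 / Num.sqrt (a s0)) ^+ 2) *
     (gerf w2 * ((b' - a' s0 * b s0 / (2 * a s0)) / Num.sqrt (a s0))
      + (m' - a' s0 * m s0 / (2 * a s0)) / d s0 / pi * expR (- pi * w2 ^+ 2))).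
Proof.
move=> q0 D0 da dm db ca' d w2.
pose d' s := (a' s * q - 2 * (m s * m')) / (2 * d s).
have dDl (s : R) : is_derive s 1 (fun s => a s * q - m s ^+ 2) (a' s * q - 2 * (m s * m')).
  have h1 := is_deriveM (da s) (is_derive_cst q s (1 : R)).
  have h2 := is_deriveM (dm s) (dm s).
  have h := is_deriveB h1 h2; apply: is_derive_eq h _; rewrite /GRing.scale /=; ring.
have cont (f : R -> R) f' (s : R) : is_derive s 1 f f' -> ctn f s by exact: is_derive_continuous.
have cDl : ctn (fun s => a s * q - m s ^+ 2) s0 by exact: cont (dDl s0).
have cd : ctn d s0 by exact: ctn_sqrt.
have ca : ctn a s0 by exact: cont (da s0).
have cm : ctn m s0 by exact: cont (dm s0).
have cb : ctn b s0 by exact: cont (db s0).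
have nD : \forall s \near s0, 0 < a s * q - m s ^+ 2 by exact: ctn_near.
have dd (s : R) : 0 < a s * q - m s ^+ 2 -> is_derive s 1 d (d' s).
  by move=> h; exact: (@is_derive_sqrt_comp (fun s => a s * q - m s ^+ 2) s _ h (dDl s)).
have dpos (s : R) : 0 < a s * q - m s ^+ 2 -> d s != 0 by move=> h; rewrite gt_eqF // sqrtr_gt0.
have sq0 : Num.sqrt q != 0 by rewrite gt_eqF // sqrtr_gt0.
have d0 := dpos _ D0.
have cc (x : R) : ctn (fun=> x) s0 by exact: ctn_cst.
have cd' : ctn d' s0.
  apply: ctnM; first by apply: ctnD; [exact: ctnM|apply: ctnN; apply: ctnM => //; exact: ctnM].
  by apply: ctnV; [rewrite mulf_neq0|exact: ctnM].
pose al' s := (m' * d s - m s * d' s) / d s ^+ 2.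
pose u1' s := ((q * b' - m' * b2) * (Num.sqrt q * d s) - (q * b s - m s * b2) * (Num.sqrt q * d' s)) / (Num.sqrt q * d s) ^+ 2.
have := @double_erf_path_near (fun s => m s / d s) (fun s => (q * b s - m s * b2) / (Num.sqrt q * d s)) al' u1' (b2 / Num.sqrt q) s0.
move=> /(_ _)/wrap[|].
  near=> s; have hs : 0 < a s * q - m s ^+ 2 by near: s.
  exact: (@is_derive_div m d s _ _ (dpos s hs) (dm s) (dd s hs)).
move=> /(_ _)/wrap[|].
  near=> s; have hs : 0 < a s * q - m s ^+ 2 by near: s.
  apply: (@is_derive_div (fun s => q * b s - m s * b2) (fun s => Num.sqrt q * d s)); first by rewrite mulf_neq0 // dpos.
    have h1 := is_deriveZ q (db s); have h2 := is_deriveM (dm s) (is_derive_cst b2 s (1 : R)).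
    have h := is_deriveB h1 h2; apply: is_derive_eq h _; rewrite /GRing.scale /=; ring.
  by have h := is_deriveZ (Num.sqrt q) (dd s hs); apply: is_derive_eq h _.
move=> /(_ _)/wrap[|].
  apply: ctnM; last by apply: ctnV; [rewrite expf_neq0|exact: ctnX].
  by apply: ctnD; [exact: ctnM|apply: ctnN; exact: ctnM].
move=> /(_ _)/wrap[|].
  apply: ctnM; last by apply: ctnV; [rewrite expf_neq0 // mulf_neq0|apply: ctnX; exact: ctnM].
  apply: ctnD; first by apply: ctnM => //; exact: ctnM.
  apply: ctnN; apply: ctnM; last exact: ctnM.
  by apply: ctnD; [exact: ctnM|apply: ctnN; exact: ctnM].
move=> /=; move=> dE; apply: is_derive_eq dE _.
have q2 : Num.sqrt q ^+ 2 = q by rewrite sqr_sqrtr // ltW.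
have a0 : 0 < a s0.
  by rewrite -(pmulr_lgt0 _ q0); apply: (le_lt_trans (sqr_ge0 (m s0))); rewrite -subr_gt0.
have a2 : Num.sqrt (a s0) ^+ 2 = a s0 by rewrite sqr_sqrtr // ltW.
have dsq : d s0 ^+ 2 = a s0 * q - m s0 ^+ 2 by rewrite sqr_sqrtr // ltW.
have sa0 : Num.sqrt (a s0) != 0 by rewrite gt_eqF // sqrtr_gt0.
have dp : 0 < d s0 by rewrite sqrtr_gt0.
have rhoE : Num.sqrt (1 + (m s0 / d s0) ^+ 2) = Num.sqrt (a s0) * Num.sqrt q / d s0.
  rewrite (_ : 1 + _ = (Num.sqrt (a s0) * Num.sqrt q / d s0) ^+ 2).
    by rewrite sqrtr_sqr ger0_norm // divr_ge0 ?mulr_ge0 ?sqrtr_ge0.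
  rewrite !expr_div_n exprMn a2 q2 -[1](divff (_ : d s0 ^+ 2 != 0)) ?expf_neq0 //.
  by rewrite -mulrDl dsq subrK.
rewrite rhoE.
have rho2 : (Num.sqrt (a s0) * Num.sqrt q / d s0) ^+ 2 = (d s0 ^+ 2 + m s0 ^+ 2) / d s0 ^+ 2.
  by rewrite expr_div_n exprMn a2 q2 dsq subrK.
rewrite rho2.
rewrite /w2 /al' /u1' /d'.
have aE : a s0 = (d s0 ^+ 2 + m s0 ^+ 2) / Num.sqrt q ^+ 2.
  by rewrite dsq subrK q2 mulfK // gt_eqF.
have dm0 : d s0 ^+ 2 + m s0 ^+ 2 != 0.
  by rewrite gt_eqF // ltr_wpDr ?sqr_ge0 // exprn_gt0.
have p0 : pi != 0 :> R by rewrite gt_eqF // pi_gt0.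
move: (d s0) (m s0) (b s0) (a' s0) (Num.sqrt q) (Num.sqrt (a s0)) q2 aE dm0 p0 sa0 sq0 d0 => D M Bb A' q' sa <- -> dm0 p0 sa0 sq0 d0.
have e1 : (q' ^+ 2 * Bb - M * b2) / (q' * D) + M / D * (b2 / q') = (sa * q' / D) * (Bb / sa).
  by field; rewrite ?d0 ?sq0 ?sa0.
have e2 : (b2 / q' - M / D * ((q' ^+ 2 * Bb - M * b2) / (q' * D))) / (sa * q' / D) =
   ((D ^+ 2 + M ^+ 2) / q' ^+ 2 * b2 - M * Bb) / (D * sa).
  by field; rewrite ?d0 ?sq0 ?sa0.
have r0 : sa * q' / D != 0 by rewrite !mulf_neq0 ?invr_eq0.
rewrite e1 [sa * q' / D * _ / _]mulrAC divff // mul1r e2.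
congr (_ * (_ * _ + _ * _)).
  by field; rewrite ?d0 ?sq0 ?sa0 ?dm0.
move: (pi : R) p0 => P p0; field.
by rewrite ?d0 ?sq0 ?sa0 ?dm0 ?p0.
Unshelve. all: by end_near. Qed.

(** To be read with [t = Bt c2 x], [D = Bt c2 c2], [h = Bt v1 c2], where [c2] moves. The factor
    [W - h t / (sq D)] removes the component along [c2] and thereby produces [Bp v1 x]. *)
Lemma gerf_gauss_du (t D h : R -> R) (t' D' h' W sq u0 : R) : 0 < D u0 -> sq != 0 ->
  is_derive u0 1 t t' -> is_derive u0 1 D D' -> is_derive u0 1 h h' ->
  is_derive u0 1 (fun u => gerf (t u / Num.sqrt (D u)) * W + h u / (sq * Num.sqrt (D u)) / pi * expR (- pi * (t u / Num.sqrt (D u)) ^+ 2))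
   (expR (- pi * (t u0 / Num.sqrt (D u0)) ^+ 2) *
     (2 * ((t' - t u0 * D' / (2 * D u0)) / Num.sqrt (D u0)) * (W - h u0 * t u0 / (sq * D u0))
      + (h' - h u0 * D' / (2 * D u0)) / (sq * Num.sqrt (D u0)) / pi)).
Proof.
move=> D0 sq0 dt dD dh.
have s0 : Num.sqrt (D u0) != 0 by rewrite gt_eqF // sqrtr_gt0.
have sE : D u0 = Num.sqrt (D u0) ^+ 2 by rewrite sqr_sqrtr // ltW.
have ds := is_derive_sqrt_comp D0 dD.
have dw := @is_derive_div t (fun u => Num.sqrt (D u)) u0 _ _ s0 dt ds.
have h1 := is_derive_mul (is_derive_gerf_comp dw) (is_derive_cst W u0 (1 : R)).
have dsq : is_derive u0 1 (fun u => sq * Num.sqrt (D u)) (sq * (D' / (2 * Num.sqrt (D u0)))).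
  by have h0 := is_deriveZ sq ds; apply: is_derive_eq h0 _.
have sq1 : sq * Num.sqrt (D u0) != 0 by rewrite mulf_neq0.
have dq := @is_derive_div h (fun u => sq * Num.sqrt (D u)) u0 _ _ sq1 dh dsq.
have h2 := is_derive_mul (is_derive_mul dq (is_derive_cst (pi^-1 : R) u0 (1 : R))) (is_derive_gauss_comp dw).
have hh := is_deriveD h1 h2; apply: is_derive_eq hh _; rewrite /cst /=.
have p0 : pi != 0 :> R by rewrite gt_eqF // pi_gt0.
move: (expR _) (gerf _) => E GG; move: (Num.sqrt (D u0)) (t u0) (h u0) (pi : R) s0 sE p0 => S tt hh0 P s0 -> p0.
by field; rewrite ?s0 ?p0 ?sq0.
Qed.

End ScalarPaths.

(** * The kernel as an average of Gaussians over the square *)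

Section Superposition.
Variables (R : realType) (n : nat) (A : 'M[R]_n).
Hypothesis A_sym : A^T = A.
Local Notation V := 'rV[R]_n.
Implicit Types (c v w x : V).

Lemma E2E c1 c2 x : 0 < Q A c2 -> 0 < Q A c1 * Q A c2 - B A c1 c2 ^+ 2 ->
  E2 A c1 c2 x = double_erf (B A c1 c2 / Num.sqrt (Q A c1 * Q A c2 - B A c1 c2 ^+ 2))
    ((Q A c2 * B A c1 x - B A c1 c2 * B A c2 x) / (Num.sqrt (Q A c2) * Num.sqrt (Q A c1 * Q A c2 - B A c1 c2 ^+ 2)))
    (B A c2 x / Num.sqrt (Q A c2)).
Proof.
move=> q2 d12.
have s2 : Q A c2 = Num.sqrt (Q A c2) ^+ 2 by rewrite sqr_sqrtr // ltW.
have sq0 : Num.sqrt (Q A c2) != 0 by rewrite gt_eqF // sqrtr_gt0.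
have sd0 : Num.sqrt (Q A c1 * Q A c2 - B A c1 c2 ^+ 2) != 0 by rewrite gt_eqF // sqrtr_gt0.
have qp : Q A (perp A c1 c2) = (Q A c1 * Q A c2 - B A c1 c2 ^+ 2) / Q A c2.
  by rewrite /perp -scaleNr QD // QZ // BZr; field; rewrite gt_eqF.
have e1 : B A (perp A c1 c2) x / Num.sqrt (Q A (perp A c1 c2)) =
    (Q A c2 * B A c1 x - B A c1 c2 * B A c2 x) / (Num.sqrt (Q A c2) * Num.sqrt (Q A c1 * Q A c2 - B A c1 c2 ^+ 2)).
  rewrite qp sqrtrM; last exact: ltW.
  rewrite sqrtrV; last exact: ltW.
  have -> : B A (perp A c1 c2) x = B A c1 x - B A c1 c2 / Num.sqrt (Q A c2) ^+ 2 * B A c2 x.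
    by rewrite -s2 /perp BDl BNl BZl.
  have -> : Q A c2 * B A c1 x - B A c1 c2 * B A c2 x = Num.sqrt (Q A c2) ^+ 2 * B A c1 x - B A c1 c2 * B A c2 x by rewrite -s2.
  move: (Num.sqrt (Q A c1 * Q A c2 - B A c1 c2 ^+ 2)) (Num.sqrt (Q A c2)) sd0 sq0 => D S D0 S0.
  by field; rewrite D0 S0.
by rewrite /E2 e1.
Qed.

(** A quarter of the mixed second derivative of [E2] when [c1], [c2] move with velocities [v1],
    [v2]. The velocities enter only through their components orthogonal to the plane; the added
    constant is the one that makes the insertion transform homogeneously in
    [point_transformation]. *)
Definition phi2 c1 c2 v1 v2 x : R :=
  (Bp A c1 c2 v1 x * Bp A c1 c2 v2 x + Bp A c1 c2 v1 v2 / (2 * pi))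
  / Num.sqrt (Q A c1 * Bt A c1 c2 c2) * expR (- pi * Qp A c1 c2 x).

Let w2 c1 c2 x := Bt A c1 c2 x / Num.sqrt (Bt A c1 c2 c2).

(** The derivative of [E2] as [c1] moves with velocity [v1]. Only one-variable functions remain, so
    the second derivative is elementary. *)
Definition E2_slope c1 c2 v1 x : R :=
  2 * expR (- pi * (B A c1 x / Num.sqrt (Q A c1)) ^+ 2) *
   (gerf (w2 c1 c2 x) * (Bt A c1 v1 x / Num.sqrt (Q A c1))
    + Bt A c1 v1 c2 / (Num.sqrt (Q A c1) * Num.sqrt (Bt A c1 c2 c2)) / pi * expR (- pi * w2 c1 c2 x ^+ 2)).

Lemma is_derive_affine (a b t : R) : is_derive t 1 (fun s : R => a + s * b) b.
Proof.
have h := is_deriveD (is_derive_cst a t (1 : R)) (is_deriveM (is_derive_id t (1 : R)) (is_derive_cst b t (1 : R))).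
by apply: is_derive_eq h _; rewrite /GRing.scale /=; ring.
Qed.

Lemma is_derive_B_seg v v' x (t : R) : is_derive t 1 (fun s => B A (seg v v' s) x) (B A (v' - v) x).
Proof. by under eq_fun do rewrite B_seg; exact: is_derive_affine. Qed.

Lemma is_derive_Q_seg v v' (t : R) : is_derive t 1 (fun s => Q A (seg v v' s)) (2 * B A (v' - v) (seg v v' t)).
Proof.
rewrite (_ : (fun _ => _) = (fun s => (Q A v + s * (2 * B A v (v' - v))) + s * (s * Q A (v' - v)))); last first.
  by apply/funext => s; rewrite /seg QD // QZ // BZr; ring.
have h0 := is_derive_mul (is_derive_id t (1 : R)) (is_derive_cst (Q A (v' - v)) t (1 : R)).
have h := is_deriveD (is_derive_affine (Q A v) (2 * B A v (v' - v)) t) (is_derive_mul (is_derive_id t (1 : R)) h0).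
apply: is_derive_eq h _; rewrite (BC A_sym (v' - v) (seg v v' t)) B_seg -/(Q A (v' - v)) /cst; ring.
Qed.

Lemma is_derive_Bt_seg c v v' x (t : R) : is_derive t 1 (fun s => Bt A c (seg v v' s) x) (Bt A c (v' - v) x).
Proof.
rewrite (_ : (fun _ => _) = (fun s => Bt A c v x + s * Bt A c (v' - v) x)); first exact: is_derive_affine.
by apply/funext => s; rewrite /Bt !B_seg; ring.
Qed.

Lemma is_derive_Bt_seg2 c v v' (t : R) :
  is_derive t 1 (fun s => Bt A c (seg v v' s) (seg v v' s)) (2 * Bt A c (v' - v) (seg v v' t)).
Proof.
have q s : Bt A c (seg v v' s) (seg v v' s) = Q A (seg v v' s) + - (Q A c)^-1 * (B A (seg v v' s) c * B A (seg v v' s) c).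
  by rewrite /Bt (BC A_sym c) -/(Q A _); ring.
under eq_fun do rewrite q.
have h := is_deriveD (is_derive_Q_seg v v' t) (is_deriveZ (- (Q A c)^-1) (is_deriveM (is_derive_B_seg v v' c t) (is_derive_B_seg v v' c t))).
apply: is_derive_eq h _; rewrite /GRing.scale /= /Bt (BC A_sym c); ring.
Qed.

Lemma Bt_diag c1 c2 : Q A c1 != 0 -> Q A c1 * Q A c2 - B A c1 c2 ^+ 2 = Q A c1 * Bt A c1 c2 c2.
Proof. by move=> q1; rewrite /Bt (BC A_sym c2 c1) -/(Q A c2); field. Qed.

Lemma E2_ds C C' c2 x (s0 : R) : 0 < Q A c2 ->
  0 < Q A (seg C C' s0) * Q A c2 - B A (seg C C' s0) c2 ^+ 2 ->
  is_derive s0 1 (fun s => E2 A (seg C C' s) c2 x) (E2_slope (seg C C' s0) c2 (C' - C) x).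
Proof.
move=> q2 d12.
have q1 : 0 < Q A (seg C C' s0).
  by rewrite -(pmulr_lgt0 _ q2); apply: (le_lt_trans (sqr_ge0 (B A (seg C C' s0) c2))); rewrite -subr_gt0.
pose a' s := 2 * B A (C' - C) (seg C C' s).
have ca : ctn a' s0.
  by apply: ctnM; [exact: ctn_cst|apply: ctn_B; [exact: vct_cst|apply: vct_seg; exact: ctn_id]].
have d := @double_erf_ds R (fun s => Q A (seg C C' s)) (fun s => B A (seg C C' s) c2) (fun s => B A (seg C C' s) x) a' _ _ _ (B A c2 x) s0 q2 d12 (is_derive_Q_seg C C') (is_derive_B_seg C C' c2) (is_derive_B_seg C C' x) ca.
(* The rewriting of [E2] by Gram data needs a positive Gram determinant, which holds near [s0] and
   suffices for a derivative. *)
have e : \forall s \near s0, double_erf (B A (seg C C' s) c2 / Num.sqrt (Q A (seg C C' s) * Q A c2 - B A (seg C C' s) c2 ^+ 2))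
    ((Q A c2 * B A (seg C C' s) x - B A (seg C C' s) c2 * B A c2 x) / (Num.sqrt (Q A c2) * Num.sqrt (Q A (seg C C' s) * Q A c2 - B A (seg C C' s) c2 ^+ 2)))
    (B A c2 x / Num.sqrt (Q A c2)) = E2 A (seg C C' s) c2 x.
  have nD : \forall s \near s0, 0 < Q A (seg C C' s) * Q A c2 - B A (seg C C' s) c2 ^+ 2.
    apply: (@ctn_near R _ 0 (fun s => Q A (seg C C' s) * Q A c2 - B A (seg C C' s) c2 ^+ 2) s0 _ d12); apply: ctnD.
      by apply: ctnM; [apply: ctn_Q; apply: vct_seg; exact: ctn_id|exact: ctn_cst].
    by apply: ctnN; apply: ctnX; apply: ctn_B; [apply: vct_seg; exact: ctn_id|exact: vct_cst].
  by near=> s; rewrite E2E //; near: s.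
have d2 := near_eq_is_derive e d.
apply: is_derive_eq d2 _; rewrite /E2_slope /w2 /a'.
have D0 : 0 < Bt A (seg C C' s0) c2 c2 by rewrite -(pmulr_rgt0 _ q1) -Bt_diag ?gt_eqF.
rewrite (Bt_diag c2 (negbT (gt_eqF q1))) sqrtrM ?ltW //.
have sq0 : Num.sqrt (Q A (seg C C' s0)) != 0 by rewrite gt_eqF // sqrtr_gt0.
have sd0 : Num.sqrt (Bt A (seg C C' s0) c2 c2) != 0 by rewrite gt_eqF // sqrtr_gt0.
have s2 : Num.sqrt (Q A (seg C C' s0)) ^+ 2 = Q A (seg C C' s0) by rewrite sqr_sqrtr // ltW.
set c := seg C C' s0 in q1 D0 sq0 sd0 s2 *.
have e1 : (Q A c * B A c2 x - B A c c2 * B A c x) / (Num.sqrt (Q A c) * Num.sqrt (Bt A c c2 c2) * Num.sqrt (Q A c)) =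
   Bt A c c2 x / Num.sqrt (Bt A c c2 c2).
  rewrite {2}/Bt (BC A_sym c2 c); move: (Num.sqrt (Bt A c c2 c2)) sd0 => S S0.
  by move: (Num.sqrt (Q A c)) sq0 s2 => T T0 <-; field; rewrite T0 S0.
rewrite e1; have e2 w : B A (C' - C) w - 2 * B A (C' - C) c * B A c w / (2 * Q A c) = Bt A c (C' - C) w.
  by rewrite /Bt; field; rewrite gt_eqF.
by rewrite !e2.
Unshelve. all: by end_near. Qed.

Lemma E2_slope_du c1 v1 C C' x (u0 : R) : 0 < Q A c1 -> 0 < Bt A c1 (seg C C' u0) (seg C C' u0) ->
  is_derive u0 1 (fun u => E2_slope c1 (seg C C' u) v1 x) (4 * phi2 c1 (seg C C' u0) v1 (C' - C) x).
Proof.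
move=> q1 D0; have sq0 : Num.sqrt (Q A c1) != 0 by rewrite gt_eqF // sqrtr_gt0.
have dh (t : R) : is_derive t 1 (fun u => Bt A c1 v1 (seg C C' u)) (Bt A c1 (C' - C) v1).
  by under eq_fun do rewrite (Bt_sym A_sym c1 v1); exact: is_derive_Bt_seg.
have d := @gerf_gauss_du R (fun u => Bt A c1 (seg C C' u) x) (fun u => Bt A c1 (seg C C' u) (seg C C' u)) (fun u => Bt A c1 v1 (seg C C' u)) _ _ _ (Bt A c1 v1 x / Num.sqrt (Q A c1)) _ u0 D0 sq0 (is_derive_Bt_seg c1 C C' x u0) (is_derive_Bt_seg2 c1 C C' u0) (dh u0).
have h := is_deriveZ (2 * expR (- pi * (B A c1 x / Num.sqrt (Q A c1)) ^+ 2)) d.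
apply: is_derive_eq h _; rewrite /GRing.scale /= /phi2.
set c2 := seg C C' u0 in D0 *;
have qpE : expR (- pi * Qp A c1 c2 x) = expR (- pi * (B A c1 x ^+ 2 / Q A c1)) * expR (- pi * (Bt A c1 c2 x ^+ 2 / Bt A c1 c2 c2)).
  by rewrite -expRD -mulrDr.
rewrite qpE sqrtrM ?ltW //.
have s1 : Num.sqrt (Q A c1) ^+ 2 = Q A c1 by rewrite sqr_sqrtr // ltW.
have s2 : Num.sqrt (Bt A c1 c2 c2) ^+ 2 = Bt A c1 c2 c2 by rewrite sqr_sqrtr // ltW.
rewrite !expr_div_n s1 s2 /Bp (Bt_sym A_sym c1 c2 (C' - C)) (Bt_sym A_sym c1 v1 (C' - C)).
have sd0 : Num.sqrt (Bt A c1 c2 c2) != 0 by rewrite gt_eqF // sqrtr_gt0.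
move: (expR _) (expR _) => E F; move: (Num.sqrt (Bt A c1 c2 c2)) sd0 s2 => S S0 <-.
move: (Num.sqrt (Q A c1)) sq0 => T T0.
have p0 : pi != 0 :> R by rewrite gt_eqF // pi_gt0.
move: (pi : R) p0 => P P0; field.
by rewrite S0 T0 P0.
Qed.

Section Rectangle.
Variables C1 C1' C2 C2' : V.
Hypothesis Q1_pos : forall s, 0 <= s <= 1 -> 0 < Q A (seg C1 C1' s).
Hypothesis Q2_pos : forall u, 0 <= u <= 1 -> 0 < Q A (seg C2 C2' u).
Hypothesis D_pos : forall s u, 0 <= s <= 1 -> 0 <= u <= 1 -> 0 < Bt A (seg C1 C1' s) (seg C2 C2' u) (seg C2 C2' u).
Let i0 : 0 <= (0 : R) <= 1. Proof. by rewrite lexx ler01. Qed.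
Let i1 : 0 <= (1 : R) <= 1. Proof. by rewrite lexx ler01. Qed.

Lemma seg0 v v' : seg v v' (0 : R) = v. Proof. by rewrite /seg scale0r addr0. Qed.
Lemma seg1 v v' : seg v v' (1 : R) = v'. Proof. by rewrite /seg scale1r subrKC. Qed.

Lemma ctn_phi2 (T : topologicalType) (f g : T -> R) v1 v2 x (t : T) : ctn f t -> ctn g t ->
  0 <= f t <= 1 -> 0 <= g t <= 1 -> ctn (fun t => phi2 (seg C1 C1' (f t)) (seg C2 C2' (g t)) v1 v2 x) t.
Proof.
move=> cf cg f01 g01; have q1 := Q1_pos f01; have d12 := D_pos f01 g01.
have q0 := negbT (gt_eqF q1); have D0 := negbT (gt_eqF d12).
have c1 := @vct_seg _ _ _ C1 C1' f t cf; have c2 := @vct_seg _ _ _ C2 C2' g t cg.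
have cc v : vct (fun _ : T => v) t by move=> i; exact: ctn_cst.
apply: ctnM; last first.
  by apply: ctn_expR; apply: ctnM; [exact: ctn_cst|exact: ctn_Qp].
apply: ctnM.
  apply: ctnD; first by apply: ctnM; exact: ctn_Bp.
  by apply: ctnM; [exact: ctn_Bp|exact: ctn_cst].
apply: ctnV; first by rewrite gt_eqF // sqrtr_gt0 mulr_gt0.
by apply: ctn_sqrt; apply: ctnM; [exact: ctn_Q|exact: ctn_Bt].
Qed.

Lemma ctn_E2_slope v1 c2 x (s : R) : 0 <= s <= 1 -> 0 < Bt A (seg C1 C1' s) c2 c2 ->
  ctn (fun s => E2_slope (seg C1 C1' s) c2 v1 x) s.
Proof.
move=> s01 d12; have q1 := Q1_pos s01.
have q0 := negbT (gt_eqF q1).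
have c1 := @vct_seg _ _ _ C1 C1' (fun s => s) s (@ctn_id R s).
have cc v : vct (fun _ : R => v) s by move=> i; exact: ctn_cst.
have sq0 : Num.sqrt (Q A (seg C1 C1' s)) != 0 by rewrite gt_eqF // sqrtr_gt0.
have sd0 : Num.sqrt (Bt A (seg C1 C1' s) c2 c2) != 0 by rewrite gt_eqF // sqrtr_gt0.
have cq : ctn (fun s => Num.sqrt (Q A (seg C1 C1' s))) s by apply: ctn_sqrt; exact: ctn_Q.
have cd : ctn (fun s => Num.sqrt (Bt A (seg C1 C1' s) c2 c2)) s by apply: ctn_sqrt; exact: ctn_Bt.
have cw : ctn (fun s => w2 (seg C1 C1' s) c2 x) s by apply: ctnM; [exact: ctn_Bt|exact: ctnV].
have k (a : R) : ctn (fun _ : R => a) s by exact: ctn_cst.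
apply: ctnM.
  apply: ctnM => //; apply: ctn_expR; apply: ctnM => //; apply: ctnX; apply: ctnM; [exact: ctn_B|exact: ctnV].
apply: ctnD; first by apply: ctnM; [exact: ctn_gerf|apply: ctnM; [exact: ctn_Bt|exact: ctnV]].
apply: ctnM; last by apply: ctn_expR; apply: ctnM => //; exact: ctnX.
apply: ctnM => //; apply: ctnM; first exact: ctn_Bt.
by apply: ctnV; [rewrite mulf_neq0|exact: ctnM].
Qed.

(** The alternating sum of [E2] over the four corners is the integral of its mixed derivative:
    [4 phi2] is integrated in [u] to a difference of slopes, then in [s]. *)
Theorem Phi2_hat_superposition x : Phi2_hat A C1 C1' C2 C2' x =
  (\int[unitP R]_s \int[unitP R]_u phi2 (seg C1 C1' (clamp s)) (seg C2 C2' (clamp u)) (C1' - C1) (C2' - C2) x)%:C.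
Proof.
congr (_%:C).
pose F c2 s := E2 A (seg C1 C1' s) c2 x.
pose g c2 s := E2_slope (seg C1 C1' s) c2 (C1' - C1) x.
have c01 (s : R) : 0 <= clamp s <= 1 by rewrite clamp_ge0 clamp_le1.
have inner (s : R) : 0 <= s <= 1 -> \int[unitP R]_u phi2 (seg C1 C1' s) (seg C2 C2' (clamp u)) (C1' - C1) (C2' - C2) x = 4^-1 * (g C2' s - g C2 s).
  move=> s01.
  have h : \int[unitP R]_u phi2 (seg C1 C1' s) (seg C2 C2' (clamp u)) (C1' - C1) (C2' - C2) x =
      4^-1 * E2_slope (seg C1 C1' s) (seg C2 C2' 1) (C1' - C1) x - 4^-1 * E2_slope (seg C1 C1' s) (seg C2 C2' 0) (C1' - C1) x; last first.
    by rewrite h seg0 seg1 -mulrBr.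
  apply: (@unit_FTC_on R (fun u => phi2 (seg C1 C1' s) (seg C2 C2' u) (C1' - C1) (C2' - C2) x)
     (fun u => 4^-1 * E2_slope (seg C1 C1' s) (seg C2 C2' u) (C1' - C1) x)).
    move=> u u01; exact: (@ctn_phi2 R (fun=> s) (fun u => u) (C1' - C1) (C2' - C2) x u (@ctn_cst R R s u) (@ctn_id R u) s01 u01).
  move=> u u01; have h := is_deriveZ (4^-1 : R) (@E2_slope_du (seg C1 C1' s) (C1' - C1) C2 C2' x u (Q1_pos s01) (D_pos s01 u01)).
  by apply: is_derive_eq h _; rewrite /GRing.scale /= mulKf.
have dF c2 (s : R) : 0 < Q A c2 -> 0 <= s <= 1 -> 0 < Bt A (seg C1 C1' s) c2 c2 -> is_derive s 1 (F c2) (g c2 s).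
  move=> q2 s01 d12; apply: E2_ds => //; rewrite Bt_diag; last by rewrite gt_eqF // Q1_pos.
  by rewrite mulr_gt0 // Q1_pos.
have D2 s : 0 <= s <= 1 -> 0 < Bt A (seg C1 C1' s) C2 C2 by move=> s01; have := D_pos s01 i0; rewrite seg0.
have D2' s : 0 <= s <= 1 -> 0 < Bt A (seg C1 C1' s) C2' C2' by move=> s01; have := D_pos s01 i1; rewrite seg1.
have q2 : 0 < Q A C2 by have := Q2_pos i0; rewrite seg0.
have q2' : 0 < Q A C2' by have := Q2_pos i1; rewrite seg1.
have outer : \int[unitP R]_s (4^-1 * (g C2' (clamp s) - g C2 (clamp s))) = 4^-1 * (F C2' 1 - F C2 1) - 4^-1 * (F C2' 0 - F C2 0).
  apply: (@unit_FTC_on R (fun s => 4^-1 * (g C2' s - g C2 s)) (fun s => 4^-1 * (F C2' s - F C2 s))).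
    move=> s s01; apply: ctnM; first exact: ctn_cst.
    by apply: ctnD; [|apply: ctnN]; apply: ctn_E2_slope => //; [exact: D2'|exact: D2].
  move=> s s01; apply: (@is_deriveZ _ _ _ (fun s => F C2' s - F C2 s) (4^-1 : R) s 1).
  by apply: is_deriveB; apply: dF => //; [exact: D2'|exact: D2].
transitivity (\int[unitP R]_s (4^-1 * (g C2' (clamp s) - g C2 (clamp s)))); last first.
  by apply: eq_Rintegral => s _; rewrite -inner.
rewrite outer /F !seg0 !seg1; move: (E2 A) => e; ring.
Qed.

End Rectangle.
End Superposition.

(** * Integral rows and fractional parts *)

Section IntegralRows.
Variables (R : realType) (n : nat).
Implicit Types (x : 'rV[R]_n) (l : 'rV[int]_n).

Definition rv l : 'rV[R]_n := map_mx intr l.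
Definition intv x : 'rV[int]_n := map_mx (@Num.floor R) x.
Definition integral_row x := forall j, x 0 j \is a Num.int.
Definition frac x : 'rV[R]_n := x - rv (intv x).

Lemma rv_int l : integral_row (rv l).
Proof. by move=> j; rewrite mxE intr_int. Qed.

Lemma intvK x : integral_row x -> rv (intv x) = x.
Proof. by move=> h; apply/rowP => j; rewrite !mxE floorK. Qed.

Lemma rvK l : intv (rv l) = l.
Proof. by apply/rowP => j; rewrite !mxE intrKfloor. Qed.

Lemma rv_inj : injective rv. Proof. exact: can_inj rvK. Qed.

Lemma rvD l l' : rv (l + l') = rv l + rv l'. Proof. exact: map_mxD. Qed.

Lemma rvN l : rv (- l) = - rv l. Proof. exact: map_mxN. Qed.

Lemma rvM l (M : 'M[int]_n) : rv (l *m M) = rv l *m map_mx intr M.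
Proof. exact: map_mxM. Qed.

Lemma integral_rowD x y : integral_row x -> integral_row y -> integral_row (x + y).
Proof. by move=> hx hy j; rewrite mxE rpredD. Qed.

Lemma integral_rowN x : integral_row x -> integral_row (- x).
Proof. by move=> hx j; rewrite mxE rpredN. Qed.

Lemma integral_rowM x (M : 'M[int]_n) : integral_row x -> integral_row (x *m map_mx intr M).
Proof. by move=> /intvK <-; rewrite -rvM; exact: rv_int. Qed.

Lemma frac_itv x j : 0 <= frac x 0 j < 1.
Proof.
rewrite !mxE subr_ge0 ltrBlDl; have /andP[-> h] := floor_itv (x 0 j).
by rewrite (lt_le_trans h) // intrD addrC.
Qed.

Lemma frac_uniq l x : (forall j, 0 <= x 0 j < 1) -> frac (rv l + x) = x.
Proof.
move=> hx; rewrite /frac; suff -> : intv (rv l + x) = l by rewrite addrC addKr.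
apply/rowP => j; rewrite !mxE; apply: floor_def; rewrite intrD lerDl ltrD2l.
by have := hx j.
Qed.

Lemma fracE x : x = rv (intv x) + frac x.
Proof. by rewrite addrC subrK. Qed.

End IntegralRows.
Arguments rv {R n}.

(** * Representatives of the dual lattice modulo the lattice *)

Section DualRepresentatives.
Variables (R : realType) (n : nat).
Local Notation V := 'rV[R]_n.
Local Notation rM := (@map_mx int R intr n n).

Definition dual_box (M : 'M[int]_n) : set V :=
  [set x | integral_row (x *m rM M) /\ forall j, 0 <= x 0 j < 1].

Lemma absz_det_unit (L : 'M[int]_n) : L \in unitmx -> absz (\det L) = 1%N.
Proof.
move=> Lu; have : (absz (\det L) * absz (\det (invmx L)) == 1)%N.
  by rewrite -abszM -det_mulmx mulmxV // det1.
by rewrite muln_eq1 => /andP[/eqP].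
Qed.

(* For a diagonal matrix the representatives are the points with coordinates
   k_i / |d_i|; the Smith normal form reduces the general case to this one. *)
Lemma dual_box_enum (M : 'M[int]_n) : \det M != 0 ->
  exists s : seq V, [/\ uniq s, dual_box M = [set` s] & size s = absz (\det M)].
Proof.
have [L Lu [S Su [d _ eM]]] := int_Smith_normal_form M.
set D : 'M[int]_n := \matrix_(i, j) _ in eM => detM.
have eD : D = diag_mx (\row_i d`_i).
  by apply/matrixP => i j; rewrite !mxE.
have dD : \det D = \prod_(i < n) d`_i.
  by rewrite eD det_diag; apply: eq_bigr => i _; rewrite mxE.
pose dd (i : 'I_n) : int := d`_i.
have eabs : absz (\det M) = (\prod_(i < n) absz (dd i))%N.
  rewrite eM !det_mulmx !abszM (absz_det_unit Lu) (absz_det_unit Su) mul1n muln1 dD.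
  by rewrite (big_morph absz abszM (id1 := 1%N)).
have d0 (i : 'I_n) : (0 < absz (dd i))%N.
  rewrite lt0n; apply/eqP => h; move/eqP: detM; apply; apply/eqP.
  by rewrite -absz_eq0 eabs (bigD1 i) //= h.
pose T := {dffun forall i : 'I_n, 'I_(absz (dd i))}.
pose yv (k : T) : V := \row_i ((nat_of_ord (k i))%:R / (absz (dd i))%:R).
have dR0 (i : 'I_n) : 0 < (absz (dd i))%:R :> R by rewrite ltr0n.
have yv_itv k j : 0 <= yv k 0 j < 1.
  rewrite mxE divr_ge0 ?ler0n //= ltr_pdivrMr // mul1r ltr_nat; exact: ltn_ord.
have yD (x : V) j : (x *m rM D) 0 j = x 0 j * (dd j)%:~R.
  rewrite mxE (bigD1 j) //= big1 => [|i ij]; first by rewrite !mxE eqxx addr0 mulr1n.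
  rewrite !mxE (_ : (i == j :> nat) = false) ?mulr0n ?mulr0 //.
  exact: negbTE ij.
have signd (z : int) : exists2 e : int, z%:~R = e%:~R * (absz z)%:R :> R & (absz z)%:R = e%:~R * z%:~R :> R.
  case: z => m; first by exists 1; rewrite mul1r.
  by exists (-1); rewrite NegzE !rmorphN /= ?mulN1r ?opprK ?mulrNN ?mul1r // abszN.
have yv_int k : integral_row (yv k *m rM D).
  move=> j; rewrite yD mxE; have [e -> _] := signd (dd j).
  by rewrite mulrCA mulfVK ?gt_eqF // rpredM ?intr_int // natr_int.
have yv_surj (x : V) : integral_row (x *m rM D) -> (forall j, 0 <= x 0 j < 1) -> exists k, x = yv k.
  move=> hi hx; have h1 j : x 0 j * (absz (dd j))%:R \is a Num.int.
    have [e _ ->] := signd (dd j); rewrite mulrCA rpredM ?intr_int //.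
    by have := hi j; rewrite yD.
  pose m j := absz (Num.floor (x 0 j * (absz (dd j))%:R)).
  have mE (j : 'I_n) : (m j)%:R = x 0 j * (absz (dd j))%:R :> R.
    have /andP[x0 _] := hx j; have y0 : 0 <= x 0 j * (absz (dd j))%:R by rewrite mulr_ge0.
    by rewrite /m natr_absz ger0_norm ?floor_ge0 // floorK.
  have mlt j : (m j < absz (dd j))%N.
    by have /andP[_ x1] := hx j; rewrite -(ltr_nat R) mE -[ltRHS]mul1r ltr_pM2r.
  exists [ffun i => Ordinal (mlt i)]; apply/rowP => j; rewrite !mxE ffunE /= mE.
  by rewrite mulfK // gt_eqF.
have yv_inj : injective yv.
  move=> k k' e; apply/ffunP => i; apply: val_inj => /=.
  move/rowP/(_ i): e; rewrite !mxE => /(mulIf _) h; apply/eqP; rewrite -(eqr_nat R); apply/eqP; apply: h.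
  by rewrite invr_eq0 gt_eqF.
have LLi : rM L *m rM (invmx L) = 1%:M by rewrite -map_mxM mulmxV // map_mx1.
have LiL : rM (invmx L) *m rM L = 1%:M by rewrite -map_mxM mulVmx // map_mx1.
(* The unimodular factor [L] identifies classes for [M] with classes for the diagonal matrix;
   reduction to the unit box makes [G] and [H] maps between representatives. *)
pose G k := frac (yv k *m rM (invmx L)).
pose H (x : V) := frac (x *m rM L).
have HG k : H (G k) = yv k.
  rewrite /H /G {2}/frac mulmxBl -mulmxA LiL mulmx1 -rvM addrC -rvN.
  exact: frac_uniq.
have eMR : rM M = rM L *m rM D *m rM S by rewrite eM !map_mxM.
have GM k : dual_box M (G k).
  split; last exact: frac_itv.
  rewrite /G /frac mulmxBl -rvM; apply: integral_rowD; last by apply: integral_rowN; exact: rv_int.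
  have -> : yv k *m rM (invmx L) *m rM M = yv k *m rM D *m rM S.
    by rewrite eMR !mulmxA -(mulmxA (yv k)) LiL mulmx1.
  exact: integral_rowM.
have GS (x : V) : dual_box M x -> exists k, x = G k.
  move=> [hi hx]; have hD : integral_row (H x *m rM D).
    rewrite /H /frac mulmxBl -rvM; apply: integral_rowD; last by apply: integral_rowN; exact: rv_int.
    have SSi : rM S *m rM (invmx S) = 1%:M by rewrite -map_mxM mulmxV // map_mx1.
    have -> : x *m rM L *m rM D = x *m rM M *m rM (invmx S).
      by rewrite eMR !mulmxA -(mulmxA _ (rM S)) SSi mulmx1.
    exact: integral_rowM.
  have [k ek] := yv_surj _ hD (frac_itv _); exists k.
  rewrite /G -ek /H {2}/frac mulmxBl -mulmxA LLi mulmx1 -rvM addrC -rvN.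
  by rewrite frac_uniq.
exists [seq G k | k <- enum {: T}]; split.
- rewrite map_inj_uniq ?enum_uniq // => k k' e; apply: yv_inj.
  by rewrite -HG e HG.
- apply/seteqP; split=> x /=.
    by move=> /GS[k ->]; apply: map_f; rewrite mem_enum.
  by move=> /mapP[k _ ->]; exact: GM.
- rewrite size_map -cardE eabs card_dep_ffun foldrE big_image /=.
  by apply: eq_bigr => i _; rewrite card_ord.
Qed.

(* Every dual lattice vector is m A^-1 for a unique integral m, and splits
   uniquely into its integral part and a representative. *)
Lemma csum_dual_split (M : 'M[int]_n) (s : seq V) (f : V -> R[i]) : \det M != 0 ->
  uniq s -> dual_box M = [set` s] ->
  abs_summable (fun m : 'rV[int]_n => f (rv m *m invmx (rM M))) ->
  csum (fun m : 'rV[int]_n => f (rv m *m invmx (rM M))) =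
  \sum_(nu <- s) csum (fun l : 'rV[int]_n => f (rv l + nu)).
Proof.
move=> dM us es sf.
have Mu : rM M \in unitmx by rewrite unitmxE det_map_mx unitfE intr_eq0.
pose x (m : 'rV[int]_n) : V := rv m *m invmx (rM M).
have xM m : x m *m rM M = rv m by rewrite mulmxKV.
have fs m : frac (x m) \in s.
  have : dual_box M (frac (x m)).
    split; last exact: frac_itv.
    rewrite /frac mulmxBl xM -rvM; apply: integral_rowD; first exact: rv_int.
    by apply: integral_rowN; exact: rv_int.
  by rewrite es.
pose F nu m := if frac (x m) == nu then f (x m) else 0.
have eF : (fun m => f (x m)) = (fun m => \sum_(nu <- s) F nu m).
  apply/funext => m; rewrite (bigD1_seq (frac (x m))) //= /F eqxx big1 ?addr0 // => nu h.
  by rewrite eq_sym (negbTE h).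
have sF nu : nu \in s -> abs_summable (F nu).
  move=> _; apply: abs_summable_le sf _ => m; rewrite /F; case: ifP => // _.
  by rewrite cabs0 cabs_ge0.
rewrite [LHS](_ : _ = csum (fun m => \sum_(nu <- s) F nu m)); last by rewrite -eF.
have [_ ->] := csum_sum sF; rewrite [LHS]big_seq_cond [RHS]big_seq_cond; apply: eq_bigr => nu.
rewrite andbT => nus.
have [hi hnu] : dual_box M nu by rewrite es.
pose e (l : 'rV[int]_n) : 'rV[int]_n := intv ((rv l + nu) *m rM M).
have ie l : integral_row ((rv l + nu) *m rM M).
  by rewrite mulmxDl -rvM; apply: integral_rowD => //; exact: rv_int.
have xe l : x (e l) = rv l + nu by rewrite /x /e intvK // mulmxK.
have e_inj : injective e.
  move=> l l' h; have : rv l + nu = rv l' + nu by rewrite -!xe h.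
  by move=> /addIr /rv_inj.
rewrite [LHS](csum_inj e_inj) => [|m].
  by congr csum; apply/funext => l; rewrite /F xe frac_uniq // eqxx.
move=> nr; rewrite /F; case: eqP => // h; case: nr; exists (intv (x m)) => //.
apply: (@rv_inj R); rewrite /e intvK; last exact: ie.
by rewrite -h -fracE xM.
Qed.

End DualRepresentatives.

(** * Integrality of the Gram matrix *)

Section IntegralGram.
Variables (R : realType) (n : nat) (A : 'M[R]_n) (p : 'rV[R]_n).
Hypothesis A_sym : A^T = A.
Hypothesis Q_int : integral_form A.
Hypothesis p_char : characteristic A p.

(** Polarising an integral [Q] gives only [2 B] integral. The characteristic vector supplies the
    missing factor: [(Q k + B k p) / 2] is integral and its second term is linear, so it can be
    polarised instead. *)
Lemma B_int k l : Lambda k -> Lambda l -> B A k l \is a Num.int.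
Proof.
move=> hk hl; have hkl : Lambda (k + l) by exact: integral_rowD.
have [_ h] := p_char.
have -> : B A k l = (Q A (k + l) + B A (k + l) p) / 2 - (Q A k + B A k p) / 2 - (Q A l + B A l p) / 2.
  by rewrite QD // BDl; field.
by rewrite !rpredB ?h.
Qed.

Lemma delta_int (i : 'I_n) : integral_row (delta_mx 0 i : 'rV[R]_n).
Proof. by move=> j; rewrite mxE natr_int. Qed.

Lemma B_delta (x : 'rV[R]_n) i : B A x (delta_mx 0 i) = (x *m A) 0 i.
Proof.
rewrite /B trmx_delta -colE mxE //.
Qed.

Lemma gram_integral : exists Az : 'M[int]_n, A = map_mx intr Az.
Proof.
exists (map_mx (@Num.floor R) A); apply/matrixP => i j; rewrite !mxE floorK //.
have := B_int (delta_int i) (delta_int j).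
by rewrite B_delta -rowE mxE.
Qed.

Lemma Lambda_dualP (x : 'rV[R]_n) : Lambda_dual A x <-> integral_row (x *m A).
Proof.
split=> [h j|h y hy]; first by rewrite -B_delta; apply: h; exact: delta_int.
rewrite /B mxE; apply: rpred_sum => j _; apply: rpredM; [exact: h|rewrite mxE; exact: hy].
Qed.

Lemma dual_reps_box (Az : 'M[int]_n) : A = map_mx intr Az -> dual_reps A = dual_box Az.
Proof.
move=> e; apply/seteqP; split=> x [h1 h2]; split=> //; first by rewrite -e; exact/Lambda_dualP.
by apply/Lambda_dualP; rewrite e.
Qed.

End IntegralGram.

Lemma is_derive_quad (R : realType) (W : normedModType R) (f : W -> R) (t v : W) (a b : R) :
  (forall h : R, f (h *: v + t) = f t + h * a + h ^+ 2 * b) -> is_derive t v f a.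
Proof.
move=> hf; apply/is_derive_dir; rewrite (_ : (fun _ => _) = (fun h : R => f t + h * (a + h * b))); last first.
  by apply/funext => h; rewrite hf; ring.
have h0 := is_derive_affine a b (0 : R).
have h := is_deriveD (is_derive_cst (f t) (0 : R) (1 : R)) (is_derive_mul (is_derive_id (0 : R) (1 : R)) h0).
by apply: is_derive_eq h _; ring.
Qed.

Lemma cabs_cint_le (R : realType) d (X : measurableType d) (m : {measure set X -> \bar R}) (f : X -> R[i]) :
  cintegrable m f -> m.-integrable setT (fun x => (cabs (f x))%:E) ->
  cabs (cint m f) <= 2 * \int[m]_x cabs (f x).
Proof.
move=> [i1 i2] i0.
have cabs_le (z : R[i]) : cabs z <= `|Re z| + `|Im z|.
  rewrite /cabs -[leRHS]ger0_norm ?addr_ge0 // -sqrtr_sqr ler_wsqrtr // sqrrD !real_normK ?num_real //.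
  by rewrite addrAC lerDl mulrn_wge0 // mulr_ge0.
have key (h : X -> R) : m.-integrable setT (EFin \o h) -> (forall x, `|h x| <= cabs (f x)) ->
    `|\int[m]_x h x| <= \int[m]_x cabs (f x).
  move=> ih hf; apply: le_trans (le_normr_Rintegral measurableT ih) _.
  apply: le_Rintegral => //; exact: (integrable_norm ih).
apply: le_trans (cabs_le _) _; rewrite mulrDl mul1r; apply: lerD.
  by apply: key => // x; exact: cabs_Re.
by apply: key => // x; exact: cabs_Im.
Qed.

Section FubiniMarginal.
Context d1 d2 (X : measurableType d1) (Y : measurableType d2) (R : realType).
Variables (m1 : {sigma_finite_measure set X -> \bar R}) (m2 : {sigma_finite_measure set Y -> \bar R}).

Lemma fubini_marginal_integrable (f : X * Y -> \bar R) : (m1 \x m2)%E.-integrable setT f ->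
  m2.-integrable setT (fun y => \int[m1]_x f (x, y))%E.
Proof.
move=> imf; have mf := measurable_int _ imf.
have mG : measurable_fun setT (fun y => \int[m1]_x f (x, y))%E by exact: (measurable_fubini_G imf).
apply/integrableP; split=> //; apply: le_lt_trans ((integrable21ltyP m1 m2 mf).1 imf).
apply: ge0_le_integral; [by []|by []|exact: measurableT_comp|..].
- by apply: (measurable_fun_fubini_tonelli_G (abse \o f)) => //=; exact: measurableT_comp.
- by move=> y _; apply: le_abse_integral => //; exact: measurableT_comp.
Qed.

Lemma cint_Fubini2_integrable (f : X * Y -> R[i]) :
  cintegrable (m1 \x m2)%E f ->
  (forall y, cintegrable m1 (fun x => f (x, y))) ->
  cintegrable m2 (fun y => cint m1 (fun x => f (x, y))).
Proof.
have key (h : X * Y -> R) : (m1 \x m2)%E.-integrable setT (EFin \o h) ->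
    (forall y, m1.-integrable setT (fun x => (h (x, y))%:E)) ->
    m2.-integrable setT (fun y => (\int[m1]_x h (x, y))%:E).
  move=> i1 i2; have := fubini_marginal_integrable i1.
  rewrite (_ : (fun y => _) = (fun y => (\int[m1]_x h (x, y))%:E)) //.
  by apply/funext => y; rewrite /Rintegral fineK //; exact: integrable_fin_num.
move=> [f1 f2] h; split.
  by apply: (key (fun z => Re (f z)) f1) => y; exact: (h y).1.
by apply: (key (fun z => Im (f z)) f2) => y; exact: (h y).2.
Qed.

End FubiniMarginal.

(** * Families of theta series averaged over the square *)

Section ThetaFamily.
Variables (R : realType) (n : nat).
Local Notation V := 'rV[R]_n.
Local Notation W := (R * R * V * V)%type.
Local Notation Y := (measurableTypeR R * measurableTypeR R)%type.
Variables (A : 'M[R]_n) (p : V).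
Hypothesis A_sym : A^T = A.
Variables (g : nat -> 'rV[int]_n) (gi : 'rV[int]_n -> nat).
Hypothesis gK : cancel g gi.
Hypothesis giK : cancel gi g.
Variable P : Y -> 'M[R]_n.
Hypothesis P_sym : forall y, (P y)^T = P y.
Hypothesis P_meas : forall i j, measurable_fun setT (fun y => P y i j).
Variable KP : R.
Hypothesis P_bnd : forall y i j, `|P y i j| <= KP.
Variable eps : R.
Hypothesis eps0 : 0 < eps.
Hypothesis P_pos : forall y x, eps * nsq x <= 2 * qf (P y) x - Q A x.

Definition kv (mu : V) (l : 'rV[int]_n) : V := map_mx intr l + mu + 2^-1 *: p.

Definition NX (x : nat * Y) : R := zwt R (g x.1).

Lemma NX0 x : 0 <= NX x. Proof. exact: zwt_ge0. Qed.

(** [gpol] transported along the enumeration [g], so that coefficients can be written as functions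
    of a lattice vector and a point of the square. *)
Definition admC (f : W -> 'rV[int]_n -> Y -> R[i]) := gpol NX (fun t x => f t (g x.1) x.2).
Definition adm (f : W -> 'rV[int]_n -> Y -> R) := admC (fun t l y => (f t l y)%:C).

Lemma admC_D f h : admC f -> admC h -> admC (fun t l y => f t l y + h t l y).
Proof. exact: gpol_add. Qed.
Lemma admC_M f h : admC f -> admC h -> admC (fun t l y => f t l y * h t l y).
Proof. exact: gpol_mul. Qed.
Lemma admC_cst c : admC (fun _ _ _ => c).
Proof. exact: gpol_cst. Qed.

Lemma adm_ext f h : (forall t l y, f t l y = h t l y) -> adm f -> adm h.
Proof. by move=> e; have -> : f = h by do 3 apply/funext => ?. Qed.
Lemma adm_cst c : adm (fun _ _ _ => c).
Proof. exact: gpol_cst. Qed.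
Lemma admD f h : adm f -> adm h -> adm (fun t l y => f t l y + h t l y).
Proof. by move=> hf hh; apply: gpol_ext (gpol_add hf hh) => t x; rewrite rmorphD. Qed.
Lemma admM f h : adm f -> adm h -> adm (fun t l y => f t l y * h t l y).
Proof. by move=> hf hh; apply: gpol_ext (gpol_mul hf hh) => t x; rewrite rmorphM. Qed.
Lemma admN f : adm f -> adm (fun t l y => - f t l y).
Proof. by move=> hf; apply: adm_ext (admM (adm_cst (-1)) hf) => t l y; rewrite mulN1r. Qed.
Lemma adm_sum (f : 'I_n -> W -> 'rV[int]_n -> Y -> R) : (forall i, adm (f i)) -> adm (fun t l y => \sum_i f i t l y).
Proof. by move=> hf; apply: gpol_ext (gpol_sum hf) => t x; rewrite rmorph_sum. Qed.

Lemma norm_pair1 (U1 U2 : normedModType R) (t : U1 * U2) : `|t.1| <= `|t|.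
Proof. by rewrite prod_normE le_max lexx. Qed.
Lemma norm_pair2 (U1 U2 : normedModType R) (t : U1 * U2) : `|t.2| <= `|t|.
Proof. by rewrite prod_normE le_max lexx orbT. Qed.

Lemma adm_x : adm (fun t _ _ => t.1.1.1).
Proof.
apply: (@gpol_lin _ _ _ _ _ (fun t : W => t.1.1.1) 1) => // t.
by rewrite mul1r; do 2 apply: le_trans (norm_pair1 _) _; exact: norm_pair1.
Qed.
Lemma adm_y : adm (fun t _ _ => t.1.1.2).
Proof.
apply: (@gpol_lin _ _ _ _ _ (fun t : W => t.1.1.2) 1) => // t.
by rewrite mul1r; apply: le_trans (norm_pair2 _) _; apply: le_trans (norm_pair1 _) _; exact: norm_pair1.
Qed.

Definition vadm (v : W -> 'rV[int]_n -> Y -> V) := forall i, adm (fun t l y => v t l y 0 i).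

Lemma vadm_cst v : vadm (fun _ _ _ => v). Proof. by move=> i; exact: adm_cst. Qed.
Lemma vadmD v w : vadm v -> vadm w -> vadm (fun t l y => v t l y + w t l y).
Proof. by move=> hv hw i; apply: adm_ext (admD (hv i) (hw i)) => t l y; rewrite mxE. Qed.

Lemma vadm_b : vadm (fun t _ _ => t.1.2).
Proof.
move=> i; apply: (@gpol_lin _ _ _ _ _ (fun t : W => t.1.2 0 i) 1) => [t s|a t|t]; rewrite ?mxE //.
by rewrite mul1r; apply: le_trans (coord_le_norm _ _) _; apply: le_trans (norm_pair2 _) _; exact: norm_pair1.
Qed.
Lemma vadm_c : vadm (fun t _ _ => t.2).
Proof.
move=> i; apply: (@gpol_lin _ _ _ _ _ (fun t : W => t.2 0 i) 1) => [t s|a t|t]; rewrite ?mxE //.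
by rewrite mul1r; apply: le_trans (coord_le_norm _ _) _; exact: norm_pair2.
Qed.
Lemma vadm_k mu : vadm (fun _ l _ => kv mu l).
Proof.
move=> i; pose c := `|mu 0 i + 2^-1 * p 0 i|.
apply: (@gpol_weight _ _ _ _ _ (fun x : nat * Y => kv mu (g x.1) 0 i) (1 + c) 1).
  exact: (measurable_count_fst (fun m => kv mu (g m) 0 i)).
move=> x; rewrite !mxE -addrA expr1; apply: le_trans (ler_normD _ _) _.
have h : `|(g x.1 0 i)%:~R : R| <= NX x.
  by rewrite -intr_norm -natr_absz /NX /zwt (bigD1 i) //= lerDl sumr_ge0.
have c0 : 0 <= c by exact: normr_ge0.
have := NX0 x; move: h; rewrite -/c; move: `|_| (NX x) => a N h N0.
by have := mulr_ge0 c0 N0; nra.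
Qed.
Lemma adm_Y (h : Y -> R) (K : R) : measurable_fun setT h -> (forall y, `|h y| <= K) -> adm (fun _ _ y => h y).
Proof.
move=> mh hK; apply: (@gpol_weight _ _ _ _ _ (fun x : nat * Y => h x.2) K 0).
  exact: (measurableT_comp mh (@measurable_snd _ _ _ _)).
by move=> x; rewrite expr0 mulr1.
Qed.

Lemma adm_B v w : vadm v -> vadm w -> adm (fun t l y => B A (v t l y) (w t l y)).
Proof.
move=> hv hw.
have h : adm (fun t l y => \sum_j (\sum_i v t l y 0 i * A i j) * w t l y 0 j).
  apply: adm_sum => j; apply: admM => //; apply: adm_sum => i; apply: admM => //; exact: adm_cst.
apply: adm_ext h => t l y; rewrite /B mxE; apply: eq_bigr => j _; rewrite !mxE //.
Qed.

Lemma adm_qf v : vadm v -> adm (fun t l y => qf (P y) (v t l y)).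
Proof.
move=> hv.
have h : adm (fun t l y => \sum_i \sum_j v t l y 0 i * P y i j * v t l y 0 j).
  apply: adm_sum => i; apply: adm_sum => j; apply: admM => //; apply: admM => //.
  exact: (@adm_Y (fun y => P y i j) KP).
by apply: adm_ext h => t l y; rewrite qfE.
Qed.

Variables (mu : V) (kap : R).

(** Together with [fim], the exponent of a Siegel theta series: [fre] joins the modulus of
    [e(- tau Q / 2)] to the Gaussian [exp (- 2 pi Im tau Qp)]. In [fim] the value [kap = 1/2]
    reproduces the phase of [theta_term]; 0 and 1 serve the inversion. *)
Definition fre (t : W) l y : R := pi * t.1.1.2 * (Q A (kv mu l + t.1.2) - 2 * qf (P y) (kv mu l + t.1.2)).
Definition fim (t : W) (l : 'rV[int]_n) (y : Y) : R :=
  2 * pi * (B A (kv mu l) p / 2 + B A t.2 (kv mu l) + kap * B A t.2 t.1.2 - t.1.1.1 * Q A (kv mu l + t.1.2) / 2).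
Definition expo t l y : R[i] := (fre t l y)%:C + 'i%C * (fim t l y)%:C.

Lemma vadm_xi : vadm (fun t l y => kv mu l + t.1.2).
Proof. by apply: vadmD; [exact: vadm_k|exact: vadm_b]. Qed.

Lemma adm_fre : adm fre.
Proof.
apply: admM; first by apply: admM; [exact: adm_cst|exact: adm_y].
apply: admD; first by apply: adm_B; exact: vadm_xi.
by apply: admN; apply: admM; [exact: adm_cst|apply: adm_qf; exact: vadm_xi].
Qed.

Lemma adm_fim : adm fim.
Proof.
apply: admM; first exact: adm_cst.
apply: admD; last first.
  apply: admN; apply: admM; last exact: adm_cst.
  by apply: admM; [exact: adm_x|apply: adm_B; exact: vadm_xi].
apply: admD; last by apply: admM; [exact: adm_cst|apply: adm_B; [exact: vadm_c|exact: vadm_b]].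
apply: admD; last by apply: adm_B; [exact: vadm_c|exact: vadm_k].
by apply: admM; [apply: adm_B; [exact: vadm_k|exact: vadm_cst]|exact: adm_cst].
Qed.

Lemma admC_expo : admC expo.
Proof. by apply: admC_D; [exact: adm_fre|apply: admC_M; [exact: admC_cst|exact: adm_fim]]. Qed.

Lemma Re_expo t l y : Re (expo t l y) = fre t l y.
Proof. by rewrite /expo cReD cReM /= !(mul0r, mul1r, mulr0) subrr addr0. Qed.

(** Cauchy-Schwarz; [n.+1] in place of [n] keeps the constant positive in dimension zero too, where
    it is divided by below. *)
Lemma sum_sqr_le (a : 'I_n -> R) : (\sum_i a i) ^+ 2 <= n.+1%:R * \sum_i a i ^+ 2.
Proof.
have h : (\sum_i a i) ^+ 2 <= n%:R * \sum_i a i ^+ 2.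
  rewrite expr2 big_distrlr /=.
  have -> : n%:R * \sum_i a i ^+ 2 = \sum_(i < n) \sum_(j < n) (a i ^+ 2 + a j ^+ 2) / 2.
    have e i : \sum_(j < n) (a i ^+ 2 + a j ^+ 2) / 2 = (n%:R * a i ^+ 2 + \sum_j a j ^+ 2) / 2.
      by rewrite -mulr_suml big_split /= sumr_const card_ord -[a i ^+ 2 *+ n]mulr_natl.
    rewrite (eq_bigr _ (fun i _ => e i)) -mulr_suml big_split /= -mulr_sumr sumr_const card_ord.
    by rewrite -[_ *+ n]mulr_natl; field.
  apply: ler_sum => i _; apply: ler_sum => j _.
  by have := sqr_ge0 (a i - a j); rewrite sqrrB; lra.
apply: le_trans h _; rewrite ler_wpM2r ?ler_nat // sumr_ge0 // => i _; exact: sqr_ge0.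
Qed.

Definition upper : set W := [set t : W | 0 < t.1.1.2].

Lemma expo_decay t0 : upper t0 -> exists r a K : R, [/\ 0 < r, 0 < a &
  forall t, `|t - t0| < r -> upper t /\ forall x : nat * Y, Re (expo t (g x.1) x.2) <= K - a * NX x ^+ 2].
Proof.
(* [H] bounds each coordinate of the offset between the lattice vector and the argument of the
   forms, uniformly for [t] in the ball; this converts decay in [nsq] of the argument into decay in
   the lattice weight. *)
have p0 := pi_gt0 R; move=> y0; pose H : R := `|mu| + 2^-1 * `|p| + (`|t0| + t0.1.1.2 / 2).
pose c := pi * (t0.1.1.2 / 2) * eps.
have yp : 0 < t0.1.1.2 := y0.
have c0 : 0 < c by rewrite !mulr_gt0 ?pi_gt0 ?divr_gt0.
have m0 : 0 < n.+1%:R :> R by [].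
exists (t0.1.1.2 / 2), (c / (2 * n.+1%:R)), (c * (n%:R * H ^+ 2)); split; rewrite ?divr_gt0 ?mulr_gt0 //.
move=> t tr.
have y1 : t0.1.1.2 / 2 <= t.1.1.2.
  have : `|t.1.1.2 - t0.1.1.2| <= `|t - t0|.
    by apply: le_trans (norm_pair2 (t.1.1 - t0.1.1)) _; apply: le_trans (norm_pair1 (t.1 - t0.1)) _; exact: norm_pair1 (t - t0).
  by rewrite ler_norml => /andP[h1 _]; lra.
split; first by rewrite /upper /=; lra.
move=> x; rewrite Re_expo /fre; set xi := kv mu (g x.1) + t.1.2.
have tn : `|t| <= `|t0| + t0.1.1.2 / 2.
  by rewrite -(subrK t0 t) (le_trans (ler_normD _ _)) // addrC lerD2l ltW.
have N2 : NX x ^+ 2 <= n.+1%:R * (2 * nsq xi + 2 * (n%:R * H ^+ 2)).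
  rewrite /NX /zwt; apply: le_trans (sum_sqr_le _) _; rewrite ler_pM2l // /nsq.
  have -> : 2 * \sum_i xi 0 i ^+ 2 + 2 * (n%:R * H ^+ 2) = \sum_(i < n) (2 * xi 0 i ^+ 2 + 2 * H ^+ 2).
    by rewrite big_split /= -mulr_sumr sumr_const card_ord -[in RHS]mulr_natl; ring.
  apply: ler_sum => i _; rewrite natr_absz intr_norm real_normK ?num_real //.
  pose h := mu 0 i + 2^-1 * p 0 i + t.1.2 0 i.
  have hH : `|h| <= H.
    rewrite /h /H; apply: le_trans (ler_normD _ _) _; apply: lerD.
      apply: le_trans (ler_normD _ _) _; apply: lerD; first exact: coord_le_norm.
      by rewrite normrM ger0_norm ?invr_ge0 // ler_wpM2l ?invr_ge0 // coord_le_norm.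
    by apply: le_trans tn; apply: le_trans (coord_le_norm _ _) _; apply: le_trans (norm_pair2 _) _; exact: norm_pair1.
  have h2 : h ^+ 2 <= H ^+ 2.
    by rewrite -[h ^+ 2]real_normK ?num_real // lerXn2r // nnegrE (le_trans _ hH).
  have -> : (g x.1 0 i)%:~R = xi 0 i - h :> R by rewrite /xi /kv /h !mxE; ring.
  move: (xi 0 i) => X; rewrite -subr_ge0 (_ : _ - _ = (X + h) ^+ 2 + 2 * (H ^+ 2 - h ^+ 2)); last by ring.
  by rewrite addr_ge0 ?sqr_ge0 // mulr_ge0 // subr_ge0.
have Pp := P_pos x.2 xi.
have ns0 := nsq_ge0 xi.
have k1 : c * nsq xi <= pi * t.1.1.2 * (2 * qf (P x.2) xi - Q A xi).
  apply: (@le_trans _ _ (pi * t.1.1.2 * (eps * nsq xi))).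
    rewrite /c -mulrA ler_wpM2r ?mulr_ge0 ?(ltW eps0) // ler_wpM2l // ltW // pi_gt0.
  by rewrite ler_wpM2l // mulr_ge0 ?(ltW (pi_gt0 R)) //; lra.
have k2 : c / (2 * n.+1%:R) * NX x ^+ 2 <= c * nsq xi + c * (n%:R * H ^+ 2).
  apply: (@le_trans _ _ (c / (2 * n.+1%:R) * (n.+1%:R * (2 * nsq xi + 2 * (n%:R * H ^+ 2))))).
    by rewrite ler_wpM2l // ltW // divr_gt0 // mulr_gt0.
  rewrite le_eqVlt; apply/orP; left; apply/eqP; field; by rewrite gt_eqF.
move: k1 k2; rewrite mulrBr [X in _ <= X -> _](_ : _ = - (pi * t.1.1.2 * (Q A xi - 2 * qf (P x.2) xi))); last by ring.
by move: (pi * t.1.1.2 * _) (c * nsq xi) (c * _) (c / _ * _) => z1 z2 z3 z4; lra.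
Qed.

Lemma expo_cder t v (re' im' : R) l y : is_derive t v (fun t => fre t l y) re' -> is_derive t v (fun t => fim t l y) im' ->
  cder (fun t => expo t l y) t v (re'%:C + 'i%C * im'%:C).
Proof. by move=> h1 h2; apply: cderD (cder_real h1) (cderZ 'i%C (cder_real h2)). Qed.

Lemma dirE (h x1 y1 x y : R) (b1 c1 b c : V) :
  h *: ((x1, y1, b1, c1) : W) + (x, y, b, c) = (h * x1 + x, h * y1 + y, h *: b1 + b, h *: c1 + c).
Proof. by []. Qed.

Let xi (t : W) l := kv mu l + t.1.2.

Lemma expo_cder_x (t : W) l y : cder (fun t => expo t l y) t (1, 0, 0, 0) ('i%C * (- pi * Q A (xi t l))%:C).
Proof.
move: t => [[[x yy] b] c]; rewrite -[X in cder _ _ _ X]add0r -[X in X + _](rmorph0 (real_complex R)); apply: expo_cder.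
  by apply: (is_derive_quad (b := 0)) => h; rewrite dirE /fre /= !scaler0 !add0r mulr0 add0r; ring.
apply: (is_derive_quad (b := 0)) => h; rewrite dirE /fim /xi /= !scaler0 !add0r mulr1.
by move: (pi : R) => P0; field.
Qed.

Lemma expo_cder_y (t : W) l y : cder (fun t => expo t l y) t (0, 1, 0, 0) (pi * (Q A (xi t l) - 2 * qf (P y) (xi t l)))%:C.
Proof.
move: t => [[[x yy] b] c]; set e := (pi * _).
rewrite (_ : e%:C = e%:C + 'i%C * (0 : R)%:C); last by rewrite mulr0 addr0.
apply: expo_cder; rewrite {}/e.
  by apply: (is_derive_quad (b := 0)) => h; rewrite dirE /fre /xi /= !scaler0 !add0r mulr1; ring.
by apply: (is_derive_quad (b := 0)) => h; rewrite dirE /fim /= !scaler0 !add0r mulr0 add0r; ring.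
Qed.

Lemma qfDh (M : 'M[R]_n) v w (h : R) : M^T = M -> qf M (w + h *: v) = qf M w + h * (2 * dotp (v *m M) w) + h ^+ 2 * qf M v.
Proof. by move=> Ms; rewrite addrC (qfD _ _ Ms) qfZ -scalemxAl dotpC dotpZr dotpC; ring. Qed.

Lemma expo_cder_b (t : W) v l y : cder (fun t => expo t l y) t (0, 0, v, 0)
  ((pi * t.1.1.2 * (2 * B A v (xi t l) - 4 * dotp (v *m P y) (xi t l)))%:C
   + 'i%C * (2 * pi * (kap * B A t.2 v - t.1.1.1 * B A v (xi t l)))%:C).
Proof.
move: t => [[[x yy] b] c]; apply: expo_cder.
  apply: (is_derive_quad (b := pi * yy * (Q A v - 2 * qf (P y) v))) => h; rewrite dirE /fre /xi /= !mulr0 !add0r.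
  have -> : kv mu l + (h *: v + b) = (kv mu l + b) + h *: v by rewrite addrCA addrC.
  move: (kv mu l + b) => X; rewrite QD // QZ BZr (BC A_sym _ v) qfDh //; ring.
apply: (is_derive_quad (b := - pi * x * Q A v)) => h; rewrite dirE /fim /xi /= !mulr0 scaler0 !add0r.
have -> : kv mu l + (h *: v + b) = (kv mu l + b) + h *: v by rewrite addrCA addrC.
have -> : B A c (h *: v + b) = h * B A c v + B A c b by rewrite BDr BZr.
move: (kv mu l + b) => X; rewrite QD // QZ BZr (BC A_sym X v).
by move: (pi : R) (B A (kv mu l) p) (B A c (kv mu l)) => P0 z1 z2; field.
Qed.

Lemma expo_cder_c (t : W) v l y : cder (fun t => expo t l y) t (0, 0, 0, v)
  ('i%C * (2 * pi * (B A v (kv mu l) + kap * B A v t.1.2))%:C).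
Proof.
move: t => [[[x yy] b] c]; rewrite -[X in cder _ _ _ X]add0r -[X in X + _](rmorph0 (real_complex R)); apply: expo_cder.
  by apply: (is_derive_quad (b := 0)) => h; rewrite dirE /fre /= !mulr0 scaler0 !add0r; ring.
apply: (is_derive_quad (b := 0)) => h; rewrite dirE /fim /= !mulr0 scaler0 !add0r !BDl !BZl; ring.
Qed.

Section Measure.
Variable nu : {sigma_finite_measure set Y -> \bar R}.
Hypothesis nu_fin : (nu setT < +oo)%E.
Let mm : {measure set (nat * Y) -> \bar R} := (@counting nat R \x nu)%E.

Lemma NX_integrable (e : nat) (a : R) : 0 < a ->
  mm.-integrable setT (EFin \o (fun x => (1 + NX x) ^+ e * expR (- a * NX x ^+ 2))).
Proof.
move=> a0; have gb : bijective g by exists gi.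
exact: (count_prod_weight_integrable gb (@zwt_ge0 R n) (summable_lattice_exp R n) nu_fin e a0).
Qed.

Definition fam (f : W -> 'rV[int]_n -> Y -> R[i]) (t : W) : R[i] :=
  gint mm (fun t x => expo t (g x.1) x.2) (fun t x => f t (g x.1) x.2) t.

Definition fterm (f : W -> 'rV[int]_n -> Y -> R[i]) t l y := f t l y * cexp (expo t l y).

Lemma fam_smooth f : admC f -> smooth_on upper (fun t => Re (fam f t)) /\ smooth_on upper (fun t => Im (fam f t)).
Proof. by move=> hf; apply: (gint_smooth NX0 NX_integrable admC_expo expo_decay hf). Qed.

Lemma fam_cder f f' q' t v : admC f -> admC f' -> admC q' ->
  (forall t l y, cder (fun t => f t l y) t v (f' t l y)) ->
  (forall t l y, cder (fun t => expo t l y) t v (q' t l y)) -> upper t ->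
  cder (fam f) t v (fam (fun t l y => f' t l y + f t l y * q' t l y) t).
Proof.
move=> hf hf' hq df dq ut.
exact: (gint_is_derive NX0 NX_integrable admC_expo expo_decay hf hf' hq (fun t x => df t (g x.1) x.2) (fun t x => dq t (g x.1) x.2) ut).
Qed.

Lemma fterm_bound f t : admC f -> upper t -> exists (C a : R) (e : nat), [/\ 0 < a, 0 <= C &
  forall l y, cabs (fterm f t l y) <= C * ((1 + zwt R l) ^+ e * expR (- a * zwt R l ^+ 2))].
Proof.
move=> hf ut; have [r [a [K [r0 a0 h]]]] := expo_decay ut.
have [C [e [C0 hC]]] := gpol_bounded NX0 `|t| hf.
exists (C * expR K), a, e; split=> //; first by rewrite mulr_ge0 ?expR_ge0.
move=> l y; have [|_ h2] := h t; first by rewrite subrr normr0.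
have := h2 (gi l, y); have := hC t (lexx _) (gi l, y); rewrite /NX /= giK => h3 h4.
rewrite /fterm cabsM cabs_cexp mulrACA -expRD mulNr.
by rewrite ler_pM ?cabs_ge0 ?expR_ge0 ?ler_expR.
Qed.

Lemma fterm_cmeas f t l : admC f -> cmeas (fterm f t l).
Proof.
move=> hf; have := gint_cmeas admC_expo t hf => -[m1 m2].
have mp : measurable_fun setT (fun y : Y => (gi l, y)) by exact: measurable_pair1.
by split; [have := measurableT_comp m1 mp|have := measurableT_comp m2 mp]; rewrite /comp /= giK.
Qed.

Lemma nu_bounded_integrable (C : R) : nu.-integrable setT (EFin \o (fun=> C)).
Proof. apply/integrableP; split; first exact/measurable_EFinP/measurable_cst.
have -> : (\int[nu]_x `|(EFin \o (fun=> C)) x| = \int[nu]_x (cst (`|C|%:E) x))%E by [].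
by rewrite integral_cst //; apply: lte_mul_pinfty. Qed.

Lemma fterm_integrable f t l : admC f -> upper t -> cintegrable nu (fterm f t l).
Proof.
move=> hf ut; have [C [a [e [a0 C0 h]]]] := fterm_bound hf ut.
apply: (@cintegrable_dominated _ _ _ _ _ (fun=> C * ((1 + zwt R l) ^+ e * expR (- a * zwt R l ^+ 2)))).
- exact: fterm_cmeas.
- exact: nu_bounded_integrable.
- by move=> y; exact: h.
Qed.

Lemma fterm_summable f t y : admC f -> upper t -> abs_summable (fun l => fterm f t l y).
Proof.
move=> hf ut; have [C [a [e [a0 C0 h]]]] := fterm_bound hf ut.
have [C' [C'0 h']] := weight_dominated e a0.
apply: (@abs_summable_le _ _ _ (fun l => C * C' * expR (- zwt R l))).
  exact: summableZ (summable_lattice_exp R n).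
move=> l; apply: le_trans (h l y) _; rewrite -mulrA ler_wpM2l //; apply: h'; exact: zwt_ge0.
Qed.

Lemma cint_fterm_summable f t : admC f -> upper t -> abs_summable (fun l => cint nu (fterm f t l)).
Proof.
move=> hf ut; have [C [a [e [a0 C0 h]]]] := fterm_bound hf ut.
have [C' [C'0 h']] := weight_dominated e a0.
apply: (@abs_summable_le _ _ _ (fun l => 2 * (C * C' * fine (nu setT)) * expR (- zwt R l))).
  exact: summableZ (summable_lattice_exp R n).
move=> l; have [c1 c2] := fterm_cmeas t l hf.
have il := fterm_integrable l hf ut.
have mc : measurable_fun setT (fun y => cabs (fterm f t l y)).
  apply: (measurableT_comp (continuous_measurable_fun (@sqrt_continuous _))).
  by apply: measurable_funD; exact: measurable_funX.
pose D := C * ((1 + zwt R l) ^+ e * expR (- a * zwt R l ^+ 2)).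
have ic : nu.-integrable setT (fun y => (cabs (fterm f t l y))%:E).
  apply: (@integrable_dominated _ _ _ nu (fun y => cabs (fterm f t l y)) (fun=> D)) => //; first exact: nu_bounded_integrable.
  by move=> y; rewrite ger0_norm ?cabs_ge0 //; exact: h.
apply: le_trans (cabs_cint_le il ic) _; rewrite -!mulrA ler_wpM2l //.
have : \int[nu]_y cabs (fterm f t l y) <= \int[nu]_y (fun=> D) y.
  apply: le_Rintegral => //; exact: nu_bounded_integrable.
rewrite Rintegral_cst // => h2; apply: le_trans h2 _.
rewrite (_ : C * (C' * _) = C * (C' * expR (- zwt R l)) * fine (nu setT)); last by ring.
rewrite ler_wpM2r ?fine_ge0 // /D ler_wpM2l //; apply: h'; exact: zwt_ge0.
Qed.

Let gbij : bijective g. Proof. by exists gi. Qed.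

(** Summing last: each term is averaged over the square, which is the theta series with the averaged
    kernel. *)
Lemma fam_csum f t : admC f -> upper t -> fam f t = csum (fun l => cint nu (fterm f t l)).
Proof.
move=> hf ut; have [_ ->] := csum_enum gbij (cint_fterm_summable hf ut).
rewrite /fam /gint; apply: (@cint_Fubini1 _ _ _ _ _ (@counting nat R) nu (fun x => fterm f t (g x.1) x.2)).
  exact: (gint_integrable NX0 NX_integrable admC_expo expo_decay hf ut).
by move=> m /=; exact: (@fterm_integrable f t (g m) hf ut).
Qed.

(** Averaging last: a transformation law for each single plane can be integrated over the square. *)
Lemma fam_cint f t : admC f -> upper t -> fam f t = cint nu (fun y => csum (fun l => fterm f t l y)).
Proof.
move=> hf ut; rewrite /fam /gint.
have -> : (fun y => csum (fun l => fterm f t l y)) = (fun y => cint (@counting nat R) (fun m => fterm f t (g m) y)).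
  by apply/funext => y; have [_ ->] := csum_enum gbij (fterm_summable y hf ut).
apply: (@cint_Fubini2 _ _ _ _ _ (@counting nat R) nu (fun x => fterm f t (g x.1) x.2)).
  exact: (gint_integrable NX0 NX_integrable admC_expo expo_decay hf ut).
by move=> y /=; have [] := csum_enum gbij (fterm_summable y hf ut).
Qed.

Lemma csum_fterm_integrable f t : admC f -> upper t -> cintegrable nu (fun y => csum (fun l => fterm f t l y)).
Proof.
move=> hf ut.
have -> : (fun y => csum (fun l => fterm f t l y)) = (fun y => cint (@counting nat R) (fun m => fterm f t (g m) y)).
  by apply/funext => y; have [_ ->] := csum_enum gbij (fterm_summable y hf ut).
apply: (@cint_Fubini2_integrable _ _ _ _ _ (@counting nat R) nu (fun x => fterm f t (g x.1) x.2)).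
  exact: (gint_integrable NX0 NX_integrable admC_expo expo_decay hf ut).
by move=> y /=; have [] := csum_enum gbij (fterm_summable y hf ut).
Qed.

End Measure.
End ThetaFamily.

Lemma cint_dirac (R : realType) d (X : measurableType d) (a : X) (f : X -> R[i]) : cmeas f ->
  cint (\d_a) f = f a.
Proof.
move=> [m1 m2]; apply: complexRI => /=; rewrite /Rintegral integral_dirac ?diracT ?mul1e //; exact/measurable_EFinP.
Qed.

(** * Inversion of the Siegel theta series of one plane *)

Section ComplexForms.
Variables (R : realType) (n : nat) (A : 'M[R]_n) (p : 'rV[R]_n).
Hypothesis A_sym : A^T = A.
Local Notation C := R[i].
Local Notation V := 'rV[R]_n.
Local Notation Y := (measurableTypeR R * measurableTypeR R)%type.
Local Notation W := (R * R * V * V)%type.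
Local Notation rC := (map_mx (real_complex R)).

Lemma qf_rC (M : 'M[R]_n) x : qf (rC M) (rC x) = (qf M x)%:C.
Proof. by rewrite /qf matrix.map_trmx -!map_mxM mxE. Qed.

Lemma dotp_rC (x y : V) : dotp (rC x) (rC y) = (dotp x y)%:C.
Proof. by rewrite /dotp matrix.map_trmx -map_mxM mxE. Qed.

Lemma dotpA x y : dotp x (y *m A) = B A x y.
Proof. by rewrite /dotp trmx_mul A_sym mulmxA. Qed.

(* In the matrix of Q_+ the complex structure of the theta exponent is
   - (conj tau P + tau (A - P)); its imaginary part is Im tau times the
   majorant 2 P - A. *)
Definition OmT (P : 'M[R]_n) (tau : C) : 'M[C]_n := - (conjc tau *: rC P + tau *: rC (A - P)).

Lemma qf_OmT P tau x : qf (OmT P tau) (rC x) = - (conjc tau * (qf P x)%:C + tau * (Q A x - qf P x)%:C).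
Proof. by rewrite /OmT qfN qfDm !qf_scale !qf_rC qfDm qfN. Qed.

Lemma OmT_sym P tau : P^T = P -> (OmT P tau)^T = OmT P tau.
Proof.
move=> Ps; apply/matrixP => i j; rewrite !mxE.
have -> : P j i = P i j by rewrite -[in LHS]Ps mxE.
by have -> : A j i = A i j by rewrite -[in LHS]A_sym mxE.
Qed.

Lemma OmT_posIm P tau : P^T = P -> 0 < Im tau -> (forall x, x != 0 -> 0 < 2 * qf P x - Q A x) -> posIm (OmT P tau).
Proof.
move=> Ps t0 h; split; first exact: OmT_sym.
move=> x x0; rewrite qf_OmT; case: tau t0 => a b /= b0.
rewrite !mulr0 !add0r.
have := mulr_gt0 b0 (h x x0); move: (qf P x) (Q A x) => u v; lra.
Qed.

Section Inverse.
Variable P : 'M[R]_n.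
Hypothesis A_unit : A \in unitmx.
Hypothesis P_idem : P *m invmx A *m P = P.

(** Relative to [A], the forms [P] and [A - P] behave as complementary idempotents, so the product
    is computed on each part separately, where [- 1 / tau] times [tau], or their conjugates, give
    -1. *)
Lemma OmT_inv tau : tau != 0 -> OmT P (- tau^-1) *m rC (invmx A) *m OmT P tau = - rC A.
Proof.
move=> t0.
have XX : rC P *m rC (invmx A) *m rC P = rC P by rewrite -!map_mxM P_idem.
have XY : rC P *m rC (invmx A) *m rC (A - P) = 0.
  by rewrite -!map_mxM mulmxBr P_idem mulmxKV // subrr map_mx0.
have YX : rC (A - P) *m rC (invmx A) *m rC P = 0.
  by rewrite -!map_mxM !mulmxBl mulmxV // mul1mx P_idem subrr map_mx0.
have YY : rC (A - P) *m rC (invmx A) *m rC (A - P) = rC (A - P).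
  by rewrite -!map_mxM mulmxBr [X in _ - X](_ : _ = 0) ?subr0 ?mulmxKV // !mulmxBl mulmxV // mul1mx P_idem subrr.
have e1 : conjc (- tau^-1) * conjc tau = -1 by rewrite -rmorphM /= mulNr mulVf // rmorphN1.
have e2 : - tau^-1 * tau = -1 by rewrite mulNr mulVf.
rewrite /OmT mulNmx mulNmx mulmxN opprK !mulmxDl !mulmxDr -!scalemxAl -!scalemxAr XX XY YX YY !scaler0 addr0 add0r !scalerA e1 e2.
by rewrite !scaleN1r -opprD -map_mxD addrC subrK.
Qed.

Lemma OmT_inv_qf tau (w : 'rV[C]_n) : tau != 0 -> OmT P (- tau^-1) \in unitmx ->
  qf (invmx (OmT P (- tau^-1))) (w *m rC A) = - qf (OmT P tau) w.
Proof.
move=> t0 Ou; have h := OmT_inv t0.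
have e : rC A *m invmx (OmT P (- tau^-1)) *m rC A = - OmT P tau.
  have -> : OmT P tau = rC A *m invmx (OmT P (- tau^-1)) *m (OmT P (- tau^-1) *m rC (invmx A) *m OmT P tau).
    by rewrite !mulmxA mulmxKV // -map_mxM mulmxV // map_mx1 mul1mx.
  by rewrite h mulmxN opprK.
rewrite /qf trmx_mul matrix.map_trmx A_sym !mulmxA -(mulmxA w) -(mulmxA w) e mulmxN mulNmx mxE //.
Qed.
End Inverse.

(** The bare Gaussian term of the series, see [cexp_expo]; by [T0_summand] it is a constant times a
    Riemann theta summand for [OmT P tau]. *)
Definition T0 (P : 'M[R]_n) (kap : R) (mu : V) (tau : C) (b c : V) l : C :=
  ee (qf (OmT P tau) (rC (kv p mu l + b)) / 2 + (B A (kv p mu l) p / 2 + B A c (kv p mu l) + kap * B A c b)%:C).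

Lemma cexp_expo (P : Y -> 'M[R]_n) kap mu (t : W) l y :
  cexp (expo A p P mu kap t l y) = T0 (P y) kap mu (t.1.1.1 +i* t.1.1.2) t.1.2 t.2 l.
Proof.
rewrite /T0 qf_OmT /ee /expo /fre /fim; congr cexp.
have h2 (z : C) : z / 2 = (2^-1)%:C * z by rewrite fmorphV rmorph_nat mulrC.
rewrite h2; apply: complexRI; rewrite ?(cReD, cImD, cReN, cImN, cReM, cImM) /=;
  rewrite ?(cReD, cImD, cReN, cImN, cReM, cImM) /=; by move: (pi : R) => P0; field.
Qed.

Lemma T0_summand P kap mu tau b c : P^T = P -> exists E, forall l,
  T0 P kap mu tau b c l = E * theta_summand (OmT P tau)
    (rC (mu + 2^-1 *: p + b) *m OmT P tau + rC ((2^-1 *: p + c) *m A)) l.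
Proof.
move=> Ps; set h := mu + 2^-1 *: p + b; have Os := OmT_sym tau Ps.
exists (ee (qf (OmT P tau) (rC h) / 2 + (B A (mu + 2^-1 *: p) p / 2 + B A c (mu + 2^-1 *: p) + kap * B A c b)%:C)) => l.
rewrite /T0 /theta_summand -ee_D; congr ee.
have -> : kv p mu l + b = rv l + h by rewrite /kv /h !addrA.
have -> : kv p mu l = rv l + (mu + 2^-1 *: p) by rewrite /kv addrA.
rewrite map_mxD -latC_real qfD // dotpDr (_ : dotp (latC R l) (rC h *m OmT P tau) = dotp (latC R l *m OmT P tau) (rC h)); last first.
  by rewrite /dotp trmx_mul Os mulmxA.
rewrite [latC R l in X in _ = _ + (_ + (_ + X))]latC_real dotp_rC dotpA -/(rv l).
have -> : (B A (rv l + (mu + 2^-1 *: p)) p / 2 + B A c (rv l + (mu + 2^-1 *: p)) + kap * B A c b)%:C =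
    (B A (mu + 2^-1 *: p) p / 2 + B A c (mu + 2^-1 *: p) + kap * B A c b)%:C + (B A (rv l) (2^-1 *: p + c))%:C.
  rewrite -rmorphD /=; congr (_%:C); rewrite !(BDl, BDr, BZl, BZr) (BC A_sym c (rv l)); by field.
move: (_%:C) (_%:C) (dotp _ _) (qf _ _) (qf _ _) => z1 z2 z3 z4 z5; by field.
Qed.

Lemma T0_summable P kap mu tau b c : posIm (OmT P tau) -> P^T = P -> abs_summable (T0 P kap mu tau b c).
Proof.
move=> hp Ps; have [E hE] := T0_summand kap mu tau b c Ps; rewrite (funext hE).
by apply: abs_summableZ; exact: theta_summable_posIm.
Qed.

Section Inversion.
Variable c0 : C -> C.
Hypothesis c_sqr : forall ps, 0 < Im ps -> c0 ps != 0 /\ c0 ps ^+ 2 * ps = 'i%C.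
Hypothesis c_inv : forall om ze, 0 < Im om ->
  [/\ abs_summable (fun k : int => ee (om * k%:~R ^+ 2 / 2 + k%:~R * ze)),
      abs_summable (fun m : int => ee (- ((m%:~R + ze) ^+ 2 / (2 * om)))) &
      csum (fun m : int => ee (- ((m%:~R + ze) ^+ 2 / (2 * om)))) =
      c0 (- om^-1) * csum (fun k : int => ee (om * k%:~R ^+ 2 / 2 + k%:~R * ze))].
Variables (P : 'M[R]_n) (Az : 'M[int]_n) (s : seq V).
Hypothesis A_int : A = map_mx intr Az.
Hypothesis A_det : \det Az != 0.
Hypothesis s_uniq : uniq s.
Hypothesis s_reps : dual_box Az = [set` s].
Hypothesis p_int : integral_row p.
Hypothesis P_sym : P^T = P.
Hypothesis P_idem : P *m invmx A *m P = P.
Hypothesis P_pos : forall x, x != 0 -> 0 < 2 * qf P x - Q A x.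

Lemma A_unit : A \in unitmx.
Proof. by rewrite A_int unitmxE det_map_mx unitfE intr_eq0. Qed.

Lemma upper_neq0 (tau : C) : 0 < Im tau -> tau != 0.
Proof. by move=> h; apply/eqP => e; move: h; rewrite e /= ltxx. Qed.

Lemma upper_inv (tau : C) : 0 < Im tau -> 0 < Im (- tau^-1).
Proof. exact: Im_negV. Qed.

(** Inversion creates the phase e(B(c, b)). With [kap = 0] on the left and [kap = 1] on the right it
    sits entirely on one side, and the factor in front depends on neither [b] nor [c], which allows
    differentiation in [c]. *)
Theorem theta_inversion mu (tau : C) (b c : V) : integral_row (mu *m A) -> 0 < Im tau ->
  csum (T0 P 0 mu (- tau^-1) c (- b)) =
  (kappa c0 (OmT P (- tau^-1)) * ee (Q A p / 4)%:C) * \sum_(nu <- s) ee (B A mu nu)%:C * csum (T0 P 1 nu tau b c).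
Proof.
move=> hmu t0; set tau' := - tau^-1; have t0' : 0 < Im tau' := upper_inv t0.
have tn0 := upper_neq0 t0.
have hp := OmT_posIm P_sym t0 P_pos; have hp' := OmT_posIm P_sym t0' P_pos.
have Ou := posIm_unit hp'.
set Om' := OmT P tau' in hp' Ou *; set h := mu + 2^-1 *: p + c; pose r := 2^-1 *: p - b.
have Os' : Om'^T = Om' by exact: OmT_sym.
pose E1 := ee (qf Om' (rC h) / 2 + (B A (mu + 2^-1 *: p) p / 2 + B A (- b) (mu + 2^-1 *: p))%:C).
have step1 l : T0 P 0 mu tau' c (- b) l = E1 * theta_summand Om' (rC h *m Om' + rC (r *m A)) l.
  rewrite /T0 /theta_summand /E1 -ee_D; congr ee; rewrite -/Om'.
  have -> : kv p mu l + c = rv l + h by rewrite /kv /h !addrA.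
  have -> : kv p mu l = rv l + (mu + 2^-1 *: p) by rewrite /kv addrA.
  rewrite map_mxD -latC_real qfD // dotpDr (_ : dotp (latC R l) (rC h *m Om') = dotp (latC R l *m Om') (rC h)); last first.
    by rewrite /dotp trmx_mul Os' mulmxA.
  rewrite [latC R l in X in _ = _ + (_ + (_ + X))]latC_real dotp_rC dotpA -/(rv l).
  have -> : (B A (rv l + (mu + 2^-1 *: p)) p / 2 + B A (- b) (rv l + (mu + 2^-1 *: p)) + 0 * B A (- b) c)%:C =
      (B A (mu + 2^-1 *: p) p / 2 + B A (- b) (mu + 2^-1 *: p))%:C + (B A (rv l) r)%:C.
    rewrite -rmorphD /= /r; congr (_%:C); rewrite !(BDl, BDr, BZl, BZr, BNl, BNr) (BC A_sym b (rv l)); by field.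
  move: (_%:C) (_%:C) (dotp _ _) (qf _ _) (qf _ _) => z1 z2 z3 z4 z5; by field.
have dual_sum (z : 'rV[C]_n) : abs_summable (fun m : 'rV[int]_n => ee (- (qf (invmx Om') (latC R m + z) / 2))).
  exact: dual_summable.
rewrite (funext step1) csumZ; last exact: theta_summable_posIm.
rewrite (gauss_inversion c_sqr c_inv _ hp'); move: (kappa c0 Om') => kap.
pose f0 (x : V) := ee (- (qf (invmx Om') (rC ((x + r) *m A) + rC h *m Om') / 2)).
have Aiu := A_unit.
have step2 (m : 'rV[int]_n) : ee (- (qf (invmx Om') (latC R m + (rC h *m Om' + rC (r *m A))) / 2)) = f0 (rv m *m invmx A).
  rewrite /f0; have -> : rC ((rv m *m invmx A + r) *m A) = latC R m + rC (r *m A).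
    by rewrite mulmxDl mulmxKV // map_mxD latC_real.
  by rewrite addrCA addrC.
rewrite (funext step2).
pose f (la : V) := f0 (- la - p).
pose pz := intv p; have ep : rv pz = p by exact: intvK.
(* On dual vectors this is the reflection sending [la] to [- la - p]. It turns the shift [p / 2 - b]
   into minus the shift [p / 2 + b] expected on the right, and the form is even. *)
pose e (m : 'rV[int]_n) := - m - pz *m Az.
have e_bij : bijective e by exists e => m; rewrite /e opprB addrAC subrr add0r opprK ?subrr // addrC subrK.
have step3 m : f0 (rv (e m) *m invmx A) = f (rv m *m invmx (map_mx intr Az)).
  rewrite /f -A_int; congr f0; rewrite /e rvD !rvN mulmxBl mulNmx; congr (_ - _).
  by rewrite rvM -A_int mulmxK.
rewrite (csum_bij _ e_bij) (funext step3).
have sf : abs_summable (fun m : 'rV[int]_n => f (rv m *m invmx (map_mx intr Az))).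
  have sf0 : abs_summable (fun m : 'rV[int]_n => f0 (rv m *m invmx A)).
    rewrite -(funext step2); exact: dual_sum.
  exact: (eq_ind _ (@abs_summable R _) (abs_summable_inj (bij_inj e_bij) sf0) _ (funext step3)).
rewrite (csum_dual_split A_det s_uniq s_reps sf).
have fE la : E1 * f la = ee (qf (OmT P tau) (rC (la + 2^-1 *: p + b)) / 2 + (B A (la + 2^-1 *: p + b) h
     + B A (mu + 2^-1 *: p) p / 2 + B A (- b) (mu + 2^-1 *: p))%:C).
  rewrite /E1 /f /f0 -ee_D; congr ee; set x := la + 2^-1 *: p + b.
  have -> : - la - p + r = - x.
    rewrite /x /r; apply/rowP => i; rewrite !mxE; by field.
  have qN : (invmx Om')^T = invmx Om' by rewrite trmx_inv Os'.
  have oq (w : 'rV[C]_n) : qf (invmx Om') (w *m rC A) = - qf (OmT P tau) w.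
    by apply: OmT_inv_qf; [exact: Aiu|exact: P_idem|exact: tn0|exact: Ou].
  rewrite (qfD _ _ qN) map_mxM oq.
  have -> : qf (invmx Om') (rC h *m Om') = qf Om' (rC h) by exact: qf_inv.
  have -> : dotp (rC (- x) *m rC A *m invmx Om') (rC h *m Om') = - (B A x h)%:C.
    rewrite /dotp trmx_mul Os' !mulmxA mulmxKV // matrix.map_trmx -!map_mxM mxE.
    by rewrite -/(B A (- x) h) BNl rmorphN.
  have -> : qf (OmT P tau) (rC (- x)) = qf (OmT P tau) (rC x).
    by rewrite !qf_OmT /Q BNl BNr opprK -[- x]scaleN1r qfZ sqrrN expr1n mul1r.
  rewrite !rmorphD /=; move: (qf _ _) (qf _ _) (B A x h)%:C (_%:C) (_%:C) => z1 z2 z3 z4 z5; by field.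
have E10 : E1 != 0 by exact: ee_neq0.
clearbody f E1.
have step4 nu : nu \in s -> E1 * csum (fun l : 'rV[int]_n => f (rv l + nu)) =
    ee (Q A p / 4)%:C * (ee (B A mu nu)%:C * csum (T0 P 1 nu tau b c)).
  move=> nus.
  have eterm l : E1 * f (rv l + nu) = (ee (Q A p / 4)%:C * ee (B A mu nu)%:C) * T0 P 1 nu tau b c l.
    rewrite fE -ee_D /T0 -ee_D.
    have -> : rv l + nu + 2^-1 *: p = kv p nu l by [].
    set k := kv p nu l.
    have -> : (B A (k + b) h + B A (mu + 2^-1 *: p) p / 2 + B A (- b) (mu + 2^-1 *: p))%:C =
       (Q A p / 4)%:C + (B A mu nu)%:C + (B A k p / 2 + B A c k + 1 * B A c b)%:C + (B A (rv l + p) mu)%:C.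
      rewrite -!rmorphD /=; congr (_%:C); rewrite /h /k /kv -/(rv l) /Q.
      rewrite !(BDl, BDr, BZl, BZr, BNl, BNr) (BC A_sym mu nu) (BC A_sym c (rv l)) (BC A_sym c nu) (BC A_sym c p) (BC A_sym c b) (BC A_sym mu p); by field.
    (* The surplus phase pairs a lattice vector with a dual one and disappears modulo integers. *)
    have hi : (B A (rv l + p) mu) \is a Num.int.
      rewrite (BC A_sym) /B mxE; apply: rpred_sum => j _; apply: rpredM; first exact: hmu.
      by rewrite mxE; apply: integral_rowD => //; exact: rv_int.
    move: (ee_int hi); move: (qf _ _ / 2) (Q A p / 4)%:C (B A mu nu)%:C (B A k p / 2 + _ + _)%:C (B A (rv l + p) mu)%:C => z1 z2 z3 z4 z5 e5.
    by rewrite (_ : z1 + (z2 + z3 + z4 + z5) = z2 + z3 + (z1 + z4) + z5) ?ee_D ?e5 ?mulr1 //; ring.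
  have sT : abs_summable (T0 P 1 nu tau b c) by exact: T0_summable.
  rewrite mulrA -(csumZ _ sT).
  have sl : abs_summable (fun l : 'rV[int]_n => f (rv l + nu)).
    have -> : (fun l : 'rV[int]_n => f (rv l + nu)) = (fun l => E1^-1 * ((ee (Q A p / 4)%:C * ee (B A mu nu)%:C) * T0 P 1 nu tau b c l)).
      apply/funext => l; rewrite -(eterm l) mulrA mulVf // mul1r //.
    by do 2 apply: abs_summableZ.
  by rewrite -(csumZ _ sl); congr csum; apply/funext => l; exact: eterm.
rewrite mulrCA -mulrA; congr (_ * _); rewrite !mulr_sumr [LHS]big_seq_cond [RHS]big_seq_cond.
by apply: eq_bigr => nu; rewrite andbT => nus; exact: step4.
Qed.

End Inversion.
End ComplexForms.

(** * Transformation with the quadratic insertion, for one plane *)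

Section PointTransformation.
Variables (R : realType) (n : nat) (A : 'M[R]_n) (p : 'rV[R]_n).
Hypothesis A_sym : A^T = A.
Local Notation C := R[i].
Local Notation V := 'rV[R]_n.
Local Notation Y := (measurableTypeR R * measurableTypeR R)%type.
Local Notation W := (R * R * V * V)%type.
Variables (g : nat -> 'rV[int]_n) (gi : 'rV[int]_n -> nat).
Hypothesis gK : cancel g gi.
Hypothesis giK : cancel gi g.
Variables (P : 'M[R]_n) (eps : R).
Hypothesis P_sym : P^T = P.
Hypothesis eps0 : 0 < eps.
Hypothesis P_maj : forall x, eps * nsq x <= 2 * qf P x - Q A x.

Let PP : Y -> 'M[R]_n := fun=> P.
Let y0 : Y := (0, 0).
Let nu0 : {sigma_finite_measure set Y -> \bar R} := \d_y0.
Let KP : R := \sum_i \sum_j `|P i j|.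

Let PP_sym y : (PP y)^T = PP y. Proof. exact: P_sym. Qed.
Let PP_meas i j : measurable_fun setT (fun y => PP y i j). Proof. exact: measurable_cst. Qed.
Let PP_bnd y i j : `|PP y i j| <= KP.
Proof.
rewrite /KP (bigD1 i) //= (bigD1 j) //= -addrA lerDl addr_ge0 ?sumr_ge0 // => k _.
exact: sumr_ge0.
Qed.
Let PP_pos y x : eps * nsq x <= 2 * qf (PP y) x - Q A x. Proof. exact: P_maj. Qed.
Let nu0_fin : (nu0 setT < +oo)%E. Proof. by rewrite /nu0 /= diracT ltry. Qed.

Let F kap mu f (t : W) := fam A p g PP mu kap nu0 f t.
Let ut (t : W) : C := t.1.1.1 +i* t.1.1.2.

Let F_csum kap mu f t : admC g f -> upper t ->
  F kap mu f t = csum (fun l => f t l y0 * T0 A p P kap mu (ut t) t.1.2 t.2 l).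
Proof.
move=> hf ht; rewrite /F (@fam_csum R n A p g gi gK giK PP PP_meas KP PP_bnd eps eps0 PP_pos mu kap nu0 nu0_fin f t hf ht).
congr csum; apply/funext => l; rewrite cint_dirac; last first.
  exact: (@fterm_cmeas R n A p g gi giK PP PP_meas KP PP_bnd mu kap f t l hf).
by rewrite /fterm cexp_expo.
Qed.

Let F_summable kap mu f (t : W) : admC g f -> upper t ->
  abs_summable (fun l => f t l y0 * T0 A p P kap mu (ut t) t.1.2 t.2 l).
Proof.
move=> hf ht; have := @fterm_summable R n A p g gi giK PP eps eps0 PP_pos mu kap f t y0 hf ht.
by congr abs_summable; apply/funext => l; rewrite /fterm cexp_expo.
Qed.

Let l1 v mu (t : W) l : R := B A v (kv p mu l + t.1.2).

Let adm_l1 v mu : adm g (fun t l _ => l1 v mu t l).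
Proof. by apply: adm_B; [exact: vadm_cst|exact: vadm_xi]. Qed.

(** This is [- 2 pi i tau] times [l1]: for [v] orthogonal to the plane only the holomorphic part of
    the exponent varies along [v], so no [conj tau] appears. *)
Let qL v mu (t : W) l (y : Y) : C := (2 * pi * t.1.1.2 * l1 v mu t l)%:C + 'i%C * (- (2 * pi * t.1.1.1) * l1 v mu t l)%:C.
Let qR v mu (t : W) l (y : Y) : C := 'i%C * (2 * pi * l1 v mu t l)%:C.

Let adm_yl (h : W -> 'rV[int]_n -> R) : adm g (fun t l _ => h t l) -> adm g (fun t l _ => 2 * pi * t.1.1.2 * h t l).
Proof. by move=> ah; apply: admM => //; apply: admM; [exact: adm_cst|exact: adm_y]. Qed.

Let adm_xl (h : W -> 'rV[int]_n -> R) : adm g (fun t l _ => h t l) -> adm g (fun t l _ => - (2 * pi * t.1.1.1) * h t l).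
Proof. by move=> ah; apply: admM => //; apply: admN; apply: admM; [exact: adm_cst|exact: adm_x]. Qed.

Let admC_yx (h h' : W -> 'rV[int]_n -> R) : adm g (fun t l _ => h t l) -> adm g (fun t l _ => h' t l) ->
  admC g (fun t l (y : Y) => (2 * pi * t.1.1.2 * h t l)%:C + 'i%C * (- (2 * pi * t.1.1.1) * h' t l)%:C).
Proof. by move=> ah ah'; apply: admC_D (adm_yl ah) (admC_M (admC_cst g 'i%C) (adm_xl ah')). Qed.

Let admC_qL v mu : admC g (qL v mu).
Proof. exact: (admC_yx (adm_l1 v mu) (adm_l1 v mu)). Qed.

Let admC_qR v mu : admC g (qR v mu).
Proof. exact: (admC_M (admC_cst g 'i%C) (admM (adm_cst g (2 * pi)) (adm_l1 v mu))). Qed.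

Let cder_expo_b v mu (t : W) l y : v *m P = 0 -> cder (fun t => expo A p PP mu 0 t l y) t (0, 0, v, 0) (qL v mu t l y).
Proof.
move=> vP; apply: cder_eq (expo_cder_b p A_sym PP_sym mu 0 t v l y) _.
rewrite /qL /l1 /PP vP /dotp mul0mx mxE; congr (_%:C + _ * _%:C); ring.
Qed.

Let cder_expo_c v mu (t : W) l y : cder (fun t => expo A p PP mu 1 t l y) t (0, 0, 0, v) (qR v mu t l y).
Proof.
apply: cder_eq (expo_cder_c A p PP mu 1 t v l y) _.
by rewrite /qR /l1 BDr mul1r.
Qed.

Let dqL v w mu (t : W) l y : cder (fun t => qL v mu t l y) t (0, 0, w, 0)
  ((2 * pi * t.1.1.2 * B A v w)%:C + 'i%C * (- (2 * pi * t.1.1.1) * B A v w)%:C).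
Proof.
move: t => [[[x yy] b] c]; apply: cderD; [apply: cder_real|apply: cderZ; apply: cder_real];
  apply: (is_derive_quad (b := 0)) => h; rewrite dirE /l1 /= !mulr0 !add0r !BDr BZr; ring.
Qed.

Let dqR v w mu (t : W) l y : cder (fun t => qR v mu t l y) t (0, 0, 0, w) 0.
Proof.
rewrite -(mulr0 'i%C) -[X in 'i%C * X](rmorph0 (real_complex R)).
move: t => [[[x yy] b] c]; apply: cderZ; apply: cder_real.
by apply: (is_derive_quad (b := 0)) => h; rewrite dirE /l1 /= !mulr0 scaler0 !add0r; ring.
Qed.

Let dF kap mu f f' q' (t : W) v : admC g f -> admC g f' -> admC g q' ->
  (forall t l y, cder (fun t => f t l y) t v (f' t l y)) ->
  (forall t l y, cder (fun t => expo A p PP mu kap t l y) t v (q' t l y)) -> upper t ->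
  cder (F kap mu f) t v (F kap mu (fun t l y => f' t l y + f t l y * q' t l y) t).
Proof.
move=> h1 h2 h3 d1 d2 ht.
exact: (@fam_cder R n A p g gi gK giK PP PP_meas KP PP_bnd eps eps0 PP_pos mu kap nu0 nu0_fin f f' q' t v h1 h2 h3 d1 d2 ht).
Qed.

Lemma cder_sum (U : normedModType R) (I : Type) (s : seq I) (k : I -> C) (H H' : I -> U -> C) t v :
  (forall i, cder (H i) t v (H' i t)) -> cder (fun t => \sum_(i <- s) k i * H i t) t v (\sum_(i <- s) k i * H' i t).
Proof.
move=> h; elim: s => [|i s ih].
  by rewrite big_nil; under eq_fun do rewrite big_nil; exact: cder_cst.
by rewrite big_cons; under eq_fun do rewrite big_cons; apply: cderD ih; exact: cderZ.
Qed.

(** The variable [c] occupies the shift slot on the left and the character slot on the right; the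
    identity is differentiated along [c + r v]. *)
Let deriv_identity (tau tau' : R * R) (b : V) v (s : seq V) (K : C) (e : V -> C) (G G1 : W -> C) (H H1 : V -> W -> C) :
  (forall c, G (tau'.1, tau'.2, c, - b) = K * \sum_(nu <- s) e nu * H nu (tau.1, tau.2, b, c)) ->
  (forall c, cder G (tau'.1, tau'.2, c, - b) (0, 0, v, 0) (G1 (tau'.1, tau'.2, c, - b))) ->
  (forall nu c, cder (H nu) (tau.1, tau.2, b, c) (0, 0, 0, v) (H1 nu (tau.1, tau.2, b, c))) ->
  forall c, G1 (tau'.1, tau'.2, c, - b) = K * \sum_(nu <- s) e nu * H1 nu (tau.1, tau.2, b, c).
Proof.
move=> hGH dG dH c.
pose ga (r : R) : W := (tau'.1, tau'.2, c + r *: v, - b); pose gb (r : R) : W := (tau.1, tau.2, b, c + r *: v).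
have ga0 : ga 0 = (tau'.1, tau'.2, c, - b) by rewrite /ga scale0r addr0.
have gb0 : gb 0 = (tau.1, tau.2, b, c) by rewrite /gb scale0r addr0.
have la (h : R) : ga (h + 0) = h *: ((0, 0, v, 0) : W) + ga 0.
  by rewrite ga0 dirE /ga !mulr0 scaler0 !add0r addr0 [h *: v + c]addrC.
have lb (h : R) : gb (h + 0) = h *: ((0, 0, 0, v) : W) + gb 0.
  by rewrite gb0 dirE /gb !mulr0 scaler0 !add0r addr0 [h *: v + c]addrC.
have d1 : cder (fun r => G (ga r)) (0 : R) 1 (G1 (tau'.1, tau'.2, c, - b)).
  by apply: (cder_line la); rewrite ga0; exact: dG.
have d2 : cder (fun r => G (ga r)) (0 : R) 1 (K * \sum_(nu <- s) e nu * H1 nu (tau.1, tau.2, b, c)).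
  rewrite (_ : (fun r => _) = (fun r => K * \sum_(nu <- s) e nu * H nu (gb r))); last by apply/funext => r; rewrite /ga hGH.
  apply: cderZ; have := @cder_sum R V s e (fun nu r => H nu (gb r)) (fun nu _ => H1 nu (tau.1, tau.2, b, c)) 0 1.
  by apply => nu; apply: (cder_line lb); rewrite gb0; exact: dH.
exact: cder_uniq d1 d2.
Qed.

Variables (s : seq V) (K : C) (e : V -> C) (tau : C) (b c : V) (mu v1 v2 : V).
Let tau' := - tau^-1.
Hypothesis tau_pos : 0 < Im tau.
Hypothesis v1P : v1 *m P = 0.
Hypothesis v2P : v2 *m P = 0.
Hypothesis inversion : forall c, csum (T0 A p P 0 mu tau' c (- b)) = K * \sum_(nu <- s) e nu * csum (T0 A p P 1 nu tau b c).
Let m12 := B A v1 v2.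

Let up (b' c' : V) : upper (Re tau, Im tau, b', c'). Proof. exact: tau_pos. Qed.
Let tau'_pos : 0 < Im tau'. Proof. exact: Im_negV. Qed.
Let up' (b' c' : V) : upper (Re tau', Im tau', b', c'). Proof. exact: tau'_pos. Qed.
Let etau (z : C) : Re z +i* Im z = z. Proof. by case: z. Qed.

Let F_csum2 kap nu f (ta : C) b' c' : admC g f -> 0 < Im ta ->
  F kap nu f (Re ta, Im ta, b', c') = csum (fun l => f (Re ta, Im ta, b', c') l y0 * T0 A p P kap nu ta b' c' l).
Proof. by move=> hf h; rewrite (@F_csum kap nu f (Re ta, Im ta, b', c') hf h) /ut /= etau. Qed.

(** Two applications of [deriv_identity], along [v1] and [v2]. On the left the first derivative
    brings down a factor that still depends on the shift, hence the extra term in [m12]; on the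
    right [kap = 1] makes the factor independent of [c]. *)
Let second_derivative :
  F 0 mu (fun t l y => ((2 * pi * t.1.1.2 * m12)%:C + 'i%C * (- (2 * pi * t.1.1.1) * m12)%:C) + (0 + 1 * qL v1 mu t l y) * qL v2 mu t l y) (Re tau', Im tau', c, - b) =
  K * \sum_(nu <- s) e nu * F 1 nu (fun t l y => 0 + (0 + 1 * qR v1 nu t l y) * qR v2 nu t l y) (Re tau, Im tau, b, c).
Proof.
pose one (t : W) (l : 'rV[int]_n) (y : Y) : C := 1; pose zero (t : W) (l : 'rV[int]_n) (y : Y) : C := 0.
have a1 : admC g one by exact: admC_cst.
have a0 : admC g zero by exact: admC_cst.
have d1 v t l y : cder (fun t => one t l y) t v (zero t l y) by exact: cder_cst.
pose fL t l y := 0 + 1 * qL v1 mu t l y; pose fR nu t l y := 0 + 1 * qR v1 nu t l y.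
have aL : admC g fL by apply: admC_D; [exact: admC_cst|apply: admC_M; [exact: admC_cst|exact: admC_qL]].
have aR nu : admC g (fR nu) by apply: admC_D; [exact: admC_cst|apply: admC_M; [exact: admC_cst|exact: admC_qR]].
have am : admC g (fun (t : W) (l : 'rV[int]_n) (y : Y) => (2 * pi * t.1.1.2 * m12)%:C + 'i%C * (- (2 * pi * t.1.1.1) * m12)%:C).
  exact: (admC_yx (adm_cst g m12) (adm_cst g m12)).
have I0 c1 : F 0 mu one (Re tau', Im tau', c1, - b) = K * \sum_(nu <- s) e nu * F 1 nu one (Re tau, Im tau, b, c1).
  have eF kap nu (ta : C) b' c' : 0 < Im ta -> F kap nu one (Re ta, Im ta, b', c') = csum (T0 A p P kap nu ta b' c').
    by move=> h; rewrite (F_csum2 kap nu b' c' a1 h); congr csum; apply/funext => l; rewrite mul1r.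
  rewrite (eF 0 mu tau' c1 (- b) tau'_pos) inversion; congr (_ * _); apply: eq_bigr => nu _.
  by rewrite (eF 1 nu tau b c1 tau_pos).
have I1 := @deriv_identity (Re tau, Im tau) (Re tau', Im tau') b v1 s K e (F 0 mu one) (F 0 mu fL) (fun nu => F 1 nu one) (fun nu => F 1 nu (fR nu)) I0.
have {}I1 c1 : F 0 mu fL (Re tau', Im tau', c1, - b) = K * \sum_(nu <- s) e nu * F 1 nu (fR nu) (Re tau, Im tau, b, c1).
  apply: I1 => [c2|nu c2].
    apply: (@dF 0 mu one zero (qL v1 mu)) => // t l y; exact: cder_expo_b.
  by apply: (@dF 1 nu one zero (qR v1 nu)) => // t l y; exact: cder_expo_c.
pose fL2 t l y := ((2 * pi * t.1.1.2 * m12)%:C + 'i%C * (- (2 * pi * t.1.1.1) * m12)%:C) + fL t l y * qL v2 mu t l y.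
pose fR2 nu t l y := zero t l y + fR nu t l y * qR v2 nu t l y.
have h1 c2 : cder (F 0 mu fL) (Re tau', Im tau', c2, - b) (0, 0, v2, 0) (F 0 mu fL2 (Re tau', Im tau', c2, - b)).
  apply: (@dF 0 mu fL _ (qL v2 mu) _ _ aL am (admC_qL v2 mu)) => [t l y|t l y|]; [|exact: cder_expo_b|exact: up'].
  by apply: cder_ext (dqL v1 v2 mu t l y) => t1; rewrite /fL add0r mul1r.
have h2 nu c2 : cder (F 1 nu (fR nu)) (Re tau, Im tau, b, c2) (0, 0, 0, v2) (F 1 nu (fR2 nu) (Re tau, Im tau, b, c2)).
  apply: (@dF 1 nu (fR nu) zero (qR v2 nu) _ _ (aR nu) a0 (admC_qR v2 nu)) => [t l y|t l y|]; [|exact: cder_expo_c|exact: up].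
  by apply: cder_ext (dqR v1 v2 nu t l y) => t1; rewrite /fR add0r mul1r.
exact: (@deriv_identity (Re tau, Im tau) (Re tau', Im tau') b v2 s K e (F 0 mu fL) (F 0 mu fL2) (fun nu => F 1 nu (fR nu)) (fun nu => F 1 nu (fR2 nu)) I1 h1 h2 c).
Qed.

Let X2 kap nu (ta : C) b' c' := csum (fun l => (B A v1 (kv p nu l + b') * B A v2 (kv p nu l + b'))%:C * T0 A p P kap nu ta b' c' l).

Let admC_l12 nu : admC g (fun t l _ => (l1 v1 nu t l * l1 v2 nu t l)%:C).
Proof. exact: (admM (adm_l1 v1 nu) (adm_l1 v2 nu)). Qed.

Let sum2 kap nu (ta : C) b' c' : 0 < Im ta -> abs_summable (fun l => (B A v1 (kv p nu l + b') * B A v2 (kv p nu l + b'))%:C * T0 A p P kap nu ta b' c' l).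
Proof.
move=> h; have := @F_summable kap nu _ (Re ta, Im ta, b', c') (admC_l12 nu) h.
by rewrite /ut /= etau.
Qed.

Let sum0 kap nu (ta : C) b' c' : 0 < Im ta -> abs_summable (T0 A p P kap nu ta b' c').
Proof.
move=> h; have := @F_summable kap nu (fun _ _ _ => 1) (Re ta, Im ta, b', c') (admC_cst g 1) h.
by rewrite /ut /= etau; congr abs_summable; apply/funext => l; rewrite mul1r.
Qed.

Let csum_combine kap nu (ta k1 k2 : C) b' c' : 0 < Im ta ->
  csum (fun l => (k1 * (B A v1 (kv p nu l + b') * B A v2 (kv p nu l + b'))%:C + k2) * T0 A p P kap nu ta b' c' l) =
  k1 * X2 kap nu ta b' c' + k2 * csum (T0 A p P kap nu ta b' c').
Proof.
move=> h; rewrite /X2 -(csumZ k1 (sum2 kap nu b' c' h)) -(csumZ k2 (sum0 kap nu b' c' h)).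
rewrite -csumD; [|exact: abs_summableZ (sum2 _ _ _ _ h)|exact: abs_summableZ (sum0 _ _ _ _ h)].
by congr csum; apply/funext => l; rewrite mulrDl mulrA.
Qed.

(** [second_derivative] with the factors [- 2 pi i tau'] and [2 pi i] pulled out of the sums. *)
Let moment_identity :
  (- (4 * pi ^+ 2)%:C * tau' ^+ 2) * X2 0 mu tau' c (- b) + (- (2 * pi * m12)%:C * 'i%C * tau') * csum (T0 A p P 0 mu tau' c (- b)) =
  K * \sum_(nu <- s) e nu * (- (4 * pi ^+ 2)%:C * X2 1 nu tau b c).
Proof.
have i2 : 'i%C * 'i%C = -1 :> C by rewrite -expr2 sqr_i.
have aone : admC g (fun (_ : W) (_ : 'rV[int]_n) (_ : Y) => 1) by exact: admC_cst.
have azero : admC g (fun (_ : W) (_ : 'rV[int]_n) (_ : Y) => 0) by exact: admC_cst.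
have aL := admC_D (admC_yx (adm_cst g m12) (adm_cst g m12)) (admC_M (admC_D azero (admC_M aone (admC_qL v1 mu))) (admC_qL v2 mu)).
have aR nu := admC_D azero (admC_M (admC_D azero (admC_M aone (admC_qR v1 nu))) (admC_qR v2 nu)).
have hq := second_derivative; rewrite (F_csum2 0 mu c (- b) aL tau'_pos) in hq.
rewrite -(csum_combine 0 mu _ _ c (- b) tau'_pos).
transitivity (K * \sum_(nu <- s) e nu * F 1 nu (fun t l y => 0 + (0 + 1 * qR v1 nu t l y) * qR v2 nu t l y) (Re tau, Im tau, b, c)).
  rewrite -hq; congr csum; apply/funext => l; congr (_ * _); rewrite /qL /l1 /= add0r mul1r.
  move: (B A v1 _) (B A v2 _) m12 (tau') => z1 z2 z3 [x y] /=.
  by apply: complexRI; rewrite ?(cReD, cImD, cReN, cImN, cReM, cImM, expr2) /= ?(cReD, cImD, cReN, cImN, cReM, cImM) /=; ring.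
congr (_ * _); apply: eq_bigr => nu _; congr (_ * _).
rewrite (F_csum2 1 nu b c (aR nu) tau_pos) /X2 -(csumZ _ (sum2 1 nu b c tau_pos)); congr csum; apply/funext => l.
rewrite mulrA; congr (_ * _); rewrite /qR /l1 /= add0r mul1r add0r mulrACA i2.
move: (B A v1 _) (B A v2 _) => z1 z2.
by apply: complexRI; rewrite ?(cReD, cImD, cReN, cImN, cReM, cImM, expr2) /= ?(cReD, cImD, cReN, cImN, cReM, cImM) /=; ring.
Qed.

Let T0_half nu (ta : C) b' c' (k : R) l : T0 A p P 2^-1 nu ta b' c' l = ee ((2^-1 - k) * B A c' b')%:C * T0 A p P k nu ta b' c' l.
Proof.
rewrite /T0 -ee_D; congr ee; rewrite addrCA; congr (_ + _); rewrite -rmorphD /=; congr (_%:C); ring.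
Qed.

(** By [moment_identity] the insertion acquires the factor [tau^2] and an inhomogeneous term in
    [m12]. Since [Im (- 1 / tau) = Im tau / (tau conj tau)] and [conj tau + 2 i Im tau = tau], the
    constant [m12 / (2 pi)] makes both parts scale by the same [tau / conj tau]. *)
Theorem point_transformation :
  csum (fun l => (2 * Im tau' * (B A v1 (kv p mu l + c) * B A v2 (kv p mu l + c)) + m12 / (2 * pi))%:C * T0 A p P 2^-1 mu tau' c (- b) l) =
  (K * (tau / conjc tau)) * \sum_(nu <- s) e nu *
    csum (fun l => (2 * Im tau * (B A v1 (kv p nu l + b) * B A v2 (kv p nu l + b)) + m12 / (2 * pi))%:C * T0 A p P 2^-1 nu tau b c l).
Proof.
have split_term nu (ta : C) b' c' (k : R) : 0 < Im ta ->
   csum (fun l => (2 * Im ta * (B A v1 (kv p nu l + b') * B A v2 (kv p nu l + b')) + m12 / (2 * pi))%:C * T0 A p P 2^-1 nu ta b' c' l) =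
   ee ((2^-1 - k) * B A c' b')%:C * ((2 * Im ta)%:C * X2 k nu ta b' c' + (m12 / (2 * pi))%:C * csum (T0 A p P k nu ta b' c')).
  move=> h; rewrite -(csum_combine k nu _ _ b' c' h) -csumZ.
    by congr csum; apply/funext => l; rewrite (T0_half nu ta b' c' k) mulrCA -rmorphM -rmorphD.
  rewrite (_ : (fun l => _) = (fun l => (2 * Im ta)%:C * ((B A v1 (kv p nu l + b') * B A v2 (kv p nu l + b'))%:C * T0 A p P k nu ta b' c' l) + (m12 / (2 * pi))%:C * T0 A p P k nu ta b' c' l)).
    by apply: abs_summableD; apply: abs_summableZ; [exact: sum2|exact: sum0].
  by apply/funext => l; rewrite mulrDl mulrA.
rewrite (split_term mu tau' c (- b) 0 tau'_pos) BNl subr0 mulrN.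
have -> : \sum_(nu <- s) e nu * csum (fun l => (2 * Im tau * (B A v1 (kv p nu l + b) * B A v2 (kv p nu l + b)) + m12 / (2 * pi))%:C * T0 A p P 2^-1 nu tau b c l) =
   ee (- (2^-1 * B A b c))%:C * ((2 * Im tau)%:C * (\sum_(nu <- s) e nu * X2 1 nu tau b c) + (m12 / (2 * pi))%:C * (\sum_(nu <- s) e nu * csum (T0 A p P 1 nu tau b c))).
  rewrite !mulr_sumr -big_split /= mulr_sumr; apply: eq_bigr => nu _.
  rewrite (split_term nu tau b c 1 tau_pos) (BC A_sym c b) (_ : (2^-1 - 1) * B A b c = - (2^-1 * B A b c)); last by field.
  by rewrite mulrCA; congr (_ * _); rewrite mulrDr; congr (_ + _); exact: mulrCA.
have := moment_identity; rewrite inversion.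
have -> : \sum_(nu <- s) e nu * (- (4 * pi ^+ 2)%:C * X2 1 nu tau b c) = - (4 * pi ^+ 2)%:C * \sum_(nu <- s) e nu * X2 1 nu tau b c.
  by rewrite mulr_sumr; apply: eq_bigr => nu _; rewrite mulrCA.
move: (\sum_(nu <- s) e nu * csum _) (\sum_(nu <- s) e nu * X2 _ _ _ _ _) (X2 _ _ _ _ _) => S0 S2 X.
have t0 : tau != 0 by apply/eqP => h; move: tau_pos; rewrite h /= ltxx.
have ct0 : conjc tau != 0 by rewrite conjc_eq0.
have y1 : (2 * Im tau)%:C = - 'i%C * (tau - conjc tau) :> C.
  by case: (tau) => x y; apply: complexRI => /=; rewrite ?(cReM, cImM) /=; ring.
have y2 : (2 * Im tau')%:C = - 'i%C * (tau - conjc tau) / (tau * conjc tau) :> C.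
  have -> : (2 * Im tau')%:C = - 'i%C * (tau' - conjc tau') by case: (tau') => x y; apply: complexRI => /=; rewrite ?(cReM, cImM) /=; ring.
  have -> : conjc tau' = - (conjc tau)^-1 by rewrite /tau' rmorphN fmorphV.
  by rewrite /tau'; field; rewrite t0 ct0.
rewrite y1 y2 {y1 y2 split_term} /tau'.
have p0 : pi%:C != 0 :> C by rewrite fmorph_eq0 gt_eqF // pi_gt0.
have i2 : 'i%C ^+ 2 = -1 :> C by rewrite sqr_i.
have -> : (4 * pi ^+ 2)%:C = 4 * pi%:C ^+ 2 :> C by rewrite rmorphM rmorph_nat rmorphXn.
have -> : (2 * pi * m12)%:C = 2 * pi%:C * m12%:C :> C by rewrite !rmorphM rmorph_nat.
have -> : (m12 / (2 * pi))%:C = m12%:C / (2 * pi%:C) :> C by rewrite rmorphM fmorphV rmorphM rmorph_nat.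
move: (ee _) (pi%:C : C) (m12%:C : C) ('i%C : C) i2 p0 => E P0 m I i2 p0 h.
have hX : X = tau ^+ 2 * K * S2 + I * tau * m * K * S0 / (2 * P0).
  have h1 : (- (4 * P0 ^+ 2) * (- tau^-1) ^+ 2) * X = K * (- (4 * P0 ^+ 2) * S2) - (- (2 * P0 * m) * I * - tau^-1) * (K * S0) by rewrite -h addrK.
  have k0 : - (4 * P0 ^+ 2) * (- tau^-1) ^+ 2 != 0 by rewrite mulf_neq0 ?oppr_eq0 ?mulf_neq0 ?expf_neq0 ?oppr_eq0 ?invr_eq0 // pnatr_eq0.
  by apply: (mulfI k0); rewrite h1; field; rewrite t0 p0.
rewrite hX; apply/eqP; rewrite -subr_eq0; apply/eqP.
(* The two sides differ by a multiple of [I^2 + 1], with [2 Im tau] written as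
   [- I (tau - conj tau)]. *)
transitivity ((I ^+ 2 + 1) * (- E * K * S0 * m * (tau - conjc tau) / (2 * P0 * conjc tau))).
  by field; rewrite t0 ct0 p0.
by rewrite i2 addNr mul0r.
Qed.

End PointTransformation.

(** Two ways of clearing one block of the same matrix. It reduces the determinant of a rank two
    perturbation to one of size 2; the powers of [t] on both sides avoid inverting [t]. *)
Lemma det_sylvester (F : comNzRingType) m n (X : 'M[F]_(m, n)) (Z : 'M[F]_(n, m)) (t : F) :
  \det (t%:M + Z *m X) * t ^+ m = \det (t%:M + X *m Z) * t ^+ n.
Proof.
pose M := block_mx 1%:M (- X) Z t%:M : 'M[F]_(m + n).
have d1 : \det M = \det (t%:M + Z *m X).
  have : \det (block_mx 1%:M 0 (- Z) 1%:M *m M) = \det (t%:M + Z *m X).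
    rewrite /M mulmx_block !mul1mx !mul0mx !addr0 mulmx1 addNr mulNmx mulmxN opprK [Z *m X + _]addrC.
    by rewrite det_ublock det1 mul1r.
  by rewrite det_mulmx det_lblock !det1 !mul1r.
have d2 : \det M * t ^+ m = \det (t%:M + X *m Z) * t ^+ n.
  have : \det (M *m block_mx t%:M 0 (- Z) 1%:M) = \det (t%:M + X *m Z) * t ^+ n.
    rewrite /M mulmx_block !mul1mx !mulmx0 !mulmx1 !add0r mulNmx mulmxN opprK mulmxN mul_mx_scalar mul_scalar_mx subrr.
    by rewrite det_ublock det_scalar.
  by rewrite det_mulmx det_lblock det1 mulr1 det_scalar.
by rewrite -d1.
Qed.

(** The quotient takes only the values 1 and -1, and by the intermediate value theorem it cannot
    change sign along the path. *)
Lemma sqr_eq_path (R : realType) (f h : R -> R[i]) : (forall s : R, ccont f s /\ ccont h s) ->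
  (forall s, h s != 0) -> (forall s, f s ^+ 2 = h s ^+ 2) -> f 0 = h 0 -> f 1 = h 1.
Proof.
move=> cfh hn e2 e0; pose r s := f s * (h s)^-1.
have cr s : ccont r s by apply: ccontM; [exact: (cfh s).1|apply: ccontV; [exact: hn|exact: (cfh s).2]].
have r2 s : r s = 1 \/ r s = -1.
  have : (r s) ^+ 2 == 1 by rewrite /r exprMn exprVn e2 mulfV // expf_neq0.
  by rewrite sqrf_eq1 => /orP[/eqP|/eqP]; [left|right].
have cRe : {within `[(0 : R), 1], continuous (fun s => Re (r s))}.
  by apply: continuous_subspaceT => s; exact: (cr s).1.
have r0 : r 0 = 1 by rewrite /r e0 mulfV.
have [r1|r1] := r2 1.
  by rewrite -[RHS]mul1r -r1 /r mulfVK.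
have [|z _ hz] := @IVT R (fun s => Re (r s)) 0 1 0 ler01 cRe.
  by rewrite r0 r1 /= ge_min le_max ler01 oppr_le0 ler01 orbT.
by have [e|e] := r2 z; move: hz; rewrite e /= => /eqP; rewrite ?oppr_eq0 oner_eq0.
Qed.

(** * The principal branch of powers on the upper half-plane *)

Section PrincipalBranch.
Variable R : realType.
Local Notation C := R[i].

Lemma cabs_upper (z : C) : 0 < Im z -> `|Re z| < cabs z.
Proof.
move=> h; have i0 : 0 < Im z ^+ 2 by rewrite exprn_gt0.
by rewrite /cabs -sqrtr_sqr ltr_sqrt; [rewrite ltrDl|rewrite ltr_wpDl ?sqr_ge0].
Qed.

Lemma cabs_upper0 (z : C) : 0 < Im z -> 0 < cabs z.
Proof. by move=> h; apply: le_lt_trans (cabs_upper h). Qed.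

Lemma ratio_upper (z : C) : 0 < Im z -> -1 < Re z / cabs z < 1.
Proof.
move=> h; have c0 := cabs_upper0 h; have := cabs_upper h; rewrite ltr_norml => /andP[h1 h2].
by rewrite ltr_pdivlMr // ltr_pdivrMr // mulN1r mul1r h1.
Qed.

Lemma upper_polar (z : C) : 0 < Im z -> (cabs z)%:C * cexp ('i%C * (acos (Re z / cabs z))%:C) = z.
Proof.
move=> h; have c0 := cabs_upper0 h; have /andP[r1 r2] := ratio_upper h.
have e : cexp ('i%C * (acos (Re z / cabs z))%:C) = (Re z / cabs z) +i* (Im z / cabs z).
  have -> : 'i%C * (acos (Re z / cabs z))%:C = 0 +i* acos (Re z / cabs z) :> C.
    by apply: complexRI; rewrite ?(cReM, cImM) /=; ring.
  rewrite /cexp /= expR0 mul1r acosK ?in_itv /= ?(ltW r1) ?(ltW r2) //.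
  rewrite sin_acos ?(ltW r1) ?(ltW r2) //; congr (_ +i* _).
  have -> : 1 - (Re z / cabs z) ^+ 2 = (Im z / cabs z) ^+ 2.
    have s2 : cabs z ^+ 2 = Re z ^+ 2 + Im z ^+ 2 by rewrite /cabs sqr_sqrtr // addr_ge0 ?sqr_ge0.
    rewrite !expr_div_n s2; field.
    by rewrite -s2 expf_neq0 // gt_eqF.
  by rewrite sqrtr_sqr ger0_norm // divr_ge0 // ltW.
have cn : cabs z != 0 by rewrite gt_eqF.
rewrite e; case: z {h c0 r1 r2 e} cn => x y /= cn.
by apply: complexRI; rewrite ?(cReM, cImM) /= mul0r ?subr0 ?addr0 mulrCA mulfV ?mulr1.
Qed.

Lemma cexpX (z : C) m : cexp z ^+ m = cexp (m%:R * z).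
Proof.
elim: m => [|m ih]; first by rewrite expr0 mul0r cexp0.
by rewrite exprS ih -cexpD -[in RHS]natr1 mulrDl mul1r addrC.
Qed.

Lemma hpow_half_sqr (z : C) m : 0 < Im z -> hpow z (m%:R / 2) ^+ 2 = z ^+ m.
Proof.
move=> h; have c0 := cabs_upper0 h.
rewrite -[in RHS](upper_polar h) /hpow [LHS]exprMn [RHS]exprMn !cexpX; congr (_ * cexp _).
  rewrite -!rmorphXn /=; congr (_%:C).
  by rewrite -(powR_mulrn 2 (powR_ge0 _ _)) -powRrM divfK // powR_mulrn // ltW.
rewrite rmorphM /= rmorphM fmorphV /= !rmorph_nat.
by move: (_%:C) => w; field.
Qed.

Lemma hpow_neq0 (z : C) w : 0 < Im z -> hpow z w != 0.
Proof.
move=> h; have c0 := cabs_upper0 h; rewrite mulf_neq0 ?cexp_neq0 // fmorph_eq0 gt_eqF //.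
exact: powR_gt0.
Qed.

Lemma hpow0 (z : C) : hpow z 0 = 1.
Proof. by rewrite /hpow powRr0 mul0r mulr0 cexp0 mulr1. Qed.

Lemma hpow_i (w : R) : hpow 'i%C w = ee (w / 4)%:C.
Proof.
have e1 : cabs ('i%C : C) = 1 by rewrite /cabs /= expr0n expr1n add0r sqrtr1.
rewrite /hpow e1 powR1 mul1r /= mul0r acos0 /ee; congr cexp.
apply: complexRI; rewrite ?(cReM, cImM) /= ?(cReM, cImM) /=; move: (pi : R) => P; by field.
Qed.

Lemma ccont_hpow (f : R -> C) (w s : R) : ccont f s -> (forall s, 0 < Im (f s)) -> ccont (fun s => hpow (f s) w) s.
Proof.
move=> [c1 c2] hp.
have ca : ctn (fun s => cabs (f s)) s by apply: ctn_sqrt; apply: ctnD; exact: ctnX.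
have c0 := cabs_upper0 (hp s).
have cl : ctn (fun s => ln (cabs (f s))) s by apply: (ctn_comp ca); exact: continuous_ln.
have ce : ctn (fun s => expR (w * ln (cabs (f s)))) s.
  by apply: ctn_expR; apply: ctnM => //; exact: ctn_cst.
have cr : ctn (fun s => Re (f s) / cabs (f s)) s by apply: ctnM => //; apply: ctnV => //; rewrite gt_eqF.
have cac : ctn (fun s => acos (Re (f s) / cabs (f s))) s.
  by apply: (ctn_comp cr); exact: continuous_acos (ratio_upper (hp s)).
have cw : ctn (fun s => w * acos (Re (f s) / cabs (f s))) s by apply: ctnM => //; exact: ctn_cst.
apply: ccontM; last by apply: ccont_cexp; apply: ccontM; [exact: ccont_cst|exact: (ccont_real cw)].
apply: ccont_real; rewrite (_ : (fun s => _) = (fun s => expR (w * ln (cabs (f s))))); first exact: ce.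
by apply/funext => x; rewrite /powR gt_eqF // cabs_upper0.
Qed.

End PrincipalBranch.

(** * The constant of the inversion formula *)

Section Constant.
Variables (R : realType) (n : nat) (A : 'M[R]_n).
Hypothesis A_sym : A^T = A.
Local Notation C := R[i].
Local Notation rC := (map_mx (real_complex R)).
Variable c0 : C -> C.
Hypothesis c_sqr : forall ps, 0 < Im ps -> c0 ps != 0 /\ c0 ps ^+ 2 * ps = 'i%C.
Hypothesis c_cont : forall (f : R -> C) (s : R), 0 < Im (f s) -> ccont f s -> ccont (fun s => c0 (f s)) s.
Hypothesis c_pos : forall t : R, 0 < t -> Im (c0 (0 +i* t)) = 0 /\ 0 < Re (c0 (0 +i* t)).
Variables (U : 'M[R]_(2, n)) (N : R).
Let P := U^T *m U.
Hypothesis A_unit : A \in unitmx.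
Hypothesis U_gram : U *m invmx A *m U^T = 1%:M.
Hypothesis P_pos : forall x, x != 0 -> 0 < 2 * qf P x - Q A x.
Hypothesis N_pos : 0 < N.
Hypothesis A_det : \det A = (-1) ^+ n * N.

Lemma P_sym : P^T = P. Proof. by rewrite /P trmx_mul trmxK. Qed.

Lemma P_idem : P *m invmx A *m P = P.
Proof.
have -> : P *m invmx A *m P = U^T *m (U *m invmx A *m U^T) *m U by rewrite /P !mulmxA.
by rewrite U_gram mulmx1.
Qed.

(** Relative to [A] the matrix has the eigenvalue [conj tau] twice and [tau] on the rest, because
    [P] has rank two with [U_gram]; [det_sylvester] expresses this, and the factor [tau^2] on the
    left replaces the exponent [n - 2] on the right. *)
Lemma det_OmT (tau : C) : \det (OmT A P tau) * tau ^+ 2 = (-1) ^+ n * (\det A)%:C * (conjc tau ^+ 2 * tau ^+ n).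
Proof.
have rU : rC (invmx A) *m rC P = rC (invmx A) *m (rC U)^T *m rC U.
  by rewrite /P map_mxM matrix.map_trmx mulmxA.
have eO : OmT A P tau = - (rC A *m (tau%:M + (rC (invmx A) *m (rC U)^T) *m ((conjc tau - tau) *: rC U))).
  rewrite /OmT; congr (- _); rewrite mulmxDr -scalemxAr -rU mul_mx_scalar -scalemxAr mulmxA -map_mxM mulmxV // map_mx1 mul1mx.
  by rewrite map_mxB scalerBr scalerBl addrCA.
have hs : \det (tau%:M + (rC (invmx A) *m (rC U)^T) *m ((conjc tau - tau) *: rC U)) * tau ^+ 2 = conjc tau ^+ 2 * tau ^+ n.
  rewrite det_sylvester -scalemxAl mulmxA.
  have -> : rC U *m rC (invmx A) *m (rC U)^T = 1%:M.
    by rewrite -[1%:M](map_mx1 (real_complex R)) -U_gram !map_mxM matrix.map_trmx.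
  by rewrite scalemx1 -raddfD /= subrKC det_scalar.
rewrite eO -hs; move: (tau%:M + _) => Z; rewrite -scaleN1r detZ det_mulmx (det_map_mx (real_complex R)) -!mulrA; exact: erefl.
Qed.

Let kc (tau : C) := kappa c0 (OmT A P (- tau^-1)) * (tau / conjc tau).
Let target (tau : C) := ee ((4 - n%:R) / 8)%:C * hpow tau (n%:R / 2) * ((Num.sqrt N)^-1)%:C.

Let posOm (tau : C) : 0 < Im tau -> posIm (OmT A P (- tau^-1)).
Proof. by move=> h; apply: OmT_posIm => //; [exact: P_sym|exact: Im_negV]. Qed.

Let N0 : N%:C != 0 :> C. Proof. by rewrite fmorph_eq0 gt_eqF. Qed.
Let i_neq0 : 'i%C != 0 :> C. Proof. by rewrite eq_complex /= oner_eq0 andbF. Qed.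

Let kc_sqr (tau : C) : 0 < Im tau -> kc tau ^+ 2 * ('i%C ^+ n * N%:C) = tau ^+ n.
Proof.
move=> h; have t0 := upper_neq0 h; have ct0 : conjc tau != 0 by rewrite conjc_eq0.
have hk := kappa_sqr c_sqr (posOm h).
have hd := det_OmT (- tau^-1).
have ec : conjc (- tau^-1) = - (conjc tau)^-1 by rewrite rmorphN fmorphV.
have s1 : (-1) ^+ n * (\det A)%:C = N%:C :> C.
  by rewrite A_det rmorphM rmorphXn rmorphN1 /= mulrA -exprMn mulrNN mulr1 expr1n mul1r.
rewrite ec s1 in hd.
have dE : \det (OmT A P (- tau^-1)) = N%:C * (tau ^+ 2 / (conjc tau ^+ 2) * ((-1) ^+ n * (tau ^+ n)^-1)).
  have nz : (- tau^-1) ^+ 2 != 0 by rewrite expf_neq0 // oppr_eq0 invr_eq0.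
  apply: (mulIf nz); rewrite hd -[- tau^-1]mulN1r [(_ * _) ^+ n]exprMn exprVn.
  have tn : tau ^+ n != 0 by rewrite expf_neq0.
  by move: (tau ^+ n) ((-1) ^+ n) tn => T S tn; field; rewrite t0 ct0 tn.
rewrite dE in hk; rewrite /kc exprMn.
have en : (- 'i%C) ^+ n * (-1) ^+ n = 'i%C ^+ n :> C by rewrite -exprMn mulrN1 opprK.
have tn : tau ^+ n != 0 by rewrite expf_neq0.
rewrite -[RHS]mul1r -hk -en; move: (kappa _ _) ((- 'i%C) ^+ n) ((-1) ^+ n) (tau ^+ n) tn => k I S T tn.
by move: (N%:C) N0 => M M0; field; rewrite ?t0 ?ct0 ?tn.
Qed.

Let eeX (z : C) m : ee z ^+ m = ee (m%:R * z).
Proof. by rewrite /ee cexpX mulrCA. Qed.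

Let ee_quarter : ee (4^-1)%:C = 'i%C :> C.
Proof.
rewrite /ee (_ : _ * (4^-1)%:C = 0 +i* (pi / 2)).
  by rewrite /cexp /= expR0 mul1r cos_pihalf sin_pihalf.
by apply: complexRI; rewrite ?(cReM, cImM) /= ?(cReM, cImM) /=; move: (pi : R) => P0; by field.
Qed.

Let target_sqr (tau : C) : 0 < Im tau -> target tau ^+ 2 * ('i%C ^+ n * N%:C) = tau ^+ n.
Proof.
move=> h; have hs := hpow_half_sqr n h.
have sN : ((Num.sqrt N)^-1)%:C ^+ 2 = N%:C^-1 :> C.
  by rewrite -rmorphXn /= exprVn sqr_sqrtr ?fmorphV // ltW.
have e1 : ee ((4 - n%:R) / 8)%:C ^+ 2 * 'i%C ^+ n = 1 :> C.
  rewrite -ee_quarter !eeX -ee_D -!(rmorph_nat (real_complex R)) -!rmorphM -rmorphD /=.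
  by rewrite (_ : _ + _ = 1) ?ee1 //; field.
rewrite /target; move: (ee _) (hpow _ _) ((_^-1)%:C) e1 hs sN => E H S e1 hs sN.
rewrite 2!exprMn hs sN; move: (tau ^+ n) => T.
by rewrite -[RHS]mul1r -e1; move: (N%:C) N0 => M M0; field.
Qed.

Let target_neq0 (tau : C) : 0 < Im tau -> target tau != 0.
Proof.
move=> h; apply: mulf_neq0; first by apply: mulf_neq0; [exact: ee_neq0|exact: hpow_neq0].
by rewrite fmorph_eq0 invr_eq0 gt_eqF // sqrtr_gt0.
Qed.

Let sqr_eq (tau : C) : 0 < Im tau -> kc tau ^+ 2 = target tau ^+ 2.
Proof.
move=> h; have k0 : 'i%C ^+ n * N%:C != 0 :> C by rewrite mulf_neq0 // expf_neq0.
by apply: (mulIf k0); rewrite kc_sqr // target_sqr.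
Qed.

(** At [i] the matrix is purely imaginary, so [kappa] is positive, while [tau / conj tau] is -1; the
    other side is [e(1/2) / sqrt N]. Equal squares and equal signs give equality. *)
Let at_i : kc 'i%C = target 'i%C.
Proof.
have hi : 0 < Im ('i%C : C) by rewrite /= ltr01.
have i2 : 'i%C * 'i%C = -1 :> C by rewrite -expr2 sqr_i.
have ei : - ('i%C : C)^-1 = 'i%C.
  by apply: (mulIf i_neq0); rewrite mulNr mulVf // i2.
have ci : conjc 'i%C = - 'i%C :> C by apply: complexRI => /=; rewrite ?oppr0.
have [|k1 k2] := kappa_pos c_pos (posOm hi).
  by move=> i j; rewrite ei /OmT ci !mxE cReN cReD !cReM /=; ring.
have s2 := sqr_eq hi.
have kE : kc 'i%C = (- Re (kappa c0 (OmT A P (- ('i%C)^-1))))%:C.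
  rewrite /kc ci invrN mulrN mulfV // mulrN1 rmorphN; congr (- _).
  by apply: complexRI; rewrite ?k1.
have tE : target 'i%C = (- (Num.sqrt N)^-1)%:C.
  rewrite /target hpow_i -ee_D -rmorphD /= (_ : (4 - n%:R) / 8 + n%:R / 2 / 4 = 4^-1 + 4^-1); last by field.
  by rewrite rmorphD ee_D ee_quarter i2 mulN1r rmorphN.
move: s2; rewrite kE tE -!rmorphXn /= !sqrrN => /(fmorph_inj (real_complex R)) /eqP.
rewrite eqrXn2 // ?invr_ge0 ?sqrtr_ge0 //; last exact: ltW.
by move=> /eqP ->.
Qed.

(** Both sides have the same square for every [tau] and agree at [i]; the sign is carried along the
    segment from [i] to [tau], parametrised through [clamp] so that the path stays in the upper
    half-plane for all real parameters. *)
Theorem inversion_constant (tau : C) : 0 < Im tau ->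
  kappa c0 (OmT A P (- tau^-1)) * (tau / conjc tau) =
  ee ((4 - n%:R) / 8)%:C * hpow tau (n%:R / 2) * ((Num.sqrt N)^-1)%:C.
Proof.
move=> h; pose ta (s : R) : C := (clamp s * Re tau) +i* ((1 - clamp s) + clamp s * Im tau).
have ta_pos s : 0 < Im (ta s).
  rewrite /=; have := clamp_ge0 s; have := clamp_le1 s; move: (clamp s) (Im tau) h => x y y0 x1 x0.
  have [->|xn] := eqVneq x 1; first by rewrite subrr add0r mul1r.
  have x2 : x < 1 by rewrite lt_neqAle xn.
  by rewrite ltr_wpDr ?subr_gt0 // mulr_ge0 // ltW.
have cc s : ctn (@clamp R) s by exact: continuous_clamp.
have cta s : ccont ta s.
  have c1 : ctn (fun s => clamp s * Re tau) s by apply: ctnM => //; exact: ctn_cst.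
  have c2 : ctn (fun s => (1 - clamp s) + clamp s * Im tau) s.
    apply: ctnD; last by apply: ctnM => //; exact: ctn_cst.
    by apply: ctnD; [exact: ctn_cst|exact: ctnN].
  by split.
have ccj (f : R -> C) s : ccont f s -> ccont (fun s => conjc (f s)) s.
  have e1 : (fun s => Re (conjc (f s))) = (fun s => Re (f s)) by apply/funext => x; case: (f x).
  have e2 : (fun s => Im (conjc (f s))) = (fun s => - Im (f s)) by apply/funext => x; case: (f x).
  by move=> [f1 f2]; split; rewrite ?e1 ?e2 //; exact: (ctnN f2).
have := @sqr_eq_path R (fun s => kc (ta s)) (fun s => target (ta s)).
have e0 : ta 0 = 'i%C by rewrite /ta clamp_id ?lexx ?ler01 // !mul0r subr0 addr0.
have e1 : ta 1 = tau by rewrite /ta clamp_id ?lexx ?ler01 // !mul1r subrr add0r; case: (tau).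
rewrite e0 e1; apply; last exact: at_i.
- move=> s; split; last first.
    by apply: ccontM; [apply: ccontM; [exact: ccont_cst|exact: ccont_hpow]|exact: ccont_cst].
  have cV : ccont (fun s => (ta s)^-1) s by apply: ccontV => //; exact: upper_neq0.
  have cN : ccont (fun s => - (ta s)^-1) s.
    by have := ccontM (ccont_cst (-1) s) cV; under eq_fun do rewrite mulN1r.
  apply: ccontM; last first.
    by apply: ccontM => //; apply: ccontV; [rewrite conjc_eq0; exact: upper_neq0|exact: ccj].
  apply: (kappa_cont c_sqr c_cont); last exact: posOm.
  move=> i j; rewrite (_ : (fun t => _) = fun t => -1 * (conjc (- (ta t)^-1) * (P i j)%:C + - (ta t)^-1 * ((A - P) i j)%:C)).
    apply: ccontM; first exact: ccont_cst.
    by apply: ccontD; apply: ccontM; [exact: ccj|exact: ccont_cst|exact: cN|exact: ccont_cst].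
  by apply/funext => t; rewrite /OmT mulN1r !mxE.
- by move=> s; exact: target_neq0.
- by move=> s; exact: sqr_eq.
Qed.

End Constant.

Lemma row_mul_tr (R : comRingType) m n (x : 'rV[R]_n) (F : 'M[R]_(m, n)) i :
  (x *m F^T) 0 i = (F *m x^T) i 0.
Proof. by rewrite !mxE; apply: eq_bigr => j _; rewrite !mxE; exact: mulrC. Qed.

(** * Orthonormal frame of a plane and the matrix of its projection form *)

Section Frame.
Variables (R : realType) (n : nat) (A : 'M[R]_n) (c1 c2 : 'rV[R]_n).
Hypothesis A_sym : A^T = A.
Hypothesis A_unit : A \in unitmx.
Hypothesis q1 : 0 < Q A c1.
Hypothesis d2 : 0 < Bt A c1 c2 c2.
Local Notation V := 'rV[R]_n.

Definition fr1 : V := (Num.sqrt (Q A c1))^-1 *: c1.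
Definition fr2 : V := (Num.sqrt (Bt A c1 c2 c2))^-1 *: (c2 - (B A c1 c2 / Q A c1) *: c1).
Definition fr (i : 'I_2) : V := if i == 0 then fr1 else fr2.
Definition frame : 'M[R]_(2, n) := (\matrix_(i < 2) fr i) *m A.
(** The matrix of [Qp]. Its entries are rational in the Gram data, so continuity and measurability
    over the square are checked entrywise; [Pmx_frame] recovers the factorisation through the
    orthonormal frame. *)
Definition Pmx : 'M[R]_n := \matrix_(i, j) (B A c1 (delta_mx 0 i) * B A c1 (delta_mx 0 j) / Q A c1
   + Bt A c1 c2 (delta_mx 0 i) * Bt A c1 c2 (delta_mx 0 j) / Bt A c1 c2 c2).

Let s1 : Num.sqrt (Q A c1) ^+ 2 = Q A c1. Proof. by rewrite sqr_sqrtr // ltW. Qed.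
Let s2 : Num.sqrt (Bt A c1 c2 c2) ^+ 2 = Bt A c1 c2 c2. Proof. by rewrite sqr_sqrtr // ltW. Qed.
Let n1 : Num.sqrt (Q A c1) != 0. Proof. by rewrite gt_eqF // sqrtr_gt0. Qed.
Let n2 : Num.sqrt (Bt A c1 c2 c2) != 0. Proof. by rewrite gt_eqF // sqrtr_gt0. Qed.
Let sk (a : R) : a != 0 -> a^-1 * a ^+ 2 = a. Proof. by move=> h; rewrite expr2 mulKf. Qed.

Let Be1 x : B A fr1 x = B A c1 x / Num.sqrt (Q A c1).
Proof. by rewrite /fr1 BZl mulrC. Qed.
Let Be2 x : B A fr2 x = Bt A c1 c2 x / Num.sqrt (Bt A c1 c2 c2).
Proof. by rewrite /fr2 BZl BDl BNl BZl mulrC /Bt (BC A_sym c2 c1) mulrAC. Qed.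
Let Bc11 : B A c1 fr1 = Num.sqrt (Q A c1).
Proof.
transitivity ((Num.sqrt (Q A c1))^-1 * Num.sqrt (Q A c1) ^+ 2); last exact: sk.
by rewrite s1 /fr1 BZr.
Qed.
Let Bc12 : B A c1 fr2 = 0.
Proof. by rewrite /fr2 BZr BDr BNr BZr -/(Q A c1) divfK ?gt_eqF // subrr mulr0. Qed.
Let Bc22 : Bt A c1 c2 fr2 = Num.sqrt (Bt A c1 c2 c2).
Proof.
transitivity ((Num.sqrt (Bt A c1 c2 c2))^-1 * Num.sqrt (Bt A c1 c2 c2) ^+ 2); last exact: sk.
rewrite s2 [LHS]/Bt Bc12 mulr0 mul0r subr0 /fr2 BZr; congr (_ * _).
rewrite BDr BNr BZr /Bt (BC A_sym c2 c1) -/(Q A c2); first [by ring | by rewrite mulrAC | by field; rewrite gt_eqF].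
Qed.

Let g11 : B A fr1 fr1 = 1.
Proof. by rewrite Be1 Bc11 mulfV. Qed.
Let g12 : B A fr1 fr2 = 0.
Proof. by rewrite Be1 Bc12 mul0r. Qed.
Let g21 : B A fr2 fr1 = 0.
Proof. by rewrite (BC A_sym fr2 fr1) g12. Qed.
Let g22 : B A fr2 fr2 = 1.
Proof. by rewrite Be2 Bc22 mulfV. Qed.

Let row_frame (i : 'I_2) x : (frame *m x^T) i 0 = B A (fr i) x.
Proof.
rewrite /frame /B; have -> : fr i = row i (\matrix_(i < 2) fr i) by rewrite rowK.
by rewrite -!row_mul [RHS]mxE.
Qed.

Lemma frame_gram : frame *m invmx A *m frame^T = 1%:M.
Proof.
have -> : frame *m invmx A *m frame^T = (\matrix_(i < 2) fr i) *m frame^T.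
  by rewrite {1}/frame -[X in X *m _ = _]mulmxA mulmxV // mulmx1.
apply/matrixP => i j; have -> : ((\matrix_(i < 2) fr i) *m frame^T) i j = (fr i *m frame^T) 0 j.
  by rewrite -[in RHS](rowK fr i) -row_mul [RHS]mxE.
rewrite row_mul_tr row_frame mxE.
have h (k : 'I_2) : k = 0 \/ k = 1 by case: k => -[|[|k]] hk //; [left|right]; exact: val_inj.
by have [->|->] := h i; have [->|->] := h j; rewrite /fr ?eqxx /= ?g11 ?g12 ?g21 ?g22.
Qed.

Lemma Pmx_frame : Pmx = frame^T *m frame.
Proof.
have fe (i : 'I_2) j : frame i j = B A (fr i) (delta_mx 0 j).
  by rewrite -row_frame trmx_delta -colE [RHS]mxE.
have ft (k : 'I_2) i : frame^T i k = frame k i by rewrite mxE.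
have ha : fr ord0 = fr1 by [].
have hb : fr (lift ord0 ord0) = fr2 by [].
apply/matrixP => i j; rewrite [LHS]mxE [RHS]mxE !big_ord_recl big_ord0 addr0 !ft !fe ha hb !Be1 !Be2.
have t1 a b : a / Num.sqrt (Q A c1) * (b / Num.sqrt (Q A c1)) = a * b / Q A c1 by rewrite mulrACA -invfM -expr2 s1.
have t2 a b : a / Num.sqrt (Bt A c1 c2 c2) * (b / Num.sqrt (Bt A c1 c2 c2)) = a * b / Bt A c1 c2 c2.
  by rewrite mulrACA -invfM -expr2 s2.
by rewrite t1 t2.
Qed.

Lemma qf_Pmx x : qf Pmx x = Qp A c1 c2 x.
Proof.
have -> : qf Pmx x = \sum_(i < 2) (frame *m x^T) i 0 ^+ 2.
  by rewrite Pmx_frame /qf mulmxA -mulmxA mxE; apply: eq_bigr => i _; rewrite row_mul_tr expr2.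
have ha : fr ord0 = fr1 by [].
have hb : fr (lift ord0 ord0) = fr2 by [].
by rewrite !big_ord_recl big_ord0 addr0 !row_frame ha hb Be1 Be2 /Qp !expr_div_n s1 s2.
Qed.

Definition vperp v : V := v - (B A v fr1) *: fr1 - (B A v fr2) *: fr2.

Let Bsub2 v x y (a b : R) k : B A (v - a *: x - b *: y) k = B A v k - a * B A x k - b * B A y k.
Proof. by rewrite BDl BDl !BNl !BZl. Qed.
Let o v k : B A (vperp v) k = B A v k - B A v fr1 * B A fr1 k - B A v fr2 * B A fr2 k.
Proof. exact: Bsub2. Qed.

Lemma B_vperp v x : B A (vperp v) x = Bp A c1 c2 v x.
Proof.
rewrite o (BC A_sym v fr1) (BC A_sym v fr2) !Be1 !Be2 /Bp.
have t1 a b : a / Num.sqrt (Q A c1) * (b / Num.sqrt (Q A c1)) = a * b / Q A c1 by rewrite mulrACA -invfM -expr2 s1.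
have t2 a b : a / Num.sqrt (Bt A c1 c2 c2) * (b / Num.sqrt (Bt A c1 c2 c2)) = a * b / Bt A c1 c2 c2.
  by rewrite mulrACA -invfM -expr2 s2.
by rewrite t1 t2 [Bt A c1 v x]/Bt (BC A_sym c1 v) (Bt_sym A_sym c1 c2 v).
Qed.

Let o1 v : B A (vperp v) fr1 = 0.
Proof. by rewrite o g11 g21 mulr1 mulr0 subr0 subrr. Qed.
Let o2 v : B A (vperp v) fr2 = 0.
Proof. by rewrite o g12 g22 mulr1 mulr0 subr0 subrr. Qed.

Lemma vperp_P v : vperp v *m Pmx = 0.
Proof.
rewrite Pmx_frame mulmxA (_ : vperp v *m frame^T = 0) ?mul0mx //.
apply/rowP => i; rewrite [RHS]mxE row_mul_tr row_frame (BC A_sym) /fr.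
by case: ifP => _; rewrite ?o1 ?o2.
Qed.

Lemma B_vperp2 v w : B A (vperp v) (vperp w) = Bp A c1 c2 v w.
Proof.
have Br x y z (a b : R) k : B A k (x - a *: y - b *: z) = B A k x - a * B A k y - b * B A k z.
  by rewrite BDr BDr !BNr !BZr.
by rewrite -B_vperp [in LHS]/(vperp w) Br o1 o2 !mulr0 !subr0.
Qed.

End Frame.

(** * Measurability and bounds over the unit square *)

Section SquareFunctions.
Variable R : realType.
Local Notation Y := (measurableTypeR R * measurableTypeR R)%type.

Lemma clamp_01 (s : R) : 0 <= clamp s <= 1. Proof. by rewrite clamp_ge0 clamp_le1. Qed.

(** By invariance under [clamp] all values are taken on the compact square. *)
Lemma square_bounded (H : R * R -> R) : continuous H ->
  (forall s u, H (clamp s, clamp u) = H (s, u)) -> exists K, forall y : Y, `|H y| <= K.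
Proof.
move=> cH hc.
have cS : compact (`[(0 : R), 1]%classic `*` `[(0 : R), 1]%classic) by apply: compact_setX; exact: segment_compact.
have [M [_ hM]] : bounded_set (H @` (`[(0 : R), 1]%classic `*` `[(0 : R), 1]%classic)).
  by apply: compact_bounded; apply: continuous_compact => //; exact: continuous_subspaceT.
exists (M + 1) => y; apply: (hM (M + 1)); first by rewrite ltrDl.
exists (clamp y.1, clamp y.2).
  by split; rewrite /= in_itv /=; exact: clamp_01.
by rewrite hc; case: y.
Qed.

Definition mfn (h : Y -> R) := measurable_fun setT h.
Lemma mfn_cst a : mfn (fun=> a). Proof. exact: measurable_cst. Qed.
Lemma mfnD f h : mfn f -> mfn h -> mfn (fun y => f y + h y). Proof. exact: measurable_funD. Qed.
Lemma mfnM f h : mfn f -> mfn h -> mfn (fun y => f y * h y). Proof. exact: measurable_funM. Qed.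
Lemma mfnN f : mfn f -> mfn (fun y => - f y).
Proof. by move=> hf; rewrite (_ : (fun y => _) = fun y => -1 * f y); [exact: mfnM (mfn_cst _) hf|apply/funext => y; rewrite mulN1r]. Qed.
Lemma mfn_comp (c : R -> R) f : continuous c -> mfn f -> mfn (fun y => c (f y)).
Proof. by move=> cc hf; apply: (measurableT_comp (continuous_measurable_fun cc)). Qed.
Lemma mfnV f : (forall y, 0 < f y) -> mfn f -> mfn (fun y => (f y)^-1).
Proof.
move=> f0 hf; rewrite (_ : (fun y => _) = fun y => expR (- ln (f y))).
  apply: mfn_comp; first exact: continuous_expR.
  by apply: mfnN; apply: (measurableT_comp (@measurable_ln R)).
by apply/funext => y; rewrite expRN lnK // posrE.
Qed.
Lemma mfn_s : mfn (fun y => clamp y.1).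
Proof. by apply: mfn_comp; [exact: continuous_clamp|exact: measurable_fst]. Qed.
Lemma mfn_u : mfn (fun y => clamp y.2).
Proof. by apply: mfn_comp; [exact: continuous_clamp|exact: measurable_snd]. Qed.

End SquareFunctions.

Section SquareFamily.
Variables (R : realType) (n : nat) (A : 'M[R]_n) (C1 C1' C2 C2' : 'rV[R]_n).
Hypothesis A_sym : A^T = A.
Local Notation V := 'rV[R]_n.
Local Notation Y := (measurableTypeR R * measurableTypeR R)%type.
Hypothesis Q1_pos : forall s, 0 <= s <= 1 -> 0 < Q A (seg C1 C1' s).
Hypothesis D_pos : forall s u, 0 <= s <= 1 -> 0 <= u <= 1 -> 0 < Bt A (seg C1 C1' s) (seg C2 C2' u) (seg C2 C2' u).
Hypothesis maj : forall s u x, 0 <= s <= 1 -> 0 <= u <= 1 -> x != 0 ->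
  0 < 2 * Qp A (seg C1 C1' s) (seg C2 C2' u) x - Q A x.

Definition cc1 (y : Y) : V := seg C1 C1' (clamp y.1).
Definition cc2 (y : Y) : V := seg C2 C2' (clamp y.2).
Definition wt2 (y : Y) : R := (Num.sqrt (Q A (cc1 y) * Bt A (cc1 y) (cc2 y) (cc2 y)))^-1.

Lemma cc_Q y : 0 < Q A (cc1 y). Proof. exact/Q1_pos/clamp_01. Qed.
Lemma cc_D y : 0 < Bt A (cc1 y) (cc2 y) (cc2 y). Proof. by apply: D_pos; exact: clamp_01. Qed.

Lemma mfn_B1 w : mfn (fun y => B A (cc1 y) w).
Proof.
rewrite /cc1; under eq_fun do rewrite B_seg; apply: mfnD; first exact: mfn_cst.
by apply: mfnM; [exact: mfn_s|exact: mfn_cst].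
Qed.
Lemma mfn_B2 w : mfn (fun y => B A (cc2 y) w).
Proof.
rewrite /cc2; under eq_fun do rewrite B_seg; apply: mfnD; first exact: mfn_cst.
by apply: mfnM; [exact: mfn_u|exact: mfn_cst].
Qed.
Lemma mfn_Q1 : mfn (fun y => Q A (cc1 y)).
Proof.
rewrite (_ : (fun y => _) = fun y => B A (cc1 y) C1 + clamp y.1 * B A (cc1 y) (C1' - C1)).
  by apply: mfnD; [exact: mfn_B1|apply: mfnM; [exact: mfn_s|exact: mfn_B1]].
by apply/funext => y; rewrite /Q {2}/cc1 /seg BDr BZr.
Qed.
Lemma mfn_B12 : mfn (fun y => B A (cc1 y) (cc2 y)).
Proof.
rewrite (_ : (fun y => _) = fun y => B A (cc1 y) C2 + clamp y.2 * B A (cc1 y) (C2' - C2)).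
  by apply: mfnD; [exact: mfn_B1|apply: mfnM; [exact: mfn_u|exact: mfn_B1]].
by apply/funext => y; rewrite {1}/cc2 /seg BDr BZr.
Qed.
Lemma mfn_Q2 : mfn (fun y => Q A (cc2 y)).
Proof.
rewrite (_ : (fun y => _) = fun y => B A (cc2 y) C2 + clamp y.2 * B A (cc2 y) (C2' - C2)).
  by apply: mfnD; [exact: mfn_B2|apply: mfnM; [exact: mfn_u|exact: mfn_B2]].
by apply/funext => y; rewrite /Q {2}/cc2 /seg BDr BZr.
Qed.
Let mQV : mfn (fun y => (Q A (cc1 y))^-1). Proof. exact: mfnV cc_Q mfn_Q1. Qed.
Lemma mfn_Bt2 w : mfn (fun y => Bt A (cc1 y) (cc2 y) w).
Proof.
apply: mfnD; first exact: mfn_B2.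
apply: mfnN; apply: mfnM => //; apply: mfnM; last exact: mfn_B1.
by under eq_fun do rewrite BC //; exact: mfn_B12.
Qed.
Lemma mfn_Btvw v w : mfn (fun y => Bt A (cc1 y) v w).
Proof.
apply: mfnD; first exact: mfn_cst.
apply: mfnN; apply: mfnM => //; apply: mfnM; last exact: mfn_B1.
by under eq_fun do rewrite BC //; exact: mfn_B1.
Qed.
Lemma mfn_D : mfn (fun y => Bt A (cc1 y) (cc2 y) (cc2 y)).
Proof.
apply: mfnD; first exact: mfn_Q2.
apply: mfnN; apply: mfnM => //; apply: mfnM; last exact: mfn_B12.
by under eq_fun do rewrite BC //; exact: mfn_B12.
Qed.
Let mDV : mfn (fun y => (Bt A (cc1 y) (cc2 y) (cc2 y))^-1). Proof. exact: mfnV cc_D mfn_D. Qed.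
Lemma mfn_Bp v w : mfn (fun y => Bp A (cc1 y) (cc2 y) v w).
Proof.
apply: mfnD; first exact: mfn_Btvw.
apply: mfnN; apply: mfnM => //; apply: mfnM; last exact: mfn_Bt2.
by under eq_fun do rewrite Bt_sym //; exact: mfn_Bt2.
Qed.
Lemma mfn_P i j : mfn (fun y => Pmx A (cc1 y) (cc2 y) i j).
Proof.
under eq_fun do rewrite mxE; apply: mfnD; apply: mfnM => //; apply: mfnM; by [exact: mfn_B1|exact: mfn_Bt2].
Qed.
Lemma mfn_wt2 : mfn wt2.
Proof.
apply: mfnV; first by move=> y; rewrite sqrtr_gt0 mulr_gt0 ?cc_Q ?cc_D.
by apply: mfn_comp; [exact: sqrt_continuous|apply: mfnM; [exact: mfn_Q1|exact: mfn_D]].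
Qed.

Section Continuity.
Variable z : R * R.
Let S1 (z : R * R) := seg C1 C1' (clamp z.1).
Let S2 (z : R * R) := seg C2 C2' (clamp z.2).
Let k1 : ctn (fun z : R * R => clamp z.1) z.
Proof. by apply: (@continuous_comp _ _ _ fst (@clamp R) z); [exact: cvg_fst|exact: continuous_clamp]. Qed.
Let k2 : ctn (fun z : R * R => clamp z.2) z.
Proof. by apply: (@continuous_comp _ _ _ snd (@clamp R) z); [exact: cvg_snd|exact: continuous_clamp]. Qed.
Let v1 : vct S1 z. Proof. exact: (@vct_seg _ _ _ C1 C1' _ z k1). Qed.
Let v2 : vct S2 z. Proof. exact: (@vct_seg _ _ _ C2 C2' _ z k2). Qed.
Let vc (w : V) : @vct R _ n (fun _ : R * R => w) z. Proof. by move=> i; exact: ctn_cst. Qed.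
Let nq : Q A (S1 z) != 0. Proof. by rewrite gt_eqF // Q1_pos // clamp_01. Qed.
Let nd : Bt A (S1 z) (S2 z) (S2 z) != 0. Proof. by rewrite gt_eqF // D_pos // clamp_01. Qed.

Lemma ctn_sq_Bp v w : ctn (fun z => Bp A (S1 z) (S2 z) v w) z.
Proof. by have wv := @vc v; have ww := @vc w; have h1 := @v1; have h2 := @v2; have h3 := @nq; have h4 := @nd; exact: ctn_Bp. Qed.
Lemma ctn_sq_P i j : ctn (fun z => Pmx A (S1 z) (S2 z) i j) z.
Proof.
have e : (fun z => Pmx A (S1 z) (S2 z) i j) = (fun z => B A (S1 z) (delta_mx 0 i) * B A (S1 z) (delta_mx 0 j) / Q A (S1 z)
   + Bt A (S1 z) (S2 z) (delta_mx 0 i) * Bt A (S1 z) (S2 z) (delta_mx 0 j) / Bt A (S1 z) (S2 z) (S2 z)).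
  by apply/funext => z'; rewrite mxE.
have b1 k : ctn (fun z => B A (S1 z) (delta_mx 0 k)) z by have wv := @vc (delta_mx 0 k); have h1 := @v1; exact: ctn_B.
have t1 k : ctn (fun z => Bt A (S1 z) (S2 z) (delta_mx 0 k)) z by have wv := @vc (delta_mx 0 k); have h1 := @v1; have h2 := @v2; have h3 := @nq; exact: ctn_Bt.
have q1 : ctn (fun z => Q A (S1 z)) z by have h1 := @v1; exact: ctn_Q.
have d1 : ctn (fun z => Bt A (S1 z) (S2 z) (S2 z)) z by have h1 := @v1; have h2 := @v2; have h3 := @nq; exact: ctn_Bt.
have h3 := @nq; have h4 := @nd.
have qv : ctn (fun z => (Q A (S1 z))^-1) z by apply: ctnV.
have dv : ctn (fun z => (Bt A (S1 z) (S2 z) (S2 z))^-1) z by apply: ctnV.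
have bb : ctn (fun z => B A (S1 z) (delta_mx 0 i) * B A (S1 z) (delta_mx 0 j)) z by have x1 := @b1 i; have x2 := @b1 j; apply: ctnM.
have tt : ctn (fun z => Bt A (S1 z) (S2 z) (delta_mx 0 i) * Bt A (S1 z) (S2 z) (delta_mx 0 j)) z.
  by have x1 := @t1 i; have x2 := @t1 j; apply: ctnM.
by rewrite e; apply: ctnD; apply: ctnM.
Qed.
Lemma ctn_sq_wt : ctn (fun z => (Num.sqrt (Q A (S1 z) * Bt A (S1 z) (S2 z) (S2 z)))^-1) z.
Proof.
have ne : Num.sqrt (Q A (S1 z) * Bt A (S1 z) (S2 z) (S2 z)) != 0.
  by rewrite gt_eqF // sqrtr_gt0 mulr_gt0 ?Q1_pos ?D_pos ?clamp_01.
have q1 : ctn (fun z => Q A (S1 z)) z by have h1 := @v1; exact: ctn_Q.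
have d1 : ctn (fun z => Bt A (S1 z) (S2 z) (S2 z)) z by have h1 := @v1; have h2 := @v2; have h3 := @nq; exact: ctn_Bt.
have m1 : ctn (fun z => Q A (S1 z) * Bt A (S1 z) (S2 z) (S2 z)) z by apply: ctnM.
have r1 : ctn (fun z => Num.sqrt (Q A (S1 z) * Bt A (S1 z) (S2 z) (S2 z))) z by apply: ctn_sqrt.
by apply: ctnV.
Qed.
End Continuity.

Let clampK (s : R) : clamp (clamp s) = clamp s. Proof. by rewrite clamp_id // clamp_01. Qed.

Lemma Bp_bounded v w : exists K, forall y, `|Bp A (cc1 y) (cc2 y) v w| <= K.
Proof.
apply: (square_bounded (H := fun z => Bp A (seg C1 C1' (clamp z.1)) (seg C2 C2' (clamp z.2)) v w)).
  by move=> z; exact: ctn_sq_Bp.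
by move=> s u; rewrite /= !clampK.
Qed.
Lemma wt2_bounded : exists K, forall y, `|wt2 y| <= K.
Proof.
apply: (square_bounded (H := fun z => (Num.sqrt (Q A (seg C1 C1' (clamp z.1)) * Bt A (seg C1 C1' (clamp z.1)) (seg C2 C2' (clamp z.2)) (seg C2 C2' (clamp z.2))))^-1)).
  by move=> z; exact: ctn_sq_wt.
by move=> s u; rewrite /= !clampK.
Qed.
Lemma Pmx_bounded : exists K, forall y i j, `|Pmx A (cc1 y) (cc2 y) i j| <= K.
Proof.
have h i j : exists K, forall y, `|Pmx A (cc1 y) (cc2 y) i j| <= K.
  apply: (square_bounded (H := fun z => Pmx A (seg C1 C1' (clamp z.1)) (seg C2 C2' (clamp z.2)) i j)).
    by move=> z; exact: ctn_sq_P.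
  by move=> s u; rewrite /= !clampK.
pose K i j := sval (cid (h i j)); have hK i j y := svalP (cid (h i j)) y.
exists (\sum_i \sum_j `|K i j|) => y i j; apply: (le_trans (hK i j y)); apply: (le_trans (ler_norm _)).
by rewrite (bigD1 i) //= (bigD1 j) //= -addrA lerDl addr_ge0 ?sumr_ge0 // => k _; exact: sumr_ge0.
Qed.

(** One constant for all planes of the square, from [uniform_posdef]. Composing with [clamp] makes
    the family continuous for all real parameters. *)
Lemma majorant_uniform : exists2 e, 0 < e & forall y x, e * nsq x <= 2 * qf (Pmx A (cc1 y) (cc2 y)) x - Q A x.
Proof.
pose f (z : R * R * V) := 2 * Qp A (seg C1 C1' (clamp z.1.1)) (seg C2 C2' (clamp z.1.2)) z.2 - Q A z.2.
have [|||e e0 he] := @uniform_posdef R n f.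
- move=> z.
  have k1 : ctn (fun z : R * R * V => clamp z.1.1) z.
    apply: (@ctn_comp _ _ _ (fun z : R * R * V => z.1.1)); last exact: continuous_clamp.
    by apply: (@continuous_comp _ _ _ fst fst); exact: cvg_fst.
  have k2 : ctn (fun z : R * R * V => clamp z.1.2) z.
    apply: (@ctn_comp _ _ _ (fun z : R * R * V => z.1.2)); last exact: continuous_clamp.
    by apply: (@continuous_comp _ _ _ fst snd); [exact: cvg_fst|exact: cvg_snd].
  have v1 := @vct_seg _ _ _ C1 C1' _ z k1; have v2 := @vct_seg _ _ _ C2 C2' _ z k2.
  have vx : vct (fun z : R * R * V => z.2) z.
    move=> i; apply: (@continuous_comp _ _ _ snd (fun x : V => x 0 i)); [exact: cvg_snd|exact: coord_continuous].
  have nq : Q A (seg C1 C1' (clamp z.1.1)) != 0 by rewrite gt_eqF // Q1_pos // clamp_01.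
  have nd : Bt A (seg C1 C1' (clamp z.1.1)) (seg C2 C2' (clamp z.1.2)) (seg C2 C2' (clamp z.1.2)) != 0.
    by rewrite gt_eqF // D_pos // clamp_01.
  have kf : ctn f z.
    apply: ctnD; first by apply: ctnM; [exact: ctn_cst|exact: ctn_Qp].
    by apply: ctnN; exact: ctn_Q.
  exact: kf.
- move=> s u a x; rewrite /f /= QZ /Qp /Bt !BZr; ring.
- by move=> s u x s01 u01 x0; rewrite /f /= !clamp_id //; exact: maj.
exists e => // y x; have := he (clamp y.1) (clamp y.2) x (clamp_01 _) (clamp_01 _).
by rewrite /f /= !clampK (@qf_Pmx R n A (cc1 y) (cc2 y) A_sym (cc_Q y) (cc_D y)).
Qed.

End SquareFamily.

(** * Elliptic transformations and the translation of [tau] *)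

Section LatticeShifts.
Variables (R : realType) (n : nat) (A : 'M[R]_n) (p : 'rV[R]_n).
Hypothesis A_sym : A^T = A.
Hypothesis Q_int : integral_form A.
Hypothesis p_char : characteristic A p.
Variable Phi : 'rV[R]_n -> R[i].
Local Notation V := 'rV[R]_n.
Implicit Types (mu b c l : V) (tau : R[i]) (k : 'rV[int]_n).

Let B_half (c q b : V) : B A c (q + 2^-1 *: b) = B A c q + B A c b / 2.
Proof. by rewrite BDr BZr mulrC. Qed.

Lemma theta_termE mu tau b c k : theta_term A Phi mu p tau b c k =
  Phi (Num.sqrt (2 * Im tau) *: (kv p mu k + b)) *
  ee ((B A (kv p mu k) p / 2 + B A c (kv p mu k) + B A c b / 2)%:C - (Q A (kv p mu k + b) / 2)%:C * tau).
Proof.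
have -> : theta_term A Phi mu p tau b c k = ee (B A (kv p mu k) p / 2)%:C
  * Phi (Num.sqrt (2 * Im tau) *: (kv p mu k + b)) * ee (- (Q A (kv p mu k + b) / 2)%:C * tau)
  * ee (B A c (kv p mu k + 2^-1 *: b))%:C by [].
rewrite B_half; move: (kv p mu k) => q.
have -> : (B A q p / 2 + B A c q + B A c b / 2)%:C - (Q A (q + b) / 2)%:C * tau =
  (B A q p / 2)%:C + (- (Q A (q + b) / 2)%:C * tau) + (B A c q + B A c b / 2)%:C.
  by rewrite !(rmorphD (real_complex R)) /= mulNr; ring.
rewrite !ee_D; move: (ee _) (ee (_ * tau)) (ee _) (Phi _) => x y z w; ring.
Qed.

(** Each law below compares real phases term by term: [d] is the multiplier, [z] the integer that is
    lost, and [w] the part containing [tau]. *)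
Lemma ee_real_shift (r r' d z : R) (w : R[i]) : z \is a Num.int -> r = r' + d + z ->
  ee (r%:C - w) = ee d%:C * ee (r'%:C - w).
Proof.
move=> hz ->; have -> : (r' + d + z)%:C - w = d%:C + (r'%:C - w) + z%:C.
  by rewrite !(rmorphD (real_complex R)) /=; ring.
by rewrite ee_D (ee_int hz) mulr1 ee_D.
Qed.

Let L_int l : Lambda l -> rv (intv l) = l.
Proof. by move=> h; apply: intvK. Qed.
Let rv_L (l : 'rV[int]_n) : Lambda (rv l : V). Proof. exact: rv_int. Qed.

Let kv_shift mu (l l0 : 'rV[int]_n) : kv p mu (l + l0) = kv p mu l + rv l0.
Proof. by rewrite /kv -[map_mx intr (l + l0)]/(rv (l + l0)) rvD -!addrA; congr (_ + _); rewrite addrC -!addrA. Qed.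

Let kv_coset mu (l l0 : 'rV[int]_n) : kv p (mu + rv l0) l = kv p mu (l + l0).
Proof. by rewrite kv_shift /kv -!addrA; congr (_ + (_ + _)); rewrite addrC. Qed.

Let shift_bij (l0 : 'rV[int]_n) : bijective (fun l : 'rV[int]_n => l + l0).
Proof. by exists (fun l : 'rV[int]_n => l - l0) => x; [exact: addrK|exact: subrK]. Qed.

Lemma theta_coset lam mu l tau b c : Lambda l ->
  theta A Phi lam p (mu + l) tau b c = theta A Phi lam p mu tau b c.
Proof.
move=> hl; move: (L_int hl); move: (intv l) => l0 <-; have e : csum (theta_term A Phi (mu + rv l0) p tau b c) = csum (theta_term A Phi mu p tau b c).
  rewrite [RHS](csum_bij _ (shift_bij l0)); apply: (congr1 (@csum _ _)); apply/funext => k.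
  by rewrite !theta_termE kv_coset.
by rewrite /theta e.
Qed.

Let p_L : Lambda p. Proof. by case: p_char. Qed.
Let lp_int l : Lambda l -> B A l p \is a Num.int. Proof. by move=> h; eapply B_int; eassumption. Qed.

Lemma theta_shift_b lam mu l tau b c : Lambda l -> abs_summable (theta_term A Phi mu p tau b c) ->
  theta A Phi lam p mu tau (b + l) c =
  ee (B A l p / 2)%:C * ee (- (B A c l / 2))%:C * theta A Phi lam p mu tau b c.
Proof.
move=> hl hs; move: (L_int hl); move: (intv l) => l0 <-; rewrite /theta [RHS]mulrCA; congr (_ * _).
rewrite (csum_bij (theta_term A Phi mu p tau b c) (shift_bij l0)) -csumZ; last first.
  by apply: (abs_summable_inj _ hs); exact: bij_inj (shift_bij _).
congr csum; apply/funext => k.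
have hz := lp_int (rv_L l0).
rewrite !theta_termE kv_shift; move: (kv p mu k) (rv l0) hz => q m hz.
rewrite (_ : q + (b + m) = q + m + b); last by rewrite addrA addrAC.
rewrite [RHS]mulrCA; congr (_ * _).
have hz' : - B A m p \is a Num.int by rewrite rpredN.
rewrite -ee_D -(rmorphD (real_complex R)) /=.
by apply: (ee_real_shift _ hz'); rewrite BDl !BDr; field.
Qed.

Lemma theta_shift_c lam mu l tau b c : Lambda_dual A mu -> Lambda l -> abs_summable (theta_term A Phi mu p tau b c) ->
  theta A Phi lam p mu tau b (c + l) =
  ee (B A l p / 2)%:C * ee (B A b l / 2)%:C * theta A Phi lam p mu tau b c.
Proof.
move=> hmu hl hs; rewrite /theta [RHS]mulrCA; congr (_ * _); rewrite -csumZ //.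
congr csum; apply/funext => k.
rewrite !theta_termE [RHS]mulrCA; congr (_ * _); rewrite -ee_D -(rmorphD (real_complex R)) /=.
have hz : B A l (rv k : V) + B A l mu \is a Num.int.
  by apply: rpredD; [have h := rv_L k; eapply B_int; eassumption|rewrite BC //; exact: hmu].
apply: (ee_real_shift _ hz).
have hk : B A l (kv p mu k) = B A l (rv k : V) + B A l mu + B A l p / 2.
  by rewrite {1}/kv -/(rv k) !BDr BZr [2^-1 * _]mulrC.
by rewrite !(BDl A c l) hk (BC A_sym b l); field.
Qed.

Lemma theta_T lam mu tau b c : Lambda_dual A mu -> abs_summable (theta_term A Phi mu p tau b c) ->
  theta A Phi lam p mu (tau + 1) b (c + b) =
  ee (- (Q A (mu + 2^-1 *: p) / 2))%:C * theta A Phi lam p mu tau b c.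
Proof.
move=> hmu hs; have hI : Im (tau + 1) = Im tau by rewrite cImD /= addr0.
rewrite /theta hI [RHS]mulrCA; congr (_ * _); rewrite -csumZ //.
congr csum; apply/funext => k.
rewrite !theta_termE hI [RHS]mulrCA; congr (_ * _).
(* The phase [- Q k / 2] from the translation is not integral by itself; the shift of the sum by
   [p / 2] adds the half pairing with [p] that the characteristic property requires. *)
have hz : - ((Q A (rv k : V) + B A (rv k) p) / 2 + B A (rv k) mu) \is a Num.int.
  rewrite rpredN rpredD //; first by case: p_char => _; apply; exact: rv_L.
  by rewrite BC //; apply: hmu; exact: rv_L.
have qk : Q A (kv p mu k) = Q A (rv k) + 2 * (B A (rv k) mu + B A (rv k) p / 2) + Q A (mu + 2^-1 *: p).
  have ek : kv p mu k = rv k + (mu + 2^-1 *: p) by rewrite /kv -addrA.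
  by rewrite ek (QD A_sym) B_half.
have e1 : ee ((B A (kv p mu k) p / 2 + B A (c + b) (kv p mu k) + B A (c + b) b / 2)%:C - (Q A (kv p mu k + b) / 2)%:C * (tau + 1)) =
  ee ((B A (kv p mu k) p / 2 + B A (c + b) (kv p mu k) + B A (c + b) b / 2 - Q A (kv p mu k + b) / 2)%:C - (Q A (kv p mu k + b) / 2)%:C * tau).
  by congr ee; rewrite mulrDr mulr1 (rmorphB (real_complex R)) /=; ring.
rewrite e1; apply: (ee_real_shift _ hz).
rewrite (QD A_sym (kv p mu k) b) qk !(BDl A c b) (BC A_sym b (kv p mu k)) -[B A b b]/(Q A b); by field.
Qed.

End LatticeShifts.

Section RealIntegral.
Context d (X : measurableType d) (R : realType) (m : {measure set X -> \bar R}).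
Lemma cint_real (h : X -> R) : cint m (fun x => (h x)%:C) = (\int[m]_x h x)%:C.
Proof.
apply: complexRI => //; transitivity (Im (cint m (fun _ : X => 0 : R[i]))); first by [].
by rewrite cint0.
Qed.
End RealIntegral.

Section BoundedFunctions.
Variable R : realType.
Local Notation Y := (measurableTypeR R * measurableTypeR R)%type.
Definition bnd (f : Y -> R) := exists K, forall y, `|f y| <= K.
Lemma bnd_cst a : bnd (fun=> a). Proof. by exists `|a|. Qed.
Lemma bndD f h : bnd f -> bnd h -> bnd (fun y => f y + h y).
Proof. by move=> [K hK] [L hL]; exists (K + L) => y; apply: le_trans (ler_normD _ _) _; exact: lerD. Qed.
Lemma bndM f h : bnd f -> bnd h -> bnd (fun y => f y * h y).
Proof. by move=> [K hK] [L hL]; exists (K * L) => y; rewrite normrM; apply: ler_pM. Qed.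

Definition nuP : probability Y R := [the probability _ _ of (unitP R \x unitP R)%E].
Definition nuY : {sigma_finite_measure set Y -> \bar R} := nuP.
Lemma nuY_fin : (nuY setT < +oo)%E.
Proof. by change (nuP setT < +oo)%E; rewrite probability_setT ltry. Qed.
End BoundedFunctions.

Lemma B_coord_sum (R : realType) n (A : 'M[R]_n) u x : B A u x = \sum_j B A u (delta_mx 0 j) * x 0 j.
Proof.
rewrite [LHS]/B mxE; apply: eq_bigr => j _; rewrite /B trmx_delta -colE.
by congr (_ * _); [rewrite [RHS]mxE|rewrite [LHS]mxE].
Qed.

Section Scaling.
Variables (R : realType) (n : nat) (A : 'M[R]_n).
Lemma BpZ c1 c2 v a x : Bp A c1 c2 v (a *: x) = a * Bp A c1 c2 v x.
Proof. rewrite /Bp /Bt !BZr; ring. Qed.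
Lemma QpZ c1 c2 a x : Qp A c1 c2 (a *: x) = a ^+ 2 * Qp A c1 c2 x.
Proof. rewrite /Qp /Bt !BZr; ring. Qed.
End Scaling.

Lemma exponent_split (R : realType) (tau : R[i]) (z1 z2 z3 z4 z5 P0 : R) :
  (P0 * Im tau * (z4 - 2 * z5))%:C + 'i%C * (2 * P0 * (z1 / 2 + z2 + 2^-1 * z3 - Re tau * z4 / 2))%:C =
  (2 * P0)%:C * 'i%C * ((z1 / 2 + z2 + z3 / 2)%:C - (z4 / 2)%:C * tau) + (- (2 * P0 * Im tau) * z5)%:C.
Proof.
apply: complexRI; rewrite ?(cReD, cImD, cReN, cImN, cReM, cImM) /=;
  rewrite ?(cReD, cImD, cReN, cImN, cReM, cImM) /=; by field.
Qed.

(** * The theta series as an averaged Gaussian family *)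

Section ThetaKernel.
Variables (R : realType) (n : nat) (A : 'M[R]_n) (p C1 C1' C2 C2' : 'rV[R]_n).
Hypothesis A_sym : A^T = A.
Local Notation V := 'rV[R]_n.
Local Notation W := (R * R * V * V)%type.
Local Notation Y := (measurableTypeR R * measurableTypeR R)%type.
Hypothesis Q1_pos : forall s, 0 <= s <= 1 -> 0 < Q A (seg C1 C1' s).
Hypothesis Q2_pos : forall u, 0 <= u <= 1 -> 0 < Q A (seg C2 C2' u).
Hypothesis D_pos : forall s u, 0 <= s <= 1 -> 0 <= u <= 1 -> 0 < Bt A (seg C1 C1' s) (seg C2 C2' u) (seg C2 C2' u).
Variables (g : nat -> 'rV[int]_n) (gi : 'rV[int]_n -> nat).
Hypothesis gK : cancel g gi.
Hypothesis giK : cancel gi g.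
Local Notation c1 y := (cc1 C1 C1' y).
Local Notation c2 y := (cc2 C2 C2' y).
Local Notation v1 := (C1' - C1).
Local Notation v2 := (C2' - C2).

Definition PP (y : Y) : 'M[R]_n := Pmx A (c1 y) (c2 y).
(** The prefactor of [phi2] at the argument scaled by [sqrt (2 Im tau)]. The root appears squared,
    so the prefactor is polynomial in the parameters. *)
Definition sker mu (t : W) (l : 'rV[int]_n) (y : Y) : R :=
  wt2 A C1 C1' C2 C2' y *
  (2 * t.1.1.2 * (Bp A (c1 y) (c2 y) v1 (kv p mu l + t.1.2) * Bp A (c1 y) (c2 y) v2 (kv p mu l + t.1.2))
   + Bp A (c1 y) (c2 y) v1 v2 / (2 * pi)).
Definition skC mu (t : W) l y : R[i] := (sker mu t l y)%:C.

Variables (KP eps : R).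
Hypothesis PP_bnd : forall y i j, `|PP y i j| <= KP.
Hypothesis eps0 : 0 < eps.
Hypothesis PP_pos : forall y x, eps * nsq x <= 2 * qf (PP y) x - Q A x.

Let cQ y : 0 < Q A (c1 y). Proof. exact: (cc_Q Q1_pos). Qed.
Let cD y : 0 < Bt A (c1 y) (c2 y) (c2 y). Proof. exact: (cc_D D_pos). Qed.
Lemma PP_meas i j : measurable_fun setT (fun y => PP y i j).
Proof. exact: (mfn_P A_sym Q1_pos D_pos i j). Qed.

Let Bp_delta y v x : Bp A (c1 y) (c2 y) v x = \sum_j Bp A (c1 y) (c2 y) v (delta_mx 0 j) * x 0 j.
Proof.
rewrite -(@B_vperp R n A (c1 y) (c2 y) A_sym (cQ y) (cD y)) B_coord_sum; apply: eq_bigr => j _.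
by rewrite (@B_vperp R n A (c1 y) (c2 y) A_sym (cQ y) (cD y)).
Qed.

Lemma adm_Bp v w : adm g (fun (_ : W) _ y => Bp A (c1 y) (c2 y) v w).
Proof.
have [K hK] := Bp_bounded Q1_pos D_pos v w.
exact: (@adm_Y R n g _ K (mfn_Bp A_sym Q1_pos D_pos v w) hK).
Qed.

Lemma adm_Bpxi mu v : adm g (fun (t : W) l y => Bp A (c1 y) (c2 y) v (kv p mu l + t.1.2)).
Proof.
apply: (@adm_ext R n g (fun t l y => \sum_j Bp A (c1 y) (c2 y) v (delta_mx 0 j) * (kv p mu l + t.1.2) 0 j)).
  by move=> t l y; rewrite [RHS]Bp_delta.
apply: (@adm_sum R n g (fun j (t : W) l y => Bp A (c1 y) (c2 y) v (delta_mx 0 j) * (kv p mu l + t.1.2) 0 j)) => j.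
exact: (admM (adm_Bp v (delta_mx 0 j)) (@vadm_xi R n p g mu j)).
Qed.

Lemma skC_adm mu : admC g (skC mu).
Proof.
have [K hK] := wt2_bounded Q1_pos D_pos.
have aw := @adm_Y R n g _ K (mfn_wt2 A_sym Q1_pos D_pos) hK.
have a1 := admM (adm_Bpxi mu v1) (adm_Bpxi mu v2).
have a2 := admM (admM (adm_cst g 2) (@adm_y R n g)) a1.
exact: (admM aw (admD a2 (admM (adm_Bp v1 v2) (adm_cst g (2 * pi)^-1)))).
Qed.

Section Point.
Variables (mu : V) (tau : R[i]) (b c : V) (l : 'rV[int]_n).
Hypothesis tau0 : 0 < Im tau.
Let t0 : W := (Re tau, Im tau, b, c).
Let xi : V := kv p mu l + b.
Let F (y : Y) : R := sker mu t0 l y * expR (- (2 * pi * Im tau) * Qp A (c1 y) (c2 y) xi).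
Let E : R[i] := ee ((B A (kv p mu l) p / 2 + B A c (kv p mu l) + B A c b / 2)%:C - (Q A xi / 2)%:C * tau).

Let r2 : Num.sqrt (2 * Im tau) ^+ 2 = 2 * Im tau.
Proof. by rewrite sqr_sqrtr // mulr_ge0 // ltW. Qed.

Let phi2_F y : phi2 A (c1 y) (c2 y) v1 v2 (Num.sqrt (2 * Im tau) *: xi) = F y.
Proof.
rewrite /phi2 !BpZ QpZ; move: r2; move: (Num.sqrt (2 * Im tau)) => r hr.
have -> : r * Bp A (c1 y) (c2 y) v1 xi * (r * Bp A (c1 y) (c2 y) v2 xi) =
  r ^+ 2 * (Bp A (c1 y) (c2 y) v1 xi * Bp A (c1 y) (c2 y) v2 xi) by ring.
rewrite hr /F /sker /wt2 /=; congr (_ * expR _); last by ring.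
by rewrite mulrC.
Qed.

Let fterm_F y : fterm A p PP mu 2^-1 (skC mu) t0 l y = E * (F y)%:C.
Proof.
have e : cexp (expo A p PP mu 2^-1 t0 l y) = E * (expR (- (2 * pi * Im tau) * Qp A (c1 y) (c2 y) xi))%:C; last first.
  have eF : (F y)%:C = (sker mu t0 l y)%:C * (expR (- (2 * pi * Im tau) * Qp A (c1 y) (c2 y) xi))%:C := rmorphM (real_complex R) _ _.
  by rewrite eF /fterm e; exact: mulrCA.
transitivity (cexp ((2 * pi)%:C * 'i%C * ((B A (kv p mu l) p / 2 + B A c (kv p mu l) + B A c b / 2)%:C - (Q A xi / 2)%:C * tau)
  + (- (2 * pi * Im tau) * Qp A (c1 y) (c2 y) xi)%:C)); last by rewrite cexpD cexp_real.
apply: (congr1 (@cexp R)).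
rewrite /expo /fre /fim /PP /= (@qf_Pmx R n A (c1 y) (c2 y) A_sym (cQ y) (cD y)) -/xi.
move: (B A (kv p mu l) p) (B A c (kv p mu l)) (B A c b) (Q A xi) (Qp A (c1 y) (c2 y) xi) (pi : R) => z1 z2 z3 z4 z5 P0.
exact: exponent_split.
Qed.

Let F_meas : mfn F.
Proof.
have m1 w : mfn (fun y => B A (c1 y) w) by exact: mfn_B1.
have m2 w : mfn (fun y => Bt A (c1 y) (c2 y) w) by first [exact: (mfn_Bt2 A_sym Q1_pos) | apply: mfn_Bt2 | apply: (@mfn_Bt2 R n A C1 C1' C2 C2')].
have mb v w := mfn_Bp A_sym Q1_pos D_pos v w.
have mqv : mfn (fun y => (Q A (c1 y))^-1) by apply: (mfnV cQ); exact: mfn_Q1.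
have mdv : mfn (fun y => (Bt A (c1 y) (c2 y) (c2 y))^-1) by apply: (mfnV cD); first [exact: (mfn_D A_sym Q1_pos) | by apply: mfn_D | by apply: (@mfn_D R n A C1 C1' C2 C2')].
have mq : mfn (fun y => Qp A (c1 y) (c2 y) xi).
  rewrite (_ : (fun y => _) = fun y => B A (c1 y) xi * B A (c1 y) xi * (Q A (c1 y))^-1 +
     Bt A (c1 y) (c2 y) xi * Bt A (c1 y) (c2 y) xi * (Bt A (c1 y) (c2 y) (c2 y))^-1).
    by apply: mfnD; apply: mfnM => //; apply: mfnM.
  by apply/funext => y; rewrite /Qp !expr2.
have ms : mfn (fun y => sker mu t0 l y).
  apply: (mfnM (mfn_wt2 A_sym Q1_pos D_pos)); apply: mfnD.
    by apply: (mfnM (mfn_cst _)); apply: mfnM; exact: mb.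
  by apply: mfnM; [exact: mb|exact: mfn_cst].
apply: (mfnM ms); apply: (@mfn_comp R expR); first exact: continuous_expR.
exact: (mfnM (mfn_cst _) mq).
Qed.

Let F_bnd : bnd F.
Proof.
have bb v w : bnd (fun y => Bp A (c1 y) (c2 y) v w) := Bp_bounded Q1_pos D_pos v w.
apply: bndM.
  apply: (bndM (wt2_bounded Q1_pos D_pos)); apply: bndD.
    by apply: (bndM (bnd_cst _)); apply: bndM; exact: bb.
  by apply: bndM; [exact: bb|exact: bnd_cst].
exists 1 => y; rewrite ger0_norm ?expR_ge0 // -expR0 ler_expR mulNr oppr_le0 mulr_ge0 //.
  by rewrite !mulr_ge0 ?pi_ge0 // ltW.
by rewrite /Qp addr_ge0 // divr_ge0 ?sqr_ge0 // ltW.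
Qed.

Let fint := @fterm_integrable R n A p g gi giK PP PP_meas KP PP_bnd eps eps0 PP_pos mu 2^-1 (nuY R) (nuY_fin R) (skC mu) t0 l (skC_adm mu) tau0.

Let F_int : cintegrable (nuY R) (fun y => (F y)%:C).
Proof.
have e : (fun y => E^-1 * fterm A p PP mu 2^-1 (skC mu) t0 l y) = (fun y => (F y)%:C).
  by apply/funext => y; rewrite fterm_F mulKf // /E ee_neq0.
have h := cintegrableZ E^-1 fint.
by rewrite e in h.
Qed.

(** At the scaled argument the Gaussians of the superposition become [exp (- 2 pi Im tau Qp)] and
    merge with the phases of [theta_term] into the exponent [expo] with [kap = 1/2]. *)
Lemma theta_term_cint : theta_term A (Phi2_hat A C1 C1' C2 C2') mu p tau b c l =
  cint (nuY R) (fterm A p PP mu 2^-1 (skC mu) t0 l).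
Proof.
have -> : fterm A p PP mu 2^-1 (skC mu) t0 l = (fun y => E * (F y)%:C) by apply/funext => y; exact: fterm_F.
rewrite theta_termE -/xi -/E mulrC cintZ; last exact: F_int.
congr (_ * _); rewrite (Phi2_hat_superposition A_sym Q1_pos Q2_pos D_pos).
have sec (s : measurableTypeR R) : cintegrable (unitP R) (fun u : measurableTypeR R => (F (s, u))%:C).
  have [K hK] := F_bnd.
  split; last by apply: (@unit_integrable_bounded R (fun=> 0) 0) => [|x]; [exact: measurable_cst|rewrite normr0].
  apply: (@unit_integrable_bounded R (fun u => F (s, u)) K) => // .
  exact: (measurableT_comp F_meas (pair1_measurable s)).
rewrite (@cint_Fubini1 _ _ _ _ _ (unitP R) (unitP R) (fun y => (F y)%:C) F_int sec) -cint_real.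
apply: (congr1 (cint (unitP R))); apply/funext => s.
rewrite (cint_real (unitP R) (fun u => F (s, u))); apply: (congr1 (fun a : R => a%:C)).
by apply: (congr1 (fun h : measurableTypeR R -> R => Rintegral (unitP R) setT h)); apply/funext => u; exact: (phi2_F (s, u)).
Qed.

End Point.

Lemma Phi2_summable mu (tau : R[i]) b c : 0 < Im tau ->
  abs_summable (theta_term A (Phi2_hat A C1 C1' C2 C2') mu p tau b c).
Proof.
move=> h; have -> : theta_term A (Phi2_hat A C1 C1' C2 C2') mu p tau b c =
  (fun l => cint (nuY R) (fterm A p PP mu 2^-1 (skC mu) (Re tau, Im tau, b, c) l)).
  by apply/funext => l; exact: theta_term_cint.
exact: (@cint_fterm_summable R n A p g gi giK PP PP_meas KP PP_bnd eps eps0 PP_pos mu 2^-1 (nuY R) (nuY_fin R) (skC mu) (Re tau, Im tau, b, c) (skC_adm mu) h).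
Qed.

Lemma theta_fam mu (tau : R[i]) b c : 0 < Im tau ->
  theta A (Phi2_hat A C1 C1' C2 C2') 0 p mu tau b c =
  fam A p g PP mu 2^-1 (nuY R) (skC mu) (Re tau, Im tau, b, c).
Proof.
move=> h; rewrite /theta mulr0z oppr0 mul0r powRr0 mul1r.
rewrite (@fam_csum R n A p g gi gK giK PP PP_meas KP PP_bnd eps eps0 PP_pos mu 2^-1 (nuY R) (nuY_fin R) (skC mu) (Re tau, Im tau, b, c) (skC_adm mu) h).
by congr csum; apply/funext => l; exact: theta_term_cint.
Qed.

End ThetaKernel.

(** * Radial derivative of the kernel *)

Section Radial.
Variables (R : realType) (n : nat) (A : 'M[R]_n).
Hypothesis A_sym : A^T = A.
Local Notation V := 'rV[R]_n.

Lemma gauss1E c x : 0 < Q A c -> gauss1 A c x =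
  B A c x / Num.sqrt (Q A c) * expR (- pi * (B A c x / Num.sqrt (Q A c)) ^+ 2).
Proof.
move=> h; have s : Num.sqrt (Q A c) ^+ 2 = Q A c by rewrite sqr_sqrtr // ltW.
rewrite /gauss1 expr_div_n s; congr (_ * expR _); by rewrite mulNr [in RHS]mulrA.
Qed.

Let dl (a s : R) : is_derive s (1 : R) (fun s : R => s * a) a.
Proof.
have h : is_derive s (1 : R) (a \*: (@id R)) (a *: (1 : R)) by apply: is_deriveZ.
have e : a \*: (@id R) = (fun s => s * a) by apply/funext => x /=; rewrite mulrC.
by move: h; rewrite e /GRing.scale /= mulr1.
Qed.

Let Bs c (r : R) w (s : R) : B A c (r *: w) / s = r * (B A c w / s).
Proof. by rewrite BZr mulrA. Qed.

Let E1_scale c (r : R) w : E1 A c (r *: w) = gerf (r * (B A c w / Num.sqrt (Q A c))).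
Proof. rewrite /E1 Bs; exact: erefl. Qed.

Let gauss1_scale c (r : R) w : 0 < Q A c -> gauss1 A c (r *: w) =
  r * (B A c w / Num.sqrt (Q A c)) * expR (- pi * (r * (B A c w / Num.sqrt (Q A c))) ^+ 2).
Proof. by move=> h; rewrite (gauss1E _ h) Bs. Qed.

Let radial_algebra (r b w1 w2 x1 x2 y1 y2 z s t : R) :
  r * (2 * b * x2 * y1 + 2 * x1 * (y2 * (w1 + 0 * (r * w2) / s) + 0 / t * z)) =
  2 * (r * b * x2 * y1 + r * w1 * x1 * y2).
Proof. by rewrite !mul0r !addr0; ring. Qed.

Section Pair.
Variables (c1 c2 : V).
Hypothesis q1 : 0 < Q A c1.
Hypothesis q2 : 0 < Q A c2.
Let D := Q A c1 * Q A c2 - B A c1 c2 ^+ 2.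
Hypothesis D0 : 0 < D.

Let s1 : Num.sqrt (Q A c1) ^+ 2 = Q A c1. Proof. by rewrite sqr_sqrtr // ltW. Qed.
Let s2 : Num.sqrt (Q A c2) ^+ 2 = Q A c2. Proof. by rewrite sqr_sqrtr // ltW. Qed.
Let s3 : Num.sqrt D ^+ 2 = D. Proof. by rewrite sqr_sqrtr // ltW. Qed.
Let p1 : 0 < Num.sqrt (Q A c1). Proof. by rewrite sqrtr_gt0. Qed.
Let p2 : 0 < Num.sqrt (Q A c2). Proof. by rewrite sqrtr_gt0. Qed.
Let p3 : 0 < Num.sqrt D. Proof. by rewrite sqrtr_gt0. Qed.

Let sqrt_of (a x : R) : 0 <= a -> x = a ^+ 2 -> Num.sqrt x = a.
Proof. by move=> ha ->; rewrite sqrtr_sqr ger0_norm. Qed.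

Let B_perp c c' x : B A (perp A c c') x = B A c x - B A c c' / Q A c' * B A c' x.
Proof. by rewrite /perp BDl BNl BZl. Qed.

Let Q_perp12 : Num.sqrt (Q A (perp A c1 c2)) = Num.sqrt D / Num.sqrt (Q A c2).
Proof.
apply: sqrt_of; first by rewrite divr_ge0 // sqrtr_ge0.
rewrite expr_div_n s3 s2 /D [LHS]/Q B_perp [B A c2 (perp _ _ _)]BC // [B A c1 (perp _ _ _)]BC // !B_perp.
rewrite (BC A_sym c2 c1) -/(Q A c1) -/(Q A c2); field; by rewrite gt_eqF.
Qed.
Let Q_perp21 : Num.sqrt (Q A (perp A c2 c1)) = Num.sqrt D / Num.sqrt (Q A c1).
Proof.
apply: sqrt_of; first by rewrite divr_ge0 // sqrtr_ge0.
rewrite expr_div_n s3 s1 /D [LHS]/Q B_perp [B A c2 (perp _ _ _)]BC // [B A c1 (perp _ _ _)]BC // !B_perp.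
rewrite (BC A_sym c2 c1) -/(Q A c1) -/(Q A c2); field; by rewrite gt_eqF.
Qed.

Let al := B A c1 c2 / Num.sqrt D.
Let rhoE : Num.sqrt (1 + al ^+ 2) = Num.sqrt (Q A c1) * Num.sqrt (Q A c2) / Num.sqrt D.
Proof.
apply: sqrt_of; first by rewrite divr_ge0 ?mulr_ge0 ?sqrtr_ge0.
rewrite /al !expr_div_n exprMn s1 s2 s3 /D; field.
by rewrite gt_eqF.
Qed.

Let W1 w : (B A (perp A c1 c2) w / Num.sqrt (Q A (perp A c1 c2)) + al * (B A c2 w / Num.sqrt (Q A c2))) / Num.sqrt (1 + al ^+ 2)
  = B A c1 w / Num.sqrt (Q A c1).
Proof.
rewrite rhoE Q_perp12 B_perp /al -[in X in _ / X * B A c2 w]s2.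
move: p1 p2 p3; move: (Num.sqrt (Q A c1)) (Num.sqrt (Q A c2)) (Num.sqrt D) => a b d a0 b0 d0.
field; by rewrite ?gt_eqF.
Qed.

Let W2 w : (B A c2 w / Num.sqrt (Q A c2) - al * (B A (perp A c1 c2) w / Num.sqrt (Q A (perp A c1 c2)))) / Num.sqrt (1 + al ^+ 2)
  = B A (perp A c2 c1) w / Num.sqrt (Q A (perp A c2 c1)).
Proof.
have hd : Num.sqrt D ^+ 2 = Num.sqrt (Q A c1) ^+ 2 * Num.sqrt (Q A c2) ^+ 2 - B A c1 c2 ^+ 2 by rewrite s1 s2 s3.
rewrite rhoE Q_perp12 Q_perp21 !B_perp /al (BC A_sym c2 c1).
rewrite -[in X in _ / X * B A c2 w]s2 -[in X in _ / X * B A c1 w]s1.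
move: p1 p2 p3 hd; move: (Num.sqrt (Q A c1)) (Num.sqrt (Q A c2)) (Num.sqrt D) (B A c1 c2) (B A c1 w) (B A c2 w) => a b d x y z a0 b0 d0 hd.
apply/eqP; rewrite -subr_eq0; apply/eqP.
transitivity (z / (a * b ^+ 2 * d) * (d ^+ 2 + x ^+ 2 - a ^+ 2 * b ^+ 2)); first by field; rewrite ?gt_eqF.
by rewrite hd; ring.
Qed.

(** On a ray [al] is constant and the other arguments are linear in [r], so [double_erf_path]
    applies with [al' = 0]. Its rotation passes from the orthogonal pair of [perp c1 c2] and [c2] to
    that of [c1] and [perp c2 c1] ([W1], [W2]), which makes the result symmetric in the two
    vectors. *)
Lemma E2_radial w (r : R) : exists d, is_derive r (1 : R) (fun r : R => E2 A c1 c2 (r *: w)) d /\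
  r * d = 2 * (gauss1 A c2 (r *: w) * E1 A (perp A c1 c2) (r *: w) + gauss1 A c1 (r *: w) * E1 A (perp A c2 c1) (r *: w)).
Proof.
pose a := B A (perp A c1 c2) w / Num.sqrt (Q A (perp A c1 c2)).
pose b := B A c2 w / Num.sqrt (Q A c2).
have e : (fun r : R => E2 A c1 c2 (r *: w)) = (fun s => double_erf al (s * a) (s * b)).
  by apply/funext => s; rewrite /E2 !Bs.
set rho := Num.sqrt (1 + al ^+ 2).
have P1 (s : R) : `|s - r| < 1 -> [/\ is_derive s (1 : R) (fun=> al) (0 : R), is_derive s 1 (fun s => s * a) a & is_derive s 1 (fun s => s * b) b].
  by move=> _; split; [exact: is_derive_cst|exact: dl|exact: dl].
have P2 (s : R) : `|s - r| < 1 -> [/\ `|0 : R| <= `|a| + `|b| + (`|r| + 1) * `|b|, `|a| <= `|a| + `|b| + (`|r| + 1) * `|b|,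
    `|b| <= `|a| + `|b| + (`|r| + 1) * `|b| & `|s * b| <= `|a| + `|b| + (`|r| + 1) * `|b|].
  move=> hs; have na := normr_ge0 a; have nb := normr_ge0 b; have nr := normr_ge0 r.
  have ns : `|s| <= `|r| + 1.
    have -> : s = r + (s - r) by ring.
    by apply: le_trans (ler_normD _ _) _; rewrite lerD2l ltW.
  have k : `|s| * `|b| <= (`|r| + 1) * `|b| by rewrite ler_wpM2r.
  have k2 : 0 <= (`|r| + 1) * `|b| by rewrite mulr_ge0 // addr_ge0.
  split.
  - by rewrite normr0 !addr_ge0.
  - by rewrite -addrA lerDl addr_ge0.
  - by rewrite [X in _ <= X + _]addrC -addrA lerDl addr_ge0.
  - by rewrite normrM; apply: (le_trans k); rewrite lerDr addr_ge0.
have H : is_derive r (1 : R) (fun s => double_erf al (s * a) (s * b))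
  (2 * b * expR (- pi * (r * b) ^+ 2) * gerf (r * a) + 2 * expR (- pi * ((r * a + al * (r * b)) / rho) ^+ 2) *
    (gerf ((r * b - al * (r * a)) / rho) * ((a + al * b) / rho + 0 * ((r * b - al * (r * a)) / rho) / rho ^+ 2)
     + 0 / (pi * rho ^+ 2) * expR (- pi * ((r * b - al * (r * a)) / rho) ^+ 2)))
  := @double_erf_path R (fun=> al) (fun s => s * a) (fun s => s * b) (fun=> 0) (fun=> a) (fun=> b) r 1 _ ltr01 P1 P2.
have w1 : (a + al * b) / rho = B A c1 w / Num.sqrt (Q A c1) by exact: W1.
have w2 : (b - al * a) / rho = B A (perp A c2 c1) w / Num.sqrt (Q A (perp A c2 c1)) by exact: W2.
have w1' : (r * a + al * (r * b)) / rho = r * (B A c1 w / Num.sqrt (Q A c1)).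
  by rewrite -w1 [RHS]mulrA [in RHS]mulrDr; congr ((_ + _) / _); exact: mulrCA.
have w2' : (r * b - al * (r * a)) / rho = r * (B A (perp A c2 c1) w / Num.sqrt (Q A (perp A c2 c1))).
  by rewrite -w2 [RHS]mulrA [in RHS]mulrBr; congr ((_ - _) / _); exact: mulrCA.
rewrite w1 w1' w2' in H.
have g2 : gauss1 A c2 (r *: w) = r * b * expR (- pi * (r * b) ^+ 2) := gauss1_scale r w q2.
have g1 := gauss1_scale r w q1.
have h1 : E1 A (perp A c1 c2) (r *: w) = gerf (r * a) := E1_scale (perp A c1 c2) r w.
have h2 := E1_scale (perp A c2 c1) r w.
have K := congr1 (fun x : R => 2 * x) (f_equal2 (fun x y : R => x + y)
  (f_equal2 (fun x y : R => x * y) g2 h1) (f_equal2 (fun x y : R => x * y) g1 h2)).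
eexists; split; [exact: (eq_ind_r (fun F : R -> R => is_derive r (1 : R) F _) H e)|].
refine (etrans _ (esym K)); exact: radial_algebra.
Qed.

End Pair.

Let comb4 (f1 f2 f3 f4 : R -> R) (r d1 d2 d3 d4 : R) : is_derive r (1 : R) f1 d1 -> is_derive r (1 : R) f2 d2 ->
  is_derive r (1 : R) f3 d3 -> is_derive r (1 : R) f4 d4 ->
  is_derive r (1 : R) (fun s => 4^-1 * (f1 s - f2 s - f3 s + f4 s)) (4^-1 * (d1 - d2 - d3 + d4)).
Proof.
move=> h1 h2 h3 h4.
have H : is_derive r (1 : R) (4^-1 \*: (f1 - f2 - f3 + f4)) (4^-1 *: (d1 - d2 - d3 + d4)).
  by first [apply: is_deriveZ | apply: is_deriveZ; apply: is_deriveD; apply: is_deriveB; apply: is_deriveB].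
exact: H.
Qed.

Let psi_real (g1 g1' g2 g2' y1 y2 y3 y4 y5 y6 y7 y8 r d1 d2 d3 d4 : R) :
  r * d1 = 2 * (g2 * y3 + g1 * y1) -> r * d2 = 2 * (g2' * y8 + g1 * y2) ->
  r * d3 = 2 * (g2 * y4 + g1' * y6) -> r * d4 = 2 * (g2' * y7 + g1' * y5) ->
  4^-1 * r * (4^-1 * (d1 - d2 - d3 + d4)) =
  8^-1 * (g1 * (y1 - y2) + g2 * (y3 - y4) + g1' * (y5 - y6) + g2' * (y7 - y8)).
Proof.
move=> e1 e2 e3 e4.
have -> : 4^-1 * r * (4^-1 * (d1 - d2 - d3 + d4)) = 16^-1 * (r * d1 - r * d2 - r * d3 + r * d4) by field.
by rewrite e1 e2 e3 e4; field.
Qed.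

Let psi_complex (q X S : R) : q * X = 8^-1 * S ->
  (8^-1)%:C * 'i%C * S%:C = 'i%C * q%:C * X%:C :> R[i].
Proof.
move=> k.
have m1 : (q * X)%:C = q%:C * X%:C := rmorphM (real_complex R) q X.
have m2 : (8^-1 * S)%:C = (8^-1)%:C * S%:C := rmorphM (real_complex R) 8^-1 S.
by rewrite -[RHS]mulrA -m1 k m2 [RHS]mulrCA [RHS]mulrA.
Qed.

(** The constants combine as [4^-1 * 4^-1 * 2 = 8^-1]; each of the four Gaussians occurs in two of
    the [E2] with opposite signs, which yields the differences of [E1]. *)
Lemma Phi2_radial (C1 C1' C2 C2' w : V) (r : R) : 0 < Q A C1 -> 0 < Q A C1' -> 0 < Q A C2 -> 0 < Q A C2' ->
  0 < Delta A [:: C1; C2] -> 0 < Delta A [:: C1'; C2] -> 0 < Delta A [:: C1; C2'] -> 0 < Delta A [:: C1'; C2'] ->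
  exists d : R[i], cder (fun r : R => Phi2_hat A C1 C1' C2 C2' (r *: w)) r 1 d /\
    Psi2 A C1 C1' C2 C2' (r *: w) = 'i%C * (4^-1 * r)%:C * d.
Proof.
move=> q1 q1' q2 q2'; rewrite !(Delta2 A_sym) => D1 D2 D3 D4.
have [d1 [h1 e1]] := E2_radial q1 q2 D1 w r; have [d2 [h2 e2]] := E2_radial q1 q2' D3 w r.
have [d3 [h3 e3]] := E2_radial q1' q2 D2 w r; have [d4 [h4 e4]] := E2_radial q1' q2' D4 w r.
have hd := cder_real (comb4 h1 h2 h3 h4).
exists (4^-1 * (d1 - d2 - d3 + d4))%:C; split; first exact: hd.
exact: (psi_complex (psi_real e1 e2 e3 e4)).
Qed.

End Radial.

Section CintSum.
Context d (X : measurableType d) (R : realType) (m : {measure set X -> \bar R}).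
Lemma cint_sum (I : eqType) (s : seq I) (k : I -> R[i]) (G : I -> X -> R[i]) : (forall i, cintegrable m (G i)) ->
  cintegrable m (fun x => \sum_(i <- s) k i * G i x) /\
  cint m (fun x => \sum_(i <- s) k i * G i x) = \sum_(i <- s) k i * cint m (G i).
Proof.
move=> hG; elim: s => [|i s [IH1 IH2]].
  have e : (fun x : X => \sum_(i <- [::]) k i * G i x) = (fun=> 0) by apply/funext => x; rewrite big_nil.
  by rewrite e big_nil cint0; split=> //; split; exact: integrable0.
have e : (fun x : X => \sum_(j <- i :: s) k j * G j x) = (fun x => k i * G i x + \sum_(j <- s) k j * G j x).
  by apply/funext => x; rewrite big_cons.
have hi := cintegrableZ (k i) (hG i).
by rewrite e big_cons; split; [exact: cintegrableD|rewrite cintD // cintZ // IH2].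
Qed.
End CintSum.

(** * Inversion of the averaged theta series *)

Section Inversion.
Variables (R : realType) (n : nat) (A : 'M[R]_n) (p C1 C1' C2 C2' : 'rV[R]_n).
Hypothesis A_sym : A^T = A.
Local Notation V := 'rV[R]_n.
Local Notation W := (R * R * V * V)%type.
Local Notation Y := (measurableTypeR R * measurableTypeR R)%type.
Hypothesis Q1_pos : forall s, 0 <= s <= 1 -> 0 < Q A (seg C1 C1' s).
Hypothesis D_pos : forall s u, 0 <= s <= 1 -> 0 <= u <= 1 -> 0 < Bt A (seg C1 C1' s) (seg C2 C2' u) (seg C2 C2' u).
Hypothesis maj : forall s u x, 0 <= s <= 1 -> 0 <= u <= 1 -> x != 0 ->
  0 < 2 * Qp A (seg C1 C1' s) (seg C2 C2' u) x - Q A x.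
Variables (g : nat -> 'rV[int]_n) (gi : 'rV[int]_n -> nat).
Hypothesis gK : cancel g gi.
Hypothesis giK : cancel gi g.
Local Notation c1 y := (cc1 C1 C1' y).
Local Notation c2 y := (cc2 C2 C2' y).
Local Notation v1 := (C1' - C1).
Local Notation v2 := (C2' - C2).
Local Notation PP := (PP A C1 C1' C2 C2').
Local Notation skC := (skC A p C1 C1' C2 C2').
Variables (KP eps : R).
Hypothesis PP_bnd : forall y i j, `|PP y i j| <= KP.
Hypothesis eps0 : 0 < eps.
Hypothesis PP_pos : forall y x, eps * nsq x <= 2 * qf (PP y) x - Q A x.
Variable c0 : R[i] -> R[i].
Hypothesis c_sqr : forall ps, 0 < Im ps -> c0 ps != 0 /\ c0 ps ^+ 2 * ps = 'i%C.
Hypothesis c_cont : forall (f : R -> R[i]) (s : R), 0 < Im (f s) -> ccont f s -> ccont (fun s => c0 (f s)) s.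
Hypothesis c_pos : forall t : R, 0 < t -> Im (c0 (0 +i* t)) = 0 /\ 0 < Re (c0 (0 +i* t)).
Hypothesis c_inv : forall om ze, 0 < Im om ->
        [/\ abs_summable (fun k : int => ee (om * k%:~R ^+ 2 / 2 + k%:~R * ze)),
            abs_summable (fun m : int => ee (- ((m%:~R + ze) ^+ 2 / (2 * om)))) &
            csum (fun m : int => ee (- ((m%:~R + ze) ^+ 2 / (2 * om)))) =
            c0 (- om^-1) * csum (fun k : int => ee (om * k%:~R ^+ 2 / 2 + k%:~R * ze))].
Variables (Az : 'M[int]_n) (s : seq V) (N : R).
Hypothesis A_int : A = map_mx intr Az.
Hypothesis Az_det : \det Az != 0.
Hypothesis s_uniq : uniq s.
Hypothesis s_reps : dual_box Az = [set` s].
Hypothesis p_int : integral_row p.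
Hypothesis A_unit : A \in unitmx.
Hypothesis N_pos : 0 < N.
Hypothesis A_det : \det A = (-1) ^+ n * N.

Let cQ y : 0 < Q A (c1 y). Proof. exact: (cc_Q Q1_pos). Qed.
Let cD y : 0 < Bt A (c1 y) (c2 y) (c2 y). Proof. exact: (cc_D D_pos). Qed.
Let mP := PP_meas A_sym Q1_pos D_pos.
Let sA mu := @skC_adm R n A p C1 C1' C2 C2' A_sym Q1_pos D_pos g mu.

Section AtPoint.
Variable y : Y.
Let fr := frame A (c1 y) (c2 y).
Let w1 := vperp A (c1 y) (c2 y) v1.
Let w2 := vperp A (c1 y) (c2 y) v2.
Let PE : PP y = fr^T *m fr. Proof. exact: (@Pmx_frame R n A (c1 y) (c2 y) A_sym (cQ y) (cD y)). Qed.
Let frG : fr *m invmx A *m fr^T = 1%:M. Proof. exact: (@frame_gram R n A (c1 y) (c2 y) A_sym A_unit (cQ y) (cD y)). Qed.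
Let Pp x : x != 0 -> 0 < 2 * qf (fr^T *m fr) x - Q A x.
Proof.
move=> x0; rewrite -PE [qf _ _](@qf_Pmx R n A (c1 y) (c2 y) A_sym (cQ y) (cD y)).
by apply: maj => //; exact: clamp_01.
Qed.
Let Psym : (PP y)^T = PP y. Proof. by rewrite PE trmx_mul trmxK. Qed.
Let Pidem : PP y *m invmx A *m PP y = PP y. Proof. by rewrite PE; exact: (P_idem frG). Qed.
Let wt0 : (wt2 A C1 C1' C2 C2' y)%:C != 0 :> R[i].
Proof. by rewrite fmorph_eq0 /wt2 invr_eq0 gt_eqF // sqrtr_gt0 mulr_gt0. Qed.

Let X0 nu (ta : R[i]) b c l : R[i] := (2 * Im ta * (B A w1 (kv p nu l + b) * B A w2 (kv p nu l + b)) + B A w1 w2 / (2 * pi))%:C * T0 A p (PP y) 2^-1 nu ta b c l.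

Let ftermE nu (ta : R[i]) b c l : fterm A p PP nu 2^-1 (skC nu) (Re ta, Im ta, b, c) l y = (wt2 A C1 C1' C2 C2' y)%:C * X0 nu ta b c l.
Proof.
rewrite /fterm cexp_expo /= (_ : Re ta +i* Im ta = ta); last by case: ta.
rewrite /X0 mulrA; congr (_ * _); rewrite -(rmorphM (real_complex R)) /=; congr (_%:C).
have bv v x := @B_vperp R n A (c1 y) (c2 y) A_sym (cQ y) (cD y) v x.
have bw := @B_vperp2 R n A (c1 y) (c2 y) A_sym (cQ y) (cD y) v1 v2.
by rewrite /sker /= /w1 /w2 bw !bv.
Qed.

Let X0_csum nu (ta : R[i]) b c : 0 < Im ta ->
  csum (fun l => fterm A p PP nu 2^-1 (skC nu) (Re ta, Im ta, b, c) l y) = (wt2 A C1 C1' C2 C2' y)%:C * csum (X0 nu ta b c).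
Proof.
move=> h; rewrite -csumZ; last first.
  have sm := @fterm_summable R n A p g gi giK PP eps eps0 PP_pos nu 2^-1 (skC nu) (Re ta, Im ta, b, c) y (sA nu) h.
  have e : (fun l => (wt2 A C1 C1' C2 C2' y)%:C^-1 * fterm A p PP nu 2^-1 (skC nu) (Re ta, Im ta, b, c) l y) = X0 nu ta b c.
    by apply/funext => l; rewrite ftermE mulKf.
  by rewrite -e; exact: abs_summableZ.
by congr csum; apply/funext => l; exact: ftermE.
Qed.

(** At a fixed point of the square the term is [wt2] times the summand of [point_transformation] for
    the projected velocities [vperp], which are orthogonal to the plane and pair as [Bp]. *)
Lemma kernel_transformation mu (tau : R[i]) b c : integral_row (mu *m A) -> 0 < Im tau ->
  csum (fun l => fterm A p PP mu 2^-1 (skC mu) (Re (- tau^-1), Im (- tau^-1), c, - b) l y) =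
  ee (Q A p / 4)%:C * (ee ((4 - n%:R) / 8)%:C * hpow tau (n%:R / 2) * ((Num.sqrt N)^-1)%:C) *
  \sum_(nu <- s) ee (B A mu nu)%:C * csum (fun l => fterm A p PP nu 2^-1 (skC nu) (Re tau, Im tau, b, c) l y).
Proof.
move=> hmu h; rewrite (X0_csum _ _ _ (upper_inv h)).
have inv (c' : V) : csum (T0 A p (PP y) 0 mu (- tau^-1) c' (- b)) =
  (kappa c0 (OmT A (PP y) (- tau^-1)) * ee (Q A p / 4)%:C) * \sum_(nu <- s) ee (B A mu nu)%:C * csum (T0 A p (PP y) 1 nu tau b c').
  have Ppos x : x != 0 -> 0 < 2 * qf (PP y) x - Q A x by rewrite PE; exact: Pp.
  exact: (@theta_inversion R n A p A_sym c0 c_sqr c_inv (PP y) Az s A_int Az_det s_uniq s_reps p_int Psym Pidem Ppos mu tau b c' hmu h).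
have w1P : w1 *m PP y = 0 by exact: (@vperp_P R n A (c1 y) (c2 y) A_sym (cQ y) (cD y)).
have w2P : w2 *m PP y = 0 by exact: (@vperp_P R n A (c1 y) (c2 y) A_sym (cQ y) (cD y)).
have pt := @point_transformation R n A p A_sym g gi gK giK (PP y) eps Psym eps0 (PP_pos y) s
  (kappa c0 (OmT A (PP y) (- tau^-1)) * ee (Q A p / 4)%:C) (fun nu => ee (B A mu nu)%:C) tau b c mu w1 w2 h w1P w2P inv.
have ic := @inversion_constant R n A A_sym c0 c_sqr c_cont c_pos fr N A_unit frG Pp N_pos A_det tau h.
rewrite -PE in ic.
have -> : csum (X0 mu (- tau^-1) c (- b)) = (ee (Q A p / 4)%:C * (ee ((4 - n%:R) / 8)%:C * hpow tau (n%:R / 2) * ((Num.sqrt N)^-1)%:C)) *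
   \sum_(nu <- s) ee (B A mu nu)%:C * csum (X0 nu tau b c).
  rewrite -ic [ee (Q A p / 4)%:C * _]mulrA [ee (Q A p / 4)%:C * _]mulrC; exact: pt.
rewrite mulrCA; congr (_ * _); rewrite mulr_sumr; apply: eq_bigr => nu _.
by rewrite mulrCA (X0_csum _ _ _ h).
Qed.

End AtPoint.

(** By [inversion_constant] the factor of [kernel_transformation] is the same at every point of the
    square, so the law can be averaged. *)
Lemma theta_inversion_fam mu (tau : R[i]) b c : integral_row (mu *m A) -> 0 < Im tau ->
  fam A p g PP mu 2^-1 (nuY R) (skC mu) (Re (- tau^-1), Im (- tau^-1), c, - b) =
  ee (Q A p / 4)%:C * (ee ((4 - n%:R) / 8)%:C * hpow tau (n%:R / 2) * ((Num.sqrt N)^-1)%:C) *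
  \sum_(nu <- s) ee (B A mu nu)%:C * fam A p g PP nu 2^-1 (nuY R) (skC nu) (Re tau, Im tau, b, c).
Proof.
move=> hmu h; have h' := upper_inv h.
rewrite (@fam_cint R n A p g gi gK giK PP mP KP PP_bnd eps eps0 PP_pos mu 2^-1 (nuY R) (nuY_fin R) (skC mu) (Re (- tau^-1), Im (- tau^-1), c, - b) (sA mu) h').
have e : (fun y => csum (fun l => fterm A p PP mu 2^-1 (skC mu) (Re (- tau^-1), Im (- tau^-1), c, - b) l y)) =
  (fun y => ee (Q A p / 4)%:C * (ee ((4 - n%:R) / 8)%:C * hpow tau (n%:R / 2) * ((Num.sqrt N)^-1)%:C) *
  \sum_(nu <- s) ee (B A mu nu)%:C * csum (fun l => fterm A p PP nu 2^-1 (skC nu) (Re tau, Im tau, b, c) l y)).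
  by apply/funext => y; exact: kernel_transformation.
have ci nu : cintegrable (nuY R) (fun y => csum (fun l => fterm A p PP nu 2^-1 (skC nu) (Re tau, Im tau, b, c) l y)).
  exact: (@csum_fterm_integrable R n A p g gi gK giK PP mP KP PP_bnd eps eps0 PP_pos nu 2^-1 (nuY R) (nuY_fin R) (skC nu) (Re tau, Im tau, b, c) (sA nu) h).
have [i1 i2] := cint_sum s (fun nu => ee (B A mu nu)%:C) ci.
transitivity (cint (nuY R) (fun y => ee (Q A p / 4)%:C * (ee ((4 - n%:R) / 8)%:C * hpow tau (n%:R / 2) * ((Num.sqrt N)^-1)%:C) *
  \sum_(nu <- s) ee (B A mu nu)%:C * csum (fun l => fterm A p PP nu 2^-1 (skC nu) (Re tau, Im tau, b, c) l y))).
  by rewrite -e.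
rewrite cintZ // i2; congr (_ * _); apply: eq_bigr => nu _; congr (_ * _).
by rewrite (@fam_cint R n A p g gi gK giK PP mP KP PP_bnd eps eps0 PP_pos nu 2^-1 (nuY R) (nuY_fin R) (skC nu) (Re tau, Im tau, b, c) (sA nu) h).
Qed.

End Inversion.

Section NearDerivative.
Variable R : realType.

Lemma cder_near (W : normedModType R) (f h : W -> R[i]) t v l :
  (\forall s \near t, f s = h s) -> cder f t v l -> cder h t v l.
Proof.
move=> e [d1 d2]; split.
  by apply: near_eq_is_derive d1; apply: filterS e => s ->.
by apply: near_eq_is_derive d2; apply: filterS e => s ->.
Qed.

Let etaC (z : R[i]) : Re z +i* Im z = z. Proof. by case: z. Qed.

Lemma dbar_cder (F : R[i] -> R[i]) (tau a b : R[i]) :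
  cder (fun x : R => F (x +i* Im tau)) (Re tau) 1 a -> cder (fun y : R => F (Re tau +i* y)) (Im tau) 1 b ->
  dbar F tau = (2^-1)%:C * (a + 'i%C * b).
Proof.
move=> [a1 a2] [b1 b2].
have -> : dbar F tau = (2^-1)%:C * ((derive1 (fun x : R => Re (F (x +i* Im tau))) (Re tau)
   +i* derive1 (fun x : R => Im (F (x +i* Im tau))) (Re tau))
   + 'i%C * (derive1 (fun y : R => Re (F (Re tau +i* y))) (Im tau) +i* derive1 (fun y : R => Im (F (Re tau +i* y))) (Im tau))) by [].
have e1 := @derive_val _ _ _ _ _ _ _ a1; have e2 := @derive_val _ _ _ _ _ _ _ a2.
have e3 := @derive_val _ _ _ _ _ _ _ b1; have e4 := @derive_val _ _ _ _ _ _ _ b2.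
by rewrite !derive1E e1 e2 e3 e4 !etaC.
Qed.

Lemma smooth_on_eq (W : normedModType R) (U : set W) (f h : W -> R) : (forall t, U t -> \forall s \near t, U s) ->
  (forall t, U t -> h t = f t) -> smooth_on U h -> smooth_on U f.
Proof.
move=> oU fh sh vs g x Ux; have [c d] := sh vs x Ux.
have key : forall t, U t -> foldr (fun v k => 'D_v k) h vs t = foldr (fun v k => 'D_v k) f vs t.
  clear - oU fh; elim: vs => [|v vs IH] t Ut /=; first exact: fh.
  by apply: near_eq_derive; apply: filterS (oU t Ut) => s Us; exact: IH.
have e : \forall s \near x, foldr (fun v k => 'D_v k) h vs s = g s by apply: filterS (oU x Ux) => s Us; exact: key.
split.
  rewrite /prop_for /continuous_at -(nbhs_singleton e); apply: cvg_trans c; exact: near_eq_cvg.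
by move=> v; apply: near_eq_derivable e _; exact: d.
Qed.

Lemma upper_near n (t : R * R * 'rV[R]_n * 'rV[R]_n) : upper t -> \forall s \near t, upper s.
Proof.
move=> ut; apply/nbhs_ballP; exists t.1.1.2 => // s; rewrite -ball_normE /= => h.
have k : `|t.1.1.2 - s.1.1.2| <= `|t - s|.
  by apply: le_trans (norm_pair2 (t.1.1 - s.1.1)) _; apply: le_trans (norm_pair1 (t.1 - s.1)) _; exact: norm_pair1 (t - s).
have := le_lt_trans k h; rewrite ltr_norml => /andP[_ h2].
by have : 0 < s.1.1.2 by lra.
Qed.
End NearDerivative.

Lemma csum_lin2 (R : realType) n (X Z : 'rV[int]_n -> R[i]) (k i : R[i]) : abs_summable X -> abs_summable Z ->
  csum (fun l => k * (X l + i * Z l)) = k * (csum X + i * csum Z).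
Proof.
move=> hX hZ; have h := abs_summableZ i hZ.
rewrite csumZ; last exact: abs_summableD.
by rewrite csumD // csumZ.
Qed.

(** The contribution of the holomorphic exponential carries the factor [1 + I * I]; only the
    derivative [d] of the kernel survives. *)
Lemma holomorphic_part_cancels (K : comRingType) (I e1 e2 e3 e4 e5 e6 e7 d : K) : I * I = -1 ->
  I * (e4 * e5 * e6) * d * e1 =
  e4 * (e5 * (e2 * (e3 * I * - (e7 * 1) * e1) + I * (d * e6 * e1 + e2 * (e3 * I * - (e7 * I) * e1)))).
Proof.
move=> i2.
have -> : e4 * (e5 * (e2 * (e3 * I * - (e7 * 1) * e1) + I * (d * e6 * e1 + e2 * (e3 * I * - (e7 * I) * e1)))) =
  I * (e4 * e5 * e6) * d * e1 - e4 * e5 * (e2 * (e3 * I * e7 * e1)) * (1 + I * I) by ring.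
by rewrite i2 subrr mulr0 subr0.
Qed.

(** * The antiholomorphic derivative *)

Section Shadow.
Variables (R : realType) (n : nat) (A : 'M[R]_n) (p C1 C1' C2 C2' : 'rV[R]_n).
Hypothesis A_sym : A^T = A.
Local Notation V := 'rV[R]_n.
Local Notation W := (R * R * V * V)%type.
Local Notation Y := (measurableTypeR R * measurableTypeR R)%type.
Hypothesis Q1_pos : forall s, 0 <= s <= 1 -> 0 < Q A (seg C1 C1' s).
Hypothesis Q2_pos : forall u, 0 <= u <= 1 -> 0 < Q A (seg C2 C2' u).
Hypothesis D_pos : forall s u, 0 <= s <= 1 -> 0 <= u <= 1 -> 0 < Bt A (seg C1 C1' s) (seg C2 C2' u) (seg C2 C2' u).
Variables (g : nat -> 'rV[int]_n) (gi : 'rV[int]_n -> nat).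
Hypothesis gK : cancel g gi.
Hypothesis giK : cancel gi g.
Local Notation c1 y := (cc1 C1 C1' y).
Local Notation c2 y := (cc2 C2 C2' y).
Local Notation v1 := (C1' - C1).
Local Notation v2 := (C2' - C2).
Local Notation PP := (PP A C1 C1' C2 C2').
Local Notation Phi := (Phi2_hat A C1 C1' C2 C2').
Local Notation nu := (nuY R).
Variables (KP eps : R).
Hypothesis PP_bnd : forall y i j, `|PP y i j| <= KP.
Hypothesis eps0 : 0 < eps.
Hypothesis PP_pos : forall y x, eps * nsq x <= 2 * qf (PP y) x - Q A x.
Variable mu : V.
Let f : W -> 'rV[int]_n -> Y -> R[i] := skC A p C1 C1' C2 C2' mu.
Let mP := PP_meas A_sym Q1_pos D_pos.
Let af : admC g f. Proof. exact: skC_adm. Qed.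

Let fam_ h (t : W) := fam A p g PP mu 2^-1 nu h t.
Let term h (l : 'rV[int]_n) (t : W) := cint nu (fterm A p PP mu 2^-1 h t l).

Let fam_csum_ h t : admC g h -> upper t -> fam_ h t = csum (fun l => term h l t).
Proof. exact: (@fam_csum R n A p g gi gK giK PP mP KP PP_bnd eps eps0 PP_pos mu 2^-1 nu (nuY_fin R) h t). Qed.
Let fam_cder_ h h' q' t v : admC g h -> admC g h' -> admC g q' ->
  (forall t l y, cder (fun t => h t l y) t v (h' t l y)) ->
  (forall t l y, cder (fun t => expo A p PP mu 2^-1 t l y) t v (q' t l y)) -> upper t ->
  cder (fam_ h) t v (fam_ (fun t l y => h' t l y + h t l y * q' t l y) t).
Proof. exact: (@fam_cder R n A p g gi gK giK PP mP KP PP_bnd eps eps0 PP_pos mu 2^-1 nu (nuY_fin R) h h' q' t v). Qed.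
Let term_summable h t : admC g h -> upper t -> abs_summable (fun l => term h l t).
Proof. exact: (@cint_fterm_summable R n A p g gi giK PP mP KP PP_bnd eps eps0 PP_pos mu 2^-1 nu (nuY_fin R) h t). Qed.

(** The indicator of a lattice vector is an admissible coefficient, so a single term of the series
    is itself a family and its derivative comes from [fam_cder]. *)
Let ind (l0 l : 'rV[int]_n) : R := (l == l0)%:R.
Let adm_ind l0 : adm g (fun (_ : W) l (_ : Y) => ind l0 l).
Proof.
have mn : measurable_fun [set: nat] (fun j : nat => ind l0 (g j)) by move=> _ B _.
apply: (@gpol_weight _ _ _ _ _ (fun x : nat * Y => ind l0 (g x.1)) 1 0).
  exact: (measurableT_comp mn (@measurable_fst _ _ _ _)).
by move=> x; rewrite expr0 mulr1 /ind; case: (_ == _); rewrite ?normr1 ?normr0.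
Qed.

Let fam_ind l0 h t : admC g h -> upper t -> fam_ (fun t l y => (ind l0 l)%:C * h t l y) t = term h l0 t.
Proof.
move=> ah ut; rewrite fam_csum_ //; last exact: (admC_M (adm_ind l0) ah).
rewrite -[RHS](csum_single l0); congr csum; apply/funext => l; case: eqP => [->|/eqP ne].
  by rewrite /term; congr cint; apply/funext => y; rewrite /fterm /ind eqxx mul1r.
rewrite /term -[RHS](@cint0 _ Y R nu); congr cint; apply/funext => y.
by rewrite /fterm /ind (negbTE ne) !mul0r.
Qed.

Let term_cder l0 h h' q' t v : admC g h -> admC g h' -> admC g q' ->
  (forall t l y, cder (fun t => h t l y) t v (h' t l y)) ->
  (forall t l y, cder (fun t => expo A p PP mu 2^-1 t l y) t v (q' t l y)) -> upper t ->
  cder (term h l0) t v (term (fun t l y => h' t l y + h t l y * q' t l y) l0 t).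
Proof.
move=> ah ah' aq dh dq ut; have ai := adm_ind l0.
have D := @fam_cder_ (fun t l y => (ind l0 l)%:C * h t l y) (fun t l y => (ind l0 l)%:C * h' t l y) q' t v
  (admC_M ai ah) (admC_M ai ah') aq (fun t l y => cderZ _ (dh t l y)) dq ut.
have e : fam_ (fun t l y => (ind l0 l)%:C * h' t l y + (ind l0 l)%:C * h t l y * q' t l y) t =
  term (fun t l y => h' t l y + h t l y * q' t l y) l0 t.
  rewrite -fam_ind //; last exact: (admC_D ah' (admC_M ah aq)).
  by congr (fam_ _ t); do 3 apply/funext => ?; rewrite mulrDr mulrA.
rewrite e in D; apply: (cder_near _ D).
by apply: filterS (upper_near ut) => s us; exact: fam_ind.
Qed.

Let ux : W := (1, 0, 0, 0).
Let uy : W := (0, 1, 0, 0).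
Let zf : W -> 'rV[int]_n -> Y -> R[i] := fun _ _ _ => (0 : R)%:C.
Let fy : W -> 'rV[int]_n -> Y -> R[i] := fun t l y =>
  (wt2 A C1 C1' C2 C2' y * (2 * (Bp A (c1 y) (c2 y) v1 (kv p mu l + t.1.2) * Bp A (c1 y) (c2 y) v2 (kv p mu l + t.1.2))))%:C.
Let qx : W -> 'rV[int]_n -> Y -> R[i] := fun t l y => 'i%C * (- pi * Q A (kv p mu l + t.1.2))%:C.
Let qy : W -> 'rV[int]_n -> Y -> R[i] := fun t l y =>
  (pi * (Q A (kv p mu l + t.1.2) - 2 * qf (PP y) (kv p mu l + t.1.2)))%:C.

Let aQ : adm g (fun (t : W) l (_ : Y) => Q A (kv p mu l + t.1.2)).
Proof. exact: (@adm_B R n A g _ _ (@vadm_xi R n p g mu) (@vadm_xi R n p g mu)). Qed.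
Let aqf : adm g (fun (t : W) l y => qf (PP y) (kv p mu l + t.1.2)).
Proof. exact: (@adm_qf R n g PP mP KP PP_bnd _ (@vadm_xi R n p g mu)). Qed.
Let azf : admC g zf. Proof. exact: (@adm_cst R n g 0). Qed.
Let afy : admC g fy.
Proof.
have [K hK] := wt2_bounded Q1_pos D_pos.
have aw := @adm_Y R n g _ K (mfn_wt2 A_sym Q1_pos D_pos) hK.
have a1 : adm g (fun (t : W) l y => Bp A (c1 y) (c2 y) v1 (kv p mu l + t.1.2)) by exact: adm_Bpxi.
have a2 : adm g (fun (t : W) l y => Bp A (c1 y) (c2 y) v2 (kv p mu l + t.1.2)) by exact: adm_Bpxi.
exact: (admM aw (admM (@adm_cst R n g 2) (admM a1 a2))).
Qed.
Let aqx : admC g qx.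
Proof. exact: (admC_M (@admC_cst R n g 'i%C) (admM (@adm_cst R n g (- pi)) aQ)). Qed.
Let aqy : admC g qy.
Proof. exact: (admM (@adm_cst R n g pi) (admD aQ (admN (admM (@adm_cst R n g 2) aqf)))). Qed.

Let dfx t l y : cder (fun t => f t l y) t ux (zf t l y).
Proof.
apply: cder_real; move: t => [[[x yy] b] c]; apply: (is_derive_quad (b := 0)) => h.
by rewrite /ux dirE /sker /= !scaler0 !mulr0 !add0r !addr0.
Qed.
Let dfy t l y : cder (fun t => f t l y) t uy (fy t l y).
Proof.
apply: cder_real; move: t => [[[x yy] b] c]; apply: (is_derive_quad (b := 0)) => h.
rewrite /uy dirE /sker /= !scaler0 !mulr0 !add0r !addr0 mulr1.
move: (Bp _ _ _ _ _) (Bp _ _ _ _ _) (Bp _ _ _ _ _ / _) (wt2 _ _ _ _ _ _) => z1 z2 z3 z4; ring.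
Qed.
Let dqx t l y : cder (fun t => expo A p PP mu 2^-1 t l y) t ux (qx t l y).
Proof. exact: expo_cder_x. Qed.
Let dqy t l y : cder (fun t => expo A p PP mu 2^-1 t l y) t uy (qy t l y).
Proof. exact: expo_cder_y. Qed.

Let Ax := fun t l y => zf t l y + f t l y * qx t l y.
Let Ay := fun t l y => fy t l y + f t l y * qy t l y.
Let aAx : admC g Ax. Proof. exact: (admC_D azf (admC_M af aqx)). Qed.
Let aAy : admC g Ay. Proof. exact: (admC_D afy (admC_M af aqy)). Qed.

Variables (tau : R[i]) (b c : V).
Hypothesis tau0 : 0 < Im tau.
Let t0 : W := (Re tau, Im tau, b, c).

Let near_pos : \forall y \near Im tau, 0 < y.
Proof.
apply/nbhs_ballP; exists (Im tau) => // y; rewrite -ball_normE /= ltr_norml => /andP[_ h].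
by first [lra | move: h; rewrite gtrBl].
Qed.

Let line_dbar (F : R[i] -> R[i]) (G : W -> R[i]) a a' : (forall ta, 0 < Im ta -> F ta = G (Re ta, Im ta, b, c)) ->
  cder G t0 ux a -> cder G t0 uy a' -> dbar F tau = (2^-1)%:C * (a + 'i%C * a').
Proof.
move=> FG dx dy; apply: dbar_cder.
  have L : cder (fun x : R => G (x, Im tau, b, c)) (Re tau) 1 a.
    apply: (@cder_line R _ G (fun x : R => (x, Im tau, b, c)) ux (Re tau) a _ dx) => h.
    by rewrite /ux dirE !scaler0 mulr0 !add0r mulr1.
  by apply: (cder_ext _ L) => x; rewrite FG.
have L : cder (fun y : R => G (Re tau, y, b, c)) (Im tau) 1 a'.
  apply: (@cder_line R _ G (fun y : R => (Re tau, y, b, c)) uy (Im tau) a' _ dy) => h.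
  by rewrite /uy dirE !scaler0 mulr0 !add0r mulr1.
by apply: (cder_near _ L); apply: filterS near_pos => y hy; rewrite FG.
Qed.

Let dbar_term l : dbar (fun ta => theta_term A Phi mu p ta b c l) tau = (2^-1)%:C * (term Ax l t0 + 'i%C * term Ay l t0).
Proof.
apply: (@line_dbar _ (term f l)).
- by move=> ta h; exact: (@theta_term_cint R n A p C1 C1' C2 C2' A_sym Q1_pos Q2_pos D_pos g gi giK KP eps PP_bnd eps0 PP_pos mu ta b c l h).
- exact: (@term_cder l f zf qx t0 ux af azf aqx dfx dqx tau0).
- exact: (@term_cder l f fy qy t0 uy af afy aqy dfy dqy tau0).
Qed.

Let dbar_summable : abs_summable (fun l => dbar (fun ta => theta_term A Phi mu p ta b c l) tau).
Proof.
have -> : (fun l => dbar (fun ta => theta_term A Phi mu p ta b c l) tau) = (fun l => (2^-1)%:C * (term Ax l t0 + 'i%C * term Ay l t0)).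
  by apply/funext => l; exact: dbar_term.
by apply: abs_summableZ; apply: abs_summableD; [exact: term_summable|apply: abs_summableZ; exact: term_summable].
Qed.

(** The derivative of the sum and the derivatives of the terms are expressed by the same
    coefficients [Ax] and [Ay], so termwise differentiation reduces to linearity of absolutely
    convergent sums. *)
Let dbar_theta : dbar (fun ta => theta A Phi 0 p mu ta b c) tau = csum (fun l => dbar (fun ta => theta_term A Phi mu p ta b c l) tau).
Proof.
have e : (fun l => dbar (fun ta => theta_term A Phi mu p ta b c l) tau) = (fun l => (2^-1)%:C * (term Ax l t0 + 'i%C * term Ay l t0)).
  by apply/funext => l; exact: dbar_term.
rewrite e (@line_dbar _ (fam_ f) (fam_ Ax t0) (fam_ Ay t0)).
- have sx := @term_summable Ax t0 aAx tau0; have sy := @term_summable Ay t0 aAy tau0.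
  rewrite (@fam_csum_ Ax t0 aAx tau0) (@fam_csum_ Ay t0 aAy tau0); symmetry.
  exact: (csum_lin2 _ _ sx sy).
- by move=> ta h; exact: (@theta_fam R n A p C1 C1' C2 C2' A_sym Q1_pos Q2_pos D_pos g gi gK giK KP eps PP_bnd eps0 PP_pos mu ta b c h).
- exact: (@fam_cder_ f zf qx t0 ux af azf aqx dfx dqx tau0).
- exact: (@fam_cder_ f fy qy t0 uy af afy aqy dfy dqy tau0).
Qed.

Let quarter (x y : R) : x != 0 -> x ^+ 2 = 2 * y -> y / 2 / x = 4^-1 * x.
Proof.
move=> x0 h; have -> : y = x ^+ 2 / 2 by rewrite h; field.
by field.
Qed.

Section Direct.
Hypothesis radial : forall w (r : R), exists d : R[i], cder (fun r : R => Phi (r *: w)) r 1 d /\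
  Psi2 A C1 C1' C2 C2' (r *: w) = 'i%C * (4^-1 * r)%:C * d.
Variable l : 'rV[int]_n.
Let xi := kv p mu l + b.
Let rho := B A (kv p mu l) p / 2 + B A c (kv p mu l) + B A c b / 2.
Let k : R[i] := (Q A xi / 2)%:C.
Let r := Num.sqrt (2 * Im tau).
Let r0 : 0 < r. Proof. by rewrite sqrtr_gt0 mulr_gt0. Qed.

Let dee (z : R -> R[i]) (s : R) dz : cder z s 1 dz ->
  cder (fun s => ee (rho%:C - k * z s)) s 1 ((2 * pi)%:C * 'i%C * (- (k * dz)) * ee (rho%:C - k * z s)).
Proof.
move=> hz; have h := cder_cexp (cderZ ((2 * pi)%:C * 'i%C) (cderD (cder_cst rho%:C s (1 : R)) (cderN (cderZ k hz)))).
by apply: (cder_eq h); rewrite add0r.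
Qed.

Let sqrt_der : is_derive (Im tau) (1 : R) (fun y : R => Num.sqrt (2 * y)) r^-1.
Proof.
have h : is_derive (Im tau) (1 : R) (2 \*: (@id R)) (2 *: (1 : R)) by apply: is_deriveZ.
have h2 : is_derive (Im tau) (1 : R) (fun y : R => 2 * y) 2 by apply: (is_derive_eq h); rewrite /GRing.scale /= mulr1.
have p2 : 0 < 2 * Im tau by rewrite mulr_gt0.
apply: (is_derive_eq (is_derive_sqrt_comp p2 h2)); rewrite -/r invfM mulrA mulfV ?mul1r //.
Qed.

Let dPhi d : cder (fun r : R => Phi (r *: xi)) r 1 d ->
  cder (fun y : R => Phi (Num.sqrt (2 * y) *: xi)) (Im tau) 1 (d * (r^-1)%:C).
Proof.
move=> [d1 d2]; split.
  have H : is_derive (Im tau) (1 : R) ((fun r : R => Re (Phi (r *: xi))) \o (fun y : R => Num.sqrt (2 * y))) (Re d * r^-1).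
    exact: is_derive1_comp.
  by apply: (is_derive_eq H); rewrite cReM cReC cImC mulr0 subr0.
have H : is_derive (Im tau) (1 : R) ((fun r : R => Im (Phi (r *: xi))) \o (fun y : R => Num.sqrt (2 * y))) (Im d * r^-1).
  exact: is_derive1_comp.
by apply: (is_derive_eq H); rewrite cImM cReC cImC mulr0 add0r.
Qed.

(** Apart from the holomorphic exponential, [tau] enters a term only through the radius
    [r = sqrt (2 Im tau)]. The antiholomorphic derivative contributes [i / 2] times [1 / r], and
    [Im tau / (2 r) = r / 4] is the factor in the radial formula. *)
Lemma shadow_term : theta_term A (Psi2 A C1 C1' C2 C2') mu p tau b c l =
  (Im tau)%:C * dbar (fun ta => theta_term A Phi mu p ta b c l) tau.
Proof.
have [d [hd ->]] : exists d : R[i], cder (fun r : R => Phi (r *: xi)) r 1 d /\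
  theta_term A (Psi2 A C1 C1' C2 C2') mu p tau b c l = 'i%C * (4^-1 * r)%:C * d * ee (rho%:C - k * tau).
  by have [d [h1 h2]] := radial xi r; exists d; split=> //; rewrite theta_termE -/xi -/r h2.
have hx : cder (fun x : R => x +i* Im tau) (Re tau) 1 1 by split; [exact: is_derive_id|exact: is_derive_cst].
have hy : cder (fun y : R => Re tau +i* y) (Im tau) 1 'i%C by split; [exact: is_derive_cst|exact: is_derive_id].
have et : Re tau +i* Im tau = tau by case: (tau).
have ex := dee hx; have ey := dee hy; rewrite /= et in ex ey.
have dx := cderZ (Phi (r *: xi)) ex; have dy := cderM (dPhi hd) ey; rewrite /= et -/r in dy.
rewrite (@dbar_cder R (fun ta => theta_term A Phi mu p ta b c l) tau _ _ (cder_ext (fun x => _) dx) (cder_ext (fun y => _) dy)); first last.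
- by move=> y; rewrite theta_termE.
- by move=> x; rewrite theta_termE.
have rr : (Im tau)%:C * (2^-1)%:C * (r^-1)%:C = (4^-1 * r)%:C :> R[i].
  rewrite -!(rmorphM (real_complex R)) /=; congr (_%:C).
  have hr : r ^+ 2 = 2 * Im tau by rewrite sqr_sqrtr // mulr_ge0 // ltW.
  have rn : r != 0 by rewrite gt_eqF.
  exact: (quarter rn hr).
rewrite -rr.
have i2 : 'i%C * 'i%C = -1 :> R[i] by first [rewrite -expr2 sqr_i | apply: complexRI; rewrite ?(cReM, cImM) /=; ring].
by apply: holomorphic_part_cancels.
Qed.

End Direct.

(** One factor [Im tau] comes from [shadow_term], the other from the prefactor of [theta] at
    homogeneity -2. *)
Lemma theta_shadow : (forall w (r : R), exists d : R[i], cder (fun r : R => Phi (r *: w)) r 1 d /\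
    Psi2 A C1 C1' C2 C2' (r *: w) = 'i%C * (4^-1 * r)%:C * d) ->
  abs_summable (theta_term A (Psi2 A C1 C1' C2 C2') mu p tau b c) /\
  (Im tau ^+ 2)%:C * dbar (fun ta => theta A Phi 0 p mu ta b c) tau = theta A (Psi2 A C1 C1' C2 C2') (-2) p mu tau b c.
Proof.
move=> radial.
have e : theta_term A (Psi2 A C1 C1' C2 C2') mu p tau b c =
  (fun l => (Im tau)%:C * dbar (fun ta => theta_term A Phi mu p ta b c l) tau).
  by apply/funext => l; exact: shadow_term.
split; first by rewrite e; exact: abs_summableZ dbar_summable.
have sc : csum (theta_term A (Psi2 A C1 C1' C2 C2') mu p tau b c) =
    (Im tau)%:C * csum (fun l => dbar (fun ta => theta_term A Phi mu p ta b c l) tau).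
  by rewrite e; apply: csumZ; exact: dbar_summable.
rewrite dbar_theta /theta sc.
have -> : - (-2)%:~R / 2 = 1 :> R by rewrite mulrNz opprK; field.
by rewrite powRr1 ?ltW // mulrA -(rmorphM (real_complex R)) -expr2.
Qed.

End Shadow.

(** * The discriminant, and assembly of the four claims *)

Lemma lattice_enum_gt0 n : (0 < n)%N -> exists g : nat -> 'rV[int]_n, bijective g.
Proof. by case: n => // n _; exact: lattice_enum. Qed.

Lemma card_fset_set_seq (T : choiceType) (s : seq T) : uniq s -> #|` fset_set [set` s]| = size s.
Proof.
move=> us; have -> : [set` s] = [set` [fset x in s]%fset].
  by apply/seteqP; split=> x /=; rewrite in_fset.
by rewrite set_fsetK card_fseq undup_id.
Qed.

(** Congruence multiplies the determinant by a nonzero square, and the diagonal form has [n - 2]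
    entries equal to -1. *)
Lemma signature_det (R : realType) n (A : 'M[R]_n) : has_signature A 2 (n - 2) -> 0 < (-1) ^+ n * \det A.
Proof.
case: n A => [|[|m]] A [en [P uP e]]; [by []|by []|].
have := congr1 determinant e; rewrite !det_mulmx det_tr det_diag.
have -> : \prod_(i < m.+2) (\row_(i < m.+2) (if (i < 2)%N then 1 else -1) : 'rV[R]_m.+2) 0 i = (-1) ^+ m.
  rewrite !big_ord_recl !mxE /= !mul1r (eq_bigr (fun=> -1)) ?prodr_const ?card_ord //.
  by move=> i _; rewrite mxE.
move=> h; have d0 : \det P != 0 by rewrite -unitfE -unitmxE.
have d2 : 0 < \det P ^+ 2 by rewrite exprn_even_gt0.
rewrite -(pmulr_lgt0 _ d2).
have -> : (-1) ^+ m.+2 * \det A * \det P ^+ 2 = (-1) ^+ m * (\det P * \det A * \det P).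
  by rewrite !exprS; ring.
by rewrite h -exprMn mulrNN mulr1 expr1n.
Qed.

Theorem theorem4p2 (R : realType) (n : nat) (A : 'M[R]_n) (p : 'rV[R]_n)
    (C1 C1' C2 C2' : 'rV[R]_n)
    (A_sym : A^T = A)
    (Q_int : integral_form A)
    (A_sig : has_signature A 2 (n - 2))
    (p_char : characteristic A p)
    (Q_C1 : 0 < Q A C1) (Q_C1' : 0 < Q A C1')
    (Q_C2 : 0 < Q A C2) (Q_C2' : 0 < Q A C2')
    (Delta_pos : 0 < Delta A [:: C1; C1'; C2; C2'])
    (D_11' : 0 <= cofactor (gram A [:: C1; C1'; C2; C2'])
                           (inord 0 : 'I_4) (inord 1 : 'I_4))
    (D_22' : 0 <= cofactor (gram A [:: C1; C1'; C2; C2'])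
                           (inord 2 : 'I_4) (inord 3 : 'I_4))
    (M_neg : neg_definite (matrixM A C1 C1' C2 C2'))
    (Delta_12 : 0 < Delta A [:: C1; C2])
    (Delta_1'2 : 0 < Delta A [:: C1'; C2])
    (Delta_12' : 0 < Delta A [:: C1; C2'])
    (Delta_1'2' : 0 < Delta A [:: C1'; C2'])
    (B_perp1 : 0 <= B A (perp A C2 C1) (perp A C2' C1))
    (B_perp2 : 0 <= B A (perp A C1 C2) (perp A C1' C2))
    (B_perp1' : 0 <= B A (perp A C2 C1') (perp A C2' C1'))
    (B_perp2' : 0 <= B A (perp A C1 C2') (perp A C1' C2')) :
  [/\ theta_summable A (Phi2_hat A C1 C1' C2 C2') p,
      nonhol_jacobi_form A 2 (n - 2) p (n%:R / 2) 0
        (theta A (Phi2_hat A C1 C1' C2 C2') 0 p),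
      theta_summable A (Psi2 A C1 C1' C2 C2') p
    & forall (mu : 'rV[R]_n) (tau : R[i]) (b c : 'rV[R]_n),
        Lambda_dual A mu -> 0 < complex.Im tau ->
        (complex.Im tau ^+ 2)%:C
        * dbar (fun t => theta A (Phi2_hat A C1 C1' C2 C2') 0 p mu t b c) tau
        = theta A (Psi2 A C1 C1' C2 C2') (-2) p mu tau b c].
Proof.
have n2 := sig_n2 A_sig.
have [g [gi gK giK]] := lattice_enum_gt0 (ltnW n2).
(* Positivity on one segment is drawn from the planes over the square with the other parameter at
   0. *)
have e0 : 0 <= (0 : R) <= 1 by rewrite lexx ler01.
have Q1 s : 0 <= s <= 1 -> 0 < Q A (seg C1 C1' s).
  by move=> hs; exact: (good_Q1 A_sym A_sig Delta_pos D_11' D_22' M_neg Q_C1 Delta_12 hs e0).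
have Q2 u : 0 <= u <= 1 -> 0 < Q A (seg C2 C2' u).
  by move=> hu; exact: (good_Q2 A_sym A_sig Delta_pos D_11' D_22' M_neg Q_C1 Delta_12 e0 hu).
have Dp s u : 0 <= s <= 1 -> 0 <= u <= 1 -> 0 < Bt A (seg C1 C1' s) (seg C2 C2' u) (seg C2 C2' u).
  by move=> hs hu; exact: (good_D A_sym A_sig Delta_pos D_11' D_22' M_neg Q_C1 Delta_12 hs hu).
have maj s u x : 0 <= s <= 1 -> 0 <= u <= 1 -> x != 0 -> 0 < 2 * Qp A (seg C1 C1' s) (seg C2 C2' u) x - Q A x.
  by move=> hs hu x0; exact: (good_majorant A_sym A_sig Delta_pos D_11' D_22' M_neg Q_C1 Delta_12 hs hu x0).
have [KP KPb0] := Pmx_bounded Q1 Dp.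
have KPb : forall y i j, `|PP A C1 C1' C2 C2' y i j| <= KP by exact: KPb0.
have [eps eps0 epsP0] := majorant_uniform A_sym Q1 Dp maj.
have epsP : forall y x, eps * nsq x <= 2 * qf (PP A C1 C1' C2 C2' y) x - Q A x by exact: epsP0.
have [c0 [c_sqr c_cont c_pos c_inv]] := jacobi_inversion R.
have [Az eAz] : exists Az : 'M[int]_n, A = map_mx intr Az by eapply gram_integral; eassumption.
have dA := signature_det A_sig.
(* The absolute discriminant plays two parts: up to sign it is [\det A], as [inversion_constant]
   requires, and it counts the representatives of the dual lattice by [dual_box_enum]. *)
pose N : R := (absz (\det Az))%:R.
have eN : N = (-1) ^+ n * \det A.
  rewrite -(gtr0_norm dA) normrM normrX normrN1 expr1n mul1r /N natr_absz intr_norm.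
  by rewrite {1}eAz det_map_mx.
have N0 : 0 < N by rewrite eN.
have A_det : \det A = (-1) ^+ n * N by rewrite eN mulrA -exprMn mulrNN mulr1 expr1n mul1r.
have Az_det : \det Az != 0 by apply: contraTneq N0 => h; rewrite /N h ltxx.
have A_un : A \in unitmx by rewrite unitmxE unitfE A_det mulf_neq0 ?signr_eq0 ?gt_eqF.
have [s [su sr ss]] := dual_box_enum R Az_det.
have p_int : integral_row p by case: p_char.
have ld mu : Lambda_dual A mu -> integral_row (mu *m A).
  move=> h j; have := h (delta_mx 0 j); rewrite /B trmx_delta -colE mxE; apply=> i.
  by rewrite mxE; case: (_ && _).
have SM mu (tau : R[i]) b c : 0 < complex.Im tau -> abs_summable (theta_term A (Phi2_hat A C1 C1' C2 C2') mu p tau b c).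
  by move=> h; exact: (@Phi2_summable R n A p C1 C1' C2 C2' A_sym Q1 Q2 Dp g gi giK KP eps KPb eps0 epsP mu tau b c h).
have TF mu (tau : R[i]) b c : 0 < complex.Im tau -> theta A (Phi2_hat A C1 C1' C2 C2') 0 p mu tau b c =
    fam A p g (PP A C1 C1' C2 C2') mu 2^-1 (nuY R) (skC A p C1 C1' C2 C2' mu) (complex.Re tau, complex.Im tau, b, c).
  by move=> h; exact: (@theta_fam R n A p C1 C1' C2 C2' A_sym Q1 Q2 Dp g gi gK giK KP eps KPb eps0 epsP mu tau b c h).
have SH mu (tau : R[i]) b c : 0 < complex.Im tau ->
    abs_summable (theta_term A (Psi2 A C1 C1' C2 C2') mu p tau b c) /\
    (complex.Im tau ^+ 2)%:C * dbar (fun ta => theta A (Phi2_hat A C1 C1' C2 C2') 0 p mu ta b c) tau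
      = theta A (Psi2 A C1 C1' C2 C2') (-2) p mu tau b c.
  move=> h; apply: (@theta_shadow R n A p C1 C1' C2 C2' A_sym Q1 Q2 Dp g gi gK giK KP eps KPb eps0 epsP mu tau b c h).
  by move=> w r; exact: (Phi2_radial A_sym w r Q_C1 Q_C1' Q_C2 Q_C2' Delta_12 Delta_1'2 Delta_12' Delta_1'2').
split.
- by move=> mu tau b c _; exact: SM.
- split.
  + move=> mu hmu U f.
    have [h1 h2] : smooth_on (@upper R n) (fun t => complex.Re (fam A p g (PP A C1 C1' C2 C2') mu 2^-1 (nuY R) (skC A p C1 C1' C2 C2' mu) t)) /\
       smooth_on (@upper R n) (fun t => complex.Im (fam A p g (PP A C1 C1' C2 C2') mu 2^-1 (nuY R) (skC A p C1 C1' C2 C2' mu) t)).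
      exact: (@fam_smooth R n A p g gi gK giK (PP A C1 C1' C2 C2') (PP_meas A_sym Q1 Dp) KP KPb eps eps0 epsP mu 2^-1 (nuY R) (nuY_fin R) _ (skC_adm p A_sym Q1 Dp g mu)).
    have ef t : upper t -> fam A p g (PP A C1 C1' C2 C2') mu 2^-1 (nuY R) (skC A p C1 C1' C2 C2' mu) t = f t.
      by case: t => [[[x y] b] c] ut; symmetry; exact: (TF mu (x +i* y) b c ut).
    split; [apply: (smooth_on_eq (@upper_near R n) _ h1) | apply: (smooth_on_eq (@upper_near R n) _ h2)] => t ut; by rewrite ef.
  + by move=> mu l tau b c _ hl _; apply: theta_coset.
  + by move=> mu l tau b c _ hl h; apply: theta_shift_b => //; exact: SM.
  + by move=> mu l tau b c hmu hl h; apply: theta_shift_c => //; exact: SM.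
  + by move=> mu tau b c hmu h; apply: theta_T => //; exact: SM.
  + move=> mu tau b c hmu h; have hm := ld mu hmu; have h' := upper_inv h.
    have SI : fam A p g (PP A C1 C1' C2 C2') mu 2^-1 (nuY R) (skC A p C1 C1' C2 C2' mu) (complex.Re (- tau^-1), complex.Im (- tau^-1), c, - b) =
      ee (Q A p / 4)%:C * (ee ((4 - n%:R) / 8)%:C * hpow tau (n%:R / 2) * ((Num.sqrt N)^-1)%:C) *
      \sum_(nu <- s) ee (B A mu nu)%:C * fam A p g (PP A C1 C1' C2 C2') nu 2^-1 (nuY R) (skC A p C1 C1' C2 C2' nu) (complex.Re tau, complex.Im tau, b, c).
      exact: (@theta_inversion_fam R n A p C1 C1' C2 C2' A_sym Q1 Dp maj g gi gK giK KP eps KPb eps0 epsP c0 c_sqr c_cont c_pos c_inv Az s N eAz Az_det su sr p_int A_un N0 A_det mu tau b c hm h).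
    rewrite (TF _ _ _ _ h') SI (dual_reps_box eAz) sr card_fset_set_seq // ss -fsbig_seq //.
    have -> : (2%:R - (n - 2)%:R) / 8 = (4 - n%:R) / 8 :> R by rewrite natrB //; congr (_ / 8); ring.
    rewrite hpow0 rmorph1 mulr1 -/N; congr (_ * _).
      move: (ee (Q A p / 4)%:C) => x; move: (ee _) => y; move: (hpow _ _) => z; move: (_%:C) => w; ring.
    by apply: eq_bigr => nu _; rewrite TF.
- by move=> mu tau b c _ h; exact: (SH mu tau b c h).1.
- by move=> mu tau b c _ h; exact: (SH mu tau b c h).2.
Qed.
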